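(* Let $(G,f)$ be a minimal graph-nonedge pair. Then there exists $\ell:E(G)\to\mathbb{R}_{>0}$ such that $\Omega^3_f(G,\ell)$ consists of exactly two distinct positive real numbers. In particular $(G,f)$ does not have the $3$-SIP.
   Context: A linkage $(G,\ell)$: finite simple graph $G$ and $\ell:E(G)\to\mathbb{R}_{\ge0}$ (squared lengths). A $3$-realization is $p:V(G)\to\mathbb{R}^3$ with $\|p(x)-p(y)\|^2=\ell(xy)$ for all $xy\in E(G)$. For a nonedge $f=uv$, $\Omega^3_f(G,\ell)=\{\|p(u)-p(v)\|^2: p \text{ a 3-realization}\}$; $(G,f)$ has the $3$-SIP if this set is convex for every $\ell$. $G\cup f$ adds $f$ as an edge. A clique is a set of pairwise adjacent vertices (possibly empty); a clique separator of $H$ is a clique $U$ with $H-U$ having at least two components; a graph is an atom if nonempty with no clique separator; an atom of $H$ is a vertex-maximal induced subgraph that is an atom. A minor model of $M$ in $H$ is a partition of $V(H)$ into nonempty branch sets $B_x$ ($x\in V(M)$) each inducing a connected subgraph, with an edge of $H$ between $B_x$ and $B_y$ for every $xy\in E(M)$; it preserves a pair $ab$ of vertices of $H$ if $a,b$ lie in different branch sets. A $3$-forbidden minor is a minor model of $K_5$ or of $K_{2,2,2}$. For a nonedge $f=uv$ of $G$ and an edge $e$ of $G$, let $(G\cup f)/e$ be obtained by contracting $e$, and let $[f]$ be the image of $f$ (an edge joining the images $[u]\ne[v]$ of $u,v$). The edge $e$ is reducing for $(G,f)$ if (a) $[u]$ and $[v]$ are non-adjacent in $G/e$ (i.e. $f$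 is the only edge of $G\cup f$ between the preimages of $[u]$ and $[v]$), and (b) some atom of $(G\cup f)/e$ containing $[u]$ and $[v]$ has a $3$-forbidden minor preserving $[u][v]$. The pair $(G,f)$ is minimal if $G\cup f$ is an atom that has a $3$-forbidden minor preserving $uv$, and $G$ has no reducing edge. *)

(* Defs.v *)
From HB Require Import structures.
From mathcomp Require Import all_boot all_order all_algebra.
From mathcomp Require Import reals.
Set Implicit Arguments. Unset Strict Implicit. Unset Printing Implicit Defensive.
Import Order.TTheory GRing.Theory Num.Theory.

(* A (finite simple) graph is given by a vertex set V : {set T} over a finType T
   and a relation E : rel T; only the edges E x y with x, y \in V count
   (i.e. the graph is the one induced on V).  All relations we build are
   symmetric and irreflexive. *)

Section Graphs.
Variable T : finType.

Definition simple_graph (E : rel T) : Prop :=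
  (forall x y, E x y = E y x) /\ (forall x, ~~ E x x).

Definition restr (S : {set T}) (E : rel T) : rel T :=
  [rel x y | [&& E x y, x \in S & y \in S]].

Definition conn_in (S : {set T}) (E : rel T) (x y : T) : bool :=
  [&& x \in S, y \in S & connect (restr S E) x y].

Definition connected_set (S : {set T}) (E : rel T) : Prop :=
  S != set0 /\ forall x y, x \in S -> y \in S -> conn_in S E x y.

Definition is_clique (U : {set T}) (E : rel T) : Prop :=
  forall x y, x \in U -> y \in U -> x != y -> E x y.

Definition clique_separator (V : {set T}) (E : rel T) (U : {set T}) : Prop :=
  U \subset V /\ is_clique U E /\
  exists x y, [/\ x \in V :\: U, y \in V :\: U & ~~ conn_in (V :\: U) E x y].

Definition is_atom (V : {set T}) (E : rel T) : Prop :=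
  V != set0 /\ ~ (exists U, clique_separator V E U).

Definition atom_of (V : {set T}) (E : rel T) (S : {set T}) : Prop :=
  S \subset V /\ is_atom S E /\
  forall S' : {set T}, S \proper S' -> S' \subset V -> ~ is_atom S' E.

Definition minor_model (k : nat) (M : rel 'I_k) (V : {set T}) (E : rel T)
  (B : 'I_k -> {set T}) : Prop :=
  [/\ (forall i, B i != set0),
      (forall i, B i \subset V),
      (forall i j, i != j -> [disjoint B i & B j]),
      (forall z, z \in V -> exists i, z \in B i) &
      (forall i, connected_set (B i) E)] /\
  (forall i j, M i j -> exists a b, [/\ a \in B i, b \in B j & E a b]).

Definition preserves (k : nat) (B : 'I_k -> {set T}) (a b : T) : Prop :=
  exists i j, [/\ i != j, a \in B i & b \in B j].

End Graphs.

Definition K5 : rel 'I_5 := fun i j => i != j.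
Definition K222 : rel 'I_6 := fun i j => ((i : nat) %/ 2 != (j : nat) %/ 2)%N.

Definition forbidden3_minor_preserving (T : finType) (V : {set T}) (E : rel T)
  (a b : T) : Prop :=
  (exists B : 'I_5 -> {set T}, minor_model K5 V E B /\ preserves B a b) \/
  (exists B : 'I_6 -> {set T}, minor_model K222 V E B /\ preserves B a b).

Section Pairs.
Variable T : finType.

Definition add_edge (G : rel T) (u v : T) : rel T :=
  [rel x y | [|| G x y, (x == u) && (y == v) | (x == v) && (y == u)]].

(* contraction of the edge ab: b is merged into a.  The contracted graph has
   vertex set [set: T] :\ b and edge relation contr_rel E a b; the image of a
   vertex z is merge a b z. *)
Definition merge (a b z : T) : T := if z == b then a else z.

Definition contr_rel (E : rel T) (a b : T) : rel T :=
  [rel x y | (x != y) &&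
     [exists x0, exists y0, [&& merge a b x0 == x, merge a b y0 == y & E x0 y0]]].

Definition reducing (G : rel T) (u v a b : T) : Prop :=
  G a b /\
  ~~ contr_rel G a b (merge a b u) (merge a b v) /\
  exists S, [/\ atom_of ([set: T] :\ b) (contr_rel (add_edge G u v) a b) S,
               merge a b u \in S, merge a b v \in S &
               forbidden3_minor_preserving S (contr_rel (add_edge G u v) a b)
                                           (merge a b u) (merge a b v)].

Definition minimal_pair (G : rel T) (u v : T) : Prop :=
  [/\ simple_graph G, u != v, ~~ G u v,
      is_atom [set: T] (add_edge G u v) &
      forbidden3_minor_preserving [set: T] (add_edge G u v) u v] /\
  forall a b, ~ reducing G u v a b.

End Pairs.

Local Open Scope ring_scope.

Section Realizations.
Variables (R : realType) (T : finType).

Definition sqdist (x y : 'rV[R]_3) : R := \sum_(i < 3) (x 0 i - y 0 i) ^+ 2.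

Definition realization3 (G : rel T) (l : T -> T -> R) (p : T -> 'rV[R]_3) : Prop :=
  forall x y, G x y -> sqdist (p x) (p y) = l x y.

Definition Omega3 (G : rel T) (l : T -> T -> R) (u v : T) (d : R) : Prop :=
  exists p, realization3 G l p /\ sqdist (p u) (p v) = d.

Definition convex_set (A : R -> Prop) : Prop :=
  forall x y z, A x -> A y -> x <= z <= y -> A z.

Definition SIP3 (G : rel T) (u v : T) : Prop :=
  forall l : T -> T -> R, (forall x y, G x y -> 0 <= l x y) ->
    convex_set (Omega3 G l u v).

End Realizations.

(* Main.v *)
Require Import Defs.
From HB Require Import structures.
From mathcomp Require Import all_boot all_order all_algebra.
From mathcomp Require Import reals.
From mathcomp Require Import ring lra.
From Stdlib Require Import Classical.
Set Implicit Arguments. Unset Strict Implicit. Unset Printing Implicit Defensive.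
Import Order.TTheory GRing.Theory Num.Theory.

(* Minimality is only used through rigidity: a quotient of part of [G + uv] by connected classes in which
   [uv] stays a simple edge, and which is an atom with a forbidden minor preserving [uv], is trivial.
   In a rigid atom that is not K_5 or K_{2,2,2}, one end of the edge, say [u], has all its other
   neighbours in common with [v], and two nonadjacent ones [w1], [w2] are preserved by a forbidden
   minor of an atom of [G - u + w1w2].
   If [u] has a third such neighbour, then some vertex [a] has its neighbourhood contained in that of
   another vertex [b] and can be deleted; a realization is recovered by putting [a] on [b].
   If not, the atom of [G - u + w1w2] containing [w1w2] is rigid for this edge, and all other vertices
   are adjacent to [w1] and [w2] only (and [v] to [u]).  By induction |w1w2| takes exactly two values
   [D1], [D2]; prescribing |uw1| and |uw2| as [(D1 + D2) / 2] and [|D1 - D2| / 2], in a suitable order,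
   makes [u] collinear with [w1] and [w2] in both cases and gives |uv| exactly two values. *)

(** * Atoms and clique separators *)

(** The passage from [u], [v] to [w1], [w2] comes from a minor model in which the classes of [u] and
    [v] are as small as possible. A class larger than {u} is then {u} with a connected set R, and
    [u] sees at most one of the three classes that its class must see besides that of [v]. Either R
    sees all required classes and does without [u] ([star]), or, in the main remaining case, [u]
    sees exactly the class that R misses ([wing]); rigidity then shrinks the classes of this
    configuration to single vertices. The obstacle is the first alternative: the minor surviving in
    [V :\ u] may live in an atom that misses [v]. Most of the middle of the development shows that
    [V :\ u] or [V :\ v] is in fact an atom. In the geometric step the two prescribed lengths have
    sum max(D1, D2) and difference min(D1, D2). The triangle inequality is therefore tight for both
    values: [u] lies between [w1] and [w2] for the larger one and beyond one of them for the smaller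
    one. *)

Section Basics.
Variables (T : finType) (E : rel T).
Implicit Types (A B C D K L P Q R S U V W : {set T}).

(** Connectedness by cuts rather than paths: it directly yields the crossing edge that the arguments
    use, and passes to quotients and restrictions without path surgery. *)
Definition conn P : Prop :=
  (exists x, x \in P) /\
  forall L, (exists2 x, x \in P & x \in L) -> (exists2 y, y \in P & y \notin L) ->
    exists x y, [/\ x \in P, x \in L, y \in P, y \notin L & E x y].

Definition adj A B : bool := [exists x in A, exists y in B, E x y].

Lemma adjP A B : reflect (exists x y, [/\ x \in A, y \in B & E x y]) (adj A B).
Proof.
apply: (iffP existsP) => [[x /andP [xA /existsP [y /andP [yB Exy]]]]|[x [y [xA yB Exy]]]].
  by exists x, y.
by exists x; rewrite xA; apply/existsP; exists y; rewrite yB.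
Qed.

Definition nb S D := [set y in S :\: D | [exists x in D, E x y]].

(** Absence of a clique separator, quantified over one side [D] of a separation; the separator is
    then [nb S D]. The form in the statement of the theorem is recovered by [is_atomP]. *)
Definition atom S : Prop := (exists x, x \in S) /\
  forall D, D \subset S -> (exists x, x \in D) -> is_clique (nb S D) E ->
    forall z, z \in S -> z \in D \/ z \in nb S D.

(** Empty when [x] lies outside [R], a convention on which later case distinctions rely. *)
Definition cmp R x := [set y in R | connect (restr R E) x y].

(** A closed side [S] of a clique separation: the separator [K] belongs to it. *)
Definition csep V S K : Prop :=
  [/\ S \subset V, K \subset S, is_clique K E &
      forall x y, x \in V -> x \notin S -> y \in S -> E x y -> y \in K].

Definition maxatom V A : Prop :=
  [/\ A \subset V, atom A & forall B, B \subset V -> A \subset B -> atom B -> B = A].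

Lemma nbP S D y : reflect (exists x, [/\ x \in D, y \in S, y \notin D & E x y]) (y \in nb S D).
Proof.
rewrite !inE; apply: (iffP andP) => [[/andP [yD yS] /existsP [x /andP [xD Exy]]]|[x [xD yS yD Exy]]].
  by exists x.
by split; [rewrite yD | apply/existsP; exists x; rewrite xD].
Qed.

Lemma conn1 x : conn [set x].
Proof.
split; first by exists x; rewrite inE.
move=> L [y /set1P -> xL] [z /set1P ->]; by rewrite xL.
Qed.

Lemma cmp_sub R x : cmp R x \subset R.
Proof. by apply/subsetP => y; rewrite inE => /andP []. Qed.

Lemma cmp_refl R x : x \in R -> x \in cmp R x.
Proof. by rewrite inE => ->; rewrite connect0. Qed.

Lemma cmp_ind R x S : x \in S ->
  (forall a b, a \in S -> a \in R -> b \in R -> E a b -> b \in S) ->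
  cmp R x \subset S.
Proof.
move=> xS cl; apply/subsetP => y; rewrite inE => /andP [yR /connectP [p pp ->]].
elim: p x xS pp => [|z p IH] x xS //= /andP [/and3P [Exz xR zR] pp].
by apply: IH => //; apply: cl Exz.
Qed.

Lemma cmp_closed R x a b : a \in cmp R x -> b \in R -> E a b -> b \in cmp R x.
Proof.
rewrite !inE => /andP [aR ca] bR Eab; rewrite bR.
by apply: connect_trans ca (connect1 _); rewrite /restr /= Eab aR bR.
Qed.

Lemma cmp_in R x y : y \in cmp R x -> x \in R.
Proof.
rewrite inE => /andP [yR /connectP [[|z p] /= pp e]]; first by rewrite -e.
by case/andP: pp => /and3P [].
Qed.

Hypothesis symE : symmetric E.

Lemma adjC A B : adj A B = adj B A.
Proof. by apply/adjP/adjP => -[x [y [? ? ?]]]; exists y, x; split=> //; rewrite symE. Qed.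

Lemma conn_cut P L : conn P -> (exists2 x, x \in P & x \in L) -> (exists2 y, y \in P & y \notin L) ->
    exists x y, [/\ x \in P, x \in L, y \in P, y \notin L & E x y].
Proof. by case=> _; apply. Qed.

Lemma conn_all P L x : conn P -> x \in P -> x \in L ->
  (forall a b, a \in P -> b \in P -> a \in L -> E a b -> b \in L) ->
  P \subset L.
Proof.
move=> cP xP xL cl; apply/subsetP => y yP; apply: contraT => yL.
case: (conn_cut (L := L) cP); [by exists x|by exists y|].
move=> a [b [aP aL bP bL Eab]]; by rewrite (cl a b) in bL.
Qed.

(** A cut without crossing edges is closed on both sides by symmetry, so the side containing [x]
    suffices. *)
Lemma connI P x : x \in P ->
  (forall L, x \in L -> (forall a b, a \in P -> b \in P -> a \in L -> E a b -> b \in L) -> P \subset L) ->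
  conn P.
Proof.
move=> xP H; split; first by exists x.
move=> L [a aP aL] [b bP bL]; apply: NNPP => nex.
have cl a' b' : a' \in P -> b' \in P -> a' \in L -> E a' b' -> b' \in L.
  by move=> *; apply: contraT => ?; case: nex; exists a', b'; split.
have cl' a' b' : a' \in P -> b' \in P -> a' \in ~: L -> E a' b' -> b' \in ~: L.
  rewrite !inE => a'P b'P a'L Ea'b'; apply: contra a'L => b'L.
  by apply: (cl b') => //; rewrite symE.
case xL : (x \in L).
  by move/subsetP: (H L xL cl) => /(_ _ bP); rewrite (negbTE bL).
have xC : x \in ~: L by rewrite inE xL.
by move/subsetP: (H _ xC cl') => /(_ _ aP); rewrite inE aL.
Qed.

Lemma conn_cmp R x : x \in R -> conn (cmp R x).
Proof.
move=> xR; apply: (connI (x := x)); first exact: cmp_refl.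
move=> L xL cl; apply/subsetP => y yC.
have: cmp R x \subset L :&: cmp R x.
  apply: cmp_ind; first by rewrite inE xL cmp_refl.
  move=> a b /setIP [aL aC] aR bR Eab; have bC := cmp_closed aC bR Eab.
  by rewrite inE bC (cl a b).
by move/subsetP/(_ _ yC); rewrite inE => /andP [].
Qed.

Lemma conn_cmp_sub R x Q y : conn Q -> Q \subset R -> y \in Q -> y \in cmp R x -> Q \subset cmp R x.
Proof.
move=> cQ QR yQ yC; apply: (conn_all cQ yQ yC) => a b aQ bQ aC Eab.
by apply: cmp_closed aC _ Eab; apply: (subsetP QR).
Qed.

Lemma connU A B x y : conn A -> conn B -> x \in A -> y \in B -> x = y \/ E x y -> conn (A :|: B).
Proof.
move=> cA cB xA yB xy; apply: (connI (x := x)); first by rewrite inE xA.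
move=> L xL cl.
have AL : A \subset L.
  by apply: (conn_all cA xA xL) => a b aA bA; apply: cl; rewrite inE ?aA ?bA.
have yL : y \in L.
  by case: xy => [<- //|Exy]; apply: (cl x); rewrite ?inE ?xA ?yB ?orbT.
have BL : B \subset L.
  by apply: (conn_all cB yB yL) => a b aA bA; apply: cl; rewrite inE ?aA ?bA orbT.
by rewrite subUset AL BL.
Qed.

Lemma connUadj A B : conn A -> conn B -> adj A B -> conn (A :|: B).
Proof. by move=> cA cB /adjP [x [y [xA yB Exy]]]; apply: (connU cA cB xA yB); right. Qed.

Lemma conn_cover P A a : conn A -> A \subset P -> a \in A ->
  (forall x, x \in P -> exists Q, [/\ conn Q, Q \subset P, x \in Q & exists2 b, b \in Q & b \in A]) ->
  conn P.
Proof.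
move=> cA AP aA H; have aP := subsetP AP _ aA.
apply: (connI aP) => L aL cl; apply/subsetP => x xP.
have AL : A \subset L.
  by apply: (conn_all cA aA aL) => c d cA' dA'; apply: cl; exact: (subsetP AP).
have [Q [cQ QP xQ [b bQ bA]]] := H x xP.
have QL : Q \subset L.
  by apply: (conn_all cQ bQ (subsetP AL _ bA)) => c d cQ' dQ'; apply: cl; exact: (subsetP QP).
exact: (subsetP QL).
Qed.

(** An excursion of [P] outside [S] leaves and returns through the clique [K], where an edge
    shortcuts it. *)
Lemma conn_side P S K x : conn P -> is_clique K E -> K \subset S ->
  (forall a b, a \in P -> a \in S -> a \notin K -> b \in P -> E a b -> b \in S) ->
  x \in P -> x \in S -> conn (P :&: S).
Proof.
move=> cP cK KS cl xP xS; apply: (connI (x := x)); first by rewrite inE xP.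
move=> L xL clL; apply/subsetP => y /setIP [yP yS].
case: (boolP [exists k, [&& k \in P, k \in K & k \in L]]) => [/existsP [k /and3P [kP kK kL]]|/existsPn nk].
  have Kin : forall k', k' \in P -> k' \in K -> k' \in L.
    move=> k' k'P k'K; case: (eqVneq k k') => [<- //|kk'].
    by apply: (clL k); rewrite ?inE ?kP ?k'P ?(subsetP KS) //; apply: cK.
  apply: contraT => yL.
  have: P \subset ~: (S :\: L).
    apply: (conn_all cP xP); first by rewrite !inE xL.
    move=> a b aP bP; rewrite !inE negb_and negbK => aSL Eab; rewrite negb_and negbK.
    case bL : (b \in L) => //=; apply/negP => bS.
    have bK : b \notin K by apply/negP => /(Kin _ bP); rewrite bL.
    have aS : a \in S by apply: (cl b) => //; rewrite symE.
    by move: aSL; rewrite aS orbF => aL; rewrite (clL a b) ?inE ?aP ?bP in bL.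
  by move/subsetP/(_ _ yP); rewrite !inE yS yL.
have: P \subset L :&: S.
  apply: (conn_all cP xP); first by rewrite inE xL xS.
  move=> a b aP bP /setIP [aL aS] Eab; have aK : a \notin K.
    by apply/negP => aK; move: (nk a); rewrite aP aK aL.
  have bS := cl _ _ aP aS aK bP Eab.
  by rewrite inE bS (clL a b) ?inE ?aP ?bP.
by move/subsetP/(_ _ yP); rewrite inE => /andP [].
Qed.

Lemma clique_sub K K' : K' \subset K -> is_clique K E -> is_clique K' E.
Proof. by move=> /subsetP s c x y xK yK; apply: c; apply: s. Qed.

Lemma cliqueN K : ~ is_clique K E -> exists p q, [/\ p \in K, q \in K, p != q & ~~ E p q].
Proof.
move=> nc; apply: NNPP => nex; apply: nc => x y xK yK xy; apply: contraT => nE.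
by case: nex; exists x, y.
Qed.

Lemma atomE S D K x : atom S -> D \subset S -> x \in D -> is_clique K E ->
  (forall a b, a \in D -> b \in S -> E a b -> b \in D \/ b \in K) ->
  forall z, z \in S -> z \in D \/ z \in K.
Proof.
case=> _ aS DS xD cK cl z zS.
have sub : nb S D \subset K.
  apply/subsetP => y /nbP [a [aD yS yD Eay]].
  by case: (cl a y aD yS Eay) => // yD'; rewrite yD' in yD.
have [] := aS D DS (ex_intro _ x xD) (clique_sub sub cK) z zS; first by left.
by right; apply: (subsetP sub).
Qed.

Lemma atomN S D x z : atom S -> D \subset S -> x \in D -> z \in S -> z \notin D -> z \notin nb S D ->
  exists p q, [/\ p \in nb S D, q \in nb S D, p != q & ~~ E p q].
Proof.
case=> _ aS DS xD zS zD zn; apply: cliqueN => c.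
by case: (aS D DS (ex_intro _ x xD) c z zS) => h; [rewrite h in zD|rewrite h in zn].
Qed.

Lemma atom_conn S : atom S -> conn S.
Proof.
move=> aS; have [[x xS] _] := aS; apply: (connI xS) => L xL cl; apply/subsetP => z zS.
have [||||] := @atomE S (S :&: L) set0 x aS (subsetIl _ _) _ _ _ z zS.
- by rewrite inE xS.
- by move=> a b; rewrite inE.
- by move=> a b /setIP [aS' aL] bS Eab; left; rewrite inE bS (cl a b).
- by case/setIP.
- by rewrite inE.
Qed.

(** The sides are [D] with its neighbourhood and the complement of [D]; they overlap in this
    neighbourhood, a clique. *)
Lemma natom_sep V : (exists x, x \in V) -> ~ atom V ->
  exists S1 S2 K, [/\ csep V S1 K, csep V S2 K & [/\ (forall x, x \in V -> x \in S1 \/ x \in S2),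
    (forall x, x \in S1 -> x \in S2 -> x \in K), (exists2 x, x \in V & x \notin S1) & (exists2 x, x \in V & x \notin S2)]].
Proof.
move=> Vne na.
have [D [DV [x xD] cK [z [zV zD zn]]]] : exists D, [/\ D \subset V, (exists x, x \in D), is_clique (nb V D) E &
    exists z, [/\ z \in V, z \notin D & z \notin nb V D]].
  apply: NNPP => nex; apply: na; split=> // D DV Dne cD z zV.
  case zD : (z \in D); first by left.
  case zn : (z \in nb V D); first by right.
  by case: nex; exists D; split => //; exists z; rewrite zD zn.
have nbV : nb V D \subset V by apply/subsetP => y /nbP [a []].
exists (D :|: nb V D), (V :\: D), (nb V D); split; [split|split|split] => //.
- by rewrite subUset DV nbV.
- by apply: subsetUr.
- move=> a b aV; rewrite !inE negb_or => /andP [aD an] /orP [bD|//] Eab.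
  by case/negP: an; have := @nbP V D a; rewrite !inE => h; apply/h; exists b; rewrite symE.
- exact: subsetDl.
- by apply/subsetP => y /nbP [a [aD yV yD _]]; rewrite inE yD.
- move=> a b aV; rewrite !inE aV andbT negbK => aD /andP [bD bV] Eab.
  by have := @nbP V D b; rewrite !inE => h; apply/h; exists a.
- move=> a aV; rewrite !inE aV; case: (a \in D) => /=; [by left|by right].
- by move=> a; rewrite !inE => /orP [->|//].
- by exists z => //; rewrite inE negb_or zD zn.
- by exists x; [exact: (subsetP DV)| rewrite inE xD].
Qed.

Lemma maxatom_ex V A : A \subset V -> atom A -> exists2 B, maxatom V B & A \subset B.
Proof.
move: {2}(#|V| - #|A|) (leqnn (#|V| - #|A|)) => n; elim: n A => [|n IH] A h AV aA.
  exists A => //; split => // B BV AB _; apply/eqP; rewrite eq_sym eqEcard AB.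
  by apply: leq_trans (subset_leq_card BV) _; rewrite -subn_eq0 -leqn0.
case: (classic (exists B, [/\ B \subset V, A \subset B, atom B & B <> A])) => [[B [BV AB aB nBA]]|nex].
  have lt : #|A| < #|B| by rewrite proper_card // properEneq AB andbT eq_sym; apply/eqP.
  have [|C mC BC] := IH B _ BV aB; last by exists C => //; apply: subset_trans BC.
  rewrite -ltnS; apply: leq_trans h; apply: ltn_sub2l => //.
  by apply: leq_trans lt (subset_leq_card BV).
exists A => //; split=> // B BV AB aB; apply: NNPP => n'; apply: nex; by exists B.
Qed.

Lemma maxatomS V S A : maxatom V A -> A \subset S -> S \subset V -> maxatom S A.
Proof.
case=> AV aA mA AS SV; split=> // B BS AB aB; apply: mA => //; exact: subset_trans SV.
Qed.

(** A part outside a maximal atom attaches along a clique that is not the whole atom. The induction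
    splits [V] along a clique separator and passes to the side [S] containing [A]: the trace of [L]
    on [S] stays connected, and whatever [L] sees from outside [S] lies in the separator. *)
Lemma maxatom_comp V A L : maxatom V A -> conn L -> L \subset V -> (forall x, x \in L -> x \notin A) ->
  (forall a b, a \in L -> b \in V -> E a b -> b \in L \/ b \in A) ->
  is_clique (nb V L) E /\ exists2 a, a \in A & a \notin nb V L.
Proof.
move: {2}#|V| (leqnn #|V|) => n; elim: n V L => [|n IH] V L h mA cL LV LA cl.
  have [[x xL] _] := cL; move: (subsetP LV _ xL); rewrite leqn0 cards_eq0 in h.
  by rewrite (eqP h) inE.
have [[l lL] _] := cL; have [AV aA maxA] := mA; have [[a0 a0A] _] := aA.
have lV := subsetP LV _ lL.
case: (classic (atom V)) => [aV|naV].
  by have := maxA V (subxx _) AV aV => e; move: (LA _ lL); rewrite -e lV.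
have [S1 [S2 [K [s1 s2 [cov int [x1 x1V x1S] [x2 x2V x2S]]]]]] := natom_sep (ex_intro _ l lV) naV.
have A12 : A \subset S1 \/ A \subset S2.
  case: (boolP (A \subset S2)) => [|/subsetPn [b bA bS2]]; [by right|left].
  have cA := @atomE A (A :\: S2) K b aA (subsetDl _ _).
  apply/subsetP => y yA; have [|||yD|yK] := cA _ _ _ y yA.
  - by rewrite inE bS2.
  - by case: s1.
  - move=> c d; rewrite !inE => /andP [cS2 cA'] dA Ecd; rewrite dA andbT.
    case dS2 : (d \in S2); last by left.
    by right; case: s2 => _ _ _ /(_ c d); apply=> //; apply: (subsetP AV).
  - move: yD; rewrite inE => /andP [yS2 _]; case: (cov y (subsetP AV _ yA)) => // h2.
    by rewrite h2 in yS2.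
  - by case: s1 => _ /subsetP h' _ _; apply: h'.
(* If [A] lies in [K], both sides contain it and one that meets [L] is taken. Otherwise a vertex of
   [A] outside [K] is at hand for the case where [L] misses [S]. *)
have [S [sS AS [z zV zS] mm]] : exists S, [/\ csep V S K, A \subset S, (exists2 z, z \in V & z \notin S) &
   (exists2 m, m \in L & m \in S) \/ ~~ (A \subset K)].
  case: (boolP (A \subset K)) => AK.
    case: (cov l lV) => lS.
      by exists S1; split => //; [apply: subset_trans AK _; case: s1|exists x1|left; exists l].
    by exists S2; split => //; [apply: subset_trans AK _; case: s2|exists x2|left; exists l].
  by case: A12 => h12; [exists S1|exists S2]; split=> //; [exists x1|right|exists x2|right].
have [SV KS cK edge] := sS.
have ltS : #|S| <= n.
  rewrite -ltnS; apply: leq_trans h; apply: proper_card; apply/properP; split=> //.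
  by exists z.
case: (boolP [exists m, (m \in L) && (m \in S)]) => [/existsP [m /andP [mL mS]]|/existsPn nm].
  have cLS : conn (L :&: S).
    apply: (conn_side (K := K) (x := m) cL cK KS) => // a b aL aS aK bL Eab.
    apply: contraT => bS; case/negP: aK; apply: (edge b) => //; last by rewrite symE.
    exact: (subsetP LV).
  have [||clq [a aAA an]] := IH S (L :&: S) ltS (maxatomS mA AS SV) cLS (subsetIr _ _).
  - by move=> x /setIP [/LA].
  - move=> a b /setIP [aL aS] bS Eab; case: (cl a b aL (subsetP SV _ bS) Eab); last by right.
    by left; rewrite inE bS andbT.
  have sub : nb V L \subset nb S (L :&: S).
    apply/subsetP => y /nbP [x [xL yV yL Exy]].
    have yA : y \in A by case: (cl x y xL yV Exy) => // h'; rewrite h' in yL.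
    have yS := subsetP AS _ yA.
    have yLS : y \notin L :&: S by rewrite inE (negbTE yL).
    case xS : (x \in S); first by apply/nbP; exists x; rewrite inE xL xS.
    have yK : y \in K by apply: (edge x) => //; [exact: (subsetP LV)|rewrite xS].
    have [||p [q [pL pS qL qS Epq]]] := conn_cut (L := S) cL; [by exists m|by exists x; rewrite ?xS|].
    have pK : p \in K by apply: (edge q) => //; [exact: (subsetP LV)|rewrite symE].
    apply/nbP; exists p; rewrite inE pL pS; split=> //; apply: cK => //.
    by apply: contraNneq yL => <-.
  split; first exact: clique_sub clq.
  by exists a => //; apply: contra an; apply: (subsetP sub).
have sub : nb V L \subset K.
  apply/subsetP => y /nbP [x [xL yV yL Exy]].
  have yA : y \in A by case: (cl x y xL yV Exy) => // h'; rewrite h' in yL.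
  apply: (edge x) => //; [exact: (subsetP LV)| by move: (nm x); rewrite xL|exact: (subsetP AS)].
split; first exact: clique_sub cK.
case: mm => [[m mL mS]|/subsetPn [a aAA aK]]; first by move: (nm m); rewrite mL mS.
by exists a => //; apply: contra aK; apply: (subsetP sub).
Qed.

Lemma is_atomP S : is_atom S E <-> atom S.
Proof.
split=> [[ne ncs]|aS].
  split; first exact/set0Pn.
  move=> D DS [x xD] cD z zS.
  case zD : (z \in D); first by left.
  case zn : (z \in nb S D); first by right.
  case: ncs; exists (nb S D); split; first by apply/subsetP => y /nbP [a []].
  split=> //; exists x, z; split.
  - by rewrite inE (subsetP DS) // andbT; apply/nbP => [[a [_ _]]]; rewrite xD.
  - by rewrite inE zS zn.
  apply/negP => /and3P [_ zD' con].
  have: cmp (S :\: nb S D) x \subset D.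
    apply: cmp_ind => // a b aD _; rewrite in_setD => /andP [bn bS] Eab.
    by apply: contraT => bD; case/negP: bn; apply/nbP; exists a.
  move/subsetP/(_ z); rewrite inE zD' con => /(_ isT); by rewrite zD.
split; first by apply/set0Pn; case: aS.
case=> U [US [cU [x [y [xU yU nc]]]]].
case/setDP: (xU) => xS xU'; case/setDP: (yU) => yS yU'.
have [|||yC|yU2] := @atomE S (cmp (S :\: U) x) U x aS _ _ cU _ y yS.
- by apply: subset_trans (cmp_sub _ _) (subsetDl _ _).
- exact: cmp_refl.
- move=> a b aC bS Eab; case bU : (b \in U); [by right|left].
  by apply: cmp_closed aC _ Eab; rewrite inE bU.
- by move: nc; rewrite /conn_in xU yU /=; move: yC; rewrite inE => /andP [_ ->].
- by rewrite yU2 in yU'.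
Qed.

Lemma connected_setP S : connected_set S E <-> conn S.
Proof.
split=> [[/set0Pn [x xS] H]|cS].
  apply: (connI xS) => L xL cl; apply/subsetP => y yS.
  have /and3P [_ _ c] := H x y xS yS.
  have: cmp S x \subset L by apply: cmp_ind => // a b aL aS bS; apply: cl.
  by move/subsetP/(_ y); rewrite inE yS; apply.
split; first by apply/set0Pn; case: cS.
move=> x y xS yS; rewrite /conn_in xS yS /=.
have := conn_cmp_sub (R := S) (x := x) cS (subxx _) xS (cmp_refl xS).
by move/subsetP/(_ _ yS); rewrite inE => /andP [].
Qed.

End Basics.

(** * Hulls and projections onto a maximal atom *)

Section Hulls.
Variables (T : finType) (E : rel T).
Hypothesis symE : symmetric E.
Implicit Types (A B C D K L P Q R S U V W : {set T}).

Lemma adjS A A' B B' : A \subset A' -> B \subset B' -> adj E A B -> adj E A' B'.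
Proof.
move=> /subsetP sA /subsetP sB /adjP [x [y [xA yB Exy]]]; apply/adjP; exists x, y.
by split=> //; [apply: sA|apply: sB].
Qed.

Lemma cmp_eq R a b : b \in cmp E R a -> cmp E R b = cmp E R a.
Proof.
move=> h; apply/eqP; rewrite eqEsubset; apply/andP; split.
  by apply: cmp_ind => // x y xC xR yR; apply: cmp_closed.
have aR := cmp_in h; have bR := subsetP (cmp_sub E R a) _ h.
apply: (conn_cmp_sub (conn_cmp symE aR) (cmp_sub _ _ _) h); exact: cmp_refl.
Qed.

(* [A] is a hull when every component of the rest attaches to it along a clique: restricting
   connected sets to [A] then loses no connectedness and no adjacency. *)
Definition hull V A : Prop :=
  A \subset V /\ forall x, x \in V -> x \notin A -> is_clique (nb E A (cmp E (V :\: A) x)) E.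

(** The projection of [p] to [A]: any connected subset of [V] joining [p] to [A] contains one of
    these points. *)
Definition pr V A p := if p \in A then [set p] else nb E A (cmp E (V :\: A) p).

Lemma csep_hull V S K : csep E V S K -> hull V S.
Proof.
case=> SV KS cK cl; split=> // x xV xS; apply: clique_sub cK.
apply/subsetP => y /nbP [z [zC yS _ Ezy]].
by have /setDP [zV zS] := subsetP (cmp_sub _ _ _) _ zC; apply: (cl z).
Qed.

Lemma maxatom_hull V A : maxatom E V A -> hull V A.
Proof.
move=> mA; have [AV _ _] := mA; split=> // x xV xA.
have xD : x \in V :\: A by rewrite inE xA.
have sub y : y \in cmp E (V :\: A) x -> y \in V /\ y \notin A.
  by move/(subsetP (cmp_sub _ _ _)) => /setDP.
have [|||c _] := maxatom_comp symE mA (conn_cmp symE xD).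
- by apply/subsetP => y /sub [].
- by move=> y /sub [].
- move=> a b aC bV Eab; case bA : (b \in A); [by right|left].
  by apply: cmp_closed aC _ Eab; rewrite inE bA.
apply: clique_sub c; apply/subsetP => y /nbP [z [zC yA yC Ezy]].
by apply/nbP; exists z; split=> //; apply: (subsetP AV).
Qed.

(** Used to find a vertex of [A] that a clique separates from [x]. *)
Lemma maxatom_pr V A x : maxatom E V A -> x \in V -> x \notin A ->
  exists2 a, a \in A & a \notin pr V A x.
Proof.
move=> mA xV xA; have [AV _ _] := mA.
have xD : x \in V :\: A by rewrite inE xA.
have sub y : y \in cmp E (V :\: A) x -> y \in V /\ y \notin A.
  by move/(subsetP (cmp_sub _ _ _)) => /setDP.
have [|||_ [a aA an]] := maxatom_comp symE mA (conn_cmp symE xD).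
- by apply/subsetP => y /sub [].
- by move=> y /sub [].
- move=> a b aC bV Eab; case bA : (b \in A); [by right|left].
  by apply: cmp_closed aC _ Eab; rewrite inE bA.
exists a => //; rewrite /pr (negbTE xA); apply: contra an => /nbP [z [zC _ yC Ezy]].
by apply/nbP; exists z; split=> //; apply: (subsetP AV).
Qed.

Lemma pr_sub V A p : pr V A p \subset A.
Proof.
rewrite /pr; case: ifP => h; first by rewrite sub1set.
by apply/subsetP => x /nbP [? []].
Qed.

Lemma pr_clique V A p : hull V A -> p \in V -> is_clique (pr V A p) E.
Proof.
case=> _ H pV; rewrite /pr; case: ifP => h; last by apply: H; rewrite ?h.
by move=> x y /set1P -> /set1P ->; rewrite eqxx.
Qed.

Lemma pr_adj V A x y : x \in V -> x \notin A -> y \in A -> E x y -> y \in pr V A x.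
Proof.
move=> xV xA yA Exy; rewrite /pr (negbTE xA); apply/nbP; exists x; split=> //.
  by apply: cmp_refl; rewrite inE xA.
by apply/negP => /(subsetP (cmp_sub _ _ _)); rewrite inE yA.
Qed.

Lemma pr_conn V A x y P : x \in P -> y \in P -> conn E P -> P \subset V :\: A ->
  pr V A x = pr V A y.
Proof.
move=> xP yP cP PV; have h z : z \in P -> z \in A = false.
  by move/(subsetP PV); rewrite inE => /andP [/negbTE].
rewrite /pr !h //; suff -> : cmp E (V :\: A) x = cmp E (V :\: A) y by [].
apply: cmp_eq; apply: (subsetP (conn_cmp_sub cP PV yP (cmp_refl _ _))) => //.
exact: (subsetP PV).
Qed.

Lemma hull_exit V A P x a : conn E P -> P \subset V -> x \in P -> a \in P -> a \in A ->
  exists2 k, k \in P & k \in pr V A x.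
Proof.
move=> cP PV xP aP aA; case xA : (x \in A); first by exists x; rewrite /pr ?xA ?inE.
have xD : x \in V :\: A by rewrite inE xA (subsetP PV).
have sub y : y \in cmp E (V :\: A) x -> y \in V /\ y \notin A.
  by move/(subsetP (cmp_sub _ _ _)) => /setDP.
have [||p [q [pP pC qP qC Epq]]] := conn_cut (L := cmp E (V :\: A) x) cP.
- by exists x => //; apply: cmp_refl.
- by exists a => //; apply/negP => /sub []; rewrite aA.
exists q => //; rewrite /pr xA; apply/nbP; exists p; split=> //.
apply: contraT => qA; case/negP: qC; apply: cmp_closed pC _ Epq.
by rewrite inE qA (subsetP PV).
Qed.

Lemma prE V A x : x \notin A -> pr V A x = nb E A (cmp E (V :\: A) x).
Proof. by rewrite /pr => /negbTE ->. Qed.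

Lemma pr_edge V A x y : x \in V -> y \in V -> x \notin A -> y \notin A -> E x y ->
  pr V A x = pr V A y.
Proof.
move=> xV yV xA yA Exy; apply: (@pr_conn _ _ _ _ [set x; y]); rewrite ?inE ?eqxx ?orbT //.
- by apply: (connU symE (conn1 E x) (conn1 E y)); rewrite ?inE; [..|right; exact: Exy].
- by apply/subsetP => z; rewrite !inE => /orP [/eqP ->|/eqP ->]; rewrite ?xA ?yA.
Qed.

(** Each excursion of [P] outside [A] is replaced by an edge of the clique along which it
    attaches. *)
Lemma hull_conn V A P x : hull V A -> conn E P -> P \subset V -> x \in P -> x \in A ->
  conn E (P :&: A).
Proof.
move=> hA cP PV xP xA; apply: (connI symE (x := x)); first by rewrite inE xP.
move=> L xL cl.
(* Tracking projections instead of vertices follows an excursion while remembering the clique it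
   started from; [M] is closed under the edges of [P]. *)
pose M := [set y in P | [exists k in pr V A y, (k \in P) && (k \in L)]].
have MP y : reflect (y \in P /\ exists k, [/\ k \in pr V A y, k \in P & k \in L]) (y \in M).
  rewrite inE; apply: (iffP andP) => -[yP].
    by move=> /existsP [k /and3P [? ? ?]]; split=> //; exists k.
  by move=> [k [? ? ?]]; split=> //; apply/existsP; exists k; apply/and3P.
have step k l y : y \in P -> k \in pr V A y -> k \in P -> k \in L -> l \in P -> l \in pr V A y -> l \in L.
  move=> yP kr kP kL lP lr; case: (eqVneq k l) => [<- //|kl].
  have sA := subsetP (pr_sub V A y).
  apply: (cl k) => //; rewrite ?inE ?kP ?lP ?sA //.
  by apply: (pr_clique hA (subsetP PV _ yP)).
have sub : P \subset M.
  apply: (conn_all cP xP).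
    by apply/MP; split=> //; exists x; rewrite /pr xA inE.
  move=> a b aP bP /MP [_ [k [kr kP kL]]] Eab; apply/MP; split=> //.
  have aV := subsetP PV _ aP; have bV := subsetP PV _ bP.
  case bA : (b \in A).
    exists b; rewrite {1}/pr bA inE eqxx; split=> //.
    case aA : (a \in A).
      move: kr; rewrite /pr aA => /set1P ka; rewrite ka in kL.
      by apply: (cl a) => //; rewrite inE ?aP ?bP.
    by apply: (step k b a) => //; apply: pr_adj; rewrite ?aA.
  case aA : (a \in A).
    exists a; split=> //; first by apply: pr_adj; rewrite ?bA // symE.
    by move: kr; rewrite /pr aA => /set1P <-.
  by exists k; split=> //; rewrite -(@pr_edge V A a b) ?aA ?bA.
apply/subsetP => y /setIP [yP yA]; have /MP [_ [k []]] := subsetP sub _ yP.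
by rewrite /pr yA => /set1P ->.
Qed.

(** An edge [xy] outside [A] has both ends projecting to the same clique, and both [P] and [Q] meet
    this clique. If one end is in [A], it belongs to the projection of the other. *)
Lemma hull_adj V A P Q a b : hull V A -> conn E P -> P \subset V -> conn E Q -> Q \subset V ->
  (forall x, x \in P -> x \in Q -> False) ->
  a \in P -> a \in A -> b \in Q -> b \in A -> adj E P Q -> adj E (P :&: A) (Q :&: A).
Proof.
move=> hA cP PV cQ QV dis aP aA bQ bA /adjP [x [y [xP yQ Exy]]]; apply/adjP.
have xV := subsetP PV _ xP; have yV := subsetP QV _ yQ.
have [p pP pr_p] := hull_exit cP PV xP aP aA.
have [q qQ pr_q] := hull_exit cQ QV yQ bQ bA.
have sA z := subsetP (pr_sub V A z).
exists p, q; rewrite !inE pP qQ !(sA _ _ pr_p, sA _ _ pr_q); split=> //.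
have pq : p != q by apply/eqP => e; apply: (dis p) => //; rewrite e.
case xA : (x \in A); case yA : (y \in A).
- by move: pr_p pr_q; rewrite /pr xA yA => /set1P -> /set1P ->.
- move: pr_p; rewrite /pr xA => /set1P px; rewrite px in pq *.
  apply: (pr_clique hA yV) => //; apply: pr_adj; rewrite ?yA //; by rewrite symE.
- move: pr_q; rewrite /pr yA => /set1P px; rewrite px in pq *.
  apply: (pr_clique hA xV) => //; apply: pr_adj; rewrite ?xA //; by rewrite symE.
- apply: (pr_clique hA xV) => //; rewrite (@pr_edge V A x y) ?xA ?yA //.
Qed.

End Hulls.

(** * Partial minor models and their restriction to atoms *)

Section Families.
Variables (T : finType) (E : rel T).
Implicit Types (A C D K L P Q R S U V W : {set T}).

(** The quotient graph: each class is contracted to its index. *)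
Definition QE (I : finType) (B : I -> {set T}) : rel I := [rel i j | (i != j) && adj E (B i) (B j)].

Definition fam V (I : finType) (S : {set I}) (B : I -> {set T}) : Prop :=
  [/\ forall i, i \in S -> conn E (B i), forall i, i \in S -> B i \subset V &
      forall i j x, i \in S -> j \in S -> x \in B i -> x \in B j -> i = j].

(* A partial minor model of K_5 or K_{2,2,2}: [a] is the identity on the five classes, or the
   antipodal involution on the six classes; classes need not cover [V]. *)
Definition model V (I : finType) (F : {set I}) (a : I -> I) (B : I -> {set T}) : Prop :=
  [/\ fam V F B, forall i, i \in F -> a i \in F /\ a (a i) = i,
      (#|F| = 5 /\ forall i, i \in F -> a i = i) \/ (#|F| = 6 /\ forall i, i \in F -> a i <> i) &
      forall i j, i \in F -> j \in F -> j != i -> j != a i -> adj E (B i) (B j)].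

(* [p] and [q] are preserved by a forbidden minor. *)
Definition sepm V (p q : T) : Prop :=
  exists (I : finType) (F : {set I}) a B i j,
    model V F a B /\ [/\ i \in F, j \in F, i != j, p \in B i & q \in B j].

End Families.

Section Models.
Variables (T : finType) (E : rel T).
Hypothesis symE : symmetric E.
Implicit Types (A C D K L P Q R S U V W : {set T}).

Lemma QE_sym (I : finType) (B : I -> {set T}) : symmetric (QE E B).
Proof. by move=> i j; rewrite /QE /= eq_sym (adjC symE). Qed.

Lemma sepm_sym V p q : sepm E V p q -> sepm E V q p.
Proof.
move=> [I [F [a [B [i [j [m [iF jF ij pB qB]]]]]]]].
by exists I, F, a, B, j, i; split=> //; rewrite eq_sym.
Qed.

Lemma sepm_mem V p q : sepm E V p q -> [/\ p \in V, q \in V & p != q].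
Proof.
move=> [I [F [a [B [i [j [[[_ s d] _ _ _] [iF jF ij pB qB]]]]]]]].
split; [exact: (subsetP (s i iF))|exact: (subsetP (s j jF))|].
by apply: contraNneq ij => e; apply/eqP; apply: (d _ _ p) => //; rewrite e.
Qed.

Lemma model_sub V V' (I : finType) (F : {set I}) a B : V \subset V' -> model E V F a B -> model E V' F a B.
Proof.
move=> s [[c h d] ? ? ?]; split=> //; split=> // i iF; apply: subset_trans s; exact: h.
Qed.

Lemma sepm_sub V V' p q : V \subset V' -> sepm E V p q -> sepm E V' p q.
Proof.
move=> s [I [F [a [B [i [j [m h]]]]]]]; exists I, F, a, B, i, j; split=> //.
exact: model_sub m.
Qed.

Lemma conn_bigcup (I : finType) (B : I -> {set T}) (X : {set I}) :
  conn (QE E B) X -> (forall i, i \in X -> conn E (B i)) -> conn E (\bigcup_(i in X) B i).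
Proof.
move=> cX cB; have [[i0 i0X] _] := cX; have [[x0 x0B] _] := cB i0 i0X.
apply: (connI symE (x := x0)); first by apply/bigcupP; exists i0.
move=> L x0L cl; have all i x : i \in X -> x \in B i -> x \in L -> B i \subset L.
  move=> iX xB xL; apply: (conn_all (cB i iX) xB xL) => a b aB bB.
  by apply: cl; apply/bigcupP; exists i.
have: X \subset [set i | B i \subset L].
  apply: (conn_all cX i0X); first by rewrite inE; apply: all x0B x0L.
  move=> i j iX jX; rewrite !inE => iL /andP [_ /adjP [x [y [xB yB Exy]]]].
  apply: (all j y) => //; apply: (cl x) => //; last exact: (subsetP iL).
    by apply/bigcupP; exists i.
  by apply/bigcupP; exists j.
move=> /subsetP h; apply/bigcupsP => i iX; by move: (h i iX); rewrite inE.
Qed.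

Lemma fam_bigcup V (I J : finType) (B : I -> {set T}) (S : {set I}) (M : J -> {set I}) (F : {set J}) :
  fam E V S B -> fam (QE E B) S F M -> fam E V F (fun j => \bigcup_(i in M j) B i).
Proof.
case=> c s d [cM sM dM]; split.
- by move=> j jF; apply: conn_bigcup; [exact: cM|move=> i /(subsetP (sM j jF)) /c].
- by move=> j jF; apply/bigcupsP => i /(subsetP (sM j jF)) /s.
- move=> j k x jF kF /bigcupP [i iM xi] /bigcupP [i' i'M xi'].
  have e : i = i' by apply: (d _ _ x) => //; [exact: (subsetP (sM j jF))|exact: (subsetP (sM k kF))].
  by apply: (dM _ _ i) => //; rewrite e.
Qed.

(** A minor of a minor is a minor. *)
Lemma sepm_lift V (I : finType) (B : I -> {set T}) (S : {set I}) i j p q :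
  fam E V S B -> sepm (QE E B) S i j -> p \in B i -> q \in B j -> sepm E V p q.
Proof.
move=> fB [J [F [a [M [k [l [[fM aF cF adjF] [kF lF kl iM jM]]]]]]]] pB qB.
exists J, F, a, (fun j => \bigcup_(i in M j) B i), k, l; split.
  split=> //; first exact: fam_bigcup fM.
  move=> k' l' k'F l'F n1 n2; have /adjP [x [y [xM yM /andP [_ /adjP [x' [y' [x'B y'B Exy]]]]]]] := adjF k' l' k'F l'F n1 n2.
  by apply/adjP; exists x', y'; split=> //; apply/bigcupP; [exists x|exists y].
by split=> //; apply/bigcupP; [exists i|exists j].
Qed.

(** The classes other than [i] only grow, so adjacencies have to be checked at [i] alone. *)
Lemma model_repl V (I : finType) (F : {set I}) a B B' i :
  model E V F a B -> fam E V F B' -> i \in F ->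
  (forall j, j \in F -> j != i -> B j \subset B' j) ->
  (forall j, j \in F -> j != i -> j != a i -> adj E (B' i) (B' j)) -> model E V F a B'.
Proof.
case=> fB aF cF adjF fB' iF sub adi; split=> // k l kF lF n1 n2.
case: (eqVneq k i) => [e|ki]; first by rewrite e in n1 n2 *; apply: adi.
case: (eqVneq l i) => [e|li].
  rewrite e (adjC symE); apply: adi => //; rewrite e in n2.
  by apply: contraNneq n2 => ->; case: (aF i iF) => _ ->.
by apply: adjS (adjF k l kF lF n1 n2); apply: sub.
Qed.

Lemma model_grow V (I : finType) (F : {set I}) a B B' :
  model E V F a B -> fam E V F B' -> (forall j, j \in F -> B j \subset B' j) -> model E V F a B'.
Proof.
case=> fB aF cF adjF fB' sub; split=> // k l kF lF n1 n2.
by apply: adjS (adjF k l kF lF n1 n2); apply: sub.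
Qed.

Definition upd (I : finType) (B : I -> {set T}) i X := fun j => if j == i then X else B j.

Lemma fam_upd V (I : finType) (F : {set I}) B i X : fam E V F B -> conn E X -> X \subset V ->
  (forall j x, j \in F -> j != i -> x \in X -> x \in B j -> False) -> fam E V F (upd B i X).
Proof.
case=> c s d cX sX dX; split=> [j jF|j jF|j k x jF kF]; rewrite /upd.
- by case: eqP => // _; apply: c.
- by case: eqP => // _; apply: s.
case: eqP => [->|/eqP ji]; case: eqP => [-> //|/eqP ki] xj xk.
- by case: (dX k x).
- by case: (dX j x).
- exact: (d j k x).
Qed.

Lemma fam_sub V (I : finType) (F F' : {set I}) B : F' \subset F -> fam E V F B -> fam E V F' B.
Proof.
by move=> /subsetP s [c h d]; split=> [i /s|i /s|i j x /s iF /s]; [apply: c|apply: h|apply: d].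
Qed.

Lemma upd_same (I : finType) (B : I -> {set T}) i X : upd B i X i = X.
Proof. by rewrite /upd eqxx. Qed.

Lemma upd_other (I : finType) (B : I -> {set T}) i X j : j != i -> upd B i X j = B j.
Proof. by rewrite /upd => /negbTE ->. Qed.

Section OneModel.
Variables (V : {set T}) (I : finType) (F : {set I}) (a : I -> I) (B : I -> {set T}).
Hypothesis m : model E V F a B.

Lemma model_aF i : i \in F -> a i \in F. Proof. by case: m => _ h _ _ /h []. Qed.
Lemma model_aK i : i \in F -> a (a i) = i. Proof. by case: m => _ h _ _ /h []. Qed.
Lemma model_a_inj i j : i \in F -> j \in F -> a i = a j -> i = j.
Proof. by move=> iF jF e; rewrite -(model_aK iF) e model_aK. Qed.

Lemma model_enum6 i j : (exists2 i, i \in F & a i <> i) -> i \in F -> j \in F -> j != i -> j != a i ->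
  exists k, [/\ k \in F, k \notin [:: i; a i; j; a j] & forall x, x \in F -> x \in [:: i; a i; j; a j; k; a k]].
Proof.
case: m => _ aF [[_ h]|[c6 ne]] _; first by case=> k /h.
move=> _ iF jF ji jai.
have aiF := model_aF iF; have ajF := model_aF jF.
have nei x : x \in F -> a x != x by move=> xF; apply/eqP/ne.
have ajai : a j != a i by apply: contraNneq ji => /(model_a_inj jF iF) ->.
have aji : a j != i by apply: contraNneq jai => <-; rewrite model_aK.
pose F2 := F :\ i :\ a i :\ j :\ a j.
have c2 : #|F2| = 2.
  move: c6; rewrite (cardsD1 i) iF (cardsD1 (a i)) !inE nei // aiF (cardsD1 j) !inE jai ji jF.
  by rewrite (cardsD1 (a j)) !inE ajF aji ajai nei //= !add1n => -[].
have [k kF2] : exists k, k \in F2 by apply/set0Pn; rewrite -card_gt0 c2.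
have := kF2; rewrite !inE => /and5P [kaj kj kai ki kF].
have akF := model_aF kF.
have akF2 : a k \in F2.
  rewrite !inE akF andbT; apply/and4P; split.
  - by apply: contraNneq kj => /(model_a_inj kF jF) ->.
  - by apply: contraNneq kaj => <-; rewrite model_aK.
  - by apply: contraNneq ki => /(model_a_inj kF iF) ->.
  - by apply: contraNneq kai => <-; rewrite model_aK.
exists k; split=> //; first by rewrite !inE !negb_or ki kai kj kaj.
move=> x xF; apply: contraT; rewrite !inE !negb_or => /and5P [xi xai xj xaj /andP [xk xak]].
move: c2; rewrite (cardsD1 k) kF2 (cardsD1 (a k)) !inE nei //=.
have := akF2; rewrite !inE => -> /=.
rewrite (cardsD1 x) !inE xi xai xj xaj xk xak xF //=.
Qed.

(** Once the two other antipodal pairs are adjacent, the only missing edge of the octahedron is at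
    [j], and dropping [j] leaves a K_5. *)
Lemma model_drop j : j \in F -> a j != j ->
  (forall k, k \in F -> k != j -> k != a j -> adj E (B k) (B (a k))) -> model E V (F :\ j) id B.
Proof.
case: m => fB aF cF adjF jF aj h; split=> //.
- by apply: fam_sub fB; apply: subsetDl.
- left; split=> //; case: cF => [[_ /(_ j jF)]|[c6 _]]; first by move/eqP: aj.
  by move: c6; rewrite (cardsD1 j) jF => -[].
- move=> k l; rewrite !inE => /andP [kj kF] /andP [lj lF] lk _.
  case: (eqVneq l (a k)) => [lak|]; last exact: adjF.
  rewrite lak; apply: h => //; apply: contraNneq lj => e.
  by rewrite lak e; case: (aF j jF) => _ ->.
Qed.

(* An adjacent antipodal pair in a K_{2,2,2} model gives K_5 by merging two classes of the other pairs. *)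
Lemma model_merge i j1 j2 : i \in F -> a i != i -> j1 \in F -> j2 \in F -> j1 != i -> j1 != a i ->
  j2 \notin [:: i; a i; j1; a j1] -> adj E (B i) (B (a i)) ->
  model E V (F :\ j2) id (upd B j1 (B j1 :|: B j2)).
Proof.
move=> iF ai j1F j2F j1i j1ai j2n adi; case: (m) => fB aF cF adjF; have [cB sB dB] := fB.
have [k [kF kn all]] := model_enum6 (ex_intro2 _ _ i iF (elimN eqP ai)) iF j1F j1i j1ai.
have [j2i j2ai j21 j2a1] : [/\ j2 != i, j2 != a i, j2 != j1 & j2 != a j1].
  by move: j2n; rewrite !inE !negb_or => /and4P.
have j12 : adj E (B j1) (B j2) by apply: adjF.
have ne x : x \in F -> a x != x.
  by move=> xF; case: cF => [[_ h]|[_ h]]; [move: ai; rewrite h ?eqxx|apply/eqP/h].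
have a21 : a j2 != j1 by apply: contraNneq j2a1 => <-; case: (aF j2 j2F) => _ ->.
split=> //.
- apply: fam_upd.
  + by apply: fam_sub fB; apply: subsetDl.
  + by apply: connUadj => //; apply: cB.
  + by rewrite subUset !sB.
  + move=> j x; rewrite !inE => /andP [j2' jF] j1' /orP [] h1 h2.
      by move: j1'; rewrite (dB j j1 x) // eqxx.
    by move: j2'; rewrite (dB j j2 x) // eqxx.
- left; split=> //; case: cF => [[_ /(_ i iF)]|[c6 _]]; first by move/eqP: ai.
  by move: c6; rewrite (cardsD1 j2) j2F => -[].
have A1 l : l \in F -> l != j2 -> l != j1 -> adj E (B j1 :|: B j2) (B l).
  move=> lF l2 l1; case: (eqVneq l (a j1)) => [->|la1].
    apply: adjS (adjF j2 (a j1) j2F _ _ _) => //; rewrite ?subsetUr //.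
    + by case: (aF j1 j1F).
    + by rewrite eq_sym.
    + by apply: contraNneq j21 => /(model_a_inj j1F j2F) ->.
  by apply: adjS (adjF j1 l j1F _ _ _) => //; rewrite ?subsetUl.
move=> l l'; rewrite !inE => /andP [l2 lF] /andP [l'2 l'F] l'l _; rewrite /upd.
case: (eqVneq l j1) l'l => [-> l'1|l1 l'l]; first by rewrite (negbTE l'1); apply: A1.
case: (eqVneq l' j1) => [_|l'1]; first by rewrite (adjC symE); apply: A1.
case: (eqVneq l' (a l)) => [e|]; last exact: adjF.
case: (eqVneq l i) => [->|li] in e *; first by rewrite e.
case: (eqVneq l (a i)) => [->|lai] in e *.
  by rewrite e; case: (aF i iF) => _ ->; rewrite (adjC symE).
have kin : j2 = k \/ j2 = a k.
  by move: (all j2 j2F); rewrite !inE (negbTE j2i) (negbTE j2ai) (negbTE j21) (negbTE j2a1) /= => /orP [] /eqP; [left|right].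
move: (all l lF); rewrite !inE (negbTE li) (negbTE lai) (negbTE l1) /=.
case/or3P => /eqP el; case: (aF j1 j1F) => _ a1; case: (aF k kF) => _ ak.
- by move: l'1; rewrite e el a1 eqxx.
- by case: kin => ek; move: l2 l'2; rewrite e el ek ?eqxx.
- by case: kin => ek; move: l2 l'2; rewrite e el ek ?ak ?eqxx.
Qed.

End OneModel.

(** The class [i] shrinks to [X] while [Y] is handed to [g], the one required class that [X] may
    fail to see; afterwards [X] sees it through [Y]. *)
Lemma model_move V (I : finType) (F : {set I}) a B i g X Y :
  model E V F a B -> i \in F -> g \in F -> g != i ->
  conn E X -> conn E Y -> X \subset B i -> Y \subset B i -> (forall z, z \in X -> z \in Y -> False) ->
  adj E X Y -> adj E Y (B g) ->
  (forall j, j \in F -> j != i -> j != a i -> j != g -> adj E X (B j)) ->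
  model E V F a (upd (upd B g (B g :|: Y)) i X).
Proof.
move=> m iF gF gi cX cY sX sY dXY aXY gY gout.
case: (m) => fB aF _ adjF; have [cB sB dB] := fB.
apply: (model_repl (i := i) m) => //.
- split=> [j jF|j jF|j k z jF kF]; rewrite /upd.
  + case: eqP => // /eqP ji; case: eqP => [_|_]; last exact: cB.
    by apply: connUadj => //; [apply: cB|rewrite (adjC symE)].
  + case: eqP => [_|/eqP ji]; first by apply: subset_trans sX (sB i iF).
    case: eqP => [_|_]; last exact: sB.
    by rewrite subUset sB //; apply: subset_trans sY (sB i iF).
  have dX l : l \in F -> z \in X -> z \in B l -> l = i.
    by move=> lF zX zl; apply: (dB _ _ z) => //; apply: (subsetP sX).
  have dY l : l \in F -> z \in Y -> z \in B l -> l = i.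
    by move=> lF zX zl; apply: (dB _ _ z) => //; apply: (subsetP sY).
  case: (eqVneq j i) => [->|ji]; case: (eqVneq k i) => [-> //|ki].
  + case: (eqVneq k g) => [->|_] zX; last by move/(dX k kF zX) => ->.
    by case/setUP => h; [rewrite (dX g gF zX h)|case: (dXY z)].
  + case: (eqVneq j g) => [->|_] zj zX; last exact: dX.
    by case/setUP: zj => h; [exact: dX|case: (dXY z)].
  + case: (eqVneq j g) => [->|_]; case: (eqVneq k g) => [-> //|_].
    * case/setUP=> h zk; first exact: (dB g k z).
      by move: ki; rewrite (dY k kF h zk) eqxx.
    * move=> zk /setUP [] h; first exact: (dB j g z).
      by move: ji; rewrite (dY j jF h zk) eqxx.
    * exact: dB.
- by move=> j jF ji; rewrite upd_other // /upd; case: eqP => [->|_] //; apply: subsetUl.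
- move=> j jF ji ja; rewrite upd_same upd_other // /upd; case: eqP => [e|/eqP jg]; last exact: gout.
  by apply: adjS aXY => //; apply: subsetUr.
Qed.

(* Splitting the class of [p] and [q] along two adjacent parts, the part of [x] seeing all required
   neighbours but at most one, which absorbs the other part. *)
Lemma sepm_parts V (I : finType) (F : {set I}) a B i c X Y x y :
  model E V F a B -> i \in F -> c \in F -> c != i -> c != a i ->
  conn E X -> conn E Y -> X \subset B i -> Y \subset B i -> (forall z, z \in X -> z \in Y -> False) ->
  adj E X Y -> adj E X (B c) -> adj E Y (B c) -> x \in X -> y \in Y ->
  (forall j, j \in F -> j != i -> j != a i -> adj E X (B j) \/ adj E Y (B j)) ->
  #|[set j in F | [&& j != i, j != a i & ~~ adj E X (B j)]]| <= 1 ->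
  sepm E V x y.
Proof.
move=> m iF cF ci ca cX cY sX sY dXY aXY aXc aYc xX yY cov small.
case: (m) => fB aF _ adjF; have [cB sB dB] := fB.
have [g [gF gi gY gout]] : exists g, [/\ g \in F, g != i, adj E Y (B g) &
    forall j, j \in F -> j != i -> j != a i -> j != g -> adj E X (B j)].
  move: small; case: (set_0Vmem [set j in F | [&& j != i, j != a i & ~~ adj E X (B j)]]) => [e _|[g gin] c1].
    exists c; split=> // j jF ji ja _; apply: contraT => h.
    have : j \in [set j in F | [&& j != i, j != a i & ~~ adj E X (B j)]] by rewrite inE jF ji ja.
    by rewrite e inE.
  have := gin; rewrite inE => /and4P [gF gi ga gX].
  exists g; split=> //; first by case: (cov g gF gi ga) => // h; rewrite h in gX.
  move=> j jF ji ja jg; apply: contraT => h.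
  have := c1; rewrite (cardsD1 g) gin ltnS leqn0 cards_eq0 => /eqP e0.
  have : j \in [set j in F | [&& j != i, j != a i & ~~ adj E X (B j)]] :\ g by rewrite !inE jg jF ji ja.
  by rewrite e0 inE.
exists I, F, a, (upd (upd B g (B g :|: Y)) i X), i, g; split; last first.
  by split; rewrite // 1?eq_sym // ?upd_same // upd_other // upd_same inE yY orbT.
exact: model_move.
Qed.

(** The components of [P :\ p] are joined to each other only through [p], so removing one of them
    disconnects nothing else. *)
Lemma conn_minus_comp P p q : conn E P -> p \in P -> q \in P -> q != p ->
  conn E (P :\: cmp E (P :\ p) q).
Proof.
move=> cP pP qP qp; set C := cmp E (P :\ p) q.
have sub y : y \in C -> y != p /\ y \in P.
  by move/(subsetP (cmp_sub _ _ _)); rewrite !inE => /andP [].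
have pC : p \notin C by apply/negP => /sub []; rewrite eqxx.
have pD : p \in P :\: C by rewrite inE pC.
apply: (connI symE pD) => L pL cl.
have H : P \subset L :|: C.
  apply: (conn_all cP pP); first by rewrite inE pL.
  move=> a b aP bP /setUP [aL|aC] Eab; rewrite inE.
    case bC : (b \in C); first by rewrite orbT.
    case aC : (a \in C); last by rewrite (cl a b) // inE ?aC ?bC.
    case: (eqVneq b p) => [->|bp]; first by rewrite pL.
    by move: bC; rewrite /C (cmp_closed aC _ Eab) // !inE bp.
  case: (eqVneq b p) => [->|bp]; first by rewrite pL.
  by rewrite (cmp_closed aC _ Eab) ?orbT // !inE bp.
apply/subsetP => y /setDP [yP yC]; move: (subsetP H _ yP); rewrite inE (negbTE yC) orbF //.
Qed.

(** Separation propagates along common neighbours. If [p] and [q] share a class, it is split into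
    the component of [q] without [p] and the rest; both parts see the class of [k], and one of them
    can keep the role of the class while the other is moved. If [q] is in no class, it joins that of
    [k]. *)
Lemma sepm_split V k p q : sepm E V k p -> E k p -> E k q -> q \in V -> p != q -> k != q ->
  sepm E V p q.
Proof.
move=> sk Ekp Ekq qV pq kq.
have main (I : finType) (F : {set I}) a B c i : model E V F a B -> c \in F -> i \in F -> c != i -> c != a i ->
   k \in B c -> p \in B i -> q \in B i -> sepm E V p q.
  move=> m cF iF ci ca kB pB qB; case: (m) => fB aF cF' adjF; have [cB sB dB] := fB.
  set Y := cmp E (B i :\ p) q; set X := B i :\: Y.
  have subY y : y \in Y -> y != p /\ y \in B i.
    by move/(subsetP (cmp_sub _ _ _)); rewrite !inE => /andP [].
  have qY : q \in Y by apply: cmp_refl; rewrite !inE qB eq_sym pq.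
  have pX : p \in X by rewrite inE pB andbT; apply/negP => /subY []; rewrite eqxx.
  have cX : conn E X by apply: conn_minus_comp => //; [exact: cB|rewrite eq_sym].
  have cY : conn E Y by apply: conn_cmp => //; rewrite !inE qB eq_sym pq.
  have sX : X \subset B i by apply: subsetDl.
  have sY : Y \subset B i by apply/subsetP => y /subY [].
  have dXY z : z \in X -> z \in Y -> False by rewrite inE => /andP [/negbTE ->].
  have aXY : adj E X Y.
    have [||y [x [_ yY xB xY Exy]]] := conn_cut (L := Y) (cB i iF).
      by exists q.
      by exists p => //; apply/negP => /subY []; rewrite eqxx.
    by apply/adjP; exists x, y; rewrite inE xY xB symE.
  have aXc : adj E X (B c) by apply/adjP; exists p, k; rewrite symE.
  have aYc : adj E Y (B c) by apply/adjP; exists q, k; rewrite symE.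
  have cov j : j \in F -> j != i -> j != a i -> adj E X (B j) \/ adj E Y (B j).
    move=> jF ji ja; have /adjP [x [y [xi yj Exy]]] := adjF i j iF jF ji ja.
    by case xY : (x \in Y); [right|left]; apply/adjP; exists x, y; split=> //; rewrite inE xY.
  pose e Z := [set j in F | [&& j != i, j != a i & ~~ adj E Z (B j)]].
  (* A class must see four others. One of them is [c], seen by both parts, and each of the three
     remaining ones is seen by at least one part; hence one part misses at most one class. *)
  have c3 : #|e X| + #|e Y| <= 3.
    have dis : [disjoint e X & e Y].
      rewrite -setI_eq0; apply/eqP/setP => j; rewrite !inE; apply/negbTE/negP.
      case/andP => /and4P [jF ji ja h1] /and4P [_ _ _ h2].
      by case: (cov j jF ji ja) => h; [rewrite h in h1|rewrite h in h2].
    have : #|e X :|: e Y| <= 3.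
      have s : e X :|: e Y \subset F :\ i :\ a i :\ c.
        by apply/subsetP => j; rewrite !inE => /orP [] /and4P [jF ji ja h]; rewrite jF ji ja !andbT; apply: contraNneq h => ->; rewrite ?aXc ?aYc.
      apply: leq_trans (subset_leq_card s) _.
      case: cF' => [[c5 ida]|[c6 nea]].
        move: c5; rewrite (cardsD1 i) iF (ida i iF) add1n => -[c4].
        have -> : F :\ i :\ i = F :\ i by apply/setP => z; rewrite !inE andbA andbb.
        by move: c4; rewrite (cardsD1 c) !inE ci cF add1n => -[->].
      have ai : a i != i by apply/eqP/nea.
      move: c6; rewrite (cardsD1 i) iF (cardsD1 (a i)) !inE ai (model_aF m iF).
      by rewrite (cardsD1 c) !inE ci ca cF !add1n => -[->].
    by rewrite cardsU (disjoint_setI0 dis) cards0 subn0.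
  have [h|h] : #|e X| <= 1 \/ #|e Y| <= 1.
    by case: (leqP #|e X| 1) => h; [left|right; rewrite leqNgt; apply/negP => h2; have := leq_trans (leq_add h h2) c3].
  - exact: (sepm_parts m iF cF ci ca cX cY sX sY dXY aXY aXc aYc pX qY cov h).
  - apply: sepm_sym; apply: (sepm_parts m iF cF ci ca cY cX sY sX _ _ aYc aXc qY pX _ h).
    + by move=> z zY zX; apply: dXY zX zY.
    + by rewrite (adjC symE).
    + by move=> j jF ji ja; case: (cov j jF ji ja); [right|left].
case: sk => I [F [a [B [c [i [m [cF iF ci kB pB]]]]]]].
case: (m) => fB aF cF' adjF; have [cB sB dB] := fB.
case: (classic (exists2 j, j \in F & q \in B j)) => [[j jF qj]|nq].
  case: (eqVneq i j) => [e|ij]; last by exists I, F, a, B, i, j.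
  rewrite -e in jF qj => {e}.
  (* If [k] is in the antipodal class, the edge [kp] makes an antipodal pair adjacent, and merging
     gives a K_5 in which [main] applies. *)
  case: (eqVneq c (a i)) => [cai|cai]; last exact: (main I F a B c i).
  have aii : a i != i by rewrite -cai.
  case: cF' => [[_ h]|[c6 nea]]; first by move: aii; rewrite h // eqxx.
  have [j1 [j1F j1i j1ai]] : exists j1, [/\ j1 \in F, j1 != i & j1 != a i].
    move: c6; rewrite (cardsD1 i) iF (cardsD1 (a i)) !inE aii (model_aF m iF) !add1n => -[c4].
    have /set0Pn [x] : F :\ i :\ a i != set0 by rewrite -card_gt0 c4.
    by rewrite !inE => /and3P [? ? ?]; exists x.
  have [j2 [j2F j2n all]] := model_enum6 m (ex_intro2 _ _ i iF (elimN eqP aii)) iF j1F j1i j1ai.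
  have adi : adj E (B i) (B (a i)) by apply/adjP; exists p, k; rewrite -cai symE.
  have m' := model_merge m iF aii j1F j2F j1i j1ai j2n adi.
  have [j2i j2ai] : j2 != i /\ j2 != a i by move: j2n; rewrite !inE !negb_or => /and4P [].
  have ij1 : i != j1 by rewrite eq_sym.
  have cj1 : c != j1 by rewrite cai eq_sym.
  apply: (main _ _ _ _ c i m') => //; rewrite ?(upd_other _ _ ij1) ?(upd_other _ _ cj1) //.
  - by rewrite !inE cF cai eq_sym j2ai.
  - by rewrite !inE iF eq_sym j2i. 
exists I, F, a, (upd B c (B c :|: [set q])), i, c; split.
  apply: (model_grow m); last by move=> j jF; rewrite /upd; case: eqP => [->|//]; rewrite subsetUl.
  apply: fam_upd => //.
  - by apply: (connU symE (cB c cF) (conn1 E q) kB (set11 q)); right.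
  - by rewrite subUset sB // sub1set.
  - move=> j x jF jc; rewrite !inE => /orP [xc xj|/eqP -> qj]; last by apply: nq; exists j.
    by move: jc; rewrite (dB j c x) // eqxx.
by split; rewrite // 1?eq_sym // ?upd_same ?upd_other // ?inE ?eqxx ?orbT // eq_sym.
Qed.

End Models.

Section Restrict.
Variables (T : finType) (E : rel T).
Hypothesis symE : symmetric E.
Implicit Types (A C D K L P Q R S U V W : {set T}).

Definition met (I : finType) (F : {set I}) (B : I -> {set T}) A := forall k, k \in F -> exists2 x, x \in B k & x \in A.

Lemma model_hull V A (I : finType) (F : {set I}) a B : hull E V A -> model E V F a B -> met F B A ->
  model E A F a (fun k => B k :&: A).
Proof.
move=> hA [[cB sB dB] aF cF adjF] mt; split=> //.
- split=> [i iF|i iF|i j x iF jF /setIP [xi _] /setIP [xj _]]; last exact: (dB i j x).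
    by have [x xB xA] := mt i iF; apply: (hull_conn symE hA (cB i iF) (sB i iF) xB xA).
  exact: subsetIr.
- move=> i j iF jF n1 n2; have [x xB xA] := mt i iF; have [y yB yA] := mt j jF.
  apply: (hull_adj symE hA (cB i iF) (sB i iF) (cB j jF) (sB j jF) _ xB xA yB yA (adjF i j iF jF n1 n2)).
  by move=> z zi zj; move: n1; rewrite (dB i j z) // eqxx.
Qed.

Section TwoSides.
Variables (V S1 S2 K : {set T}) (I : finType) (F : {set I}) (a : I -> I) (B : I -> {set T}) (i1 i2 : I).
Hypotheses (s1 : csep E V S1 K) (s2 : csep E V S2 K) (cov : forall x, x \in V -> x \in S1 \/ x \in S2).
Hypotheses (m : model E V F a B) (i1F : i1 \in F) (i2F : i2 \in F).
Hypotheses (miss1 : forall x, x \in B i1 -> x \notin S1) (miss2 : forall x, x \in B i2 -> x \notin S2).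

Let sB i x : i \in F -> x \in B i -> x \in V.
Proof. by move=> iF; case: m => [[_ s _] _ _ _]; apply: (subsetP (s i iF)). Qed.

Let m1S x : x \in B i1 -> x \in S2.
Proof. by move=> xB; case: (cov (sB i1F xB)) => // h; move: (miss1 xB); rewrite h. Qed.

Let m2S x : x \in B i2 -> x \in S1.
Proof. by move=> xB; case: (cov (sB i2F xB)) => // h; move: (miss2 xB); rewrite h. Qed.

(** Classes strictly on opposite sides of a clique separation are not adjacent, and distinct
    nonadjacent classes of a model are antipodal. *)
Lemma two_sides_antipodal : i2 = a i1 /\ i1 != i2.
Proof.
have [[cB _ _] _ _ adjF] := m; have ne : i1 != i2.
  apply/eqP => e; have [[x xB] _] := cB i1 i1F.
  by move: (miss2 (x := x)); rewrite -e => /(_ xB); rewrite m1S.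
split=> //; apply/eqP; apply: contraT => n.
have /adjP [x [y [xB yB Exy]]] : adj E (B i1) (B i2) by apply: adjF => //; rewrite eq_sym.
case: s1 => _ _ _ /(_ x y (sB i1F xB) (miss1 xB) (m2S yB) Exy) yK.
by case: s2 => _ /subsetP /(_ _ yK) h _ _; move: (miss2 yB); rewrite h.
Qed.

(** [B k] must see both [B i1] and [B i2], which lie strictly on opposite sides, so it passes
    through the separator. *)
Lemma two_sides_K k : k \in F -> k != i1 -> k != i2 -> exists2 x, x \in B k & x \in K.
Proof.
have [e ne] := two_sides_antipodal; have [[cB _ _] aF _ adjF] := m.
move=> kF k1 k2.
have /adjP [x [y [xB yB Exy]]] : adj E (B i1) (B k) by apply: adjF => //; rewrite -e.
have /adjP [x' [y' [x'B y'B Ex'y']]] : adj E (B i2) (B k).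
  by apply: adjF => //; rewrite e; case: (aF i1 i1F) => _ ->.
case: (boolP (y \in S1)) => yS.
  by exists y => //; case: s1 => _ _ _; apply; [exact: sB xB|exact: miss1| |exact: Exy].
case: (boolP (y' \in S2)) => y'S.
  by exists y' => //; case: s2 => _ _ _; apply; [exact: sB x'B|exact: miss2| |exact: Ex'y'].
have y'S1 : y' \in S1 by case: (cov (sB kF y'B)) => // h; rewrite h in y'S.
have [||p [q [pB pS qB qS Epq]]] := conn_cut (L := S1) (cB k kF); [by exists y'|by exists y|].
exists p => //; case: s1 => _ _ _ /(_ q p); apply=> //; [exact: sB qB|by rewrite symE].
Qed.

(** All classes but [i1] and its antipode meet the clique [K], hence are pairwise adjacent: without
    [i1] the octahedron model is a K_5 model. *)
Lemma two_sides_model : model E V (F :\ i1) id B /\ met (F :\ i1) B S1.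
Proof.
have [e ne] := two_sides_antipodal; have [[cB _ dB] aF _ adjF] := m.
split.
  apply: (model_drop m) => //; first by rewrite -e eq_sym.
  move=> k kF k1 k2; case: (eqVneq (a k) k) => [ak|ak].
    by rewrite -e in k2; move: m => [_ _ [[_ h]|[_ h]] _];
       [move: ne; rewrite e h // eqxx|case: (h k kF)].
  have akF := (aF k kF).1.
  have ak1 : a k != i1.
    by apply: contraNneq k2 => h; rewrite -h; case: (aF k kF) => _ ->.
  have ak2 : a k != i2.
    rewrite e; apply: contraNneq k1 => h; apply/eqP.
    by case: (aF k kF) => _ <-; rewrite h; case: (aF i1 i1F) => _ ->.
  rewrite -e in k2.
  have [x xB xK] := two_sides_K kF k1 k2; have [y yB yK] := two_sides_K akF ak1 ak2.
  apply/adjP; exists x, y; split=> //; case: s1 => _ _ cK _; apply: cK => //.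
  by apply: contraNneq ak => h; apply/eqP; apply: (dB _ _ y) => //; rewrite -h.
move=> k; rewrite !inE => /andP [k1 kF]; case: (eqVneq k i2) => [->|k2].
  by have [[x xB] _] := cB i2 i2F; exists x => //; apply: m2S.
have [x xB xK] := two_sides_K kF k1 k2; exists x => //.
by case: s1 => _ /subsetP h _ _; apply: h.
Qed.

(* The dropped class [i1] is absorbed by a neighbouring class when it carries a separated point. *)
Lemma two_sides_absorb x y : x \in F -> y \in F -> x != y -> y != i1 ->
  exists B' x' y', [/\ model E V (F :\ i1) id B', met (F :\ i1) B' S1 &
    [/\ x' \in F :\ i1, y' \in F :\ i1, x' != y', B x \subset B' x' & B y \subset B' y']].
Proof.
move=> xF yF xy y1; have [m' mt] := two_sides_model; have [e ne] := two_sides_antipodal.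
have [[cB sB' dB] aF cF adjF] := m.
case: (eqVneq x i1) => [ex|x1]; last first.
  by exists B, x, y; split => //; split; rewrite // !inE ?x1 ?y1.
have [k [kF k1 k2 ky]] : exists k, [/\ k \in F, k != i1, k != i2 & k != y].
  have c : 4 <= #|F :\ i1 :\ i2|.
    case: cF => [[_ /(_ i1 i1F)]|[c6 _]]; first by move=> h; move: ne; rewrite e h eqxx.
    by move: c6; rewrite (cardsD1 i1) i1F (cardsD1 i2) !inE eq_sym ne i2F !add1n => -[->].
  move: c; rewrite (cardsD1 y) => c.
  have /set0Pn [k] : F :\ i1 :\ i2 :\ y != set0.
    by rewrite -card_gt0; move: c; case: (y \in _); case: #|_|.
  by rewrite !inE => /and4P [? ? ? ?]; exists k.
exists (upd B k (B k :|: B i1)), k, y; split; last first.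
- split; rewrite ?inE ?k1 ?y1 //; first by rewrite upd_same ex subsetUr.
  by rewrite upd_other // eq_sym.
- move=> j jF; have [z zB zS] := mt j jF; exists z => //; rewrite /upd; case: eqP => [<-|//].
  by rewrite inE zB.
apply: (model_grow m'); last by move=> j jF; rewrite /upd; case: eqP => [->|//]; rewrite subsetUl.
apply: fam_upd => //; first by case: m'.
- apply: connUadj => //; [exact: cB|exact: cB|apply: adjF => //; first by rewrite eq_sym].
  by apply: contraNneq k2 => h; rewrite e h; case: (aF k kF) => _ ->.
- by rewrite subUset !sB'.
- move=> j z; rewrite !inE => /andP [j1 jF] jk /orP [] h1 h2.
    by move: jk; rewrite (dB j k z) // eqxx.
  by move: j1; rewrite (dB j i1 z) // eqxx.
Qed.

End TwoSides.

(** At a clique separation, either all classes meet one side, to which the model is restricted, or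
    two classes lie strictly on opposite sides and one of them is dropped. The marked classes are
    kept as supersets, so that the points to be separated need not lie in the atom. *)
Lemma model_restrict V (I : finType) (F : {set I}) a B i j :
  model E V F a B -> i \in F -> j \in F -> i != j ->
  exists (I' : finType) (F' : {set I'}) a' B' i' j' A,
    [/\ model E V F' a' B', maxatom E V A, met F' B' A &
     [/\ i' \in F', j' \in F', i' != j', B i \subset B' i' & B j \subset B' j']].
Proof.
move: {2}#|V| (leqnn #|V|) => n; elim: n V I F a B i j => [|n IH] V I F a B i j h m iF jF ij.
  have [[cB sB _] _ _ _] := m; have [[x xB] _] := cB i iF; move: (subsetP (sB i iF) _ xB).
  by rewrite leqn0 cards_eq0 in h; rewrite (eqP h) inE.
have [[cB sB _] _ _ _] := m; have [[x0 x0B] _] := cB i iF.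
case: (classic (atom E V)) => [aV|naV].
  exists I, F, a, B, i, j, V; split=> //.
  - split=> // S SV VS _; apply/eqP; rewrite eqEsubset SV VS //.
  - move=> k kF; have [[x xB] _] := cB k kF; exists x => //; exact: (subsetP (sB k kF)).
have [S1 [S2 [K [s1 s2 [cov _ [x1 x1V x1S] [x2 x2V x2S]]]]]] :=
  natom_sep symE (ex_intro _ x0 (subsetP (sB i iF) _ x0B)) naV.
have fin (S : {set T}) (J : finType) (G : {set J}) b (C : J -> {set T}) k l x : csep E V S K -> x \in V -> x \notin S ->
  model E V G b C -> met G C S -> k \in G -> l \in G -> k != l -> B i \subset C k -> B j \subset C l ->
  exists (I' : finType) (F' : {set I'}) a' B' i' j' A,
    [/\ model E V F' a' B', maxatom E V A, met F' B' A &
     [/\ i' \in F', j' \in F', i' != j', B i \subset B' i' & B j \subset B' j']].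
  move=> sS xV xS mC mt kG lG kl sk sl.
  have [SV _ _ _] := sS; have hS := csep_hull sS.
  have ltS : #|S| <= n.
    by rewrite -ltnS; apply: leq_trans h; apply: proper_card; apply/properP; split=> //; exists x.
  have [I' [F' [a' [B' [k' [l' [A [m' mA mt' [k'F l'F kl' sk' sl']]]]]]]]] :=
    IH S J G b _ k l ltS (model_hull hS mC mt) kG lG kl.
  have [A1 mA1 AA1] := maxatom_ex (subset_trans (let: And3 AS _ _ := mA in AS) SV) (let: And3 _ aA _ := mA in aA).
  have [[cC sC dC] _ _ _] := mC; have [[cB' sB' dB'] _ _ _] := m'.
  (* Restriction to the side cuts the marked classes; the original classes are glued back onto their
     restrictions. *)
  exists I', F', a', (fun t => if t == k' then B' t :|: C k else if t == l' then B' t :|: C l else B' t), k', l', A1.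
  have sub t : B' t \subset (if t == k' then B' t :|: C k else if t == l' then B' t :|: C l else B' t).
    by case: eqP => _; [apply: subsetUl|case: eqP => _; [apply: subsetUl|]].
  split=> //; last first.
  - split=> //; first by rewrite eqxx; apply: subset_trans sk (subsetUr _ _).
    by rewrite eq_sym (negbTE kl') eqxx; apply: subset_trans sl (subsetUr _ _).
  - move=> t tF; have [z zB zA] := mt' t tF; exists z; [exact: (subsetP (sub t))|exact: (subsetP AA1)].
  apply: (model_grow (B := B')); [exact: model_sub m'| |by move=> t _; apply: sub].
  have cU g t : g \in G -> t \in F' -> C g :&: S \subset B' t -> conn E (B' t :|: C g).
    move=> gG tF s; have [z zC zS] := mt g gG.
    by apply: (connU symE (cB' t tF) (cC g gG) (x := z) (y := z)); [apply: (subsetP s); rewrite inE zC| |left].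
  split.
  - move=> t tF; case: eqP => [->|_]; first exact: cU.
    by case: eqP => [->|_]; [exact: cU|exact: cB'].
  - move=> t tF; have := subset_trans (sB' t tF) SV; case: eqP => [_ s|_]; first by rewrite subUset s sC.
    by case: eqP => [_ s|//]; rewrite subUset s sC.
  have cr g t s z : g \in G -> t \in F' -> s \in F' -> C g :&: S \subset B' t -> z \in C g -> z \in B' s -> s = t.
    move=> gG tF sF su zC zs; apply: (dB' s t z) => //; apply: (subsetP su).
    by rewrite inE zC (subsetP (sB' s sF)).
  have ckl z : z \in C k -> z \in C l -> False.
    by move=> zk zl; move: kl; rewrite (dC k l z) // eqxx.
  move=> s t z sF tF; case: (eqVneq s k') => [->|sk1]; case: (eqVneq t k') => [-> //|tk1].
  - case: (eqVneq t l') => [->|tl1] /setUP [] h1.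
    + by case/setUP => h2; [exact: (dB' _ _ z)|rewrite (cr l l' k' z)].
    + by case/setUP => h2; [rewrite (cr k k' l' z)|case: (ckl z)].
    + by move=> h2; apply: (dB' _ _ z).
    + by move=> h2; rewrite (cr k k' t z).
  - case: (eqVneq s l') => [->|sl1].
    + case/setUP => h1 /setUP [] h2; first exact: (dB' _ _ z).
      * by rewrite (cr k k' l' z).
      * by rewrite (cr l l' k' z).
      * by case: (ckl z).
    + by move=> h1 /setUP [] h2; [exact: (dB' _ _ z)|rewrite (cr k k' s z)].
  - case: (eqVneq s l') => [->|sl1]; case: (eqVneq t l') => [-> //|tl1].
    + by case/setUP => h1 h2; [exact: (dB' _ _ z)|rewrite (cr l l' t z)].
    + by move=> h1 /setUP [] h2; [exact: (dB' _ _ z)|rewrite (cr l l' s z)].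
    + exact: dB'.
have nmet (S : {set T}) : ~ met F B S -> exists2 t, t \in F & forall x, x \in B t -> x \notin S.
  move=> nm; apply: NNPP => nex; apply: nm => k kF; apply: NNPP => n1; apply: nex; exists k => // x xB.
  by apply/negP => xS; apply: n1; exists x.
case: (classic (met F B S1)) => [m1|/nmet [i1 i1F miss1]]; first exact: (fin S1 I F a B i j x1).
case: (classic (met F B S2)) => [m2|/nmet [i2 i2F miss2]]; first exact: (fin S2 I F a B i j x2).
case: (eqVneq j i1) => [ej|ji1].
  have [||B' [y' [x' [m' mt [y'F x'F xy sy sx]]]]] := two_sides_absorb s1 s2 cov m i1F i2F miss1 miss2 jF iF.
    by rewrite eq_sym.
    by rewrite -ej.
  by apply: (fin S1 _ _ _ _ x' y' x1 s1 x1V x1S m' mt) => //; rewrite eq_sym.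
have [B' [x' [y' [m' mt [y'F x'F xy sy sx]]]]] := two_sides_absorb s1 s2 cov m i1F i2F miss1 miss2 iF jF ij ji1.
by apply: (fin S1 _ _ _ _ x' y' x1 s1 x1V x1S m' mt).
Qed.

Lemma sepm_restrict V p q : sepm E V p q ->
  exists (I : finType) (F : {set I}) a B i j A, [/\ model E V F a B, maxatom E V A, met F B A &
     [/\ i \in F, j \in F, i != j, p \in B i & q \in B j]].
Proof.
case=> I [F [a [B [i [j [m [iF jF ij pB qB]]]]]]].
have [I' [F' [a' [B' [i' [j' [A [m' mA mt [i'F j'F ij' s1 s2]]]]]]]]] := model_restrict m iF jF ij.
exists I', F', a', B', i', j', A; split=> //; split=> //; [exact: (subsetP s1)|exact: (subsetP s2)].
Qed.

Lemma met_pr V A (I : finType) (F : {set I}) a B i p : model E V F a B -> met F B A ->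
  i \in F -> p \in B i -> exists2 k, k \in B i & k \in pr E V A p.
Proof.
move=> [[cB sB _] _ _ _] mt iF pB; have [x xB xA] := mt i iF.
exact: (hull_exit (cB i iF) (sB i iF) pB xB xA).
Qed.

(** Separated points outside the atom are represented inside it by points of their projections. *)
Lemma sepm_proj V p q : sepm E V p q -> exists A p' q',
  [/\ maxatom E V A, p' \in pr E V A p, q' \in pr E V A q & sepm E A p' q'].
Proof.
case/sepm_restrict => I [F [a [B [i [j [A [m mA mt [iF jF ij pB qB]]]]]]]].
have hA := maxatom_hull symE mA.
have [p' pB' p'r] := met_pr m mt iF pB; have [q' qB' q'r] := met_pr m mt jF qB.
exists A, p', q'; split=> //; exists I, F, a, (fun k => B k :&: A), i, j; split.
  exact: (model_hull hA m mt).
by split=> //; rewrite inE ?pB' ?qB' (subsetP (pr_sub E V A _) _ p'r, subsetP (pr_sub E V A _) _ q'r).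
Qed.

End Restrict.

Section Atoms.
Variables (T : finType) (E : rel T).
Hypothesis symE : symmetric E.
Implicit Types (A C D K L P Q R S U V W : {set T}).

Lemma atom_clique S x : x \in S -> is_clique S E -> atom E S.
Proof.
move=> xS cS; split; first by exists x.
move=> D DS [y yD] _ z zS; case zD : (z \in D); [by left|right].
apply/nbP; exists y; split=> //; first by rewrite zD.
apply: cS => //; first exact: (subsetP DS).
by apply: contraFneq zD => <-.
Qed.

(** No clique separates the atom [A], so a clique separator would have to cut off [w] and contain
    both [p] and [q]. *)
Lemma atom_attach A w p q : atom E A -> w \notin A -> p \in A -> q \in A -> p != q -> ~~ E p q ->
  E w p -> E w q -> atom E (w |: A).
Proof.
move=> aA wA pA qA pq nE Ewp Ewq; split; first by exists w; rewrite !inE eqxx.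
move=> D DS [x xD] cD z zS; case zD : (z \in D); [by left|right].
apply: contraT => zn; exfalso; move/negP: nE; apply.
have pS : p \in w |: A by rewrite inE pA orbT.
have qS : q \in w |: A by rewrite inE qA orbT.
case: (classic (exists2 y, y \in D & y \in A)) => [[y yD yA]|nD].
  have sub : nb E A (D :&: A) \subset nb E (w |: A) D.
    apply/subsetP => b /nbP [c [/setIP [cD' _] bA bn Ecb]]; apply/nbP; exists c; split=> //.
      by rewrite inE bA orbT.
    by apply: contra bn => bD; rewrite inE bD.
  have all : forall b, b \in A -> b \in D \/ b \in nb E A (D :&: A).
    move=> b bA; case: (proj2 aA (D :&: A) (subsetIr _ _) _ (clique_sub sub cD) b bA).
    - by exists y; rewrite inE yD.
    - by case/setIP; left.
    - by right.
  have zw : z = w.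
    move: zS; rewrite !inE => /orP [/eqP //|zA].
    by case: (all z zA) => h; [rewrite h in zD|rewrite (subsetP sub _ h) in zn].
  have nw b : b \in A -> E w b -> b \in nb E A (D :&: A).
    move=> bA Ewb; case: (all b bA) => // bD; case/negP: zn; apply/nbP; exists b; split=> //.
      by rewrite zD.
    by rewrite zw symE.
  by apply: cD => //; apply: (subsetP sub); apply: nw.
have Dw b : b \in D -> b = w.
  move=> bD; move: (subsetP DS _ bD); rewrite !inE => /orP [/eqP //|bA].
  by case: nD; exists b.
have wD : w \in D by rewrite -(Dw x xD).
have nbw b : b \in A -> E w b -> b \in nb E (w |: A) D.
  move=> bA Ewb; apply/nbP; exists w; split=> //; first by rewrite inE bA orbT.
  by apply/negP => bD; apply: nD; exists b.
by apply: cD => //; apply: nbw.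
Qed.

Lemma atom_C4 p q r s : p != r -> q != s -> E p q -> E q r -> E r s -> E s p -> ~~ E p r -> ~~ E q s ->
  p != q -> q != r -> r != s -> s != p -> atom E [set p; q; r; s].
Proof.
move=> pr qs Epq Eqr Ers Esp nr ns pq qr rs sp; split; first by exists p; rewrite !inE eqxx.
move=> D DS [x xD] cD z zS; case zD : (z \in D); [by left|right].
apply: contraT => zn; exfalso.
have key a b c d : [set p; q; r; s] =i [:: a; b; c; d] -> E a b -> E b c -> E c d -> E d a -> b != d -> ~~ E b d -> z != a.
  move=> e Eab Ebc Ecd Eda bd nbd; apply: contraNneq nbd => za.
  have no y : y \in [set p; q; r; s] -> E a y -> y \notin D.
    move=> yS Eay; apply: contra zn => yD; apply/nbP; exists y; split=> //; rewrite ?zD //.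
    by rewrite za symE.
  have bS : b \in [set p; q; r; s] by rewrite e !inE eqxx orbT.
  have dS : d \in [set p; q; r; s] by rewrite e !inE eqxx !orbT.
  have bD := no b bS Eab.
  have dD : d \notin D by apply: no => //; rewrite symE.
  have cD' : c \in D.
    move: (subsetP DS _ xD); rewrite e !inE => /or4P [] /eqP xe; move: xD; rewrite xe.
    - by rewrite -za zD.
    - by move: bD => /negbTE ->.
    - by [].
    - by move: dD => /negbTE ->.
  by apply: cD => //; apply/nbP; exists c; split=> //; rewrite symE.
move: zS; rewrite !inE -!orbA => /or4P [] zx.
- have : z != p by apply: (key p q r s) => // y; rewrite !inE -!orbA.
  by rewrite zx.
- have : z != q by apply: (key q r s p) => //; rewrite 1?eq_sym // 1?symE // => y; rewrite !inE; do 4!case: eqP => //=.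
  by rewrite zx.
- have : z != r by apply: (key r s p q) => //; rewrite 1?eq_sym // 1?symE // => y; rewrite !inE; do 4!case: eqP => //=.
  by rewrite zx.
- have : z != s by apply: (key s p q r) => //; rewrite 1?eq_sym // 1?symE // => y; rewrite !inE; do 4!case: eqP => //=.
  by rewrite zx.
Qed.

End Atoms.

Section Extend.
Variables (T : finType) (E1 E2 : rel T).
Implicit Types (P S D : {set T}).

Lemma conn_mono P : {in P &, forall x y, E1 x y -> E2 x y} -> conn E1 P -> conn E2 P.
Proof.
move=> sub [ne cut]; split=> // L h1 h2; have [x [y [xP xL yP yL Exy]]] := cut L h1 h2.
by exists x, y; split=> //; apply: sub.
Qed.

Lemma sepm_mono S p q : {in S &, forall x y, E1 x y -> E2 x y} -> sepm E1 S p q -> sepm E2 S p q.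
Proof.
move=> sub [I [F [a [B [i [j [[[cB sB dB] aF cF adjF] h]]]]]]].
exists I, F, a, B, i, j; split=> //; split=> //.
  split=> // k kF; apply: conn_mono (cB k kF) => x y xB yB.
  by apply: sub; apply: (subsetP (sB k kF)).
move=> k l kF lF n1 n2; have /adjP [x [y [xB yB Exy]]] := adjF k l kF lF n1 n2.
apply/adjP; exists x, y; split=> //; apply: sub Exy; [exact: (subsetP (sB k kF))|exact: (subsetP (sB l lF))].
Qed.

Lemma atom_ext S : {in S &, forall x y, E1 x y = E2 x y} -> atom E1 S -> atom E2 S.
Proof.
move=> e [ne H]; split=> // D DS Dne cD z zS.
have enb : nb E2 S D = nb E1 S D.
  apply/setP => y; apply/nbP/nbP => -[x [xD yS yD Exy]]; exists x; split=> //.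
    by rewrite e // (subsetP DS).
  by rewrite -e // (subsetP DS).
rewrite enb in cD *; apply: H => // x y xn yn xy.
have /nbP [? [_ xS _ _]] := xn; have /nbP [? [_ yS _ _]] := yn.
by rewrite e //; apply: cD.
Qed.

End Extend.

(** * Quotients and rigid edges *)

Section Lift.
Variables (T : finType) (E : rel T).
Hypothesis symE : symmetric E.
Implicit Types (A C D K L P Q R S U V W : {set T}).

Definition fsimple u v P Q := forall x y, x \in P -> y \in Q -> E x y -> x = u /\ y = v.

(** Since the quotient is an atom, no clique separation of [V] has classes strictly on both sides,
    so all classes meet one side. Restricting to it preserves the quotient; the classes of [u] and
    [v] stay adjacent, and as [uv] is their only edge, both ends survive. *)
Lemma good_lift V (I : finType) (S : {set I}) B i j u v :
  fam E V S B -> i \in S -> j \in S -> i != j -> u \in B i -> v \in B j -> fsimple u v (B i) (B j) -> E u v ->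
  atom (QE E B) S -> sepm (QE E B) S i j ->
  exists A, [/\ A \subset V, u \in A, v \in A, atom E A & sepm E A u v].
Proof.
move=> fB iS jS ij uB vB fs Euv aS sS.
move: {2}#|V| (leqnn #|V|) => n; elim: n V B fB uB vB fs aS sS => [|n IH] V B fB uB vB fs aS sS h.
  case: fB => _ /(_ i iS) /subsetP /(_ _ uB) uV _.
  by rewrite leqn0 cards_eq0 in h; rewrite (eqP h) inE in uV.
have [cB sB dB] := fB.
have uV := subsetP (sB i iS) _ uB; have vV := subsetP (sB j jS) _ vB.
case: (classic (atom E V)) => [aV|naV].
  by exists V; split=> //; apply: (sepm_lift symE fB sS).
have [S1 [S2 [K [s1 s2 [cov _ [x1 x1V x1S] [x2 x2V x2S]]]]]] := natom_sep symE (ex_intro _ u uV) naV.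
have fin S' x : csep E V S' K -> x \in V -> x \notin S' -> met S B S' ->
  exists A, [/\ A \subset V, u \in A, v \in A, atom E A & sepm E A u v].
  move=> sS' xV xS' mt; have [SV _ _ _] := sS'; have hS := csep_hull sS'.
  pose B' k := B k :&: S'.
  have dis k l : k \in S -> l \in S -> k != l -> forall x, x \in B k -> x \in B l -> False.
    by move=> kS lS kl z zk zl; move: kl; rewrite (dB k l z) // eqxx.
  have e : {in S &, forall k l, QE E B k l = QE E B' k l}.
    move=> k l kS lS; rewrite /QE /=; case: (eqVneq k l) => //= kl.
    have [y yB yS] := mt k kS; have [z zB zS] := mt l lS.
    apply/idP/idP => [h'|]; last by apply: adjS; apply: subsetIl.
    by apply: (hull_adj symE hS (cB k kS) (sB k kS) (cB l lS) (sB l lS) (dis k l kS lS kl) yB yS zB zS h').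
  have fB' : fam E S' S B'.
    split=> [k kS|k kS|k l z kS lS /setIP [zk _] /setIP [zl _]]; last exact: (dB k l z).
      by have [y yB yS] := mt k kS; apply: (hull_conn symE hS (cB k kS) (sB k kS) yB yS).
    exact: subsetIr.
  have sS2 : sepm (QE E B') S i j by apply: sepm_mono sS => k l kS lS; rewrite e.
  have aS2 : atom (QE E B') S by apply: atom_ext aS.
  have ltS : #|S'| <= n.
    by rewrite -ltnS; apply: leq_trans h; apply: proper_card; apply/properP; split=> //; exists x.
  have [uS vS] : u \in S' /\ v \in S'.
    have /andP [_ /adjP [y [z [yB zB Eyz]]]] : QE E B' i j.
      rewrite -e // /QE /= ij; apply/adjP; exists u, v; split=> //.
    have /setIP [yB2 yS] := yB; have /setIP [zB2 zS] := zB.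
    by have [<- <-] := fs y z yB2 zB2 Eyz.
  have [||||||A [AS uA vA aA sA]] := IH S' B' fB'; rewrite ?inE ?uB ?vB ?uS ?vS //.
    by move=> y z /setIP [? _] /setIP [? _]; apply: fs.
  by exists A; split=> //; apply: subset_trans AS SV.
have nmet (S' : {set T}) : ~ met S B S' -> exists2 t, t \in S & forall x, x \in B t -> x \notin S'.
  move=> nm; apply: NNPP => nex; apply: nm => k kF; apply: NNPP => n1; apply: nex; exists k => // x xB.
  by apply/negP => xS; apply: n1; exists x.
case: (classic (met S B S1)) => [m1|/nmet [i1 i1S miss1]]; first exact: (fin S1 x1).
case: (classic (met S B S2)) => [m2|/nmet [i2 i2S miss2]]; first exact: (fin S2 x2).
(* The classes meeting [K] form a clique of the quotient that separates [i1] from [i2]. *)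
exfalso; pose D := [set k in S | [disjoint B k & S1]].
pose KS := [set k in S | ~~ [disjoint B k & K]].
have [S1V K1 cK e1] := s1; have [_ K2 _ _] := s2.
have dP k (P : {set T}) : reflect (forall x, x \in B k -> x \notin P) [disjoint B k & P].
  apply: (iffP idP) => [d x xB|H]; first by rewrite (disjointFr d).
  by apply/pred0P => x /=; apply/negbTE/negP => /andP [/H /negbTE ->].
have KP k : reflect (k \in S /\ exists2 x, x \in B k & x \in K) (k \in KS).
  rewrite inE; apply: (iffP andP) => -[kS].
    by move=> /pred0Pn [x /= /andP [xB xK]]; split=> //; exists x.
  by move=> [x xB xK]; split=> //; apply/pred0Pn; exists x; rewrite /= xB.
have [||||/setIdP [_ /dP h2]|/KP [_ [y yB yK]]] := atomE (x := i1) (K := KS) (D := D) aS _ _ _ _ i2S.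
- by apply/subsetP => k; rewrite inE => /andP [].
- by rewrite inE i1S; apply/dP.
- move=> k l /KP [kS [y yB yK]] /KP [lS [z zB zK]] kl; rewrite /QE /= kl /=; apply/adjP.
  exists y, z; split=> //; apply: cK => //.
  by apply: contraNneq kl => eyz; apply/eqP; apply: (dB k l y) => //; rewrite eyz.
- move=> k l /setIdP [kS /dP kd] lS /andP [_ /adjP [y [z [yB zB Eyz]]]].
  case: (boolP [disjoint B l & S1]) => dl; [by left; rewrite inE lS|right; apply/KP; split=> //].
  have yV := subsetP (sB k kS) _ yB.
  case zS : (z \in S1); first by exists z => //; apply: (e1 y z yV (kd y yB) zS Eyz).
  have /pred0Pn [w /= /andP [wB wS]] := dl.
  have [||p [q [pB pS qB qS Epq]]] := conn_cut (L := S1) (cB l lS); [by exists w|by exists z; rewrite ?zS|].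
  exists p => //; apply: (e1 q p) => //; [exact: (subsetP (sB l lS))|by rewrite symE].
- have [[y yB] _] := cB i2 i2S; have := miss2 y yB; case: (cov y (subsetP (sB i2 i2S) _ yB)) => [|-> //].
  by move: (h2 y yB) => /negbTE ->.
- by move: (miss2 y yB); rewrite (subsetP K2 _ yK).
Qed.

End Lift.

Definition dis (T : finType) (A B : {set T}) : Prop := forall x, x \in A -> x \in B -> False.
Definition sing (T : finType) (A : {set T}) : Prop := forall x y, x \in A -> y \in A -> x = y.

Ltac disx := match goal with
  | H : dis _ _, H1 : is_true (in_mem ?x _), H2 : is_true (in_mem ?x _) |- _ => solve [case: (H x H1 H2)]
  end.

(** * Models of K_5 and K_{2,2,2} written out *)

Section Explicit.
Variables (T : finType) (E : rel T).
Hypothesis symE : symmetric E.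
Implicit Types (A B C D K L P Q R S U V W : {set T}).

Record five V P1 P2 P3 P4 P5 : Prop := Five {
  five_c : [/\ conn E P1, conn E P2, conn E P3, conn E P4 & conn E P5];
  five_s : [/\ P1 \subset V, P2 \subset V, P3 \subset V, P4 \subset V & P5 \subset V];
  five_d : [/\ dis P1 P2, dis P1 P3, dis P1 P4 & dis P1 P5] /\
    [/\ dis P2 P3, dis P2 P4 & dis P2 P5] /\ [/\ dis P3 P4, dis P3 P5 & dis P4 P5];
  five_a : [/\ adj E P1 P2, adj E P1 P3, adj E P1 P4 & adj E P1 P5] /\
    [/\ adj E P2 P3, adj E P2 P4 & adj E P2 P5] /\ [/\ adj E P3 P4, adj E P3 P5 & adj E P4 P5] }.

(* The antipodal pairs are [Pi], [Qi]. *)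
Record six V P1 Q1 P2 Q2 P3 Q3 : Prop := Six {
  six_c : [/\ conn E P1, conn E P2 & conn E P3] /\ [/\ conn E Q1, conn E Q2 & conn E Q3];
  six_s : [/\ P1 \subset V, P2 \subset V & P3 \subset V] /\ [/\ Q1 \subset V, Q2 \subset V & Q3 \subset V];
  six_d : [/\ dis P1 Q1, dis P2 Q2 & dis P3 Q3] /\
    [/\ dis P1 P2, dis P1 Q2, dis Q1 P2 & dis Q1 Q2] /\
    [/\ dis P1 P3, dis P1 Q3, dis Q1 P3 & dis Q1 Q3] /\
    [/\ dis P2 P3, dis P2 Q3, dis Q2 P3 & dis Q2 Q3];
  six_a : [/\ adj E P1 P2, adj E P1 Q2, adj E Q1 P2 & adj E Q1 Q2] /\
    [/\ adj E P1 P3, adj E P1 Q3, adj E Q1 P3 & adj E Q1 Q3] /\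
    [/\ adj E P2 P3, adj E P2 Q3, adj E Q2 P3 & adj E Q2 Q3] }.

Lemma disC A B : dis A B -> dis B A. Proof. by move=> d x xB xA; apply: (d x). Qed.

Lemma adjUl A B C : adj E A C -> adj E (A :|: B) C. Proof. by apply: adjS; rewrite ?subsetUl. Qed.
Lemma adjUr A B C : adj E B C -> adj E (A :|: B) C. Proof. by apply: adjS; rewrite ?subsetUr. Qed.
Lemma adjrUl A B C : adj E A B -> adj E A (B :|: C). Proof. by apply: adjS; rewrite ?subsetUl. Qed.
Lemma adjrUr A B C : adj E A C -> adj E A (B :|: C). Proof. by apply: adjS; rewrite ?subsetUr. Qed.

Lemma five_model V P1 P2 P3 P4 P5 : five V P1 P2 P3 P4 P5 ->
  model E V [set: 'I_5] id (fun t : 'I_5 => nth set0 [:: P1; P2; P3; P4; P5] t).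
Proof.
case=> [[c1 c2 c3 c4 c5] [s1 s2 s3 s4 s5] [[d12 d13 d14 d15] [[d23 d24 d25] [d34 d35 d45]]]
  [[a12 a13 a14 a15] [[a23 a24 a25] [a34 a35 a45]]]].
split=> //.
- split.
  + by case=> [[|[|[|[|[|//]]]]] h] _.
  + by case=> [[|[|[|[|[|//]]]]] h] _.
  + move=> [[|[|[|[|[|//]]]]] h] [[|[|[|[|[|//]]]]] k] x _ _ /= xi xj; try exact: val_inj;
    disx.
- by left; rewrite cardsT card_ord.
- move=> [[|[|[|[|[|//]]]]] h] [[|[|[|[|[|//]]]]] k] _ _ //=; by rewrite // (adjC symE).
Qed.

Definition o6 k (h : k < 6) : 'I_6 := Ordinal h.
Definition a6 (i : 'I_6) : 'I_6 :=
  nth (@o6 0 isT) [:: @o6 1 isT; @o6 0 isT; @o6 3 isT; @o6 2 isT; @o6 5 isT; @o6 4 isT] i.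

Lemma six_model V P1 Q1 P2 Q2 P3 Q3 : six V P1 Q1 P2 Q2 P3 Q3 ->
  model E V [set: 'I_6] a6 (fun t : 'I_6 => nth set0 [:: P1; Q1; P2; Q2; P3; Q3] t).
Proof.
case=> [[[c1 c2 c3] [c4 c5 c6]] [[s1 s2 s3] [s4 s5 s6]]
  [[? ? ?] [[? ? ? ?] [[? ? ? ?] [? ? ? ?]]]] [[? ? ? ?] [[? ? ? ?] [? ? ? ?]]]].
split=> //.
- split.
  + by case=> [[|[|[|[|[|[|//]]]]]] h] _.
  + by case=> [[|[|[|[|[|[|//]]]]]] h] _.
  + move=> [[|[|[|[|[|[|//]]]]]] h] [[|[|[|[|[|[|//]]]]]] k] x _ _ /= xi xj; try exact: val_inj;
    disx.
- by move=> [[|[|[|[|[|[|//]]]]]] h] _; split; rewrite ?inE //; apply: val_inj.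
- right; rewrite cardsT card_ord; split=> // -[[|[|[|[|[|[|//]]]]]] h] _ e; by have := congr1 val e.
- move=> [[|[|[|[|[|[|//]]]]]] h] [[|[|[|[|[|[|//]]]]]] k] _ _ //=; by rewrite // (adjC symE).
Qed.

Lemma sepm_five V P1 P2 P3 P4 P5 p q : five V P1 P2 P3 P4 P5 -> p \in P1 -> q \in P2 -> sepm E V p q.
Proof.
move=> f pP qP; exists 'I_5, [set: 'I_5], id, (fun t : 'I_5 => nth set0 [:: P1; P2; P3; P4; P5] t).
by exists (Ordinal (isT : 0 < 5)), (Ordinal (isT : 1 < 5)); split; [exact: five_model|split; rewrite ?inE].
Qed.

Lemma sepm_six V P1 Q1 P2 Q2 P3 Q3 p q : six V P1 Q1 P2 Q2 P3 Q3 -> p \in P1 -> q \in P2 -> sepm E V p q.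
Proof.
move=> f pP qP; exists 'I_6, [set: 'I_6], a6, (fun t : 'I_6 => nth set0 [:: P1; Q1; P2; Q2; P3; Q3] t).
by exists (Ordinal (isT : 0 < 6)), (Ordinal (isT : 2 < 6)); split; [exact: six_model|split; rewrite ?inE].
Qed.

Section FromModel.
Variables (V : {set T}) (I : finType) (F : {set I}) (a : I -> I) (B : I -> {set T}).
Hypothesis m : model E V F a B.

Lemma model_dis i j : i \in F -> j \in F -> i != j -> dis (B i) (B j).
Proof. by case: m => [[_ _ d] _ _ _] iF jF ij x xi xj; move: ij; rewrite (d i j x) ?eqxx. Qed.

Lemma model_to_five i j : #|F| = 5 -> (forall i, i \in F -> a i = i) -> i \in F -> j \in F -> i != j ->
  exists k l n, [/\ k \in F, l \in F, n \in F & uniq [:: i; j; k; l; n]] /\ five V (B i) (B j) (B k) (B l) (B n).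
Proof.
move=> c5 ida iF jF ij; have [[cB sB dB] _ _ adjF] := m.
have [k [l [n [kF lF nF U]]]] : exists k l n, [/\ k \in F, l \in F, n \in F & uniq [:: i; j; k; l; n]].
  move: c5; rewrite (cardsD1 i) iF (cardsD1 j) !inE eq_sym ij jF !add1n => -[c3].
  have /set0Pn [k kin] : F :\ i :\ j != set0 by rewrite -card_gt0 c3.
  move: c3; rewrite (cardsD1 k) kin add1n => -[c2].
  have /set0Pn [l lin] : F :\ i :\ j :\ k != set0 by rewrite -card_gt0 c2.
  move: c2; rewrite (cardsD1 l) lin add1n => -[c1].
  have /set0Pn [n nin] : F :\ i :\ j :\ k :\ l != set0 by rewrite -card_gt0 c1.
  move: kin lin nin; rewrite !inE => /and3P [kj ki kF] /and4P [lk lj li lF] /and5P [nl nk nj ni nF].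
  exists k, l, n; split=> //=; rewrite !inE !negb_or ij.
  by rewrite (eq_sym i k) (eq_sym i l) (eq_sym i n) (eq_sym j k) (eq_sym j l) (eq_sym j n) (eq_sym k l) (eq_sym k n) (eq_sym l n) ki kj li lj lk ni nj nk nl.
exists k, l, n; split=> //.
move: U => /=; rewrite !inE !negb_or !andbT => /and4P [/and4P [_ ik il iN] /and3P [jk jl jn] /andP [kl kn] ln].
split; [by split; apply: cB|by split; apply: sB|by split; [split|split; split]; apply: model_dis|].
by split; [split|split; split]; apply: adjF => //; rewrite ?ida // eq_sym.
Qed.

Lemma model_to_six i j : (exists2 i, i \in F & a i <> i) -> i \in F -> j \in F -> j != i -> j != a i ->
  exists k, [/\ k \in F, k \notin [:: i; a i; j; a j] & forall x, x \in F -> x \in [:: i; a i; j; a j; k; a k]] /\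
  six V (B i) (B (a i)) (B j) (B (a j)) (B k) (B (a k)).
Proof.
move=> ex iF jF ji jai; have [k [kF kn all]] := model_enum6 m ex iF jF ji jai.
exists k; split=> //; have [[cB sB dB] aF cF adjF] := m.
have [aiF aai] := aF i iF; have [ajF aaj] := aF j jF; have [akF aak] := aF k kF.
have ne x : x \in F -> a x != x.
  by move=> xF; case: ex => y yF ay; case: cF => [[_ h]|[_ h]]; [case: ay; apply: h|apply/eqP/h].
have inj := model_a_inj m.
have nea x y : x \in F -> y \in F -> x != y -> a x != a y by move=> xF yF; apply: contraNneq => /inj ->.
have ney x y : x \in F -> y \in F -> x != a y -> a x != y.
  by move=> xF yF; apply: contraNneq => <-; case: (aF x xF) => _ ->.
move: kn; rewrite !inE !negb_or => /and4P [ki kai kj kaj].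
have ad x y : x \in F -> y \in F -> y != x -> y != a x -> [/\ adj E (B x) (B y), adj E (B x) (B (a y)),
    adj E (B (a x)) (B y) & adj E (B (a x)) (B (a y))].
  move=> xF yF yx yax; have [axF aax] := aF x xF; have [ayF aay] := aF y yF.
  by split; apply: adjF; rewrite ?aax // ?nea // ?ney.
have di x y : x \in F -> y \in F -> y != x -> y != a x -> [/\ dis (B x) (B y), dis (B x) (B (a y)),
    dis (B (a x)) (B y) & dis (B (a x)) (B (a y))].
  move=> xF yF yx yax; have [axF aax] := aF x xF; have [ayF aay] := aF y yF.
  by split; apply: model_dis => //; rewrite eq_sym ?nea // ?ney.
split.
- by split; split; apply: cB.
- by split; split; apply: sB.
- by split; [split; apply: model_dis => //; rewrite eq_sym ne|split; [exact: di|split; exact: di]].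
- by split; [exact: ad|split; exact: ad].
Qed.

End FromModel.

End Explicit.

(** * Adding an edge between separated vertices *)

Section AddEdge.
Variables (T : finType) (E : rel T).
Hypothesis symE : symmetric E.
Implicit Types (A B C D K L P Q R S U V W : {set T}).

Lemma add_edge_sym p q : symmetric (add_edge E p q).
Proof. by move=> x y; rewrite /add_edge /= symE andbC (andbC (x == q)) [X in _ || X]orbC. Qed.

Lemma add_edge_old p q x y : E x y -> add_edge E p q x y.
Proof. by rewrite /add_edge /= => ->. Qed.

(** With [pq] added, some atom contains this edge and has a forbidden minor preserving it: what [p],
    [q] need to be the next pair of the induction. *)
Definition good V p q : Prop :=
  exists S, [/\ S \subset V, p \in S, q \in S, atom (add_edge E p q) S & sepm (add_edge E p q) S p q].

(** The minor lives in a maximal atom [S] of the graph with [pq] added. If [S] missed [p] or [q],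
    its attachment cliques would already be cliques before the addition and would separate the atom
    [A]. *)
Lemma atom_good A p q : atom E A -> ~~ E p q -> sepm E A p q -> good A p q.
Proof.
move=> aA nE sA; have [pA qA pq] := sepm_mem sA.
have sym' := add_edge_sym p q.
have sA' : sepm (add_edge E p q) A p q by apply: sepm_mono sA => x y _ _; apply: add_edge_old.
have [S [p' [q' [mS p'r q'r sS]]]] := sepm_proj sym' sA'.
have [SA aS _] := mS.
have Epq : add_edge E p q p q by rewrite /add_edge /= !eqxx orbT.
have key x : x \in A -> x \notin S -> ~ (p \in S /\ q \in S) -> False.
  move=> xA xS noboth; have xD : x \in A :\: S by rewrite inE xS.
  have [b bS bn] := maxatom_pr sym' mS xA xS; have hS := maxatom_hull sym' mS.
  have cl := pr_clique hS xA.
  have sub y : y \in cmp (add_edge E p q) (A :\: S) x -> y \in A /\ y \notin S.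
    by move/(subsetP (cmp_sub _ _ _)) => /setDP.
  have cl' : is_clique (pr (add_edge E p q) A S x) E.
    move=> y z yr zr yz; have := cl y z yr zr yz; rewrite /add_edge /= => /or3P [//|/andP [/eqP e1 /eqP e2]|/andP [/eqP e1 /eqP e2]];
    case: noboth; split; rewrite -?e1 -?e2; apply: (subsetP (pr_sub _ _ _ _) _); eassumption.
  have [|||bL|br] := atomE (D := cmp (add_edge E p q) (A :\: S) x) (x := x) aA _ _ cl' _ (subsetP SA _ bS).
  - by apply/subsetP => y /sub [].
  - exact: cmp_refl.
  - move=> y z yC zA Eyz; have [yA yS] := sub y yC; case zS : (z \in S).
      right; rewrite (prE _ _ xS); apply/nbP; exists y; split=> //; last exact: add_edge_old.
      by apply/negP => /sub []; rewrite zS.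
    by left; apply: cmp_closed yC _ (add_edge_old _ _ Eyz); rewrite inE zS.
  - by have [] := sub b bL; rewrite bS.
  - by rewrite br in bn.
have pS : p \in S by apply: contraT => pS; case: (key p pA pS); case; rewrite (negbTE pS).
have qS : q \in S by apply: contraT => qS; case: (key q qA qS); case; rewrite (negbTE qS).
move: p'r q'r sS; rewrite /pr pS qS => /set1P -> /set1P -> sS.
by exists S.
Qed.

End AddEdge.

(* No proper quotient of [V] by disjoint connected classes, between which [uv] remains the only edge
   joining the classes of [u] and [v], is an atom separating these two classes in a forbidden minor.
   Unlike the absence of a reducing edge, this passes to induced subgraphs. *)
Definition rigid (T : finType) (E : rel T) (V : {set T}) (u v : T) : Prop :=
  forall (I : finType) (S : {set I}) (B : I -> {set T}) i j,
    fam E V S B -> i \in S -> j \in S -> i != j -> u \in B i -> v \in B j -> fsimple E u v (B i) (B j) ->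
    atom (QE E B) S -> sepm (QE E B) S i j -> forall k, k \in S -> sing (B k).

(** * Minimal pairs are rigid *)

Section Minimal.
Variables (T : finType) (G : rel T) (u v : T).
Implicit Types (A C D K L P Q R S U V W : {set T}).

(** As [V] is connected, some uncovered vertex is adjacent to a class and can join it. This
    reconciles partial models with the partitions required by the definition of a minor. *)
Lemma cover_model (E : rel T) V (I : finType) (F : {set I}) a B : symmetric E -> conn E V -> model E V F a B ->
  exists B', [/\ model E V F a B', forall k, k \in F -> B k \subset B' k & forall x, x \in V -> exists2 k, k \in F & x \in B' k].
Proof.
move=> symE cV; move: {2}(#|V :\: \bigcup_(k in F) B k|) (leqnn #|V :\: \bigcup_(k in F) B k|) => n.
elim: n B => [|n IH] B h m; have [[cB sB dB] aF cF adjF] := m.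
  exists B; split=> // x xV; rewrite leqn0 cards_eq0 in h.
  have : x \notin V :\: \bigcup_(k in F) B k by rewrite (eqP h) inE.
  by rewrite inE xV andbT negbK => /bigcupP [k]; exists k.
case: (boolP (V :\: \bigcup_(k in F) B k == set0)) => [e|/set0Pn [z /setDP [zV zn]]].
  by apply: IH => //; rewrite (eqP e) cards0.
have [k0 k0F] : exists k0, k0 \in F by apply/set0Pn; rewrite -card_gt0; case: cF => -[-> _].
have [[x0 x0B] _] := cB k0 k0F.
have [||p [q [pV pU qV qU Epq]]] := conn_cut (L := \bigcup_(k in F) B k) cV.
- by exists x0; [exact: (subsetP (sB k0 k0F))|apply/bigcupP; exists k0].
- by exists z.
case/bigcupP: pU => k kF pB.
have m' : model E V F a (upd B k (B k :|: [set q])).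
  apply: (model_grow m); last by move=> j jF; rewrite /upd; case: eqP => [->|//]; rewrite subsetUl.
  apply: fam_upd => //.
  - by apply: (connU symE (cB k kF) (conn1 E q) pB (set11 q)); right.
  - by rewrite subUset sB // sub1set.
  - move=> j x jF jk; rewrite !inE => /orP [xk xj|/eqP -> qj].
      by move: jk; rewrite (dB j k x) ?eqxx.
    by case/negP: qU; apply/bigcupP; exists j.
have sub j : B j \subset upd B k (B k :|: [set q]) j by rewrite /upd; case: eqP => [->|//]; rewrite subsetUl.
have [|B' [m'' s'' c'']] := IH _ _ m'; last first.
  by exists B'; split=> // j jF; apply: subset_trans (sub j) (s'' j jF).
rewrite -ltnS; apply: leq_trans h; apply: proper_card; apply/properP; split.
  apply/subsetP => x; rewrite !inE => /andP [xn ->]; rewrite andbT; apply: contra xn => /bigcupP [j jF xj].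
  by apply/bigcupP; exists j => //; apply: (subsetP (sub j)).
exists q; rewrite inE qV ?qU // andbT negbK; apply/bigcupP; exists k => //.
by rewrite upd_same !inE eqxx orbT.
Qed.

Lemma sepm_forbidden (E : rel T) V p q : symmetric E -> conn E V -> sepm E V p q -> forbidden3_minor_preserving V E p q.
Proof.
move=> symE cV [I [F [a [B0 [i [j [m0 [iF jF ij pB0 qB0]]]]]]]].
have [B [m sub cov]] := cover_model symE cV m0.
have pB := subsetP (sub i iF) _ pB0; have qB := subsetP (sub j jF) _ qB0.
have [[cB sB dB] aF cF adjF] := m.
have gen k (M : rel 'I_k) (s : seq I) : uniq s -> size s = k -> (forall x, x \in F <-> x \in s) ->
    (forall t t' : 'I_k, M t t' -> adj E (B (nth i s t)) (B (nth i s t'))) ->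
    exists B' : 'I_k -> {set T}, minor_model M V E B' /\ preserves B' p q.
  move=> us ss Fs ad; exists (fun t : 'I_k => B (nth i s t)).
  have inF (t : 'I_k) : nth i s t \in F by apply/Fs/mem_nth; rewrite ss.
  have idx x : x \in F -> exists t : 'I_k, nth i s t = x.
    move=> /Fs xs; have h : index x s < k by rewrite -ss index_mem.
    by exists (Ordinal h); rewrite /= nth_index.
  split; [split; [split|]|].
  - by move=> t; have [[x xB] _] := cB _ (inF t); apply/set0Pn; exists x.
  - by move=> t; apply: sB.
  - move=> t t' tt'; apply/pred0P => x /=; apply/negbTE/negP => /andP [xt xt'].
    have /eqP := dB _ _ x (inF t) (inF t') xt xt'; rewrite nth_uniq ?ss //.
    by move/eqP/val_inj/eqP; rewrite (negbTE tt').
  - move=> z zV; have [k' k'F zk] := cov z zV; have [t e] := idx k' k'F; by exists t; rewrite e.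
  - by move=> t; apply/connected_setP => //; apply: cB.
  - by move=> t t' /ad /adjP.
  - have [t e] := idx i iF; have [t' e'] := idx j jF; exists t, t'; rewrite e e'; split=> //.
    by apply: contraNneq ij => tt'; rewrite -e -e' tt'.
case: (cF) => [[c5 ida]|[c6 nea]].
  left; apply: (gen 5 K5 (enum F)); rewrite ?enum_uniq -?cardE //.
  - by move=> x; rewrite mem_enum.
  - move=> t t' tt'; have inF (s : 'I_5) : nth i (enum F) s \in F by rewrite -mem_enum mem_nth // -cardE c5.
    apply: adjF; rewrite ?ida // nth_uniq ?enum_uniq // -?cardE ?c5 //.
      by rewrite eq_sym; apply: contra tt' => /eqP /val_inj ->.
    by rewrite eq_sym; apply: contra tt' => /eqP /val_inj ->.
right.
have aiF : a i \in F by case: (aF i iF).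
have [j1 [j1F j1i j1ai]] : exists j1, [/\ j1 \in F, j1 != i & j1 != a i].
  have : 0 < #|F :\ i :\ a i|.
    by move: c6; rewrite (cardsD1 i) iF (cardsD1 (a i)) !inE aiF andbT (introN eqP (nea i iF)) !add1n => -[->].
  by rewrite card_gt0 => /set0Pn [x]; rewrite !inE => /and3P [? ? ?]; exists x.
have [k [[kF kn all] s6]] := model_to_six m (ex_intro2 _ _ i iF (nea i iF)) iF j1F j1i j1ai.
have [[? ? ? ?] [[? ? ? ?] [? ? ? ?]]] := six_a s6.
have akF : a k \in F by case: (aF k kF).
have aj1F : a j1 \in F by case: (aF j1 j1F).
(* [K222] makes [2m] and [2m + 1] antipodal, so antipodal classes are listed next to each other. *)
apply: (gen 6 K222 [:: i; a i; j1; a j1; k; a k]) => //.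
- rewrite /= !inE !negb_or !andbT.
  have ne x : x \in F -> x != a x by move=> xF; rewrite eq_sym; apply/eqP/nea.
  have nea' x y : x \in F -> y \in F -> x != y -> a x != a y.
    by move=> xF yF; apply: contraNneq => e; apply/eqP; apply: (model_a_inj m).
  have ney x y : x \in F -> y \in F -> y != a x -> x != a y.
    move=> xF yF; apply: contraNneq => e; rewrite e; by case: (aF y yF) => _ ->.
  move: kn; rewrite !inE !negb_or => /and4P [ki kai kj kaj].
  have [n1 n2 n3] : [/\ i != a j1, i != a k & j1 != a k] by split; apply: ney.
  have [n4 n5 n6] : [/\ a i != a j1, a i != a k & a j1 != a k] by split; apply: nea' => //; rewrite eq_sym.
  rewrite !ne // n1 n2 n3 n4 n5 n6 (eq_sym i j1) (eq_sym i k) (eq_sym (a i) j1) (eq_sym (a i) k).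
  by rewrite (eq_sym j1 k) (eq_sym (a j1) k) j1i j1ai ki kai kj kaj.
- move=> x; split; first exact: all.
  by rewrite !inE => /or4P [/eqP ->|/eqP ->|/eqP ->|/or3P [/eqP ->|/eqP ->|/eqP ->]].
- move=> [[|[|[|[|[|[|//]]]]]] h] [[|[|[|[|[|[|//]]]]]] h'] //= _; by rewrite // (adjC symE).
Qed.

Lemma forbidden_sepm (E : rel T) V p q : symmetric E -> forbidden3_minor_preserving V E p q -> sepm E V p q.
Proof.
move=> symE; case=> -[B [[[ne sB dB _ cB] ad] [i [j [ij pB qB]]]]].
- exists 'I_5, [set: 'I_5], id, B, i, j; split; last by split; rewrite ?inE.
  split=> //.
  + split=> [k _|k _|k l x _ _ xk xl]; [exact/connected_setP|exact: sB|].
    by apply/eqP; apply: contraT => kl; have := disjointFr (dB k l kl) xk; rewrite xl.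
  + by left; rewrite cardsT card_ord.
  + by move=> k l _ _ kl _; apply/adjP; apply: ad; rewrite /K5 eq_sym.
- exists 'I_6, [set: 'I_6], a6, B, i, j; split; last by split; rewrite ?inE.
  split=> //.
  + split=> [k _|k _|k l x _ _ xk xl]; [exact/connected_setP|exact: sB|].
    by apply/eqP; apply: contraT => kl; have := disjointFr (dB k l kl) xk; rewrite xl.
  + by move=> [[|[|[|[|[|[|//]]]]]] h] _; split; rewrite ?inE //; apply: val_inj.
  + right; rewrite cardsT card_ord; split=> // -[[|[|[|[|[|[|//]]]]]] h] _ e; by have := congr1 val e.
  + move=> k l _ _ kl kal; apply/adjP; apply: ad; move: k l kl kal.
    by move=> [[|[|[|[|[|[|//]]]]]] h] [[|[|[|[|[|[|//]]]]]] k].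
Qed.

Hypothesis mp : minimal_pair G u v.
Let E := add_edge G u v.

Let symG : symmetric G. Proof. by case: mp => [[[h _] _ _ _ _] _]. Qed.
Lemma minimal_sym : symmetric E. Proof. exact: add_edge_sym. Qed.
Lemma minimal_irr x : ~~ E x x.
Proof.
case: mp => [[[_ irr] uv _ _ _] _]; rewrite /E /add_edge /= (negbTE (irr x)) /=.
by apply/norP; split; apply/negP => /andP [/eqP e1 /eqP e2]; move: uv; rewrite -e1 -e2 eqxx.
Qed.

(** A class with two vertices contains an edge [ab], which is not [uv] because the two ends are in
    different classes. Contracting [ab] does not change the quotient, so [good_lift] would make [ab]
    a reducing edge. *)
Lemma minimal_rigid : rigid E [set: T] u v.
Proof.
move=> I S B i j fB iS jS ij uB vB fs aS sS k kS x y xB yB.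
apply/eqP; apply: contraT => xy; exfalso.
have [cB sB dB] := fB; have symE := minimal_sym.
have [[[_ irr] uv nG _ _] nred] := mp.
have [||a [b [aB /set1P ea bB b1 Eab]]] := conn_cut (L := [set x]) (cB k kS).
- by exists x; rewrite ?inE.
- by exists y; rewrite ?inE 1?eq_sym.
have ab : a != b by rewrite ea eq_sym; rewrite inE in b1.
have noboth : u \in B k -> v \in B k -> False.
  by move=> uk vk; move: ij; rewrite -(dB k i u kS iS uk uB) -(dB k j v kS jS vk vB) eqxx.
have Guv : G a b.
  move: Eab; rewrite /E /add_edge /= => /or3P [//|/andP [/eqP e1 /eqP e2]|/andP [/eqP e1 /eqP e2]]; exfalso.
    by apply: noboth; rewrite -?e1 -?e2.
  by apply: noboth; rewrite -?e1 -?e2.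
pose m := Defs.merge a b; have mE z : m z = if z == b then a else z by [].
have mB s z : s \in S -> z \in B s -> m z \in B s.
  by move=> sS' zB; rewrite mE; case: eqP => // e; rewrite -(dB k s b) // -e.
have mBr s z : s \in S -> m z \in B s -> z \in B s.
  by move=> sS'; rewrite mE; case: eqP => // -> aB'; rewrite -(dB k s a).
have mb z : m z != b by rewrite mE; case: (eqVneq z b).
have mid z : z != b -> m z = z by rewrite mE => /negbTE ->.
apply: (nred a b); split=> //.
have muB := mB i u iS uB; have mvB := mB j v jS vB.
have muv : m u != m v by apply: contraNneq ij => e; rewrite (dB i j (m u)) // e.
split.
  rewrite /contr_rel /= muv /=; apply/existsP => -[x0 /existsP [y0 /and3P [/eqP ex /eqP ey Gxy]]].
  have [e1 e2] : x0 = u /\ y0 = v.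
    apply: fs; [apply: mBr; rewrite // /m ex //|apply: mBr; rewrite // /m ey //|exact: add_edge_old].
  by move: Gxy; rewrite e1 e2 (negbTE nG).
rewrite -/E -/m; set E' := contr_rel E a b.
have symE' : symmetric E'.
  move=> p q; rewrite /E' /contr_rel /= eq_sym; congr (_ && _).
  by apply/existsP/existsP => -[x0 /existsP [y0 /and3P [h1 h2 h3]]]; exists y0; apply/existsP; exists x0; rewrite h1 h2 symE.
have E'I p q : E p q -> m p != m q -> E' (m p) (m q).
  by move=> Epq n; rewrite /E' /contr_rel /= n; apply/existsP; exists p; apply/existsP; exists q; rewrite !eqxx.
have E'P p q : E' p q -> exists p0 q0, [/\ m p0 = p, m q0 = q & E p0 q0].
  by rewrite /E' /contr_rel /= => /andP [_ /existsP [p0 /existsP [q0 /and3P [/eqP h1 /eqP h2 h3]]]]; exists p0, q0.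
(* The images of the classes in the contracted graph, where [b] is represented by [a]. *)
pose P s := B s :\ b.
have mP s z : s \in S -> z \in B s -> m z \in P s by move=> sS' zB; rewrite !inE mb mB.
have PB s : P s \subset B s by apply: subD1set.
have cP s : s \in S -> conn E' (P s).
  move=> sS'; have [[z zB] _] := cB s sS'; apply: (connI symE' (mP s z sS' zB)) => L zL cl.
  have sub : B s \subset [set y | m y \in L].
    apply: (conn_all (cB s sS') zB); first by rewrite inE.
    move=> p q pB qB; rewrite !inE => pL Epq; case: (eqVneq (m p) (m q)) => [<- //|n].
    by apply: (cl (m p)); rewrite ?mP //; apply: E'I.
  apply/subsetP => w; rewrite !inE => /andP [wb wB]; move: (subsetP sub _ wB).
  by rewrite inE mid.
have fP : fam E' ([set: T] :\ b) S P.
  split=> // [s sS'|s t z sS' tS]; first by apply/subsetP => z; rewrite !inE => /andP [->].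
  by move=> /(subsetP (PB s)) zs /(subsetP (PB t)); apply: dB.
have eQ : {in S &, forall s t, QE E B s t = QE E' P s t}.
  move=> s t sS' tS; rewrite /QE /=; case: (eqVneq s t) => //= st.
  apply/adjP/adjP => -[p [q [pB qB Epq]]].
    exists (m p), (m q); split; [exact: mP|exact: mP|apply: E'I => //].
    by apply: contraNneq st => e; apply/eqP; apply: (dB s t (m p)) => //; [exact: mB|rewrite e; exact: mB].
  have [p0 [q0 [e1 e2 E0]]] := E'P p q Epq; exists p0, q0; split=> //; apply: mBr => //.
    by rewrite e1 (subsetP (PB s)).
  by rewrite e2 (subsetP (PB t)).
have Euv : E u v by rewrite /E /add_edge /= !eqxx orbT.
have fs' : fsimple E' (m u) (m v) (P i) (P j).
  move=> p q /(subsetP (PB i)) pB /(subsetP (PB j)) qB /E'P [p0 [q0 [e1 e2 E0]]].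
  have [e3 e4] : p0 = u /\ q0 = v by apply: fs => //; apply: mBr; rewrite ?e1 ?e2.
  by rewrite -e1 -e2 e3 e4.
have [||A [AV uA vA aA sA]] := good_lift symE' fP iS jS ij (mP i u iS uB) (mP j v jS vB) fs' (E'I _ _ Euv muv).
- exact: atom_ext aS.
- by apply: sepm_mono sS => s t sS' tS; rewrite eQ.
have [C mC AC] := maxatom_ex AV aA; have [CV aC maxC] := mC.
exists C; split; [|exact: (subsetP AC)|exact: (subsetP AC)|].
- split=> //; split; first exact: (proj2 (is_atomP _ C) aC).
  move=> D pr DV aD; have e := maxC D DV (proper_sub pr) (proj1 (is_atomP _ D) aD).
  by move: pr; rewrite e properxx.
- by apply: sepm_forbidden => //; [exact: atom_conn|exact: sepm_sub sA].
Qed.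

Lemma minimal_atom : atom E [set: T].
Proof. by case: mp => [[_ _ _ a _] _]; apply/is_atomP => //; exact: minimal_sym. Qed.

Lemma minimal_sepm : sepm E [set: T] u v.
Proof. by case: mp => [[_ _ _ _ f] _]; apply: forbidden_sepm => //; exact: minimal_sym. Qed.

End Minimal.

Lemma disUl (T : finType) (A B C : {set T}) : dis A C -> dis B C -> dis (A :|: B) C.
Proof. by move=> h1 h2 x /setUP [] h; [apply: h1|apply: h2]. Qed.
Lemma disrU (T : finType) (A B C : {set T}) : dis A B -> dis A C -> dis A (B :|: C).
Proof. by move=> h1 h2 x xA /setUP []; [apply: h1|apply: h2]. Qed.
Lemma dis11 (T : finType) (x y : T) : x != y -> dis [set x] [set y].
Proof. by move=> n z /set1P -> /set1P e; rewrite e eqxx in n. Qed.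
Lemma dis1 (T : finType) (x : T) (A : {set T}) : x \notin A -> dis [set x] A.
Proof. by move=> n z /set1P -> xA; rewrite xA in n. Qed.
Lemma adj11 (T : finType) (E : rel T) x y : E x y -> adj E [set x] [set y].
Proof. by move=> e; apply/adjP; exists x, y; rewrite !inE !eqxx. Qed.
Lemma subU (T : finType) (A B V : {set T}) : A \subset V -> B \subset V -> A :|: B \subset V.
Proof. by move=> h1 h2; rewrite subUset h1 h2. Qed.
Lemma sub1 (T : finType) (x : T) (V : {set T}) : x \in V -> [set x] \subset V.
Proof. by rewrite sub1set. Qed.

Ltac splitall := repeat match goal with
  | |- _ /\ _ => split | |- True => exact I | |- and3 _ _ _ => split | |- and4 _ _ _ _ => split | |- and5 _ _ _ _ _ => split end.
Ltac destr := repeat match goal with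
  | H : _ /\ _ |- _ => let H1 := fresh "H" in let H2 := fresh "H" in case: H => H1 H2
  | H : and3 _ _ _ |- _ => let H1 := fresh "H" in let H2 := fresh "H" in let H3 := fresh "H" in case: H => H1 H2 H3
  | H : and4 _ _ _ _ |- _ => let H1 := fresh "H" in let H2 := fresh "H" in let H3 := fresh "H" in let H4 := fresh "H" in case: H => H1 H2 H3 H4
  | H : and5 _ _ _ _ _ |- _ => let H1 := fresh "H" in let H2 := fresh "H" in let H3 := fresh "H" in let H4 := fresh "H" in let H5 := fresh "H" in case: H => H1 H2 H3 H4 H5
  end.
(* Syntactic matching throughout: letting unification compare distinct finite sets is very slow. *)
Ltac hyp := match goal with H : ?G |- ?G => exact H end.
Ltac dtac := lazymatch goal with
  | |- dis (_ :|: _) _ => apply: disUl; dtac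
  | |- dis _ (_ :|: _) => apply: disrU; dtac
  | |- dis [set _] [set _] => first [hyp | apply: disC; hyp | apply: dis11; hyp | apply: dis11; rewrite eq_sym; hyp]
  | |- _ => first [hyp | apply: disC; hyp]
  end.
Ltac atac1 symE := first [hyp | rewrite (adjC symE); hyp
   | match goal with
     | |- is_true (adj _ [set _] [set _]) => apply: adj11; first [hyp | rewrite symE; hyp]
     | |- is_true (adj _ (_ :|: _) _) => solve [apply: adjUl; atac1 symE]
     | |- is_true (adj _ (_ :|: _) _) => solve [apply: adjUr; atac1 symE]
     | |- is_true (adj _ _ (_ :|: _)) => solve [apply: adjrUl; atac1 symE]
     | |- is_true (adj _ _ (_ :|: _)) => solve [apply: adjrUr; atac1 symE]
     end].
Ltac atac symE := solve [atac1 symE].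
Ltac ctac symE := first [hyp
   | match goal with
     | |- conn _ [set _] => apply: conn1
     | |- conn _ (_ :|: _) => solve [apply: (connUadj symE); [ctac symE|ctac symE|atac symE]]
     end].
Ltac stac := first [hyp | apply: sub1; hyp | apply: subU; stac].

(** Unfolds to a plain conjunction, which [splitall] and [destr] can build or take apart. *)
Definition pdis (T : finType) (l : seq {set T}) : Prop :=
  (fix f l := match l with [::] => True | A :: l' => foldr (fun B P => dis A B /\ P) True l' /\ f l' end) l.

Definition clist (T : finType) (E : rel T) (V : {set T}) (l : seq {set T}) : Prop :=
  foldr (fun A P => (conn E A /\ A \subset V) /\ P) True l.

Ltac mk symE := try (progress rewrite /clist /pdis /=); splitall; match goal with
  | |- conn _ _ => ctac symE
  | |- dis _ _ => dtac
  | |- is_true (adj _ _ _) => atac symE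
  | |- _ => first [hyp | stac | idtac]
  end.

Definition slist (T : finType) (l : seq {set T}) : Prop := foldr (fun A P => sing A /\ P) True l.

Lemma conn_neq (T : finType) (E : rel T) (A B : {set T}) : conn E A -> dis A B -> A != B.
Proof. by move=> [[x xA] _] d; apply/eqP => e; apply: (d x) => //; rewrite -e. Qed.

Lemma pdis_in (T : finType) (l : seq {set T}) A B : pdis l -> A \in l -> B \in l -> A != B -> dis A B.
Proof.
have aux (C : {set T}) (l' : seq {set T}) D : foldr (fun B P => dis C B /\ P) True l' -> D \in l' -> dis C D.
  elim: l' => //= D' l' IH [h hs]; rewrite inE => /orP [/eqP -> //|]; exact: IH.
elim: l => // C l IH [h hs]; rewrite !inE => /orP [/eqP ->|Al] /orP [/eqP ->|Bl] n.
- by rewrite eqxx in n.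
- exact: aux h Bl.
- by apply: disC; apply: aux h Al.
- exact: IH.
Qed.

Lemma clist_in (T : finType) (E : rel T) (V : {set T}) (l : seq {set T}) A : clist E V l -> A \in l -> conn E A /\ A \subset V.
Proof. by elim: l => //= B l IH [h hs]; rewrite inE => /orP [/eqP -> //|]; exact: IH. Qed.

(** * Rigidity applied to explicit families of classes *)

Section Rigid.
Variables (T : finType) (E : rel T) (V : {set T}) (u v : T).
Hypotheses (symE : symmetric E) (Euv : E u v) (rig : rigid E V u v).
Implicit Types (A B C D K L P Q R S U W X Y : {set T}).

(** The classes serve as their own indices, so that the quotient graph has sets as vertices. *)
Let N : rel {set T} := QE E (@id {set T}).

Let symN : symmetric N. Proof. exact: (QE_sym symE). Qed.

Let NI A B : A != B -> adj E A B -> N A B. Proof. by rewrite /N /QE /= => ->. Qed.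

Let NN A B : ~~ adj E A B -> ~~ N A B. Proof. by rewrite /N /QE /= negb_and => ->; rewrite orbT. Qed.

Let rigid_sets (l : seq {set T}) U W : clist E V l -> pdis l -> U \in l -> W \in l -> U != W ->
  u \in U -> v \in W -> fsimple E u v U W -> atom N [set X in l] -> sepm N [set X in l] U W ->
  forall X, X \in l -> sing X.
Proof.
move=> cl dl Ul Wl UW uU vW fs aS sS X Xl.
apply: (rig (I := {set T}) (S := [set X in l]) (B := id) (i := U) (j := W)); rewrite ?inE //.
split=> [A|A|A B x]; rewrite ?inE.
- by move=> /(clist_in cl) [].
- by move=> /(clist_in cl) [].
- by move=> Al Bl xA xB; apply/eqP; apply: contraT => n; case: (pdis_in dl Al Bl n xA xB).
Qed.

Let slistI (l : seq {set T}) : (forall X, X \in l -> sing X) -> slist l.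
Proof.
elim: l => // A l IH h; split; first by apply: h; rewrite inE eqxx.
by apply: IH => X Xl; apply: h; rewrite inE Xl orbT.
Qed.

Let inl (l : seq {set T}) X : (X \in [set Y in l]) = (X \in l). Proof. by rewrite inE. Qed.

(** A complete quotient is an atom, so rigidity applies at once. *)
Lemma simple5 X1 X2 X3 X4 X5 : five E V X1 X2 X3 X4 X5 -> u \in X1 -> v \in X2 -> fsimple E u v X1 X2 ->
  slist [:: X1; X2; X3; X4; X5].
Proof.
move=> f u1 v2 fs; case: f => c s d a; destr; apply: slistI.
have cl : clist E V [:: X1; X2; X3; X4; X5] by mk symE.
have dl : pdis [:: X1; X2; X3; X4; X5] by mk symE.
have ne A B : A \in [:: X1; X2; X3; X4; X5] -> B \in [:: X1; X2; X3; X4; X5] -> dis A B -> A != B.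
  by move=> Al _; apply: (conn_neq (proj1 (clist_in cl Al))).
have [n12 n13 n14 n15] : [/\ X1 != X2, X1 != X3, X1 != X4 & X1 != X5] by split; apply: ne; rewrite ?inE ?eqxx ?orbT.
have [n23 n24 n25] : [/\ X2 != X3, X2 != X4 & X2 != X5] by split; apply: ne; rewrite ?inE ?eqxx ?orbT.
have [n34 n35 n45] : [/\ X3 != X4, X3 != X5 & X4 != X5] by split; apply: ne; rewrite ?inE ?eqxx ?orbT.
have cq : is_clique [set X in [:: X1; X2; X3; X4; X5]] N.
  move=> A B; rewrite !inE => hA hB n; apply: NI => //.
  move: hA hB n; case/or4P => [/eqP ->|/eqP ->|/eqP ->|/orP [] /eqP ->];
    case/or4P => [/eqP ->|/eqP ->|/eqP ->|/orP [] /eqP ->]; rewrite ?eqxx // => _; atac symE.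
have in1 : X1 \in [set X in [:: X1; X2; X3; X4; X5]] by rewrite !inE eqxx.
apply: (rigid_sets (U := X1) (W := X2)) => //; rewrite ?inE ?eqxx ?orbT //.
  exact: atom_clique in1 cq.
apply: (@sepm_five _ N symN _ [set X1] [set X2] [set X3] [set X4] [set X5]); rewrite ?inE //.
by split; splitall; first [exact: conn1 | by rewrite sub1set !inE eqxx ?orbT | exact: dis11 | by apply: adj11; apply: NI].
Qed.

(** An adjacent antipodal pair would give a K_5 with two classes merged into one, which [simple5]
    forbids. Hence the quotient is exactly the octahedron, which is an atom. *)
Lemma simple6 P1 Q1 P2 Q2 P3 Q3 : six E V P1 Q1 P2 Q2 P3 Q3 -> u \in P1 -> v \in P2 -> fsimple E u v P1 P2 ->
  [/\ ~~ adj E P1 Q1, ~~ adj E P2 Q2 & ~~ adj E P3 Q3] /\ slist [:: P1; Q1; P2; Q2; P3; Q3].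
Proof.
move=> f u1 v2 fs; case: f => c s d a; destr.
have two A B : conn E A -> conn E B -> dis A B -> sing (A :|: B) -> False.
  move=> [[x xA] _] [[y yB] _] dd sg; apply: (dd x) => //.
  by rewrite (sg x y) // inE ?xA ?yB ?orbT.
have n3 : ~~ adj E P3 Q3.
  apply/negP => a3; have [|_ [_ [_ [_ [h _]]]]] := @simple5 P1 P2 P3 Q3 (Q1 :|: Q2) _ u1 v2 fs.
    by split; mk symE.
  exact: (two Q1 Q2).
have n1 : ~~ adj E P1 Q1.
  apply/negP => a3; have [|_ [_ [_ [_ [h _]]]]] := @simple5 P1 P2 Q1 P3 (Q2 :|: Q3) _ u1 v2 fs.
    by split; mk symE.
  exact: (two Q2 Q3).
have n2 : ~~ adj E P2 Q2.
  apply/negP => a3; have [|_ [_ [_ [_ [h _]]]]] := @simple5 P1 P2 Q2 P3 (Q1 :|: Q3) _ u1 v2 fs.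
    by split; mk symE.
  exact: (two Q1 Q3).
split=> //; apply: slistI.
set l := [:: P1; Q1; P2; Q2; P3; Q3].
have cl : clist E V l by mk symE.
have dl : pdis l by mk symE.
have ne A B : A \in l -> B \in l -> dis A B -> A != B.
  by move=> Al _; apply: (conn_neq (proj1 (clist_in cl Al))).
have [p1 q1 p2 q2] : [/\ P1 \in l, Q1 \in l, P2 \in l & Q2 \in l] by rewrite !inE !eqxx !orbT.
have [p3 q3] : P3 \in l /\ Q3 \in l by rewrite !inE !eqxx !orbT.
have [m1 m2 m3] : [/\ P1 != Q1, P2 != Q2 & P3 != Q3] by split; apply: ne.
have [? ? ? ?] : [/\ P1 != P2, P1 != Q2, Q1 != P2 & Q1 != Q2] by split; apply: ne.
have [? ? ? ?] : [/\ P1 != P3, P1 != Q3, Q1 != P3 & Q1 != Q3] by split; apply: ne.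
have [? ? ? ?] : [/\ P2 != P3, P2 != Q3, Q2 != P3 & Q2 != Q3] by split; apply: ne.
have nn : ~~ N P1 Q1 /\ ~~ N P2 Q2 by split; apply: NN.
have aC : atom N [set P1; P2; Q1; Q2].
  by apply: (atom_C4 symN) => //; rewrite 1?eq_sym //; try (apply: NI => //; rewrite 1?eq_sym //; atac symE); case: nn.
have aC' : atom N (P3 |: [set P1; P2; Q1; Q2]).
  apply: (atom_attach symN (p := P1) (q := Q1) aC) => //; rewrite ?inE ?eqxx ?orbT //; try by case: nn.
  - by rewrite !negb_or; do !(apply/andP; split) => //; rewrite eq_sym.
  - by apply: NI; [rewrite eq_sym|atac symE].
  - by apply: NI; [rewrite eq_sym|atac symE].
have aC2 : atom N (Q3 |: (P3 |: [set P1; P2; Q1; Q2])).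
  apply: (atom_attach symN (p := P1) (q := Q1) aC') => //; rewrite ?inE ?eqxx ?orbT //; try by case: nn.
  - by rewrite !negb_or; do !(apply/andP; split) => //; rewrite eq_sym.
  - by apply: NI; [rewrite eq_sym|atac symE].
  - by apply: NI; [rewrite eq_sym|atac symE].
have eS : [set X in l] = Q3 |: (P3 |: [set P1; P2; Q1; Q2]).
  by apply/setP => X; rewrite !inE; do 6!case: eqP => //=.
apply: (rigid_sets (U := P1) (W := P2)) => //; first by rewrite eS.
apply: (@sepm_six _ N symN _ [set P1] [set Q1] [set P2] [set Q2] [set P3] [set Q3]); rewrite ?inE //.
by split; splitall; first [exact: conn1 | by rewrite sub1set inE | exact: dis11 | by apply: adj11; apply: NI].
Qed.

(** K_5 on R, Y0, J, K1, K2 minus the edge RJ, with [X0] attached to R, J and Y0; merging [X0] with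
    [J] restores the K_5. If [X0] sees both [K1] and [K2], merging [K1] with [J] instead contradicts
    [simple5]; otherwise the quotient is an atom. *)
Lemma half_wing5 X0 Y0 R J K1 K2 : let l := [:: X0; Y0; R; J; K1; K2] in
  clist E V l -> pdis l -> u \in X0 -> v \in Y0 -> fsimple E u v X0 Y0 ->
  [/\ adj E X0 R, adj E X0 J & ~~ adj E R J] ->
  [/\ adj E R Y0, adj E R K1 & adj E R K2] -> [/\ adj E J Y0, adj E J K1 & adj E J K2] ->
  [/\ adj E K1 K2, adj E Y0 K1 & adj E Y0 K2] -> slist l.
Proof.
move=> l cl dl uX vY fs hX hR hJ hK.
have aXY : adj E X0 Y0 by apply/adjP; exists u, v.
have := cl; have := dl; rewrite /l /= => dl' cl'; destr.
have two A B : conn E A -> conn E B -> dis A B -> sing (A :|: B) -> False.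
  move=> [[x xA] _] [[y yB] _] dd sg; apply: (dd x) => //.
  by rewrite (sg x y) // inE ?xA ?yB ?orbT.
have ne A B : A \in l -> B \in l -> dis A B -> A != B.
  by move=> Al _; apply: (conn_neq (proj1 (clist_in cl Al))).
have [i1 i2 i3 i4] : [/\ X0 \in l, Y0 \in l, R \in l & J \in l] by rewrite !inE !eqxx !orbT.
have [i5 i6] : K1 \in l /\ K2 \in l by rewrite !inE !eqxx !orbT.
have [? ? ? ?] : [/\ X0 != Y0, X0 != R, X0 != J & X0 != K1] by split; apply: ne.
have [? ? ? ?] : [/\ X0 != K2, Y0 != R, Y0 != J & Y0 != K1] by split; apply: ne.
have [? ? ? ?] : [/\ Y0 != K2, R != J, R != K1 & R != K2] by split; apply: ne.
have [? ? ?] : [/\ J != K1, J != K2 & K1 != K2] by split; apply: ne.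
(* [A] is whichever of [K1], [K2] the class [X0] misses: then X0, R, A, J is an induced 4-cycle, and
   [B] and [Y0] attach to its nonadjacent pair R, J. *)
have main A B : A \in l -> B \in l -> (forall X, X \in l -> X \in [:: X0; Y0; R; J; A; B]) -> X0 != A -> X0 != B -> R != A -> R != B -> J != A -> J != B -> Y0 != A -> Y0 != B -> A != B ->
   adj E A B -> adj E R A -> adj E J A -> adj E R B -> adj E J B -> adj E Y0 A -> adj E Y0 B ->
   ~~ adj E X0 A -> slist l.
  move=> Al Bl AB *; apply: slistI.
  have nn : ~~ N R J /\ ~~ N X0 A by split; apply: NN.
  have aC : atom N [set X0; R; A; J].
    by apply: (atom_C4 symN) => //; rewrite 1?eq_sym //; try (apply: NI => //; rewrite 1?eq_sym //; atac symE); case: nn.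
  have aC' : atom N (B |: [set X0; R; A; J]).
    apply: (atom_attach symN (p := R) (q := J) aC) => //; rewrite ?inE ?eqxx ?orbT //; try by case: nn.
    - by rewrite !negb_or; do !(apply/andP; split) => //; rewrite eq_sym.
    - by apply: NI; [rewrite eq_sym|atac symE].
    - by apply: NI; [rewrite eq_sym|atac symE].
  have aC2 : atom N (Y0 |: (B |: [set X0; R; A; J])).
    apply: (atom_attach symN (p := R) (q := J) aC') => //; rewrite ?inE ?eqxx ?orbT //; try by case: nn.
    - by rewrite !negb_or; do !(apply/andP; split) => //; rewrite eq_sym.
    - by apply: NI => //; atac symE.
    - by apply: NI => //; atac symE.
  have eS : [set X in l] = Y0 |: (B |: [set X0; R; A; J]).
    apply/setP => X; apply/idP/idP; rewrite inl.
      by move/AB; rewrite !inE; do 6!case: eqP => //=.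
    by rewrite !(in_setU, in_set1) => /or3P [/eqP ->|/eqP ->|] //; rewrite -!orbA => /or4P [] /eqP ->.
  apply: (rigid_sets (U := X0) (W := Y0)) => //; first by rewrite eS.
  apply: (@sepm_five _ N symN _ ([set X0] :|: [set J]) [set Y0] [set R] [set A] [set B]); rewrite ?inE ?eqxx //.
  have aNXJ : adj N [set X0] [set J] by apply: adj11; apply: NI.
  have [? ? ? ?] : [/\ adj N [set X0] [set Y0], adj N [set X0] [set R], adj N [set J] [set A] & adj N [set J] [set B]].
    by split; apply: adj11; apply: NI => //; atac symE.
  have [? ? ?] : [/\ adj N [set Y0] [set R], adj N [set Y0] [set A] & adj N [set Y0] [set B]].
    by split; apply: adj11; apply: NI => //; atac symE.
  have [? ? ?] : [/\ adj N [set R] [set A], adj N [set R] [set B] & adj N [set A] [set B]].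
    by split; apply: adj11; apply: NI => //; atac symE.
  have [? ? ?] : [/\ X0 \in [set X in l], Y0 \in [set X in l] & R \in [set X in l]] by rewrite !inl.
  have [? ? ?] : [/\ J \in [set X in l], A \in [set X in l] & B \in [set X in l]] by rewrite !inl.
  by split; mk symN.
case: (boolP (adj E X0 K1)) => a1; last first.
  by apply: (main K1 K2) => //; atac symE.
case: (boolP (adj E X0 K2)) => a2; last first.
  apply: (main K2 K1) => //; rewrite 1?eq_sym //; try atac symE.
  by move=> X; rewrite !inE; do 6!case: eqP => //=.
exfalso; have [|_ [_ [_ [h _]]]] := @simple5 X0 Y0 R (K1 :|: J) K2 _ uX vY fs.
  by split; mk symE.
by apply: (two K1 J) => //; apply: disC.
Qed.

(* K_{2,2,2} on the antipodal pairs (R,Q1), (Y0,Q2), (C,Q3), minus the edge RC, with [X0] attached to Y0, R and C. *)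
Lemma half_wing6 X0 Y0 R Q1 Q2 C Q3 : let l := [:: X0; Y0; R; Q1; Q2; C; Q3] in
  clist E V l -> pdis l -> u \in X0 -> v \in Y0 -> fsimple E u v X0 Y0 ->
  [/\ adj E X0 R, adj E X0 C & ~~ adj E R C] -> [/\ ~~ adj E R Q1, ~~ adj E Y0 Q2 & ~~ adj E C Q3] ->
  [/\ adj E R Y0, adj E R Q2, adj E Q1 Y0 & adj E Q1 Q2] -> [/\ adj E R Q3, adj E Q1 C & adj E Q1 Q3] ->
  [/\ adj E Y0 C, adj E Y0 Q3, adj E Q2 C & adj E Q2 Q3] -> slist l.
Proof.
move=> l cl dl uX vY fs hX hn h12 h13 h23.
have aXY : adj E X0 Y0 by apply/adjP; exists u, v.
apply: slistI; have := cl; have := dl; rewrite {1 2}/l /= => dl' cl'; destr.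
have ne A B : A \in l -> B \in l -> dis A B -> A != B.
  by move=> Al _; apply: (conn_neq (proj1 (clist_in cl Al))).
have [i1 i2 i3 i4] : [/\ X0 \in l, Y0 \in l, R \in l & Q1 \in l] by rewrite !inE !eqxx !orbT.
have [i5 i6 i7] : [/\ Q2 \in l, C \in l & Q3 \in l] by rewrite !inE !eqxx !orbT.
have [? ? ? ?] : [/\ X0 != Y0, X0 != R, X0 != Q1 & X0 != Q2] by split; apply: ne.
have [? ? ? ?] : [/\ X0 != C, X0 != Q3, Y0 != R & Y0 != Q1] by split; apply: ne.
have [? ? ? ?] : [/\ Y0 != Q2, Y0 != C, Y0 != Q3 & R != Q1] by split; apply: ne.
have [? ? ? ?] : [/\ R != Q2, R != C, R != Q3 & Q1 != Q2] by split; apply: ne.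
have [? ? ? ?] : [/\ Q1 != C, Q1 != Q3, Q2 != C & Q2 != Q3] by split; apply: ne.
have [? nRC] : C != Q3 /\ ~~ N R C by split; [apply: ne|apply: NN].
have nn : ~~ N R Q1 /\ ~~ N Q2 Y0 by split; apply: NN => //; rewrite (adjC symE).
have aC : atom N [set R; Q2; Q1; Y0].
  by apply: (atom_C4 symN) => //; rewrite 1?eq_sym //; try (apply: NI => //; rewrite 1?eq_sym //; atac symE); case: nn.
have aC1 : atom N (Q3 |: [set R; Q2; Q1; Y0]).
  apply: (atom_attach symN (p := R) (q := Q1) aC) => //; rewrite ?inE ?eqxx ?orbT //; try by case: nn.
  - by rewrite !negb_or; do !(apply/andP; split) => //; rewrite eq_sym.
  - by apply: NI; [rewrite eq_sym|atac symE].
  - by apply: NI; [rewrite eq_sym|atac symE].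
have aC2 : atom N (C |: (Q3 |: [set R; Q2; Q1; Y0])).
  apply: (atom_attach symN (p := Q2) (q := Y0) aC1) => //; rewrite ?inE ?eqxx ?orbT //; try by case: nn.
  - by rewrite !negb_or; do !(apply/andP; split) => //; rewrite eq_sym.
  - by rewrite eq_sym.
  - by apply: NI; [rewrite eq_sym|atac symE].
  - by apply: NI; [rewrite eq_sym|atac symE].
have aC3 : atom N (X0 |: (C |: (Q3 |: [set R; Q2; Q1; Y0]))).
  apply: (atom_attach symN (p := R) (q := C) aC2) => //; rewrite ?inE ?eqxx ?orbT //; try by case: nn.
  - by rewrite !negb_or; do !(apply/andP; split) => //; rewrite eq_sym.
  - by apply: NI => //; atac symE.
  - by apply: NI => //; atac symE.
have eS : [set X in l] = X0 |: (C |: (Q3 |: [set R; Q2; Q1; Y0])).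
  by apply/setP => X; rewrite !inE; do 7!case: eqP => //=.
apply: (rigid_sets (U := X0) (W := Y0)) => //; first by rewrite eS.
have [? ? ? ?] : [/\ X0 \in [set X in l], Y0 \in [set X in l], R \in [set X in l] & Q1 \in [set X in l]].
  by rewrite !inl.
have [? ? ?] : [/\ Q2 \in [set X in l], C \in [set X in l] & Q3 \in [set X in l]] by rewrite !inl.
have [? ? ?] : [/\ adj N [set X0] [set R], adj N [set X0] [set Y0] & adj N [set X0] [set C]].
  by split; apply: adj11; apply: NI.
have [? ? ? ?] : [/\ adj N [set R] [set Y0], adj N [set R] [set Q2], adj N [set Q1] [set Y0] & adj N [set Q1] [set Q2]].
  by split; apply: adj11; apply: NI => //; rewrite eq_sym.
have [? ? ?] : [/\ adj N [set R] [set Q3], adj N [set Q1] [set C] & adj N [set Q1] [set Q3]].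
  by split; apply: adj11; apply: NI.
have [? ? ? ?] : [/\ adj N [set Y0] [set C], adj N [set Y0] [set Q3], adj N [set Q2] [set C] & adj N [set Q2] [set Q3]].
  by split; apply: adj11; apply: NI.
apply: (@sepm_six _ N symN _ ([set X0] :|: [set R]) [set Q1] [set Y0] [set Q2] [set C] [set Q3]); rewrite ?inE ?eqxx //.
by split; mk symN.
Qed.

End Rigid.

Section Octa.
Variables (T : finType) (E : rel T).
Hypothesis symE : symmetric E.

Lemma atom_octa p1 q1 p2 q2 p3 q3 : uniq [:: p1; q1; p2; q2; p3; q3] ->
  [/\ E p1 p2, E p1 q2, E q1 p2 & E q1 q2] -> [/\ E p1 p3, E p1 q3, E q1 p3 & E q1 q3] ->
  [/\ E p2 p3, E p2 q3, E q2 p3 & E q2 q3] -> ~~ E p1 q1 -> ~~ E p2 q2 ->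
  atom E (p3 |: (q3 |: [set p1; p2; q1; q2])).
Proof.
rewrite /= !inE !negb_or !andbT => /and5P [/and5P [? ? ? ? ?] /and4P [? ? ? ?] /and3P [? ? ?] /andP [? ?] ?] h1 h2 h3 n1 n2; destr.
have aC : atom E [set p1; p2; q1; q2] by apply: (atom_C4 symE) => //; rewrite 1?eq_sym // symE.
have aC1 : atom E (q3 |: [set p1; p2; q1; q2]).
  apply: (atom_attach symE (p := p1) (q := q1) aC) => //; rewrite ?inE ?eqxx ?orbT //; try by rewrite symE.
  by rewrite !negb_or; do !(apply/andP; split) => //; rewrite eq_sym.
apply: (atom_attach symE (p := p1) (q := q1) aC1) => //; rewrite ?inE ?eqxx ?orbT //; try by rewrite symE.
by rewrite !negb_or; do !(apply/andP; split) => //; rewrite eq_sym.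
Qed.

End Octa.

(** * Bases and steps *)

Section Core.
Variables (T : finType) (E : rel T).
Hypotheses (symE : symmetric E) (irrE : forall x, ~~ E x x).
Implicit Types (A B C D K L P Q R S U V W X Y : {set T}).

Lemma rigid_sym V u v : rigid E V u v -> rigid E V v u.
Proof.
move=> rig I S B i j fB iS jS ij vB uB fs aS sS; apply: (rig I S B j i) => //; rewrite 1?eq_sym //.
  by move=> x y xB yB Exy; rewrite symE in Exy; have [-> ->] := fs y x yB xB Exy.
by apply: sepm_sym.
Qed.

Definition clean V u v : Prop := forall x, x \in V -> E u x -> x != v -> E v x.

(** The minor does without [u], a neighbour [x] of [u] taking its place. *)
Definition star V u v : Prop := exists x, [/\ x \in V, x != v, E u x & sepm E (V :\ u) v x].

(** The configuration from which the induction continues with [w1], [w2] or deletes a vertex. *)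
Definition step V u v : Prop := clean V u v /\
  exists w1 w2, [/\ w1 \in V, w2 \in V, w1 != w2 & ~~ E w1 w2] /\
    [/\ E u w1, E u w2, E v w1, E v w2 & good E (V :\ u) w1 w2].

Definition baseK5 V u v : Prop := exists a b c, V = [set u; v; a; b; c] /\
  five E V [set u] [set v] [set a] [set b] [set c].

Definition baseK222 V u v : Prop := exists u' v' c c', V = [set u; u'; v; v'; c; c'] /\
  six E V [set u] [set u'] [set v] [set v'] [set c] [set c'] /\ [/\ ~~ E u u', ~~ E v v' & ~~ E c c'].

(** The class of [u] is {u} with [R], that of [v] is [W]; only [u] reaches [J], and only [R] reaches
    [K1] and [K2]. *)
Definition wing u R W J K1 K2 : Prop := [/\ adj E R W, adj E R K1 & adj E R K2] /\
  [/\ ~~ adj E R J, adj E [set u] J, ~~ adj E [set u] K1 & ~~ adj E [set u] K2].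

Lemma adjUinv A B C : adj E (A :|: B) C -> adj E A C \/ adj E B C.
Proof. by move=> /adjP [x [y [/setUP [] xA yC Exy]]]; [left|right]; apply/adjP; exists x, y. Qed.

Lemma adj1P x y : adj E [set x] [set y] = E x y.
Proof. by apply/adjP/idP => [[a [b [/set1P -> /set1P ->]]]|h] //; exists x, y; rewrite !inE !eqxx. Qed.

Lemma adjN A A' B B' : A \subset A' -> B \subset B' -> ~~ adj E A' B' -> ~~ adj E A B.
Proof. by move=> h1 h2; apply: contra; apply: adjS. Qed.

Lemma disS A A' B B' : A \subset A' -> B \subset B' -> dis A' B' -> dis A B.
Proof. by move=> /subsetP h1 /subsetP h2 d x /h1 xA /h2 xB; apply: (d x). Qed.

Lemma sing_conn A : conn E A -> sing A -> exists x, A = [set x].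
Proof.
by move=> [[x xA] _] sg; exists x; apply/setP => y; rewrite inE; apply/idP/eqP => [yA|-> //]; apply: sg.
Qed.

Lemma two_sing A B : conn E A -> conn E B -> dis A B -> sing (A :|: B) -> False.
Proof.
by move=> [[x xA] _] [[y yB] _] d sg; apply: (d x) => //; rewrite (sg x y) // inE ?xA ?yB ?orbT.
Qed.

Lemma fsimple_split u v R S : ~~ adj E R [set v] -> ~~ adj E [set u] S -> ~~ adj E R S ->
  fsimple E u v ([set u] :|: R) ([set v] :|: S).
Proof.
move=> h1 h2 h3 x y /setUP [/set1P ->|xR] /setUP [/set1P ->|yS] Exy //; exfalso.
- by case/negP: h2; apply/adjP; exists u, y; rewrite inE eqxx.
- by case/negP: h1; apply/adjP; exists x, v; rewrite inE eqxx.
- by case/negP: h3; apply/adjP; exists x, y.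
Qed.

Lemma fsimple1l u v S : ~~ adj E [set u] S -> fsimple E u v [set u] ([set v] :|: S).
Proof.
move=> h x y /set1P -> /setUP [/set1P ->|yS] Exy //; exfalso.
by case/negP: h; apply/adjP; exists u, y; rewrite inE eqxx.
Qed.

Lemma fsimple11 u v : fsimple E u v [set u] [set v].
Proof. by move=> x y /set1P -> /set1P ->. Qed.

Lemma fsimpleC u v A B : fsimple E u v A B -> fsimple E v u B A.
Proof. by move=> fs x y xB yA Exy; rewrite symE in Exy; have [-> ->] := fs y x yA xB Exy. Qed.

(** Since [u] sees at most one of the three classes, [R] sees two; as it does not see all three, the
    one it misses is the one seen by [u]. *)
Lemma side_wing u R W O1 O2 O3 :
  [/\ adj E ([set u] :|: R) O1, adj E ([set u] :|: R) O2 & adj E ([set u] :|: R) O3] ->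
  [/\ ~~ adj E [set u] O1 \/ ~~ adj E [set u] O2, ~~ adj E [set u] O1 \/ ~~ adj E [set u] O3 &
      ~~ adj E [set u] O2 \/ ~~ adj E [set u] O3] -> adj E R W ->
  (adj E R O1 -> adj E R O2 -> adj E R O3 -> False) ->
  [\/ wing u R W O1 O2 O3, wing u R W O2 O1 O3 | wing u R W O3 O1 O2].
Proof.
move=> [/adjUinv h1 /adjUinv h2 /adjUinv h3] [k12 k13 k23] aW st; rewrite /wing.
case: (boolP (adj E [set u] O1)) k12 k13 h1 => u1 k12 k13 h1; case: (boolP (adj E [set u] O2)) k12 k23 h2 => u2 k12 k23 h2;
case: (boolP (adj E [set u] O3)) k13 k23 h3 => u3 k13 k23 h3;
case: (boolP (adj E R O1)) h1 st => r1 h1 st; case: (boolP (adj E R O2)) h2 st => r2 h2 st; case: (boolP (adj E R O3)) h3 st => r3 h3 st;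
try (by case: k12); try (by case: k13); try (by case: k23); try (by case: h1); try (by case: h2); try (by case: h3); try (by case: st);
first [by apply: Or31 | by apply: Or32 | by apply: Or33].
Qed.

Section OneSide.
Variables (V : {set T}) (u v : T).
Hypotheses (Euv : E u v) (rig : rigid E V u v) (aV : atom E V).

(** The adjacent vertices [u], [v] do not separate the atom [V], so a component outside [S] attaches
    to a third vertex of [S]. *)
Lemma absorb S x : S \subset V -> x \in S -> x != u -> x != v -> ~~ (V \subset S) ->
  exists D y, [/\ conn E D, D \subset V, (forall z, z \in D -> z \notin S), y \in S & [/\ y != u, y != v & adj E [set y] D]].
Proof.
move=> SV xS xu xv /subsetPn [z zV zS]; have zD : z \in V :\: S by rewrite inE zS.
have sub y : y \in cmp E (V :\: S) z -> y \in V /\ y \notin S by move/(subsetP (cmp_sub _ _ _)) => /setDP.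
apply: NNPP => nex; set D := cmp E (V :\: S) z in sub nex.
have cD : conn E D by apply: conn_cmp.
have [||||xD|] := atomE (D := D) (x := z) (K := [set u; v]) aV _ _ _ _ (subsetP SV _ xS).
- by apply/subsetP => y /sub [].
- exact: cmp_refl.
- by move=> a b /set2P [] -> /set2P [] -> //; rewrite ?eqxx // symE.
- move=> a b aD bV Eab; case bS : (b \in S); last first.
    by left; apply: cmp_closed aD _ Eab; rewrite inE bS.
  right; rewrite !inE; apply: contraT; rewrite negb_or => /andP [bu bv]; case: nex.
  exists D, b; split=> //; [by apply/subsetP => y /sub []|by move=> y /sub []|split=> //].
  by apply/adjP; exists b, a; rewrite inE eqxx symE.
- by have [] := sub x xD; rewrite xS.
- by rewrite !inE (negbTE xu) (negbTE xv).
Qed.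

(** A vertex outside the model would enlarge, together with its component, a class other than {u}
    and {v}; rigidity excludes this. *)
Lemma five_base A B C : five E V [set u] [set v] A B C -> baseK5 V u v.
Proof.
move=> f; have fs := @fsimple11 u v.
have [_ [_ [sA [sB [sC _]]]]] := simple5 symE rig f (set11 u) (set11 v) fs.
case: (f) => c s d a; destr.
have [a0 eA] : exists x, A = [set x] by apply: sing_conn.
have [b0 eB] : exists x, B = [set x] by apply: sing_conn.
have [c0 eC] : exists x, C = [set x] by apply: sing_conn.
subst A B C; exists a0, b0, c0; split=> //.
have SV : [set u; v; a0; b0; c0] \subset V.
  by apply/subsetP => y; rewrite !inE -!orbA => /or4P [/eqP ->|/eqP ->|/eqP ->|/orP [] /eqP ->]; rewrite -sub1set.
have n1 (x y : T) : dis [set x] [set y] -> y != x.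
  by move=> dd; apply/eqP => e; apply: (dd x); rewrite ?inE ?e eqxx.
apply/eqP; rewrite eqEsubset SV andbT; apply: contraT => nS; exfalso.
have [|||D [y [cD DV DS yS [yu yv aD]]]] := absorb (x := a0) SV _ _ _ nS; rewrite ?inE ?eqxx ?orbT //; try by apply: n1.
have dD x : x \in [set u; v; a0; b0; c0] -> dis [set x] D.
  by move=> xS z /set1P -> zD; move: (DS x zD); rewrite xS.
have [? ? ? ? ?] : [/\ dis [set u] D, dis [set v] D, dis [set a0] D, dis [set b0] D & dis [set c0] D].
  by split; apply: dD; rewrite !inE eqxx ?orbT.
have : y \in [:: a0; b0; c0] by move: yS; rewrite !inE (negbTE yu) (negbTE yv) -!orbA.
rewrite !inE => /or3P [] /eqP ey; rewrite ey in aD.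
- have [|_ [_ [h _]]] := @simple5 _ E V u v symE rig [set u] [set v] ([set a0] :|: D) [set b0] [set c0] _ (set11 u) (set11 v) fs.
    by split; mk symE.
  by apply: (@two_sing [set a0] D) => //; apply: conn1.
- have [|_ [_ [_ [h _]]]] := @simple5 _ E V u v symE rig [set u] [set v] [set a0] ([set b0] :|: D) [set c0] _ (set11 u) (set11 v) fs.
    by split; mk symE.
  by apply: (@two_sing [set b0] D) => //; apply: conn1.
- have [|_ [_ [_ [_ [h _]]]]] := @simple5 _ E V u v symE rig [set u] [set v] [set a0] [set b0] ([set c0] :|: D) _ (set11 u) (set11 v) fs.
    by split; mk symE.
  by apply: (@two_sing [set c0] D) => //; apply: conn1.
Qed.

Lemma six_base U' W' C C' : six E V [set u] U' [set v] W' C C' -> baseK222 V u v.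
Proof.
move=> f; have fs := @fsimple11 u v.
have [[nU nV nC] [_ [sU [_ [sW [sC [sC' _]]]]]]] := simple6 symE rig f (set11 u) (set11 v) fs.
case: (f) => c s d a; destr.
have [u0 eU] : exists x, U' = [set x] by apply: sing_conn.
have [v0 eW] : exists x, W' = [set x] by apply: sing_conn.
have [c0 eC] : exists x, C = [set x] by apply: sing_conn.
have [d0 eC'] : exists x, C' = [set x] by apply: sing_conn.
subst U' W' C C'; exists u0, v0, c0, d0; split; last by split=> //; split; rewrite -adj1P.
have SV : [set u; u0; v; v0; c0; d0] \subset V.
  by apply/subsetP => y; rewrite !inE -!orbA => /or4P [/eqP ->|/eqP ->|/eqP ->|/or3P [] /eqP ->]; rewrite -sub1set.
have n1 (x y : T) : dis [set x] [set y] -> y != x.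
  by move=> dd; apply/eqP => e; apply: (dd x); rewrite ?inE ?e eqxx.
apply/eqP; rewrite eqEsubset SV andbT; apply: contraT => nS; exfalso.
have [|||D [y [cD DV DS yS [yu yv aD]]]] := absorb (x := c0) SV _ _ _ nS; rewrite ?inE ?eqxx ?orbT //; try by apply: n1.
have dD x : x \in [set u; u0; v; v0; c0; d0] -> dis [set x] D.
  by move=> xS z /set1P -> zD; move: (DS x zD); rewrite xS.
have [? ? ? ? ?] : [/\ dis [set u] D, dis [set v] D, dis [set u0] D, dis [set v0] D & dis [set c0] D].
  by split; apply: dD; rewrite !inE eqxx ?orbT.
have ? : dis [set d0] D by apply: dD; rewrite !inE eqxx ?orbT.
have : y \in [:: u0; v0; c0; d0] by move: yS; rewrite !inE (negbTE yu) (negbTE yv) -!orbA.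
have s6 := @simple6 _ E V u v symE rig [set u] _ [set v] _ _ _ _ (set11 u) (set11 v) fs.
rewrite !inE => /or4P [] /eqP ey; rewrite ey in aD.
- have [|_ [_ [h _]]] := s6 ([set u0] :|: D) [set v0] [set c0] [set d0]; first by split; mk symE.
  by apply: (@two_sing [set u0] D) => //; apply: conn1.
- have [|_ [_ [_ [_ [h _]]]]] := s6 [set u0] ([set v0] :|: D) [set c0] [set d0]; first by split; mk symE.
  by apply: (@two_sing [set v0] D) => //; apply: conn1.
- have [|_ [_ [_ [_ [_ [h _]]]]]] := s6 [set u0] [set v0] ([set c0] :|: D) [set d0]; first by split; mk symE.
  by apply: (@two_sing [set c0] D) => //; apply: conn1.
- have [|_ [_ [_ [_ [_ [_ [h _]]]]]]] := s6 [set u0] [set v0] [set c0] ([set d0] :|: D); first by split; mk symE.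
  by apply: (@two_sing [set d0] D) => //; apply: conn1.
Qed.

Lemma wing5_sing W R J K1 K2 : let l := [:: [set u]; W; R; J; K1; K2] in
  clist E V l -> pdis l -> v \in W -> fsimple E u v [set u] W -> adj E [set u] R -> wing u R W J K1 K2 ->
  [/\ adj E J W, adj E J K1, adj E J K2 & [/\ adj E K1 K2, adj E W K1 & adj E W K2]] -> slist l.
Proof.
move=> l cl dl vW fs uR [[h1 h2 h3] [h4 h5 h6 h7]] [h8 h9 h10 [h11 h12 h13]].
exact: (half_wing5 symE Euv rig cl dl (set11 u) vW fs).
Qed.

(** A neighbour of [u] that [v] misses could share the class of [u], leaving [uv] the only edge to
    [v], against [half_wing5]; hence cleanness. The new pair is given by [R] and [J]: joining them
    completes a K_5 with [v], [K1], [K2] that avoids [u]. *)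
Lemma wing5_step R J K1 K2 : let l := [:: [set u]; [set v]; R; J; K1; K2] in
  clist E V l -> pdis l -> adj E [set u] R -> wing u R [set v] J K1 K2 ->
  [/\ adj E J [set v], adj E J K1, adj E J K2 & [/\ adj E K1 K2, adj E [set v] K1 & adj E [set v] K2]] -> step V u v.
Proof.
move=> l cl dl uR wg h8.
have [_ [_ [sR [sJ [s1 [s2 _]]]]]] := wing5_sing cl dl (set11 v) (@fsimple11 u v) uR wg h8.
move: wg h8 cl dl uR; rewrite /l /wing /= => *; destr.
have [r eR] : exists x, R = [set x] by apply: sing_conn.
have [j eJ] : exists x, J = [set x] by apply: sing_conn.
have [k1 e1] : exists x, K1 = [set x] by apply: sing_conn.
have [k2 e2] : exists x, K2 = [set x] by apply: sing_conn.
clear l; subst R J K1 K2.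
have n1 (x y : T) : dis [set x] [set y] -> x != y.
  by move=> dd; apply/eqP => e; apply: (dd x); rewrite ?inE ?e eqxx.
have iV x : [set x] \subset V -> x \in V by rewrite sub1set.
split.
  move=> x xV Eux xv; apply: contraT => Evx; exfalso.
  have xu : u != x by apply: contraNneq (irrE u) => {2}->.
  have nx y : adj E [set v] [set y] -> y != x.
    by rewrite adj1P => Evy; apply: contraNneq Evx => <-.
  have [? ? ? ?] : [/\ r != x, j != x, k1 != x & k2 != x] by split; apply: nx => //; rewrite (adjC symE).
  have vx : v != x by rewrite eq_sym.
  have [|||||||||s _] := @half_wing5 _ E V u v symE Euv rig ([set u] :|: [set x]) [set v] [set r] [set j] [set k1] [set k2].
  - by mk symE.
  - by mk symE.
  - by rewrite !inE eqxx.
  - by rewrite inE.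
  - move=> y z /setUP [] /set1P -> /set1P -> // Exv; by rewrite symE Exv in Evx.
  - by mk symE.
  - by mk symE.
  - by mk symE.
  - by mk symE.
  - by move: xu; rewrite (s u x) ?inE ?eqxx ?orbT.
exists r, j; split.
  by split; [exact: iV|exact: iV|exact: n1|rewrite -adj1P].
have [? ? ? ?] : [/\ E u r, E u j, E v r & E v j] by rewrite -!adj1P (adjC symE [set v]) (adjC symE [set v] [set j]).
split=> //.
set E' := add_edge E r j; have symE' : symmetric E' := add_edge_sym symE r j.
have up A B : adj E A B -> adj E' A B.
  by move=> /adjP [x [y [xA yB Exy]]]; apply/adjP; exists x, y; split=> //; apply: add_edge_old.
pose S := [set r; j; v; k1; k2].
have aE x y : adj E [set x] [set y] -> E' x y by rewrite adj1P; apply: add_edge_old.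
have [? ? ? ?] : [/\ E' r v, E' r k1, E' r k2 & E' j v] by split; apply: aE => //; rewrite (adjC symE).
have [? ? ? ?] : [/\ E' j k1, E' j k2, E' v k1 & E' v k2] by split; apply: aE.
have [? ?] : E' k1 k2 /\ E' r j by split; [apply: aE|rewrite /E' /add_edge /= !eqxx orbT].
have rS : r \in S by rewrite !inE eqxx.
have iS x : x \in [:: r; j; v; k1; k2] -> x \in S by rewrite !inE -!orbA.
have aS : atom E' S.
  apply: (atom_clique rS) => x y; rewrite !inE -!orbA.
  by case/or4P => [/eqP ->|/eqP ->|/eqP ->|/orP [] /eqP ->]; case/or4P => [/eqP ->|/eqP ->|/eqP ->|/orP [] /eqP ->]; rewrite ?eqxx // symE'.
exists S; split=> //.
- apply/subsetP => x; rewrite !inE -!orbA => h; apply/andP; split; last first.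
    by case/or4P: h => [/eqP ->|/eqP ->|/eqP ->|/orP [] /eqP ->]; apply: iV.
  by case/or4P: h => [/eqP ->|/eqP ->|/eqP ->|/orP [] /eqP ->]; rewrite eq_sym; apply: n1.
- by apply: iS; rewrite !inE eqxx orbT.
- apply: (@sepm_five _ E' symE' _ [set r] [set j] [set v] [set k1] [set k2]); rewrite ?inE //.
  have [? ? ? ?] : [/\ r \in S, j \in S, v \in S & k1 \in S] by split; apply: iS; rewrite !inE eqxx ?orbT.
  have ? : k2 \in S by apply: iS; rewrite !inE eqxx ?orbT.
  by split; mk symE'.
Qed.

Lemma wing6_sing W R Q1 Q2 C Q3 : let l := [:: [set u]; W; R; Q1; Q2; C; Q3] in
  clist E V l -> pdis l -> v \in W -> fsimple E u v [set u] W -> adj E [set u] R -> wing u R W C Q2 Q3 ->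
  [/\ ~~ adj E R Q1, ~~ adj E W Q2 & ~~ adj E C Q3] -> [/\ adj E Q1 W, adj E Q1 Q2, adj E Q1 C & adj E Q1 Q3] ->
  [/\ adj E W C, adj E W Q3, adj E Q2 C & adj E Q2 Q3] -> slist l.
Proof.
move=> l cl dl vW fs uR [[h1 h2 h3] [h4 h5 h6 h7]] hn [h8 h9 h10 h11] h12.
exact: (half_wing6 symE Euv rig cl dl (set11 u) vW fs).
Qed.

(** As in [wing5_step]; the edge between [R] and [C] is the one missing from an octahedron that
    avoids [u]. *)
Lemma wing6_step R Q1 Q2 C Q3 : let l := [:: [set u]; [set v]; R; Q1; Q2; C; Q3] in
  clist E V l -> pdis l -> adj E [set u] R -> wing u R [set v] C Q2 Q3 ->
  [/\ ~~ adj E R Q1, ~~ adj E [set v] Q2 & ~~ adj E C Q3] -> [/\ adj E Q1 [set v], adj E Q1 Q2, adj E Q1 C & adj E Q1 Q3] ->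
  [/\ adj E [set v] C, adj E [set v] Q3, adj E Q2 C & adj E Q2 Q3] -> step V u v.
Proof.
move=> l cl dl uR wg h1 h2 h3.
have [_ [_ [sR [s1 [s2 [sC [s3 _]]]]]]] := wing6_sing cl dl (set11 v) (@fsimple11 u v) uR wg h1 h2 h3.
move: wg h1 h2 h3 cl dl uR; rewrite /l /wing /= => *; destr.
have [r eR] : exists x, R = [set x] by apply: sing_conn.
have [q1 e1] : exists x, Q1 = [set x] by apply: sing_conn.
have [q2 e2] : exists x, Q2 = [set x] by apply: sing_conn.
have [q3 e3] : exists x, Q3 = [set x] by apply: sing_conn.
have [j eC] : exists x, C = [set x] by apply: sing_conn.
clear l; subst R C Q1 Q2 Q3.
have n1 (x y : T) : dis [set x] [set y] -> x != y.
  by move=> dd; apply/eqP => e; apply: (dd x); rewrite ?inE ?e eqxx.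
have iV x : [set x] \subset V -> x \in V by rewrite sub1set.
split.
  move=> x xV Eux xv; apply: contraT => Evx; exfalso.
  have xu : u != x by apply: contraNneq (irrE u) => {2}->.
  have nx y : adj E [set v] [set y] -> y != x.
    by rewrite adj1P => Evy; apply: contraNneq Evx => <-.
  have [? ? ? ?] : [/\ r != x, j != x, q1 != x & q3 != x] by split; apply: nx => //; rewrite (adjC symE).
  have ? : q2 != x by apply: contraTneq Eux => <-; rewrite -adj1P.
  have vx : v != x by rewrite eq_sym.
  have [||||||||||s _] := @half_wing6 _ E V u v symE Euv rig ([set u] :|: [set x]) [set v] [set r] [set q1] [set q2] [set j] [set q3].
  - by mk symE.
  - by mk symE.
  - by rewrite !inE eqxx.
  - by rewrite inE.
  - move=> y z /setUP [] /set1P -> /set1P -> // Exv; by rewrite symE Exv in Evx.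
  - by mk symE.
  - by mk symE.
  - by mk symE.
  - by mk symE.
  - by mk symE.
  - by move: xu; rewrite (s u x) ?inE ?eqxx ?orbT.
exists r, j; split.
  by split; [exact: iV|exact: iV|exact: n1|rewrite -adj1P].
have [? ? ? ?] : [/\ E u r, E u j, E v r & E v j] by rewrite -!adj1P (adjC symE [set v] [set r]).
split=> //.
set E' := add_edge E r j; have symE' : symmetric E' := add_edge_sym symE r j.
have aE x y : adj E [set x] [set y] -> E' x y by rewrite adj1P; apply: add_edge_old.
have [n12 n13 n14 n15] : [/\ r != q1, r != q2, r != j & r != q3] by split; apply: n1.
have [n16 n23 n24 n25] : [/\ r != v, q1 != q2, q1 != j & q1 != q3] by split; apply: n1 => //; apply: disC.
have [n26 n34 n35 n36] : [/\ q1 != v, q2 != j, q2 != q3 & q2 != v] by split; apply: n1 => //; apply: disC.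
have [n45 n46 n56] : [/\ j != q3, j != v & q3 != v] by split; apply: n1 => //; apply: disC.
have [? ? ? ?] : [/\ E' r v, E' r q2, E' r q3 & E' q1 v] by split; apply: aE.
have [? ? ? ?] : [/\ E' q1 q2, E' q1 j, E' q1 q3 & E' v j] by split; apply: aE.
have [? ? ? ?] : [/\ E' v q3, E' q2 j, E' q2 q3 & E' r j] by split; [apply: aE..|rewrite /E' /add_edge /= !eqxx orbT].
have ? : ~~ E' r q1.
  by rewrite /E' /add_edge /= (negbTE n24) (negbTE n14) andbF orbF -adj1P.
have ? : ~~ E' v q2.
  by rewrite /E' /add_edge /= (eq_sym v r) (eq_sym v j) (negbTE n16) (negbTE n46) orbF -adj1P.
have aS : atom E' (j |: (q3 |: [set r; v; q1; q2])).
  apply: (atom_octa symE') => //.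
  by rewrite /= !inE !negb_or n12 n13 n14 n15 n16 n23 n24 n25 n26 (eq_sym v q2) n36 (eq_sym v j) n46 (eq_sym v q3) n56 n34 n35 n45.
set S := j |: _ in aS *.
have iS x : x \in [:: r; q1; v; q2; j; q3] -> x \in S.
  by rewrite !inE; do 6!case: eqP => //=.
exists S; split=> //.
- apply/subsetP => x; rewrite !inE -!orbA => h; apply/andP; split; last first.
    by case/or4P: h => [/eqP ->|/eqP ->|/eqP ->|/or3P [] /eqP ->]; apply: iV.
  by case/or4P: h => [/eqP ->|/eqP ->|/eqP ->|/or3P [] /eqP ->]; rewrite eq_sym; apply: n1.
- by apply: iS; rewrite !inE eqxx.
- by apply: iS; rewrite !inE eqxx ?orbT.
- have [? ? ? ?] : [/\ r \in S, j \in S, v \in S & q1 \in S] by split; apply: iS; rewrite !inE eqxx ?orbT.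
  have [? ?] : q2 \in S /\ q3 \in S by split; apply: iS; rewrite !inE eqxx ?orbT.
  apply: (@sepm_six _ E' symE' S [set r] [set q1] [set j] [set q3] [set v] [set q2]); rewrite ?inE //.
  by split; mk symE'.
Qed.

End OneSide.
End Core.

Ltac undis := repeat match goal with
  | H : dis (?A :|: ?B) ?C |- _ => let H1 := fresh "H" in let H2 := fresh "H" in
     have H1 : dis A C := disS (subsetUl _ _) (subxx _) H;
     have H2 : dis B C := disS (subsetUr _ _) (subxx _) H; clear H
  | H : dis ?C (?A :|: ?B) |- _ => let H1 := fresh "H" in let H2 := fresh "H" in
     have H1 : dis C A := disS (subxx _) (subsetUl _ _) H;
     have H2 : dis C B := disS (subxx _) (subsetUr _ _) H; clear H
  end.

(** * Possible shapes of the two minimal classes *)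

Section Cases.
Variables (T : finType) (E : rel T).
Hypotheses (symE : symmetric E) (irrE : forall x, ~~ E x x).
Variables (V : {set T}).
Hypothesis aV : atom E V.
Implicit Types (A B C D K L P Q R S U W X Y : {set T}).

(** That is, [x] sees at most one of the three sets. *)
Definition alo3 x A B C : Prop := [/\ ~~ adj E [set x] A \/ ~~ adj E [set x] B,
  ~~ adj E [set x] A \/ ~~ adj E [set x] C & ~~ adj E [set x] B \/ ~~ adj E [set x] C].

Lemma subUinv A B W : A :|: B \subset W -> A \subset W /\ B \subset W.
Proof. by rewrite subUset => /andP. Qed.

Lemma subD1dis A x W : A \subset W -> dis [set x] A -> A \subset W :\ x.
Proof.
move=> /subsetP s d; apply/subsetP => y yA; rewrite !inE s // andbT.
by apply: contraTneq yA => ->; apply/negP; apply: d; rewrite inE.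
Qed.

Lemma fsimple1r u v R : ~~ adj E R [set v] -> fsimple E u v ([set u] :|: R) [set v].
Proof.
move=> h x y /setUP [/set1P ->|xR] /set1P -> // Exy; exfalso.
by case/negP: h; apply/adjP; exists x, v; rewrite inE eqxx.
Qed.

(** [R] alone can play the role of the class of [u]; the vertex required by [star] is a neighbour of
    [u] in [R]. *)
Lemma five_star u v R W A B C : five E V ([set u] :|: R) W A B C -> v \in W -> E u v ->
  dis [set u] R -> conn E R -> adj E [set u] R -> adj E R W ->
  adj E R A -> adj E R B -> adj E R C -> star E V u v.
Proof.
move=> f vW Euv d cR uR aW a1 a2 a3; case: f => c s dd a; destr; undis.
have [? ?] : [set u] \subset V /\ R \subset V by apply: subUinv.
have /adjP [u' [x [/set1P -> xR Eux]]] := uR; exists x; split=> //.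
- by apply: (subsetP (_ : R \subset V)).
- by apply/eqP => e; match goal with H : dis R W |- _ => apply: (H x); rewrite // e end.
apply: sepm_sym; apply: (@sepm_five _ E symE _ R W A B C) => //.
have [? ? ? ? ?] : [/\ R \subset V :\ u, W \subset V :\ u, A \subset V :\ u, B \subset V :\ u & C \subset V :\ u].
  by split; apply: subD1dis.
by split; mk symE.
Qed.

Lemma six_star u v R U' W W' C C' : six E V ([set u] :|: R) U' W W' C C' -> v \in W -> E u v ->
  dis [set u] R -> conn E R -> adj E [set u] R -> adj E R W ->
  adj E R W' -> adj E R C -> adj E R C' -> star E V u v.
Proof.
move=> f vW Euv d cR uR aW a1 a2 a3; case: f => c s dd a; destr; undis.
have [? ?] : [set u] \subset V /\ R \subset V by apply: subUinv.
have /adjP [u' [x [/set1P -> xR Eux]]] := uR; exists x; split=> //.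
- by apply: (subsetP (_ : R \subset V)).
- by apply/eqP => e; match goal with H : dis R W |- _ => apply: (H x); rewrite // e end.
apply: sepm_sym; apply: (@sepm_six _ E symE _ R U' W W' C C') => //.
have [? ? ? ? ?] : [/\ R \subset V :\ u, U' \subset V :\ u, W \subset V :\ u, W' \subset V :\ u & C \subset V :\ u].
  by split; apply: subD1dis.
have ? : C' \subset V :\ u by apply: subD1dis.
by split; mk symE.
Qed.

Section Pair.
Variables (u v : T).
Hypotheses (Euv : E u v) (rig : rigid E V u v).

(** If [R] missed [v], the edge [uv] would be simple and rigidity would shrink the class of [u].
    Otherwise, without a star, the class forms a wing. *)
Lemma five_one R A B C : five E V ([set u] :|: R) [set v] A B C -> dis [set u] R -> conn E R -> adj E [set u] R ->
  alo3 u A B C -> ~ star E V u v -> step E V u v.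
Proof.
move=> f d cR uR al nst.
have st : adj E R [set v] -> adj E R A -> adj E R B -> adj E R C -> False.
  by move=> *; apply: nst; apply: (five_star f); rewrite ?set11.
case: (boolP (adj E R [set v])) => aR; last first.
  exfalso; have [s _] := simple5 symE rig f (setU11 u R) (set11 v) (fsimple1r aR).
  by apply: (two_sing (conn1 E u) cR d s).
case: (f) => c s dd a; have {al} al := al; rewrite /alo3 in al; destr; undis.
have [? ?] : [set u] \subset V /\ R \subset V by apply: subUinv.
have [||wg|wg|wg] := @side_wing _ E u R [set v] A B C _ _ aR (st aR); try by split; first [done|atac symE].
- by apply: (wing5_step symE irrE Euv rig _ _ uR wg); first [done|mk symE].
- by apply: (wing5_step symE irrE Euv rig _ _ uR wg); first [done|mk symE].
- by apply: (wing5_step symE irrE Euv rig _ _ uR wg); first [done|mk symE].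
Qed.

Lemma six_one R U' W' C C' : six E V ([set u] :|: R) U' [set v] W' C C' -> dis [set u] R -> conn E R -> adj E [set u] R ->
  [/\ ~~ adj E ([set u] :|: R) U', ~~ adj E [set v] W' & ~~ adj E C C'] ->
  alo3 u W' C C' -> ~ star E V u v -> step E V u v.
Proof.
move=> f d cR uR [nU nW nC] al nst.
have st : adj E R [set v] -> adj E R W' -> adj E R C -> adj E R C' -> False.
  by move=> *; apply: nst; apply: (six_star f); rewrite ?set11.
case: (boolP (adj E R [set v])) => aR; last first.
  exfalso; have [_ [s _]] := simple6 symE rig f (setU11 u R) (set11 v) (fsimple1r aR).
  by apply: (two_sing (conn1 E u) cR d s).
case: (f) => c s dd a; rewrite /alo3 in al; destr; undis.
have [? ?] : [set u] \subset V /\ R \subset V by apply: subUinv.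
have ? : ~~ adj E R U' by apply: adjN nU; rewrite ?subsetUr.
have nC' : ~~ adj E C' C by rewrite (adjC symE).
have [||wg|wg|wg] := @side_wing _ E u R [set v] W' C C' _ _ aR (st aR); try by split; first [done|atac symE].
(* The class seen by [u] alone is the antipode of the class of [v]. Giving it to [u] and merging [R]
   with [C] produces a K_5 in which [uv] is still simple. *)
- exfalso; have := wg; rewrite /wing => wg'; destr.
  have [|||s _] := simple5 (X1 := [set u] :|: W') (X2 := [set v]) (X3 := R :|: C) (X4 := C') (X5 := U') symE rig _ _ (set11 v) _.
  + by split; mk symE.
  + by rewrite !inE eqxx.
  + by apply: fsimple1r; rewrite (adjC symE).
  by apply: (two_sing (conn1 E u) _ _ s); first [done|dtac].
- by apply: (wing6_step symE irrE Euv rig (R := R) (Q1 := U') (Q2 := W') (C := C) (Q3 := C')); first [done|mk symE].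
- by apply: (wing6_step symE irrE Euv rig (R := R) (Q1 := U') (Q2 := W') (C := C') (Q3 := C)); first [done|mk symE].
Qed.

(** As [u] misses [S], the edge [uv] is simple between {u} and the whole class of [v]. A wing with
    this class contradicts rigidity, since the class has two vertices. *)
Lemma five_two R S A B C : five E V ([set v] :|: S) ([set u] :|: R) A B C ->
  dis [set u] R -> conn E R -> dis [set v] S -> conn E S -> adj E [set u] R ->
  alo3 u A B C -> ~~ adj E [set u] S -> ~ star E V u v -> False.
Proof.
move=> f d cR d' cS uR al nuS nst.
case: (f) => c s dd a; have {al} al := al; rewrite /alo3 in al; destr; undis.
have [? ?] : [set u] \subset V /\ R \subset V by apply: subUinv.
have f' : five E V ([set u] :|: R) ([set v] :|: S) A B C by split; mk symE.
have [? ?] : [set v] \subset V /\ S \subset V by apply: subUinv.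
have st : adj E R ([set v] :|: S) -> adj E R A -> adj E R B -> adj E R C -> False.
  by move=> *; apply: nst; apply: (five_star f'); rewrite ?setU11.
case: (boolP (adj E R ([set v] :|: S))) => aR; last first.
  have fs : fsimple E u v ([set u] :|: R) ([set v] :|: S).
    by apply: fsimple_split => //; apply: adjN aR; rewrite ?subsetUl ?subsetUr.
  have [sg _] := simple5 symE rig f' (setU11 u R) (setU11 v S) fs.
  by apply: (two_sing (conn1 E u) cR d sg).
have fs := fsimple1l (v := v) nuS.
have fin J K1 K2 : slist [:: [set u]; [set v] :|: S; R; J; K1; K2] -> False.
  by move=> [_ [sg _]]; apply: (two_sing (conn1 E v) cS d' sg).
have [||wg|wg|wg] := @side_wing _ E u R ([set v] :|: S) A B C _ _ aR (st aR); try by split; first [done|atac symE].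
- by apply: (fin A B C); apply: (wing5_sing symE Euv rig _ _ _ fs uR wg); first [rewrite setU11; done|mk symE].
- by apply: (fin B A C); apply: (wing5_sing symE Euv rig _ _ _ fs uR wg); first [rewrite setU11; done|mk symE].
- by apply: (fin C A B); apply: (wing5_sing symE Euv rig _ _ _ fs uR wg); first [rewrite setU11; done|mk symE].
Qed.

Lemma six_two R S U' W' C C' : six E V ([set v] :|: S) W' ([set u] :|: R) U' C C' ->
  dis [set u] R -> conn E R -> dis [set v] S -> conn E S -> adj E [set u] R ->
  [/\ ~~ adj E ([set u] :|: R) U', ~~ adj E ([set v] :|: S) W' & ~~ adj E C C'] ->
  alo3 u W' C C' -> ~~ adj E [set u] S -> ~ star E V u v -> False.
Proof.
move=> f d cR d' cS uR [nU nW nC] al nuS nst.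
case: (f) => c s dd a; rewrite /alo3 in al; destr; undis.
have [? ?] : [set u] \subset V /\ R \subset V by apply: subUinv.
have f' : six E V ([set u] :|: R) U' ([set v] :|: S) W' C C' by split; mk symE.
have [? ?] : [set v] \subset V /\ S \subset V by apply: subUinv.
have st : adj E R ([set v] :|: S) -> adj E R W' -> adj E R C -> adj E R C' -> False.
  by move=> *; apply: nst; apply: (six_star f'); rewrite ?setU11.
case: (boolP (adj E R ([set v] :|: S))) => aR; last first.
  have fs : fsimple E u v ([set u] :|: R) ([set v] :|: S).
    by apply: fsimple_split => //; apply: adjN aR; rewrite ?subsetUl ?subsetUr.
  have [_ [sg _]] := simple6 symE rig f' (setU11 u R) (setU11 v S) fs.
  by apply: (two_sing (conn1 E u) cR d sg).
have fs := fsimple1l (v := v) nuS.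
have ? : ~~ adj E R U' by apply: adjN nU; rewrite ?subsetUr.
have nC' : ~~ adj E C' C by rewrite (adjC symE).
have fin Q1 Q2 Q3 Q4 : slist [:: [set u]; [set v] :|: S; R; Q1; Q2; Q3; Q4] -> False.
  by move=> [_ [sg _]]; apply: (two_sing (conn1 E v) cS d' sg).
have [||wg|wg|wg] := @side_wing _ E u R ([set v] :|: S) W' C C' _ _ aR (st aR); try by split; first [done|atac symE].
- have := wg; rewrite /wing => wg'; destr.
  have [||||s _] := simple5 (X1 := [set u] :|: W') (X2 := [set v] :|: S) (X3 := R :|: C) (X4 := C') (X5 := U') symE rig _ _ _ _.
  + by split; mk symE.
  + by rewrite !inE eqxx.
  + by rewrite setU11.
  + by apply: fsimple_split => //; rewrite (adjC symE); apply: adjN nW; rewrite ?subsetUl ?subsetUr.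
  by apply: (two_sing (conn1 E u) _ _ s); first [done|dtac].
- apply: (fin U' W' C C'); apply: (wing6_sing symE Euv rig _ _ _ fs uR wg); first [rewrite setU11; done|by mk symE].
- apply: (fin U' W' C' C); apply: (wing6_sing symE Euv rig _ _ _ fs uR wg); first [rewrite setU11; done|by mk symE].
Qed.

(** Both ends have wings. If [R] and [S] are adjacent, then {u}, {v}, [R], [S] and the union of the
    other classes form a K_5; if not, one of [A], [B], [C] is merged with [R] to connect it with
    [S]. In both cases a class is too large. *)
Lemma five_three R S A B C : five E V ([set u] :|: R) ([set v] :|: S) A B C ->
  dis [set u] R -> conn E R -> dis [set v] S -> conn E S -> adj E [set u] R -> adj E [set v] S ->
  alo3 u A B C -> alo3 v A B C -> adj E R [set v] -> adj E [set u] S ->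
  ~ star E V u v -> ~ star E V v u -> False.
Proof.
move=> f d cR d' cS uR vS al al' aRv auS n1 n2.
have Evu : E v u by rewrite symE.
have f' : five E V ([set v] :|: S) ([set u] :|: R) A B C by case: f => ? ? ? ?; destr; undis; split; mk symE.
have st : adj E R ([set v] :|: S) -> adj E R A -> adj E R B -> adj E R C -> False.
  by move=> *; apply: n1; apply: (five_star f); rewrite ?setU11.
have st' : adj E S ([set u] :|: R) -> adj E S A -> adj E S B -> adj E S C -> False.
  by move=> *; apply: n2; apply: (five_star f'); rewrite ?setU11.
have aR : adj E R ([set v] :|: S) by apply: adjrUl.
have aS : adj E S ([set u] :|: R) by apply: adjrUl; rewrite (adjC symE).
case: (f) => c s dd a; rewrite /alo3 in al al'; destr; undis.
have [? ?] : [set u] \subset V /\ R \subset V by apply: subUinv.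
have [? ?] : [set v] \subset V /\ S \subset V by apply: subUinv.
have aUV : adj E [set u] [set v] by rewrite adj1P.
have wgu : [\/ wing E u R ([set v] :|: S) A B C, wing E u R ([set v] :|: S) B A C | wing E u R ([set v] :|: S) C A B].
  by apply: side_wing; [split; atac symE|split; done|done|exact: st].
have wgv : [\/ wing E v S ([set u] :|: R) A B C, wing E v S ([set u] :|: R) B A C | wing E v S ([set u] :|: R) C A B].
  by apply: side_wing; [split; atac symE|split; done|done|exact: st'].
rewrite /wing in wgu wgv.
case: (boolP (adj E R S)) => aRS.
  have [|_ [_ [_ [_ [s _]]]]] := simple5 (X1 := [set u]) (X2 := [set v]) (X3 := R) (X4 := S) (X5 := A :|: B :|: C) symE rig _ (set11 u) (set11 v) (@fsimple11 _ E u v).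
    by case: wgu => wgu; destr; case: wgv => wgv; destr; split; mk symE.
  by apply: (@two_sing _ E (A :|: B) C) => //; [apply: connUadj|apply: disUl].
have go X Y Z : dis R X -> conn E X -> five E V [set u] [set v] (R :|: X) S (Y :|: Z) -> False.
  move=> dRX cX h; have [_ [_ [s _]]] := simple5 symE rig h (set11 u) (set11 v) (@fsimple11 _ E u v).
  exact: (two_sing cR cX dRX s).
case: wgu => wgu; destr; case: wgv => wgv; destr;
first [by apply: (go A B C) => //; split; mk symE | by apply: (go B A C) => //; split; mk symE | by apply: (go C A B) => //; split; mk symE].
Qed.

Lemma six_three R S U' W' C C' : six E V ([set u] :|: R) U' ([set v] :|: S) W' C C' ->
  dis [set u] R -> conn E R -> dis [set v] S -> conn E S -> adj E [set u] R -> adj E [set v] S ->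
  alo3 u W' C C' -> alo3 v U' C C' -> adj E R [set v] -> adj E [set u] S ->
  ~ star E V u v -> ~ star E V v u -> False.
Proof.
move=> f d cR d' cS uR vS al al' aRv auS n1 n2.
have Evu : E v u by rewrite symE.
have f' : six E V ([set v] :|: S) W' ([set u] :|: R) U' C C' by case: f => ? ? ? ?; destr; undis; split; mk symE.
have st : adj E R ([set v] :|: S) -> adj E R W' -> adj E R C -> adj E R C' -> False.
  by move=> *; apply: n1; apply: (six_star f); rewrite ?setU11.
have st' : adj E S ([set u] :|: R) -> adj E S U' -> adj E S C -> adj E S C' -> False.
  by move=> *; apply: n2; apply: (six_star f'); rewrite ?setU11.
have aR : adj E R ([set v] :|: S) by apply: adjrUl.
have aS : adj E S ([set u] :|: R) by apply: adjrUl; rewrite (adjC symE).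
case: (f) => c s dd a; rewrite /alo3 in al al'; destr; undis.
have [? ?] : [set u] \subset V /\ R \subset V by apply: subUinv.
have [? ?] : [set v] \subset V /\ S \subset V by apply: subUinv.
have aUV : adj E [set u] [set v] by rewrite adj1P.
have wgu : [\/ wing E u R ([set v] :|: S) W' C C', wing E u R ([set v] :|: S) C W' C' | wing E u R ([set v] :|: S) C' W' C].
  by apply: side_wing; [split; atac symE|split; done|done|exact: st].
have wgv : [\/ wing E v S ([set u] :|: R) U' C C', wing E v S ([set u] :|: R) C U' C' | wing E v S ([set u] :|: R) C' U' C].
  by apply: side_wing; [split; atac symE|split; done|done|exact: st'].
rewrite /wing in wgu wgv.
case: (boolP (adj E R S)) => aRS.
  have [|_ [_ [_ [_ [s _]]]]] := simple5 (X1 := [set u]) (X2 := [set v]) (X3 := R) (X4 := S) (X5 := (W' :|: C) :|: (U' :|: C')) symE rig _ (set11 u) (set11 v) (@fsimple11 _ E u v).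
    by case: wgu => wgu; destr; case: wgv => wgv; destr; split; mk symE.
  by apply: (@two_sing _ E (W' :|: C) (U' :|: C')) => //; [ctac symE|ctac symE|dtac].
have go h h' : dis R h -> conn E h -> five E V [set u] [set v] (R :|: h) S ((W' :|: h') :|: U') -> False.
  move=> dRX cX hh; have [_ [_ [s _]]] := simple5 symE rig hh (set11 u) (set11 v) (@fsimple11 _ E u v).
  exact: (two_sing cR cX dRX s).
(* Here the nonadjacent sets [R] and [S] become an antipodal pair of another octahedron, in which
   {u} and {v} are classes. *)
have oct h h' : conn E h' -> dis h' U' -> conn E U' -> six E V [set u] (h' :|: U') [set v] (h :|: W') R S -> False.
  move=> ch dh cU hh; have [_ [_ [s _]]] := simple6 symE rig hh (set11 u) (set11 v) (@fsimple11 _ E u v).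
  exact: (two_sing ch cU dh s).
case: wgu => wgu; destr; case: wgv => wgv; destr;
first [by apply: (go C C') => //; split; mk symE | by apply: (go C' C) => //; split; mk symE
  | by apply: (oct C C') => //; first [dtac|split; mk symE] | by apply: (oct C' C) => //; first [dtac|split; mk symE]].
Qed.

End Pair.

End Cases.

(** * Minor models with smallest classes of the two ends *)

Section MinimalModel.
Variables (T : finType) (E : rel T).
Hypotheses (symE : symmetric E) (irrE : forall x, ~~ E x x).
Variables (V : {set T}).
Hypothesis aV : atom E V.
Implicit Types (A C D K L P Q R S U W X Y : {set T}).

Definition classes u v U W : Prop := [/\ u \in U, v \in W &
  exists (I : finType) (F : {set I}) a B i j, model E V F a B /\
    [/\ i \in F, j \in F, j != i, j != a i & B i = U /\ B j = W]].

Lemma model_aC (I : finType) (F : {set I}) a B i j : model E V F a B -> i \in F -> j \in F -> j != a i -> i != a j.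
Proof. by move=> m iF jF; apply: contraNneq => ->; rewrite (model_aK m). Qed.

Lemma classes_sym u v U W : classes u v U W -> classes v u W U.
Proof.
move=> [uU vW [I [F [a [B [i [j [m [iF jF ji jai [eU eW]]]]]]]]]]; split=> //.
exists I, F, a, B, j, i; split=> //; split=> //; first by rewrite eq_sym.
exact: (model_aC m).
Qed.

(** If the two classes are antipodal, the edge [uv] joins them and merging two other classes gives a
    K_5. *)
Lemma sepm_classes u v : E u v -> sepm E V u v -> exists U W, classes u v U W.
Proof.
move=> Euv [I [F [a [B [i [j [m [iF jF ij uB vB]]]]]]]].
case: (eqVneq j (a i)) => [e|ja]; last first.
  exists (B i), (B j); split=> //; exists I, F, a, B, i, j; split=> //; split=> //; by rewrite eq_sym.
have aii : a i != i by rewrite -e eq_sym.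
have [_ _ cF _] := m; case: cF => [[_ h]|[c6 nea]]; first by move: aii; rewrite h // eqxx.
have [j1 [j1F j1i j1ai]] : exists j1, [/\ j1 \in F, j1 != i & j1 != a i].
  move: c6; rewrite (cardsD1 i) iF (cardsD1 (a i)) !inE aii (model_aF m iF) !add1n => -[c4].
  have /set0Pn [x] : F :\ i :\ a i != set0 by rewrite -card_gt0 c4.
  by rewrite !inE => /and3P [? ? ?]; exists x.
have [j2 [j2F j2n all]] := model_enum6 m (ex_intro2 _ _ i iF (elimN eqP aii)) iF j1F j1i j1ai.
have adi : adj E (B i) (B (a i)) by apply/adjP; exists u, v; rewrite -e.
have m' := model_merge symE m iF aii j1F j2F j1i j1ai j2n adi.
have [j2i j2ai] : j2 != i /\ j2 != a i by move: j2n; rewrite !inE !negb_or => /and4P [].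
have ij1 : i != j1 by rewrite eq_sym.
have jj1 : j != j1 by rewrite e eq_sym.
exists (B i), (B j); split=> //.
exists I, (F :\ j2), id, (upd B j1 (B j1 :|: B j2)), i, j; split=> //; split.
- by rewrite !inE iF eq_sym j2i.
- by rewrite !inE jF e eq_sym j2ai.
- by rewrite eq_sym.
- by rewrite /= eq_sym.
- by rewrite !upd_other.
Qed.

Definition min_classes u v U W : Prop := classes u v U W /\
  forall U' W', classes u v U' W' -> #|U| + #|W| <= #|U'| + #|W'|.

Lemma min_classes_sym u v U W : min_classes u v U W -> min_classes v u W U.
Proof.
move=> [c m]; split; first exact: classes_sym.
by move=> U' W' /classes_sym /m; rewrite addnC (addnC #|W'|).
Qed.

Lemma min_classes_ex u v : (exists U W, classes u v U W) -> exists U W, min_classes u v U W.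
Proof.
move=> [U [W c]]; move: {2}(#|U| + #|W|) (leqnn (#|U| + #|W|)) => n.
elim: n U W c => [|n IH] U W c h.
  by exists U, W; split=> // U' W' _; apply: leq_trans h _.
case: (classic (exists U' W', classes u v U' W' /\ #|U'| + #|W'| < #|U| + #|W|)) => [[U' [W' [c' lt]]]|nex].
  by apply: (IH U' W' c'); rewrite -ltnS; apply: leq_trans lt h.
exists U, W; split=> // U' W' c'; rewrite leqNgt; apply/negP => lt; apply: nex; by exists U', W'.
Qed.

Definition one_side (I : finType) (F : {set I}) (a : I -> I) (B : I -> {set T}) u U i j : Prop :=
  U = [set u] \/ exists R, [/\ U = [set u] :|: R, dis [set u] R, conn E R, adj E [set u] R &
    forall k l, k \in F -> l \in F -> k != l -> k \notin [:: i; a i; j] -> l \notin [:: i; a i; j] ->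
      ~~ adj E [set u] (B k) \/ ~~ adj E [set u] (B l)].

(** Each component of [U :\ u] is indispensable: without it the class misses two of the three other
    required classes. Two such components are impossible, and for the single one the statement says
    what {u} misses. *)
Lemma min_one_side u v U W (I : finType) (F : {set I}) a B i j : E u v -> min_classes u v U W ->
  model E V F a B -> i \in F -> j \in F -> j != i -> j != a i -> B i = U -> B j = W ->
  one_side F a B u U i j.
Proof.
move=> Euv [[uU vW _] mn] m iF jF ji jai eU eW.
have [[cB sB dB] aF cF adjF] := m.
have cU : conn E U by rewrite -eU; apply: cB.
pose O := [set k in F | k \notin [:: i; a i; j]].
have cO : #|O| <= 3.
  have aiF := model_aF m iF.
  case: cF => [[c5 ida]|[c6 nea]].
    have s : O \subset F :\ i :\ j.
      by apply/subsetP => k; rewrite !inE ida // !negb_or => /and4P [kF ki _ kj]; rewrite kj ki kF.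
    apply: leq_trans (subset_leq_card s) _.
    by move: c5; rewrite (cardsD1 i) iF (cardsD1 j) !inE ji jF !add1n => -[->].
  have s : O \subset F :\ i :\ a i :\ j.
    by apply/subsetP => k; rewrite !inE !negb_or => /and4P [kF ki kai kj]; rewrite kj ki kF kai.
  apply: leq_trans (subset_leq_card s) _.
  have ai : a i != i by apply/eqP/nea.
  by move: c6; rewrite (cardsD1 i) iF (cardsD1 (a i)) !inE ai aiF (cardsD1 j) !inE ji jai jF !add1n => -[->].
(* Two pairs in a set of at most three elements intersect. *)
have pig k l k' l' : k \in O -> l \in O -> k' \in O -> l' \in O -> k != l -> k' != l' ->
    k' \in [:: k; l] \/ l' \in [:: k; l].
  move=> kO lO k'O l'O kl kl'; case: (boolP (k' \in [:: k; l])) => h; [by left|right].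
  apply: contraT => h'; exfalso; move: h h'; rewrite !inE !negb_or => /andP [h1 h2] /andP [h3 h4].
  have s : [set k'; l'; k; l] \subset O.
    by apply/subsetP => z; rewrite !(in_setU, in_set1) => /orP [/orP [/orP [] |]|] /eqP ->.
  have := leq_trans (subset_leq_card s) cO; rewrite -setUA cardsU !cards2 kl kl'.
  suff -> : [set k'; l'] :&: [set k; l] = set0 by rewrite cards0.
  apply/setP => z; rewrite !inE; apply/negbTE/negP => /andP [/orP [] /eqP -> /orP [] e].
  - by rewrite e in h1.
  - by rewrite e in h2.
  - by rewrite e in h3.
  - by rewrite e in h4.
(* If the rest [X] of the class missed at most one class of [O], the component could be moved to
   that class, or dropped, against minimality. *)
have key r : r \in U -> r != u -> exists k l, [/\ k \in O, l \in O, k != l,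
    ~~ adj E (U :\: cmp E (U :\ u) r) (B k) & ~~ adj E (U :\: cmp E (U :\ u) r) (B l)].
  move=> rU ru; set D := cmp E (U :\ u) r; set X := U :\: D.
  have subD y : y \in D -> y != u /\ y \in U by move/(subsetP (cmp_sub _ _ _)); rewrite !inE => /andP [].
  have rD : r \in D by apply: cmp_refl; rewrite !inE ru.
  have uX : u \in X by rewrite inE uU andbT; apply/negP => /subD []; rewrite eqxx.
  have cX : conn E X by apply: conn_minus_comp.
  have cD : conn E D by apply: conn_cmp => //; rewrite !inE ru.
  have sX : X \subset U by apply: subsetDl.
  have sD : D \subset U by apply/subsetP => y /subD [].
  have dXD z : z \in X -> z \in D -> False by rewrite inE => /andP [/negbTE ->].
  have aXD : adj E X D.
    have [||y [x [_ yD xU xD Exy]]] := conn_cut (L := D) cU; [by exists r| |].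
      by exists u => //; apply/negP => /subD []; rewrite eqxx.
    by apply/adjP; exists x, y; rewrite inE xD xU symE.
  have ltX : #|X| < #|U| by apply: proper_card; apply/properP; split=> //; exists r; rewrite // inE rD.
  have aXj : adj E X (B j) by apply/adjP; exists u, v; rewrite eW.
  have small B' : model E V F a B' -> B' i = X -> B' j = W -> False.
    move=> m' e1 e2; have : classes u v X W by split=> //; exists I, F, a, B', i, j.
    by move/mn; rewrite leq_add2r leqNgt ltX.
  apply: NNPP => nex.
  have one k l : k \in O -> l \in O -> ~~ adj E X (B k) -> ~~ adj E X (B l) -> k = l.
    move=> kO lO nk nl; apply/eqP; apply: contraT => kl; case: nex; by exists k, l.
  have inO k : k \in F -> k != i -> k != a i -> k != j -> k \in O by move=> kF ki ka kj; rewrite !inE !negb_or kF ki ka kj.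
  case: (classic (exists2 g, g \in O & ~~ adj E X (B g))) => [[g gO ng]|ng].
    have := gO; rewrite !inE !negb_or => /and4P [gF gi gai gj].
    apply: (small (upd (upd B g (B g :|: D)) i X)); last first.
    - by rewrite upd_other // upd_other // eq_sym.
    - by rewrite upd_same.
    apply: (model_move symE m) => //; rewrite ?eU //.
    + have /adjP [x [y [xU yB Exy]]] := adjF i g iF gF gi gai; rewrite eU in xU.
      apply/adjP; exists x, y; split=> //; apply: contraT => xD; case/negP: ng; apply/adjP; exists x, y.
      by rewrite inE xD.
    + move=> k kF ki ka kg; case: (eqVneq k j) => [-> //|kj]; apply: contraT => nk.
      by move: kg; rewrite (one k g) ?eqxx //; apply: inO.
  apply: (small (upd B i X)); last first.
  - by rewrite upd_other.
  - by rewrite upd_same.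
  apply: (model_repl symE (i := i) m) => //.
  + apply: fam_upd => //; first by rewrite -eU in sX; apply: subset_trans sX (sB i iF).
    move=> k x kF ki xX xk; move: ki; rewrite (dB k i x) ?eqxx // eU; exact: (subsetP sX).
  + by move=> k kF ki; rewrite upd_other.
  + move=> k kF ki ka; rewrite upd_same upd_other //; case: (eqVneq k j) => [-> //|kj].
    by apply: contraT => nk; case: ng; exists k => //; apply: inO.
case: (set_0Vmem (U :\ u)) => [e|[r rR]].
  by left; rewrite -(setD1K uU) e setU0.
right; exists (U :\ u).
have := rR; rewrite !inE => /andP [ru rU].
have [k [l [kO lO kl nk nl]]] := key r rU ru.
set D := cmp E (U :\ u) r in nk nl.
have uX r' : u \in U :\: cmp E (U :\ u) r'.
  by rewrite inE uU andbT; apply/negP => /(subsetP (cmp_sub _ _ _)); rewrite !inE eqxx.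
have nu r' k' : ~~ adj E (U :\: cmp E (U :\ u) r') (B k') -> ~~ adj E [set u] (B k').
  by apply: adjN; rewrite ?sub1set.
(* For two different components, some class of [O] would be missed by both complements, whose union
   is all of [U]. *)
have eD : D = U :\ u.
  apply/eqP; rewrite eqEsubset cmp_sub /=; apply/subsetP => r' r'R; apply: contraT => r'D.
  have := r'R; rewrite !inE => /andP [r'u r'U].
  have [k' [l' [k'O l'O kl' nk' nl']]] := key r' r'U r'u.
  have dD z : z \in D -> z \notin cmp E (U :\ u) r'.
    move=> zD; apply/negP => zD'; case/negP: r'D; rewrite /D -(cmp_eq symE zD) (cmp_eq symE zD'); exact: cmp_refl.
  have no o : o \in O -> ~~ adj E (U :\: D) (B o) -> ~~ adj E (U :\: cmp E (U :\ u) r') (B o) -> False.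
    rewrite !inE !negb_or => /and4P [oF oi oai _] n1 n2.
    have /adjP [x [y [xU yB Exy]]] := adjF i o iF oF oi oai; rewrite eU in xU.
    case xD : (x \in D); last by case/negP: n1; apply/adjP; exists x, y; rewrite inE xD.
    by case/negP: n2; apply/adjP; exists x, y; rewrite inE xU dD.
  case: (pig k l k' l' kO lO k'O l'O kl kl'); rewrite !inE => /orP [] /eqP e.
  - by exfalso; apply: (no k') => //; rewrite e.
  - by exfalso; apply: (no k') => //; rewrite e.
  - by exfalso; apply: (no l') => //; rewrite e.
  - by exfalso; apply: (no l') => //; rewrite e.
have cR : conn E (U :\ u) by rewrite -eD; apply: conn_cmp.
have d : dis [set u] (U :\ u) by apply: dis1; rewrite !inE eqxx.
split=> //.
- by rewrite (setD1K uU).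
- have [||x [y [xU /set1P ex yU yu Exy]]] := conn_cut (L := [set u]) cU; [by exists u; rewrite ?inE|by exists r; rewrite ?inE|].
  by apply/adjP; exists u, y; rewrite !inE eqxx yU -ex; split=> //; rewrite inE in yu; rewrite andbT ex.
- move=> k' l' k'F l'F kl' k'n l'n.
  have k'O : k' \in O by rewrite inE k'F.
  have l'O : l' \in O by rewrite inE l'F.
  case: (pig k l k' l' kO lO k'O l'O kl kl'); rewrite !inE => /orP [] /eqP e.
  - by left; rewrite e; apply: nu nk.
  - by left; rewrite e; apply: nu nl.
  - by right; rewrite e; apply: nu nk.
  - by right; rewrite e; apply: nu nl.
Qed.

Lemma base_or_star u v : E u v -> rigid E V u v -> sepm E V u v ->
  (baseK5 E V u v \/ baseK222 E V u v) \/ (step E V u v \/ step E V v u) \/ (star E V u v \/ star E V v u).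
Proof.
move=> Euv rig sV; have Evu : E v u by rewrite symE.
have rig' := rigid_sym symE rig.
case: (classic (star E V u v)) => [s|nst1]; first by right; right; left.
case: (classic (star E V v u)) => [s|nst2]; first by right; right; right.
have [U [W mc]] := min_classes_ex (sepm_classes Euv sV).
have mc' := min_classes_sym mc; have [[uU vW [I [F [a [B [i [j [m [iF jF ji jai [eU eW]]]]]]]]]] mn] := mc.
(* A K_5 model with the same two classes is preferred; when there is none, all antipodal pairs of an
   octahedron model are nonadjacent ([exact3]). *)
case: (classic (exists A B C, five E V U W A B C)) => [[A [B' [C f0]]]|n5].
  have m5 := five_model symE f0; set B5 := (fun t : 'I_5 => _) in m5.
  pose o k (h : k < 5) := Ordinal h.
  have sd := min_one_side Euv mc m5 (i := @o 0 isT) (j := @o 1 isT) (in_setT _) (in_setT _) isT isT erefl erefl.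
  have sd' := min_one_side Evu mc' m5 (i := @o 1 isT) (j := @o 0 isT) (in_setT _) (in_setT _) isT isT erefl erefl.
  have alo x H : (forall k l, k \in [set: 'I_5] -> l \in [set: 'I_5] -> k != l -> k \notin [:: @o 0 isT; @o 1 isT] -> l \notin [:: @o 0 isT; @o 1 isT] ->
      ~~ adj E [set x] (B5 k) \/ ~~ adj E [set x] (B5 l)) -> H = x -> alo3 E x A B' C.
    move=> h _; split; [exact: (h (@o 2 isT) (@o 3 isT))|exact: (h (@o 2 isT) (@o 4 isT))|exact: (h (@o 3 isT) (@o 4 isT))].
  have {sd} sd : U = [set u] \/ exists R, [/\ U = [set u] :|: R, dis [set u] R, conn E R, adj E [set u] R & alo3 E u A B' C].
    case: sd => [|[R [h1 h2 h3 h4 h5]]]; [by left|right; exists R; split=> //; apply: (alo u u) => // k l kF lF kl kn ln].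
    by apply: h5 => //; [move: kn|move: ln]; rewrite !inE !negb_or => /andP [-> ->].
  have {sd'} sd' : W = [set v] \/ exists S, [/\ W = [set v] :|: S, dis [set v] S, conn E S, adj E [set v] S & alo3 E v A B' C].
    case: sd' => [|[R [h1 h2 h3 h4 h5]]]; [by left|right; exists R; split=> //; apply: (alo v v) => // k l kF lF kl kn ln].
    by apply: h5 => //; [move: kn|move: ln]; rewrite !inE !negb_or => /andP [-> ->].
  have f1 : five E V W U A B' C by case: (f0) => ? ? ? ?; destr; split; mk symE.
  case: sd => [e1|[R [e1 d1 c1 a1 al1]]]; case: sd' => [e2|[S [e2 d2 c2 a2 al2]]]; rewrite {}e1 {}e2 in f0 f1.
  - by left; left; apply: (five_base symE Euv rig aV f0).
  - by right; left; right; apply: (five_one symE irrE Evu rig' f1).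
  - by right; left; left; apply: (five_one symE irrE Euv rig f0).
  - exfalso; case: (boolP (adj E [set u] S)) => auS; last by apply: (five_two symE Euv rig f1 d1 c1 d2 c2 a1 al1 auS).
    case: (boolP (adj E R [set v])) => aRv; last by apply: (five_two symE Evu rig' f0 d2 c2 d1 c1 a2 al2); rewrite // (adjC symE).
    exact: (five_three symE Euv rig f0 d1 c1 d2 c2 a1 a2 al1 al2 aRv auS).
have n5' (G : {set I}) b (C : I -> {set T}) : model E V G b C -> #|G| = 5 -> (forall i, i \in G -> b i = i) -> i \in G -> j \in G -> C i = U -> C j = W -> False.
  move=> mG c5 idb iG jG e1 e2; apply: n5.
  have ij : i != j by rewrite eq_sym.
  have [k [l [n [_ f]]]] := model_to_five mG c5 idb iG jG ij.
  by exists (C k), (C l), (C n); rewrite -e1 -e2.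
have [fB aF cF adjF] := m.
case: (cF) => [[c5 ida]|[c6 nea]]; first by case: (n5' F a B).
have exn : exists2 x, x \in F & a x <> x by exists i => //; apply: nea.
have [k [[kF kn all] f0]] := model_to_six m exn iF jF ji jai.
have sd := min_one_side Euv mc m iF jF ji jai eU eW.
have ij : i != j by rewrite eq_sym.
have iaj := model_aC m iF jF jai.
have sd' := min_one_side Evu mc' m jF iF ij iaj eW eU.
have aiF := model_aF m iF; have ajF := model_aF m jF; have akF := model_aF m kF.
have ne x : x \in F -> a x != x by move=> xF; apply/eqP/nea.
have nea' x y : x \in F -> y \in F -> x != y -> a x != a y.
  by move=> xF yF; apply: contraNneq => e; apply/eqP; apply: (model_a_inj m).
have ney x y : x \in F -> y \in F -> x != a y -> a x != y.
  by move=> xF yF; apply: contraNneq => <-; rewrite (model_aK m).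
move: kn; rewrite !inE !negb_or => /and4P [ki kai kj kaj].
have [kai' kaj'] : a k != i /\ a k != j by split; apply: ney.
have alo x : (forall p q, p \in F -> q \in F -> p != q -> p \notin [:: i; a i; j] -> q \notin [:: i; a i; j] ->
      ~~ adj E [set x] (B p) \/ ~~ adj E [set x] (B q)) -> alo3 E x (B (a j)) (B k) (B (a k)).
  have [h1 h2 h3] : [/\ a j \notin [:: i; a i; j], k \notin [:: i; a i; j] & a k \notin [:: i; a i; j]].
    by rewrite !inE !negb_or ki kai kj kai' kaj' !nea' // (eq_sym (a j) i) iaj ne.
  by move=> h; split; apply: h; rewrite // 1?eq_sym ?ne // nea' // eq_sym.
have alo' x : (forall p q, p \in F -> q \in F -> p != q -> p \notin [:: j; a j; i] -> q \notin [:: j; a j; i] ->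
      ~~ adj E [set x] (B p) \/ ~~ adj E [set x] (B q)) -> alo3 E x (B (a i)) (B k) (B (a k)).
  have [h1 h2 h3] : [/\ a i \notin [:: j; a j; i], k \notin [:: j; a j; i] & a k \notin [:: j; a j; i]].
    by rewrite !inE !negb_or ki kaj kj kai' kaj' !nea' // (eq_sym (a i) j) jai ne.
  by move=> h; split; apply: h; rewrite // 1?eq_sym ?ne // nea' // eq_sym.
rewrite eU eW in f0.
have exact3 : [/\ ~~ adj E U (B (a i)), ~~ adj E W (B (a j)) & ~~ adj E (B k) (B (a k))].
  case: (f0) => c s d ad; destr.
  split; apply/negP => h; apply: n5.
  - by exists (B (a i)), (B k), (B (a j) :|: B (a k)); split; mk symE.
  - by exists (B (a j)), (B k), (B (a i) :|: B (a k)); split; mk symE.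
  - by exists (B k), (B (a k)), (B (a i) :|: B (a j)); split; mk symE.
have f1 : six E V W (B (a j)) U (B (a i)) (B k) (B (a k)) by case: (f0) => ? ? ? ?; destr; split; mk symE.
have exact3' : [/\ ~~ adj E W (B (a j)), ~~ adj E U (B (a i)) & ~~ adj E (B k) (B (a k))] by case: exact3.
case: sd => [e1|[R [e1 d1 c1 a1 al1]]]; case: sd' => [e2|[S [e2 d2 c2 a2 al2]]]; rewrite {}e1 {}e2 in f0 f1 exact3 exact3'.
- by left; right; apply: (six_base symE Euv rig aV f0).
- by right; left; right; apply: (six_one symE irrE Evu rig' f1 d2 c2 a2 exact3' (alo' _ al2)).
- by right; left; left; apply: (six_one symE irrE Euv rig f0 d1 c1 a1 exact3 (alo _ al1)).
- exfalso; case: (boolP (adj E [set u] S)) => auS.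
    case: (boolP (adj E R [set v])) => aRv.
      exact: (six_three symE Euv rig f0 d1 c1 d2 c2 a1 a2 (alo _ al1) (alo' _ al2) aRv auS).
    by apply: (six_two symE Evu rig' f0 d2 c2 d1 c1 a2 exact3' (alo' _ al2)); rewrite // (adjC symE).
  exact: (six_two symE Euv rig f1 d1 c1 d2 c2 a1 exact3 (alo _ al1) auS).
Qed.

End MinimalModel.

Lemma pick_in (T : finType) (S : {set T}) : 0 < #|S| -> exists x, x \in S.
Proof. by rewrite card_gt0 => /set0Pn. Qed.

Lemma pick3 (T : finType) (S : {set T}) : 3 <= #|S| ->
  exists a b c, [/\ a \in S, b \in S, c \in S & [/\ a != b, a != c & b != c]].
Proof.
move=> h; have [|a aS] := @pick_in _ S; first exact: leq_trans h.
move: h; rewrite (cardsD1 a) aS add1n ltnS => h.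
have [|b] := @pick_in _ (S :\ a); first exact: leq_trans h.
rewrite !inE => /andP [ba bS]; move: h; rewrite (cardsD1 b) !inE ba bS add1n ltnS => h.
have [c] := @pick_in _ (S :\ a :\ b) h; rewrite !inE => /and3P [cb ca cS].
by exists a, b, c; split=> //; rewrite (eq_sym a b) (eq_sym a c) (eq_sym b c).
Qed.

Section Extra.
Variables (T : finType) (E : rel T).
Hypotheses (symE : symmetric E).
Implicit Types (A C D K L P Q R S U W X Y : {set T}).

Lemma sepm_add S p r w : sepm E S p r -> E r w -> w \notin S -> sepm E (w |: S) p w.
Proof.
move=> [I [F [a [B [i [j [m [iF jF ij pB rB]]]]]]]] Erw wS.
have [[cB sB dB] aF cF adjF] := m.
exists I, F, a, (upd B j (B j :|: [set w])), i, j; split; last first.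
  by split; rewrite // ?(upd_other _ _ ij) // upd_same !inE eqxx orbT.
apply: (model_grow (B := B)); first by apply: model_sub m; apply: subsetUr.
  apply: fam_upd.
  - by split=> // k kF; apply: subset_trans (sB k kF) (subsetUr _ _).
  - by apply: (connU symE (cB j jF) (conn1 E w) rB (set11 w)); right.
  - by rewrite subUset sub1set setU11 (subset_trans (sB j jF)) // subsetUr.
  - move=> k x kF kj; rewrite !inE => /orP [xj xk|/eqP -> wk].
      by move: kj; rewrite (dB k j x) ?eqxx.
    by case/negP: wS; apply: (subsetP (sB k kF)).
by move=> k kF; rewrite /upd; case: eqP => [->|//]; rewrite subsetUl.
Qed.

Lemma model_lift V (I J : finType) (B : I -> {set T}) (S : {set I}) (F : {set J}) a (M : J -> {set I}) :
  fam E V S B -> model (QE E B) S F a M -> model E V F a (fun j => \bigcup_(i in M j) B i).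
Proof.
move=> fB [fM aF cF adjF]; split=> //; first exact: (fam_bigcup symE fB).
move=> k' l' k'F l'F n1 n2.
have /adjP [x [y [xM yM /andP [_ /adjP [x' [y' [x'B y'B Exy]]]]]]] := adjF k' l' k'F l'F n1 n2.
by apply/adjP; exists x', y'; split=> //; apply/bigcupP; [exists x|exists y].
Qed.

Lemma sepm_card S p q : sepm E S p q -> 5 <= #|S|.
Proof.
move=> [I [F [a [B [i [j [[[cB sB dB] aF cF _] _]]]]]]].
have h : 5 <= #|F| by case: cF => -[->].
apply: leq_trans h _; pose f k := odflt p [pick x in B k].
have fB k : k \in F -> f k \in B k.
  move=> kF; rewrite /f; case: pickP => [x //|nx]; have [[x xB] _] := cB k kF.
  by move: (nx x); rewrite xB.
have inj : {in F &, injective f}.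
  by move=> k l kF lF e; apply: (dB k l (f k)); rewrite ?fB // e fB.
rewrite -(card_in_imset inj); apply: subset_leq_card; apply/subsetP => x /imsetP [k kF ->].
exact: (subsetP (sB k kF) _ (fB k kF)).
Qed.

End Extra.

(** * A maximal atom containing one end of the edge *)

Section Proj.
Variables (T : finType) (E : rel T).
Hypotheses (symE : symmetric E) (irrE : forall x, ~~ E x x).
Variables (V : {set T}) (u v : T).
Hypotheses (aV : atom E V) (Euv : E u v) (rig : rigid E V u v).
Implicit Types (A C D K L P Q R S U W X Y : {set T}).

Section Family.
Variables (H A : {set T}) (f : T -> T) (Q : {set T}).
Hypotheses (hA : hull E H A) (aA : atom E A) (HV : H \subset V) (uA : u \in A).
Hypotheses (fH : forall a, a \in A -> f a \in H /\ a \in pr E H A (f a)) (fu : f u = u).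
(** The component that [a] absorbs, empty when [f a] is in [A]. *)
Let L a := cmp E (H :\: A) (f a).
Hypotheses (dL : forall a b, a \in A -> b \in A -> a != b -> dis (L a) (L b)).
Hypotheses (cQ : conn E Q) (QV : Q \subset V) (vQ : v \in Q) (dQA : dis Q A) (dQL : forall a, a \in A -> dis Q (L a)).
Hypotheses (uQ : forall x, x \in Q -> E u x -> x = v).

Let C a := a |: L a.

Let subL a x : x \in L a -> x \in H /\ x \notin A.
Proof. by move/(subsetP (cmp_sub _ _ _)) => /setDP. Qed.

Lemma L_triv a : a \in A -> f a \in A -> L a = set0.
Proof.
move=> aA' fA; apply/setP => x; rewrite in_set0; apply/negbTE/negP => /cmp_in; by rewrite inE fA.
Qed.

Lemma L_nb a : a \in A -> f a \notin A -> a \in nb E A (L a) /\ conn E (L a).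
Proof.
move=> aA' fA; have [h1 h2] := fH aA'; rewrite -(prE E H fA); split=> //.
by apply: conn_cmp; rewrite // inE fA.
Qed.

Lemma C_conn a : a \in A -> conn E (C a).
Proof.
move=> aA'; case fA : (f a \in A); first by rewrite /C (L_triv aA' fA) setU0; apply: conn1.
have [/nbP [x [xL _ _ Exa]] cL] := L_nb aA' (negbT fA).
by apply: (connU symE (conn1 E a) cL (set11 a) xL); right; rewrite symE.
Qed.

(** The component absorbed by [a] sees in [A] only the clique to which it attaches, and [a] belongs
    to that clique. *)
Lemma C_adj a b : a \in A -> b \in A -> a != b -> adj E (C a) (C b) = E a b.
Proof.
move=> aA' bA ab; apply/adjP/idP => [[x [y [xC yC Exy]]]|Eab]; last first.
  by exists a, b; rewrite !inE !eqxx.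
have nbL c z w : c \in A -> z \in L c -> w \in A -> E z w -> w != c -> E c w.
  move=> cA zL yA Ezy yc; have fA : f c \notin A.
    by apply/negP => fA; move: zL; rewrite (L_triv cA fA) inE.
  have [h1 h2] := fH cA; apply: (pr_clique hA h1) => //; last by rewrite eq_sym.
  rewrite prE //; apply/nbP; exists z; split=> //; apply/negP => /subL []; by rewrite yA.
move: xC yC => /setU1P [ex|xL] /setU1P [ey|yL].
- by rewrite -ex -ey.
- rewrite symE; apply: (nbL b y a) => //; by rewrite symE -ex.
- by apply: (nbL a x b) => //; [rewrite -ey|rewrite eq_sym].
- exfalso; have [yH yA] := subL yL; apply: (dL aA' bA ab (x := y)) => //.
  by apply: cmp_closed xL _ Exy; rewrite inE yA.
Qed.

(* Contracting the components into points of the atom leaves the atom unchanged, so that only [Q]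
   is new: it attaches to a nonadjacent pair. *)
Lemma proj_rig p q r : p \in A -> q \in A -> p != q -> ~~ E p q ->
  adj E (C p) Q -> adj E (C q) Q -> r \in A -> adj E (C r) Q -> sepm E A u r ->
  sing Q /\ forall a, a \in A -> L a = set0.
Proof.
move=> pA qA pq npq aCp aCq rA aCr sur.
have vA : v \notin A by apply/negP => vA; apply: (dQA vQ vA).
pose B s := if s == v then Q else C s.
have BA s : s \in A -> B s = C s by rewrite /B; case: eqP => // -> h; rewrite h in vA.
have Bv : B v = Q by rewrite /B eqxx.
have fB : fam E V (v |: A) B.
  split=> [s|s|s t x]; rewrite ?inE.
  - by case/orP => [/eqP ->|sA]; rewrite ?Bv // BA //; apply: C_conn.
  - case/orP => [/eqP ->|sA]; rewrite ?Bv // BA // subUset sub1set; apply/andP; split.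
      by apply: (subsetP HV); case: hA => h _; apply: (subsetP h).
    by apply/subsetP => x /subL [xH _]; apply: (subsetP HV).
  - have dQC a : a \in A -> x \in Q -> x \in C a -> False.
      move=> aA' xQ /setU1P [e|xL]; last exact: (dQL aA' xQ xL).
      by apply: (dQA xQ); rewrite e.
    case/orP => [/eqP ->|sA] /orP [/eqP ->|tA]; rewrite ?Bv ?BA //.
    + by move=> h1 h2; case: (dQC t).
    + by move=> h1 h2; case: (dQC s).
    + move=> h1 h2; apply/eqP; apply: contraT => st; exfalso.
      case/setU1P: h1 => [e|h1]; case/setU1P: h2 => [e'|h2].
      * by move: st; rewrite -e -e' eqxx.
      * by have [_] := subL h2; rewrite e sA.
      * by have [_] := subL h1; rewrite e' tA.
      * exact: (dL sA tA st h1 h2).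
set N := QE E B; have symN : symmetric N := QE_sym symE B.
have eN : {in A &, forall a b, E a b = N a b}.
  move=> a b aA' bA; rewrite /N /QE /= !BA //; case: (eqVneq a b) => [->|ab] /=; first exact: negbTE.
  by rewrite C_adj.
have Nv a : a \in A -> adj E (C a) Q -> N v a.
  move=> aA' h; rewrite symN /N /QE /= Bv BA // h andbT; apply: contraNneq vA => <-; done.
have aN : atom N A by apply: atom_ext aA.
have aN' : atom N (v |: A).
  by apply: (atom_attach symN (p := p) (q := q) aN) => //; [rewrite -eN|exact: Nv|exact: Nv].
have sN : sepm N (v |: A) u v.
  apply: (sepm_add symN (r := r)) => //; last by rewrite symN Nv.
  by apply: sepm_mono sur => a b aA' bA; rewrite eN.
have uv : u != v by apply: contraNneq vA => <-.
have Lu : L u = set0 by apply: L_triv; rewrite ?fu.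
have [h1 h2 h3] : [/\ u \in v |: A, v \in v |: A & u \in B u] by rewrite !inE eqxx uA orbT BA // inE set11.
have fs : fsimple E u v (B u) (B v).
  rewrite Bv BA // /C Lu setU0 => x y /set1P -> yQ Exy; by rewrite (uQ yQ Exy).
have all := rig fB h1 h2 uv h3 _ fs aN' sN.
split; first by rewrite -Bv; apply: all; rewrite ?Bv.
move=> a aA'; apply/setP => x; rewrite in_set0; apply/negbTE/negP => xL.
have [_ xA] := subL xL.
have : x = a.
  have aS : a \in v |: A by rewrite !inE aA' orbT.
  by apply: (all _ a aS); rewrite ?Bv // BA //; [apply/setU1P; right|apply: setU11].
by move=> e; move: xA; rewrite e aA'.
Qed.

End Family.

Section Projection.
Variables (P A : {set T}) (z0 y0 : T).
Let H := V :\: P.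
Hypotheses (cP : conn E P) (PV : P \subset V) (vP : v \in P) (uP : forall x, x \in P -> E u x -> x = v).
Hypotheses (mA : maxatom E H A) (uA : u \in A).
Hypotheses (z0H : z0 \in H) (z0P : adj E [set z0] P) (y0r : y0 \in pr E H A z0) (s0 : sepm E A u y0).
Let cm z := cmp E (H :\: A) z.

Let hA : hull E H A. Proof. exact: maxatom_hull. Qed.
Let aA : atom E A. Proof. by case: mA. Qed.
Let AH : A \subset H. Proof. by case: mA. Qed.
Let HV : H \subset V. Proof. exact: subsetDl. Qed.
Let dPH x : x \in P -> x \in H -> False. Proof. by move=> xP; rewrite inE xP. Qed.
Let dPA : dis P A. Proof. by move=> x xP /(subsetP AH); apply: dPH. Qed.
Let subC z x : x \in cm z -> x \in H /\ x \notin A.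
Proof. by move/(subsetP (cmp_sub _ _ _)) => /setDP. Qed.
Let dPC z : dis P (cm z). Proof. by move=> x xP /subC [xH _]; apply: dPH xP xH. Qed.

(* The points of the atom at which [P] attaches, directly or through a component. *)
Let att y : Prop := exists2 z, z \in H & adj E [set z] P /\ y \in pr E H A z.

Let att_adj y z : y \in A -> z \in H -> adj E [set z] P -> y \in pr E H A z -> adj E (y |: cm z) P.
Proof.
move=> yA zH /adjP [z' [x [/set1P -> xP Ezx]]] yr; apply/adjP; exists z, x; split=> //.
case zA : (z \in A); last by rewrite inE cmp_refl ?orbT // inE zA.
by move: yr; rewrite /pr zA => /set1P ->; rewrite !inE eqxx.
Qed.

Let attA y : att y -> y \in A.
Proof. by move=> [z _ [_ yr]]; apply: (subsetP (pr_sub E H A z)). Qed.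

Let att_u : att u.
Proof.
exists u; first exact: (subsetP AH); split; last by rewrite /pr uA set11.
by apply/adjP; exists u, v; rewrite inE.
Qed.

Let att_y0 : att y0. Proof. by exists z0. Qed.
Let y0A : y0 \in A. Proof. exact: attA. Qed.
Let y0u : y0 != u. Proof. by have [_ _] := sepm_mem s0; rewrite eq_sym. Qed.

Let disc z z' : (exists2 y, y \in pr E H A z & y \notin pr E H A z') -> z \in H -> z' \in H -> z \notin A -> z' \notin A -> dis (cm z) (cm z').
Proof.
move=> [y yz yz'] zH z'H zA z'A x xz xz'; case/negP: yz'.
by rewrite prE // -/(cm z') /cm -(cmp_eq symE xz') (cmp_eq symE xz) -(prE E H zA).
Qed.

(** Two nonadjacent attachments make the quotient with class [P] an atom, so [P] is {v}. A further
    component outside [A] could join the class of [v] if it does not see [u], or else be absorbed by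
    an attachment other than [u]; both contradict rigidity. *)
Lemma proj_open p q : att p -> att q -> p != q -> ~~ E p q -> P = [set v] /\ V = v |: A.
Proof.
move=> ap0 aq0 pq0 npq0.
(* The nonadjacent pair is rechosen so that one of its points is separated from [u]: separation
   passes from [y0] to its neighbours by [sepm_split], and a point not adjacent to [y0] forms the
   pair with [y0] itself. *)
have {ap0 aq0 pq0 npq0} [p1 [q1 [ap aq pq npq [r [ar ru [rpq sr]]]]]] : exists p q, [/\ att p, att q, p != q, ~~ E p q &
    exists r, [/\ att r, r != u & (r = p \/ r = q) /\ sepm E A u r]].
  case: (boolP (E y0 u)) => Ey0u; last first.
    by exists y0, u; split=> //; exists y0; split=> //; split=> //; left.
  have spl t : att t -> t != u -> E y0 t -> sepm E A u t.
    move=> at' tu Ey0t; apply: (sepm_split symE (k := y0)) => //; [exact: sepm_sym|exact: attA|by rewrite eq_sym|].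
    by apply: contraNneq (irrE t) => e; rewrite -{1}e.
  have try0 t t' : att t -> att t' -> t != t' -> ~~ E t t' -> t != u -> exists p q, [/\ att p, att q, p != q, ~~ E p q &
    exists r, [/\ att r, r != u & (r = p \/ r = q) /\ sepm E A u r]].
    move=> att_t att_t' tt' ntt' tu; case: (eqVneq t y0) => [e|ty].
      by exists t, t'; split=> //; exists t; split=> //; split; [left|rewrite e].
    case: (boolP (E y0 t)) => Ey.
      by exists t, t'; split=> //; exists t; split=> //; split; [left|apply: spl].
    by exists y0, t; split; rewrite // 1?eq_sym //; exists y0; split=> //; split; [left|].
  case: (eqVneq p u) => [e|pu]; last exact: (try0 p q).
  by apply: (try0 q p) => //; rewrite 1?eq_sym // 1?symE // -e // eq_sym.
move=> {p q}; rename p1 into p; rename q1 into q.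
have [pA qA rA] : [/\ p \in A, q \in A & r \in A] by split; apply: attA.
have z_of y : att y -> exists z, [/\ z \in H, adj E [set z] P, y \in pr E H A z & (y = u -> z = u)].
  move=> [z zH [zP yr]]; case: (eqVneq y u) => [->|yu]; last by exists z; split=> // e; rewrite e eqxx in yu.
  exists u; split=> //; [exact: (subsetP AH)| |by rewrite /pr uA set11].
  by apply/adjP; exists u, v; rewrite inE.
have [zp [zpH zpP pr_p up]] := z_of p ap; have [zq [zqH zqP pr_q uq]] := z_of q aq.
(* Only [p] and [q] absorb a component, the one through which they reach [P]. *)
pose f a := if a == p then zp else if a == q then zq else a.
have fp : f p = zp by rewrite /f eqxx.
have fq : f q = zq by rewrite /f eq_sym (negbTE pq) eqxx.
have fo a : a != p -> a != q -> f a = a by rewrite /f => /negbTE -> /negbTE ->.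
have fH a : a \in A -> f a \in H /\ a \in pr E H A (f a).
  move=> aA'; case: (eqVneq a p) => [->|ap']; first by rewrite fp.
  case: (eqVneq a q) => [->|aq']; first by rewrite fq.
  by rewrite fo // /pr aA' set11 (subsetP AH).
have fu : f u = u.
  case: (eqVneq u p) => [e|ap']; first by rewrite e fp up.
  case: (eqVneq u q) => [e|aq']; first by rewrite e fq uq.
  exact: fo.
have npr : q \notin pr E H A zp.
  by apply/negP => h; case/negP: npq; apply: (pr_clique hA zpH).
have npr' : p \notin pr E H A zq.
  by apply/negP => h; case/negP: npq; apply: (pr_clique hA zqH).
have emp a : a \in A -> cm a = set0.
  by move=> aA'; apply/setP => x; rewrite in_set0; apply/negbTE/negP => /cmp_in; rewrite inE aA'.
have dpq : dis (cm zp) (cm zq).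
  case zpA : (zp \in A); first by rewrite emp // => x; rewrite inE.
  case zqA : (zq \in A); first by rewrite (emp zq) // => x _; rewrite inE.
  by apply: disc; rewrite ?zpA ?zqA //; exists p.
have dL a b : a \in A -> b \in A -> a != b -> dis (cm (f a)) (cm (f b)).
  move=> aA' bA ab; case: (boolP (f a \in A)) => fa; first by rewrite (emp _ fa) => x; rewrite inE.
  case: (boolP (f b \in A)) => fb; first by rewrite (emp _ fb) => x _; rewrite inE.
  have ina c : c \in A -> f c \notin A -> c = p \/ c = q.
    move=> cA; case: (eqVneq c p) => [|cp]; [by left|case: (eqVneq c q) => [|cq]; [by right|]].
    by rewrite fo // cA.
  case: (ina a aA' fa) => ea; case: (ina b bA fb) => eb; move: ab; rewrite ea eb ?eqxx // fp fq => _ //.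
  exact: disC.
have [aCp aCq] : adj E (p |: cm (f p)) P /\ adj E (q |: cm (f q)) P.
  by rewrite fp fq; split; apply: att_adj.
have aCr : adj E (r |: cm (f r)) P by case: rpq => ->.
have [sP eL] := proj_rig hA aA HV uA fH fu dL cP PV vP dPA (fun a _ => @dPC (f a)) uP pA qA pq npq aCp aCq rA aCr sr.
have eP : P = [set v] by apply/setP => x; rewrite inE; apply/idP/eqP => [xP|-> //]; apply: sP.
split=> //.
have Hv : H = V :\ v by rewrite /H eP.
have Evt t z : t \in A -> z = f t -> adj E (t |: cm z) P -> E v t.
  move=> tA ez; rewrite ez /cm (eL t tA) setU0 eP adj1P symE //.
have [Evp Evq Evr] : [/\ E v p, E v q & E v r].
  by split; [exact: (Evt p (f p))|exact: (Evt q (f q))|exact: (Evt r (f r))].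
have vA : v \notin A by apply/negP => vA; apply: (dPA vP vA).
have vV := subsetP PV _ vP.
apply/eqP; rewrite eqEsubset subUset sub1set vV (subset_trans AH HV) !andbT.
apply/subsetP => z zV; rewrite !inE; apply: contraT; rewrite negb_or => /andP [zv zA]; exfalso.
have zH : z \in H by rewrite Hv !inE zv.
have zC : z \in cm z by apply: cmp_refl; rewrite inE zA.
have cC : conn E (cm z) by apply: conn_cmp; rewrite // inE zA.
have CV : cm z \subset V by apply/subsetP => x /subC [xH _]; apply: (subsetP HV).
have cl x y : x \in cm z -> y \in V -> E x y -> [\/ y \in cm z, y \in pr E H A z | y = v].
  move=> xC yV Exy; case: (eqVneq y v) => [->|yv]; first by apply: Or33.
  have yH : y \in H by rewrite Hv !inE yv.
  case yA : (y \in A); last by apply: Or31; apply: cmp_closed xC _ Exy; rewrite inE yA.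
  apply: Or32; rewrite prE //; apply/nbP; exists x; split=> //; apply/negP => /subC []; by rewrite yA.
case: (classic (exists2 x, x \in cm z & E x v)) => [[x xC Exv]|nCv]; last first.
  have [|||||] := atomE (D := cm z) (K := pr E H A z) (x := z) aV _ _ _ _ vV => //.
  - exact: (pr_clique hA zH).
  - move=> a b aC bV Eab; case: (cl a b aC bV Eab) => h; [by left|by right|].
    by case: nCv; exists a; rewrite // -h.
  - by move/subC => []; rewrite Hv !inE eqxx.
  - by move/(subsetP (pr_sub E H A z)); rewrite (negbTE vA).
have idH a : a \in A -> id a \in H /\ a \in pr E H A (id a).
  by move=> aA'; rewrite /pr aA' set11 (subsetP AH).
have d0 a b : a \in A -> b \in A -> a != b -> dis (cm (id a)) (cm (id b)).
  by move=> aA' _ _ x'; rewrite emp // inE.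
case: (boolP (u \in pr E H A z)) => uz; last first.
  pose Q := v |: cm z.
  have cQ : conn E Q by apply: (connU symE (conn1 E v) cC (set11 v) xC); right; rewrite symE.
  have dQA : dis Q A by move=> y /setUP [/set1P ->|/subC [_ /negP //]] h; rewrite h in vA.
  have dQL a : a \in A -> dis Q (cm (id a)) by move=> aA' y _; rewrite emp // inE.
  have uQ y : y \in Q -> E u y -> y = v.
    move=> /setUP [/set1P //|yC] Euy; case/negP: uz; rewrite prE //; apply/nbP; exists y.
    by rewrite symE; split=> //; apply/negP => /subC []; rewrite uA.
  have adQ t : t \in A -> E v t -> adj E (t |: cm (id t)) Q.
    by move=> tA Evt'; apply/adjP; exists t, v; rewrite !inE !eqxx symE.
  have QV : Q \subset V by rewrite subUset sub1set vV.
  have [sQ _] := proj_rig hA aA HV uA idH (erefl u) d0 cQ QV (setU11 v _) dQA dQL uQ pA qA pq npq (adQ p pA Evp) (adQ q qA Evq) rA (adQ r rA Evr) sr.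
  by case/eqP: zv; apply: sQ; [apply/setU1P; right|apply: setU11].
have [k kr ku] : exists2 k, k \in pr E H A z & k != u.
  apply: NNPP => nk.
  have sub y : y \in pr E H A z -> y = u.
    by move=> yr; apply/eqP; apply: contraT => yu; case: nk; exists y.
  have [|||||] := atomE (D := cm z) (K := [set u; v]) (x := z) aV _ _ _ _ (subsetP (subset_trans AH HV) r rA) => //.
  - by move=> a b /set2P [] -> /set2P [] -> //; rewrite ?eqxx // symE.
  - move=> a b aC bV Eab; case: (cl a b aC bV Eab) => h; [by left|right|right]; rewrite !inE.
      by rewrite (sub b h) eqxx.
    by rewrite h eqxx orbT.
  - by move/subC => []; rewrite rA.
  - by rewrite !inE (negbTE ru) /= => /eqP e; move: rA; rewrite e (negbTE vA).
have kA := subsetP (pr_sub E H A z) _ kr.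
pose g a := if a == k then z else a.
have gk : g k = z by rewrite /g eqxx.
have go a : a != k -> g a = a by rewrite /g => /negbTE ->.
have gH a : a \in A -> g a \in H /\ a \in pr E H A (g a).
  move=> aA'; case: (eqVneq a k) => [->|ak]; first by rewrite gk.
  by rewrite go // /pr aA' set11 (subsetP AH).
have gu : g u = u by rewrite go // eq_sym.
have dg a b : a \in A -> b \in A -> a != b -> dis (cm (g a)) (cm (g b)).
  move=> aA' bA ab; case: (eqVneq a k) => [ea|ak]; last by rewrite (go _ ak) emp // => x'; rewrite inE.
  have bk : b != k by rewrite -ea eq_sym.
  by rewrite (go _ bk) (emp b) // => x' _; rewrite inE.
have adg t : t \in A -> E v t -> adj E (t |: cm (g t)) P.
  by move=> tA Evt'; apply/adjP; exists t, v; rewrite !inE !eqxx symE.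
have [_ eg] := proj_rig hA aA HV uA gH gu dg cP PV vP dPA (fun a _ => @dPC (g a)) uP pA qA pq npq (adg p pA Evp) (adg q qA Evq) rA (adg r rA Evr) sr.
by have := eg k kA; rewrite gk => e; move: zC; rewrite /cm e inE.
Qed.

(** A clique of attachments cannot separate the atom [V], so every point of [A] is an attachment,
    and [A] is a clique with at least five points. Either a component yields a wing, or the absorbed
    components yield a K_5, with a class that is too large. *)
Lemma proj_closed : (forall p q, att p -> att q -> p != q -> E p q) -> False.
Proof.
move=> clq.
have vA : v \notin A by apply/negP => vA; apply: (dPA vP vA).
have vV := subsetP PV _ vP.
have AV := subset_trans AH HV.
have uV := subsetP AV _ uA.
have allA y : y \in A -> att y.
  move=> yA; apply: NNPP => ny.
  pose K := [set x in A | [exists z in H, adj E [set z] P && (x \in pr E H A z)]].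
  have KP x : reflect (att x) (x \in K).
    rewrite inE; apply: (iffP andP) => [[xA /existsP [z /and3P [zH zP xr]]]|ax]; first by exists z.
    split; first exact: attA.
    by case: ax => z zH [zP xr]; apply/existsP; exists z; rewrite zH zP.
  (* The part that the clique of attachments would cut off from [P]. *)
  pose D := [set z in H | (z \notin K) && ((z \in A) || ~~ adj E (cm z) P)].
  have [|||||] := atomE (D := D) (K := K) (x := y) aV _ _ _ _ vV.
  - by apply/subsetP => x; rewrite inE => /andP [xH _]; apply: (subsetP HV).
  - rewrite inE yA (subsetP AH) //= andbT; by apply/negP => /KP.
  - by move=> a b /KP h1 /KP h2; apply: clq.
  - move=> a b; rewrite inE => /and3P [aH aK aD] bV Eab.
    have naP : ~ adj E [set a] P.
      move=> aP; case/orP: aD => [aA'|/negP]; first by case/negP: aK; apply/KP; exists a => //; rewrite /pr aA' set11.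
      case aA' : (a \in A); first by case/negP: aK; apply/KP; exists a => //; rewrite /pr aA' set11.
      by apply; apply: adjS aP => //; rewrite sub1set cmp_refl // inE aA'.
    have bH : b \in H.
      rewrite inE bV andbT; apply/negP => bP; apply: naP; apply/adjP; exists a, b; by rewrite inE.
    case bK : (b \in K); [by right|left].
    rewrite inE bH bK /=; case bA : (b \in A) => //=; apply/negP => /adjP [x [w [xC wP Exw]]].
    case aA' : (a \in A).
      case/negP: aK; apply/KP; exists x; first by case: (subC xC).
      split; first by apply/adjP; exists x, w; rewrite inE.
      have [xH xA] := subC xC; rewrite prE //.
      rewrite (cmp_eq symE xC); apply/nbP; exists b; split; [|done| |by rewrite symE].
        by apply: cmp_refl; rewrite inE bA.
      by apply/negP => /subC []; rewrite aA'.
    rewrite aA' /= in aD; case/negP: aD; apply/adjP; exists x, w; split=> //.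
    suff -> : cm a = cm b by [].
    rewrite /cm -(@cmp_eq _ _ symE (H :\: A) a b) //.
    by apply: cmp_closed (cmp_refl _ _) _ Eab; rewrite inE ?aA' ?bA.
  - by rewrite !inE vP.
  - by rewrite inE (negbTE vA).
have cA x y : x \in A -> y \in A -> x != y -> E x y by move=> xA yA; apply: clq; apply: allA.
have c5 := sepm_card s0.
have emp a : a \in A -> cm a = set0.
  by move=> aA'; apply/setP => x; rewrite in_set0; apply/negbTE/negP => /cmp_in; rewrite inE aA'.
have rig' := rigid_sym symE rig.
have Evu : E v u by rewrite symE.
have uv : u != v by apply: contraNneq vA => <-.
have uP' : u \notin P by apply/negP => h; apply: (dPA h uA).
have fsP : fsimple E v u P [set u].
  by move=> x y xP /set1P -> Exu; rewrite symE in Exu; rewrite (uP xP Exu).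
have sA1 x : x \in A -> [set x] \subset V by move=> xA; rewrite sub1set (subsetP AV).
have dP1 x : x \in A -> dis P [set x] by move=> xA y yP /set1P e; apply: (dPA yP); rewrite e.
have dC1 z x : x \in A -> dis (cm z) [set x] by move=> xA y /subC [_ yA] /set1P e; move: yA; rewrite e xA.
have a1 x y : x \in A -> y \in A -> x != y -> adj E [set x] [set y] by move=> xA yA xy; rewrite adj1P cA.
have sC z : cm z \subset V by apply/subsetP => x /subC [xH _]; apply: (subsetP HV).
(* Such a component is the class R of a wing, with the roles of [u] and [v] exchanged. A point [b]
   that it does not see gives J, and a fifth point [d] makes the class of [c1] too large. *)
case: (classic (exists z c1 c2, [/\ z \in H, adj E [set z] P, z \notin A & u \in pr E H A z] /\
    [/\ c1 \in pr E H A z, c2 \in pr E H A z, c1 != c2, c1 != u & c2 != u])).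
  move=> [z [c1 [c2 [[zH zP zA uz] [c1z c2z c12 c1u c2u]]]]].
  have [b bA bz] := maxatom_pr symE mA zH zA.
  have subA x : x \in pr E H A z -> x \in A by apply: (subsetP (pr_sub E H A z)).
  have [c1A c2A] : c1 \in A /\ c2 \in A by split; apply: subA.
  have nbz x : x \in pr E H A z -> x != b by move=> xz; apply: contraNneq bz => <-.
  have [bu bc1 bc2] : [/\ u != b, c1 != b & c2 != b] by split; apply: nbz.
  have [d dA dn] : exists2 d, d \in A & d \notin [:: u; b; c1; c2].
    apply: NNPP => nd; have : A \subset [set u; b; c1; c2].
      apply/subsetP => x xA; apply: contraT => xn; case: nd; exists x => //; move: xn; rewrite !inE.
      by rewrite -!orbA.
    move/subset_leq_card => h; have := leq_trans c5 h.
    by rewrite -!setUA !cardsU1 cards1; do 3!case: (_ \in _).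
  move: dn; rewrite !inE !negb_or => /and4P [du db dc1 dc2].
  have [zb zbH [zbP bzb]] := allA b bA.
  have zC : z \in cm z by apply: cmp_refl; rewrite inE zA.
  have cC : conn E (cm z) by apply: conn_cmp; rewrite // inE zA.
  have aCP : adj E P (cm z) by rewrite (adjC symE); apply: adjS zP; rewrite ?sub1set.
  have aCx x : x \in pr E H A z -> adj E (cm z) [set x].
    rewrite prE // => /nbP [y [yC xA _ Eyx]]; apply/adjP; exists y, x; by rewrite inE.
  have [JC JS] : conn E (b |: cm zb) /\ b |: cm zb \subset V.
    split; last by apply: subU; [exact: sA1|exact: sC].
    case zbA : (zb \in A); first by rewrite emp // setU0; apply: conn1.
    move: bzb; rewrite prE ?zbA // => /nbP [y [yC _ _ Eyb]].
    by apply: (connU symE (conn1 E b) (conn_cmp symE _) (set11 b) yC); [rewrite inE zbA|right; rewrite symE].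
  have dzb : dis (cm z) (cm zb).
    case zbA : (zb \in A); first by rewrite (emp zb) // => x _; rewrite inE.
    by apply: disC; apply: disc; rewrite ?zbA //; exists b.
  have aPJ : adj E P (b |: cm zb) by rewrite (adjC symE); apply: att_adj.
  have nRJ : ~~ adj E (cm z) (b |: cm zb).
    apply/negP => /adjP [x [y [xC yJ Exy]]]; case/setUP: yJ => [/set1P e|yC].
      case/negP: bz; rewrite prE //; apply/nbP; exists x; rewrite -e; split=> //; first by rewrite e.
      by apply/negP => /subC []; rewrite e bA.
    have [yH yA] := subC yC; apply: (dzb y) => //; apply: cmp_closed xC _ Exy; by rewrite inE yA.
  have aJ x : x \in A -> x != b -> adj E (b |: cm zb) [set x].
    by move=> xA xb; apply: adjUl; rewrite adj1P cA // eq_sym.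
  have cK : conn E (c1 |: [set d]) by apply: (connUadj symE (conn1 E c1) (conn1 E d)); apply: a1; rewrite // eq_sym.
  have dJ x : x \in A -> x != b -> dis (b |: cm zb) [set x].
    by move=> xA xb; apply: disUl; [apply: dis11; rewrite eq_sym|apply: dC1].
  have dPJ : dis P (b |: cm zb) by apply: disrU; [apply: dP1|apply: dPC].
  have dRJ : dis (cm z) (b |: cm zb) by apply: disrU; [apply: dC1|].
  have [_ [_ [_ [_ [sK _]]]]] : slist [:: P; [set u]; cm z; b |: cm zb; c1 |: [set d]; [set c2]].
    apply: (half_wing5 symE Evu rig') => //.
    - split; [by []|split; [by split; [apply: conn1|apply: sA1]|]].
      split; [by split; [|apply: sC]|split; [by []|split]].
        by split=> //; apply: subU; apply: sA1.
      by split=> //; split; [apply: conn1|apply: sA1].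
    - have [? ? ?] : [/\ dis P [set u], dis P (cm z) & dis P [set c2]] by split; [apply: dP1|apply: dPC|apply: dP1].
      have ? : dis P (c1 |: [set d]) by apply: disrU; apply: dP1.
      have [? ? ? ?] : [/\ dis [set u] (cm z), dis [set u] (b |: cm zb), dis [set u] (c1 |: [set d]) & dis [set u] [set c2]].
        split; [by apply: disC; apply: dC1|by apply: disC; apply: dJ|by apply: disrU; apply: dis11; rewrite eq_sym|by apply: dis11; rewrite eq_sym].
      have [? ?] : dis (cm z) (c1 |: [set d]) /\ dis (cm z) [set c2] by split; [apply: disrU; apply: dC1|apply: dC1].
      have [? ?] : dis (b |: cm zb) (c1 |: [set d]) /\ dis (b |: cm zb) [set c2] by split; [apply: disrU; apply: dJ|apply: dJ].
      have ? : dis (c1 |: [set d]) [set c2] by apply: disUl; apply: dis11.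
      by rewrite /pdis /=; splitall.
    - exact: set11.
    - by split; [apply: aCx|apply: adjrUl; apply: aCx|apply: aCx].
    - by split; [apply: aJ|apply: adjrUl; apply: aJ|apply: aJ].
    - by split; [apply: adjUl; apply: a1|apply: adjrUl; apply: a1; rewrite // eq_sym|apply: a1; rewrite // eq_sym].
  by apply: (two_sing (conn1 E c1) (conn1 E d) _ sK); apply: dis11; rewrite eq_sym.
move=> nz.
(* Components that touch [P] and miss [u] can join the class of [v] without a new edge to [u]. By
   [nz], a component that touches [P] and sees [u] sees at most one further point, so distinct
   points absorb disjoint components in order to reach [Q]. *)
pose Q := P :|: [set z in H :\: A | (u \notin pr E H A z) && adj E (cm z) P].
have QP z : reflect (z \in P \/ [/\ z \in H, z \notin A, u \notin pr E H A z & adj E (cm z) P]) (z \in Q).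
  apply: (iffP idP) => [|[zP|[h1 h2 h3 h4]]]; rewrite ?inE.
  - by case/orP => [|/andP [/andP [h1 h2] /andP [h3 h4]]]; [left|right; split=> //; rewrite inE].
  - by rewrite zP.
  - move: h1; rewrite inE => /andP [h5 h6]; by rewrite h2 h5 h6 h3 h4 orbT.
have [x0 x0P] : exists x, x \in P by exists v.
have cmQ z : z \in H -> z \notin A -> u \notin pr E H A z -> adj E (cm z) P -> cm z \subset Q.
  move=> zH zA uz aC; apply/subsetP => x xC; apply/QP; right; have [xH xA] := subC xC.
  have e : cm x = cm z by rewrite /cm (cmp_eq symE xC).
  by split; rewrite // ?prE // -/(cm x) ?e // -prE.
have cQ : conn E Q.
  apply: (conn_cover symE cP (subsetUl _ _) x0P) => x /QP [xP|[xH xA ux ax]].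
    by exists P; split=> //; [apply: subsetUl|exists x].
  exists (P :|: cm x); split.
  - by apply: (connUadj symE cP); [apply: conn_cmp; rewrite // inE xA|rewrite (adjC symE)].
  - by rewrite subUset subsetUl cmQ.
  - by rewrite inE cmp_refl ?orbT // inE xA.
  - by exists x0; rewrite // inE x0P.
have QV : Q \subset V by apply/subsetP => x /QP [|[xH _ _ _]]; [apply: (subsetP PV)|apply: (subsetP HV)].
have dQA : dis Q A by move=> x /QP [xP|[_ /negP h _ _]] // xA; [apply: (dPA xP xA)].
have uQ x : x \in Q -> E u x -> x = v.
  move=> /QP [xP|[xH xA ux _]]; first exact: uP.
  move=> Eux; case/negP: ux; apply: pr_adj => //; by rewrite symE.
have vQ : v \in Q by apply/QP; left.
have [a [b [c [aS bS cS [ab ac bc]]]]] : exists a b c, [/\ a \in A :\ u, b \in A :\ u, c \in A :\ u & [/\ a != b, a != c & b != c]].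
  by apply: pick3; move: c5; rewrite (cardsD1 u) uA add1n ltnS => h; apply: leq_trans h.
move: aS bS cS; rewrite !inE => /andP [au aA'] /andP [bu bA] /andP [cu cA'].
have piece x : x \in A -> x != u -> exists X, [/\ conn E (x |: X), X \subset V, dis X A, adj E (x |: X) Q & dis Q X] /\
    forall z, z \in X -> [/\ z \in H, z \notin A, pr E H A z \subset [set u; x] & x \in pr E H A z].
  move=> xA xu; case: (boolP (adj E [set x] Q)) => aX.
    exists set0; split; last by move=> z; rewrite inE.
    split; rewrite ?setU0 ?sub0set //; [exact: conn1|by move=> y; rewrite inE|by move=> y _; rewrite inE].
  have [z zH [zP xz]] := allA x xA.
  have zA : z \notin A.
    apply/negP => zA; move: xz; rewrite /pr zA => /set1P e; case/negP: aX; rewrite e; apply: adjS zP => //; exact: subsetUl.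
  have zC : z \in cm z by apply: cmp_refl; rewrite inE zA.
  have aC : adj E (cm z) P by apply: adjS zP; rewrite ?sub1set.
  have xnb : exists2 y, y \in cm z & E y x by move: xz; rewrite prE // => /nbP [y [yC _ _ Eyx]]; exists y.
  have uz : u \in pr E H A z.
    apply: contraT => uz; case/negP: aX; have [y yC Eyx] := xnb; apply/adjP; exists x, y.
    by rewrite inE symE; split=> //; apply: (subsetP (cmQ z zH zA uz aC)).
  have prx w : w \in cm z -> pr E H A w = pr E H A z.
    by move=> wC; have [wH wA] := subC wC; rewrite !prE // -/(cm w) /cm (cmp_eq symE wC).
  exists (cm z); split; last first.
    move=> w wC; have [wH wA] := subC wC; split=> //; rewrite prx //.
    apply/subsetP => y yz; rewrite !inE; apply: contraT; rewrite negb_or => /andP [yu yx]; case: nz.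
    by exists z, x, y; split=> //; split; rewrite // eq_sym.
  split.
  - have [y yC Eyx] := xnb; apply: (connU symE (conn1 E x) (conn_cmp symE _) (set11 x) yC); first by rewrite inE zA.
    by right; rewrite symE.
  - exact: sC.
  - by move=> w /subC [_ /negP].
  - by apply: adjUr; apply: adjS aC => //; apply: subsetUl.
  - move=> w /QP [wP|[_ _ uw _]] wC; first exact: (dPC wP wC).
    by move: uw; rewrite prx ?uz.
have [X1 [[cX1 sX1 dX1 aX1 dQ1] pX1]] := piece a aA' au.
have [X2 [[cX2 sX2 dX2 aX2 dQ2] pX2]] := piece b bA bu.
have [X3 [[cX3 sX3 dX3 aX3 dQ3] pX3]] := piece c cA' cu.
have dXX x y (X Y : {set T}) : x != u -> x != y ->
   (forall z, z \in X -> [/\ z \in H, z \notin A, pr E H A z \subset [set u; x] & x \in pr E H A z]) ->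
   (forall z, z \in Y -> [/\ z \in H, z \notin A, pr E H A z \subset [set u; y] & y \in pr E H A z]) -> dis X Y.
  move=> xu xy hX hY z /hX [_ _ _ h1] /hY [_ _ /subsetP h2 _]; move: (h2 x h1).
  by rewrite !inE (negbTE xu) (negbTE xy).
have f5 : five E V [set u] Q (a |: X1) (b |: X2) (c |: X3).
  have uQ' : adj E [set u] Q by apply/adjP; exists u, v; rewrite inE.
  have dQ x : x \in A -> dis Q [set x] by move=> xA y yQ /set1P e; apply: (dQA y yQ); rewrite e.
  have dX x (X : {set T}) : dis X A -> x \in A -> dis X [set x] by move=> dXA xA y yX /set1P e; apply: (dXA y yX); rewrite e.
  have dU x y (X Y : {set T}) : x \in A -> y \in A -> x != y -> dis X A -> dis Y A -> dis X Y -> dis (x |: X) (y |: Y).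
    move=> xA yA xy dXA dYA dXY; apply: disUl; apply: disrU => //; [exact: dis11| |exact: dX].
    by apply: disC; apply: dX.
  have du x (X : {set T}) : x \in A -> x != u -> dis X A -> dis [set u] (x |: X).
    by move=> xA xu dXA; apply: disrU; [apply: dis11; rewrite eq_sym|apply: disC; apply: dX].
  have dq x (X : {set T}) : x \in A -> dis Q X -> dis Q (x |: X) by move=> xA h; apply: disrU => //; apply: dQ.
  have d12 : dis X1 X2 by apply: (dXX a b).
  have d13 : dis X1 X3 by apply: (dXX a c).
  have d23 : dis X2 X3 by apply: (dXX b c).
  have aU x y (X Y : {set T}) : x \in A -> y \in A -> x != y -> adj E (x |: X) (y |: Y).
    by move=> *; apply: adjUl; apply: adjrUl; apply: a1.
  have au' x (X : {set T}) : x \in A -> x != u -> adj E [set u] (x |: X).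
    by move=> *; apply: adjrUl; apply: a1; rewrite // eq_sym.
  split.
  - by split=> //; apply: conn1.
  - by split=> //; [exact: sA1|apply: subU => //; exact: sA1..].
  - split; first by split; [exact: disC (dQ u uA)|exact: du|exact: du|exact: du].
    by split; [split; apply: dq|split; apply: dU].
  - split; first by split=> //; apply: au'.
    by split; [split; rewrite (adjC symE)|split; apply: aU].
have fsQ : fsimple E u v [set u] Q by move=> x y /set1P -> yQ Euy; rewrite (uQ y yQ Euy).
have [_ [sQ _]] := simple5 symE rig f5 (set11 u) vQ fsQ.
have eQ : Q = [set v] by apply/setP => x; rewrite inE; apply/idP/eqP => [xQ|-> //]; apply: sQ.
rewrite eQ in f5.
have [a' [b' [c' [eV _]]]] := five_base symE Euv rig aV f5.
(* [five_base] leaves only five vertices, whereas [A] has at least five and misses [v]. *)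
have : #|A| < #|V| by apply: proper_card; apply/properP; split=> //; exists v.
rewrite eV => h; have := leq_ltn_trans c5 h.
by rewrite -!setUA !cardsU1 cards1; do 4!case: (_ \in _).
Qed.

Lemma proj : P = [set v] /\ V = v |: A.
Proof.
case: (classic (forall p q, att p -> att q -> p != q -> E p q)) => [/proj_closed //|nc].
have [p [q [ap aq pq npq]]] : exists p q, [/\ att p, att q, p != q & ~~ E p q].
  apply: NNPP => nex; apply: nc => p q ap aq pq; apply: contraT => npq; case: nex; by exists p, q.
exact: (proj_open ap aq pq npq).
Qed.

End Projection.
End Proj.

(** * Both ends outside the maximal atom *)

Section BothOut.
Variables (T : finType) (E : rel T).
Hypotheses (symE : symmetric E) (irrE : forall x, ~~ E x x).
Variables (V W A : {set T}).
Hypotheses (aV : atom E V) (WV : W \subset V) (hA : hull E W A) (aA : atom E A).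
Implicit Types (C D K L P Q R S U X Y : {set T}).

Let AW : A \subset W. Proof. by case: hA. Qed.
Let AV : A \subset V. Proof. exact: subset_trans AW WV. Qed.
Let cm z := cmp E (W :\: A) z.
Let subC z x : x \in cm z -> x \in W /\ x \notin A.
Proof. by move/(subsetP (cmp_sub _ _ _)) => /setDP. Qed.

Definition Att a := [set y in A | E a y || [exists z, [&& z \in W, z \notin A, adj E (cm z) [set a] & y \in pr E W A z]]].

(** The end [a] with the components that touch [a] but not [b]. For two ends [a], [b] as in [sides],
    [Own a b] and [Own b a] are disjoint and joined by the edge [ab] only. *)
Definition Own a b := a |: [set z | [&& z \in W, z \notin A, adj E (cm z) [set a] & ~~ adj E (cm z) [set b]]].

Lemma AttP a y : reflect (y \in A /\ (E a y \/ exists z, [/\ z \in W, z \notin A, adj E (cm z) [set a] & y \in pr E W A z]))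
  (y \in Att a).
Proof.
rewrite inE; apply: (iffP andP) => -[yA].
  by case/orP => [|/existsP [z /and4P [? ? ? ?]]]; split=> //; [left|right; exists z].
case=> [->|[z [? ? ? ?]]]; split=> //; apply/orP; right; apply/existsP; exists z; by apply/and4P.
Qed.

Lemma OwnP a b z : reflect (z = a \/ [/\ z \in W, z \notin A, adj E (cm z) [set a] & ~~ adj E (cm z) [set b]]) (z \in Own a b).
Proof.
rewrite !inE; apply: (iffP orP) => -[]; [by move/eqP; left|by move/and4P; right|by move=> ->; left|].
by move=> h; right; apply/and4P.
Qed.

Let cm_eq x z : x \in cm z -> cm x = cm z. Proof. by move=> h; rewrite /cm (cmp_eq symE h). Qed.
Let cm_refl z : z \in W -> z \notin A -> z \in cm z. Proof. by move=> zW zA; apply: cmp_refl; rewrite inE zA. Qed.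
Let cm_conn z : z \in W -> z \notin A -> conn E (cm z).
Proof. by move=> zW zA; apply: conn_cmp; rewrite // inE zA. Qed.
Let adj_at z a : z \in W -> z \notin A -> E z a -> adj E (cm z) [set a].
Proof. by move=> zW zA Eza; apply/adjP; exists z, a; rewrite inE cm_refl. Qed.
Let pr_cm z w : w \in cm z -> pr E W A w = pr E W A z.
Proof.
move=> wC; have [wW wA] := subC wC; have zA : z \notin A.
  by have := cmp_in wC; rewrite inE => /andP [].
by rewrite !prE // -/(cm w) -/(cm z) (cm_eq wC).
Qed.
Let nb_cm z y : z \in W -> z \notin A -> y \in pr E W A z -> adj E (cm z) [set y].
Proof. by move=> zW zA; rewrite prE // => /nbP [w [wC _ _ Ewy]]; apply/adjP; exists w, y; rewrite inE. Qed.
Let pr_of z y : y \in A -> z \in W -> z \notin A -> E z y -> y \in pr E W A z.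
Proof. by move=> yA zW zA Ezy; apply: pr_adj. Qed.

Lemma Own_sub a b z : z \in W -> z \notin A -> adj E (cm z) [set a] -> ~~ adj E (cm z) [set b] -> cm z \subset Own a b.
Proof.
move=> zW zA h1 h2; apply/subsetP => x xC; apply/OwnP; right; have [xW xA] := subC xC.
by rewrite (cm_eq xC).
Qed.

Lemma Own_conn a b : conn E (Own a b).
Proof.
apply: (conn_cover symE (conn1 E a) (subsetUl _ _) (set11 a)) => x /OwnP [->|[xW xA h1 h2]].
  by exists [set a]; split; [apply: conn1|apply: subsetUl|apply: set11|exists a; apply: set11].
exists (a |: cm x); split.
- by apply: (connUadj symE (conn1 E a)); [apply: cm_conn|rewrite (adjC symE)].
- by rewrite subUset subsetUl Own_sub.
- by apply/setU1P; right; apply: cm_refl.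
- by exists a; [apply: setU11|apply: set11].
Qed.

Lemma Own_att a b y : y \in Att a -> y \notin Att b -> adj E (Own a b) [set y].
Proof.
move=> /AttP [yA [Eay|[z [zW zA h yz]]]] yb.
  by apply/adjP; exists a, y; rewrite inE setU11.
apply: (adjS (A := cm z) (B := [set y])) => //; last exact: nb_cm.
apply: Own_sub => //; apply/negP => h'; case/negP: yb; apply/AttP; split=> //; right; by exists z.
Qed.

Lemma Own_nb a b x y : x \in Own a b -> y \in A -> E x y -> y \in Att a.
Proof.
move=> /OwnP [->|[xW xA h1 h2]] yA Exy; apply/AttP; split=> //; [by left|right].
by exists x; split=> //; apply: pr_of.
Qed.

Lemma Own_dis a b : a != b -> a \notin W -> b \notin W -> dis (Own a b) (Own b a).
Proof.
move=> ab aW bW x /OwnP [->|[xW xA h1 h2]] /OwnP [e|[h3 h4 h5 h6]].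
- by rewrite e eqxx in ab.
- by rewrite h3 in aW.
- by rewrite -e xW in bW.
- by rewrite h1 in h6.
Qed.

Lemma Own_out a b : a \notin W -> dis (Own a b) A.
Proof.
by move=> aW x /OwnP [->|[_ /negP h _ _]] // xA; case/negP: aW; apply: (subsetP AW).
Qed.

Lemma Own_V a b : a \in V -> Own a b \subset V.
Proof. by move=> aV'; apply/subsetP => x /OwnP [->|[xW _ _ _]] //; apply: (subsetP WV). Qed.

Lemma Own_fsimple a b p : p \in A -> p \notin Att b -> fsimple E a b (p |: Own a b) (Own b a).
Proof.
move=> pA pb x y /setU1P [->|xO] yO Exy.
  by case/negP: pb; apply: (Own_nb yO) => //; rewrite symE.
move: xO yO Exy => /OwnP [->|[xW xA h1 h2]] /OwnP [->|[yW yA h3 h4]] Exy //; exfalso.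
- by case/negP: h4; apply: adj_at; rewrite // symE.
- by case/negP: h2; apply: adj_at.
- have yC : y \in cm x by apply: cmp_closed (cm_refl xW xA) _ Exy; rewrite inE yA.
  by move: h4; rewrite (cm_eq yC) h1.
Qed.

Definition sides a b : Prop := [/\ a \in V, b \in V, a \notin W, b \notin W & [/\ E a b, rigid E V a b,
  is_clique (Att a) E & is_clique (Att b) E]].

Lemma sides_sym a b : sides a b -> sides b a.
Proof.
by move=> [h1 h2 h3 h4 [h5 h6 h7 h8]]; split=> //; split=> //; [rewrite symE|exact: rigid_sym].
Qed.

Let neq_ab a b : E a b -> a != b. Proof. by move=> Eab; apply: contraNneq (irrE a) => {2}->. Qed.

Let ne_out a x : a \notin W -> x \in A -> x != a.
Proof. by move=> aW xA; apply: contraNneq aW => <-; apply: (subsetP AW). Qed.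

Let Att_A a y : y \in Att a -> y \in A. Proof. by case/AttP. Qed.

Let Own_conn_p a b p : p \in Att a -> p \notin Att b -> conn E (p |: Own a b).
Proof.
move=> pa pb; apply: (connUadj symE (conn1 E p) (Own_conn a b)).
by rewrite (adjC symE); apply: Own_att.
Qed.

Let not_sing a b p : a \notin W -> p \in A -> sing (p |: Own a b) -> False.
Proof.
move=> aW pA sg; have := ne_out aW pA; rewrite (sg p a) ?eqxx ?setU11 //.
by apply/setU1P; right; apply: setU11.
Qed.

(** [Own a b] is merged into [p], and [Own b a] is a new class that sees [p] through the edge [ab]
    and [q] on its own. The nonadjacency of [p] and [q] makes the quotient an atom, but the class of
    [p] also contains [a]. *)
Lemma both_open a b p q y0 : sides a b -> p \in Att a -> p \notin Att b -> q \in Att b -> q \notin Att a ->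
  ~~ E p q -> y0 \in Att b -> y0 \notin Att a -> sepm E A p y0 -> False.
Proof.
move=> [aV' bV aW bW [Eab rig cla clb]] pa pb qb qa npq yb ya spy.
have [pA qA yA] : [/\ p \in A, q \in A & y0 \in A] by split; [exact: Att_A pa|exact: Att_A qb|exact: Att_A yb].
have bA : b \notin A by apply/negP => /(subsetP AW); rewrite (negbTE bW).
have aA' : a \notin A by apply/negP => /(subsetP AW); rewrite (negbTE aW).
pose B s := if s == b then Own b a else if s == p then p |: Own a b else [set s].
have Bb : B b = Own b a by rewrite /B eqxx.
have Bp : B p = p |: Own a b by rewrite /B eqxx; case: eqP => // e; rewrite -e pA in bA.
have Bo s : s \in A -> s != p -> B s = [set s].
  by move=> sA sp; rewrite /B (negbTE sp); case: eqP => // e; rewrite -e sA in bA.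
have cp := Own_conn_p pa pb.
have dOb := Own_out (b := a) bW; have dOa := Own_out (b := b) aW.
have dOO := Own_dis (neq_ab Eab) aW bW.
have BA s x : s \in A -> x \in B s -> x = s \/ x \in Own a b /\ s = p.
  move=> sA; case: (eqVneq s p) => [->|sp]; last by rewrite Bo // => /set1P; left.
  by rewrite Bp => /setU1P []; [left|right].
have fB : fam E V (b |: A) B.
  split=> [s|s|s t x].
  - case/setU1P => [->|sA]; first by rewrite Bb; apply: Own_conn.
    by case: (eqVneq s p) => [->|sp]; [rewrite Bp|rewrite Bo //; apply: conn1].
  - case/setU1P => [->|sA]; first by rewrite Bb; apply: Own_V.
    case: (eqVneq s p) => [->|sp]; last by rewrite Bo // sub1set (subsetP AV).
    by rewrite Bp; apply: subU; [rewrite sub1set (subsetP AV)|apply: Own_V].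
  - have dB s' : s' \in A -> x \in B s' -> x \in Own b a -> False.
      move=> sA' /(BA _ _ sA') [->|[xo _]] xb; [exact: dOb xb sA'|exact: dOO xo xb].
    case/setU1P => [->|sA] /setU1P [->|tA]; rewrite ?Bb //.
    + by move=> h1 h2; case: (dB t).
    + by move=> h1 h2; case: (dB s).
    + move=> /(BA _ _ sA) [e|[xo e]] /(BA _ _ tA) [e'|[xo' e']].
      * by rewrite -e -e'.
      * by exfalso; apply: (dOa x) => //; rewrite e.
      * by exfalso; apply: (dOa x) => //; rewrite e'.
      * by rewrite e e'.
set N := QE E B; have symN : symmetric N := QE_sym symE B.
have Np t : t \in A -> t != p -> N p t = E p t.
  move=> tA tp; rewrite /N /QE /= Bp Bo // eq_sym tp /=; apply/adjP/idP => [[x [y [xC /set1P -> Ext]]]|Ept].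
    case/setU1P: xC => [<- //|xO]; apply: cla => //; last by rewrite eq_sym.
    by apply: Own_nb xO tA Ext.
  by exists p, t; rewrite setU11 set11.
have eN : {in A &, forall s t, E s t = N s t}.
  move=> s t sA tA; case: (eqVneq s t) => [->|st]; first by rewrite /N /QE /= eqxx; apply: negbTE.
  case: (eqVneq s p) => [e|sp]; first by rewrite e Np // -e eq_sym.
  case: (eqVneq t p) => [e|tp]; first by rewrite e symE symN Np.
  by rewrite /N /QE /= !Bo // adj1P st.
have Nb t : t \in A -> adj E (Own b a) (B t) -> N b t.
  move=> tA h; rewrite /N /QE /= Bb h andbT; apply: contraNneq bA => ->; done.
have Nbt t : t \in Att b -> t \notin Att a -> N b t.
  move=> tb ta; have tA := Att_A tb; apply: Nb => //.
  rewrite Bo //; [exact: Own_att|by apply: contraNneq ta => ->].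
have Nbp : N b p.
  apply: Nb => //; rewrite Bp; apply/adjP; exists b, a; rewrite setU11 symE Eab; split=> //.
  by apply/setU1P; right; apply: setU11.
have aN' : atom N (b |: A).
  apply: (atom_attach symN (p := p) (q := q)) => //.
  - exact: atom_ext aA.
  - by apply: contraNneq pb => ->.
  - by rewrite -eN.
  - exact: Nbt.
have sN : sepm N (b |: A) p b.
  apply: (sepm_add symN (r := y0)) => //; last by rewrite symN; apply: Nbt.
  by apply: sepm_mono spy => s t sA tA; rewrite eN.
have [h1 h2] : p \in b |: A /\ b \in b |: A by split; [apply/setU1P; right|apply: setU11].
have h3 : p != b by apply: ne_out.
have h4 : a \in B p by rewrite Bp; apply/setU1P; right; apply: setU11.
have h5 : b \in B b by rewrite Bb; apply: setU11.
have fs : fsimple E a b (B p) (B b) by rewrite Bp Bb; apply: Own_fsimple.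
have := rig _ _ _ _ _ fB h1 h2 h3 h4 h5 fs aN' sN p h1; rewrite Bp.
exact: not_sing.
Qed.

Section Closed.
Hypothesis cA : is_clique A E.

(** A component touching both ends, with two attachments [c], [d], is the class R in [half_wing5]; J
    is {q}, and the class of [a] contains [p] as well. *)
Lemma both_wing a b p q z c d : sides a b -> p \in Att a -> p \notin Att b -> q \in Att b -> q \notin Att a ->
  z \in W -> z \notin A -> adj E (cm z) [set a] -> adj E (cm z) [set b] -> c \in pr E W A z -> d \in pr E W A z -> c != d -> False.
Proof.
move=> sd pa pb qb qa zW zA za zb cz dz cd; have [aV' bV aW bW [Eab rig cla clb]] := sd.
have [pA qA] : p \in A /\ q \in A by split; [exact: Att_A pa|exact: Att_A qb].
have prA x : x \in pr E W A z -> x \in A by apply: (subsetP (pr_sub E W A z)).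
have atz x : x \in pr E W A z -> x \in Att a /\ x \in Att b.
  by move=> xz; split; apply/AttP; split; rewrite ?prA //; right; exists z.
have [[ca cb] [da db]] := (atz c cz, atz d dz).
have [cA' dA] : c \in A /\ d \in A by split; apply: prA.
have [pc pd qc qd] : [/\ p != c, p != d, q != c & q != d].
  by split; [apply: contraNneq pb|apply: contraNneq pb|apply: contraNneq qa|apply: contraNneq qa] => ->.
have pq : p != q by apply: contraNneq qa => <-.
have Eba : E b a by rewrite symE.
have dOb := Own_out (b := a) bW; have dOa := Own_out (b := b) aW.
have dOO := Own_dis (neq_ab Eab) aW bW.
have cC := cm_conn zW zA.
have CV : cm z \subset V by apply/subsetP => x /subC [xW _]; apply: (subsetP WV).
have dC x : x \in A -> dis (cm z) [set x] by move=> xA y /subC [_ yA] /set1P e; move: yA; rewrite e xA.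
have dCO a' b' : a' \notin W -> adj E (cm z) [set b'] -> dis (cm z) (Own a' b').
  move=> aW' h x xC /OwnP [e|[_ _ _ h']].
    by have [xW _] := subC xC; move: aW'; rewrite -e xW.
  by move: h'; rewrite (cm_eq xC) h.
have dO1 a' b' x : a' \notin W -> x \in A -> dis (Own a' b') [set x].
  by move=> aW' xA y yO /set1P e; apply: (Own_out aW' yO); rewrite e.
have cp := Own_conn_p pa pb.
have inV x : x \in A -> [set x] \subset V by move=> xA; rewrite sub1set (subsetP AV).
have a1 x y : x \in A -> y \in A -> x != y -> adj E [set x] [set y] by move=> xA yA xy; rewrite adj1P cA.
have pV : p |: Own a b \subset V by apply: subU; [exact: inV|exact: Own_V].
have dp x : x \in A -> p != x -> dis (p |: Own a b) [set x].
  by move=> xA px; apply: disUl; [apply: dis11|apply: dO1].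
have [_ [s2 _]] : slist [:: Own b a; p |: Own a b; cm z; [set q]; [set c]; [set d]].
  apply: (half_wing5 symE Eba (rigid_sym symE rig)).
  - rewrite /clist /=; splitall; rewrite ?inV ?Own_V //; first [exact: Own_conn|exact: conn1].
  - have [? ? ? ?] : [/\ dis (Own b a) (p |: Own a b), dis (Own b a) (cm z), dis (Own b a) [set q] & dis (Own b a) [set c]].
      split; [|by apply: disC; apply: dCO|exact: dO1|exact: dO1].
      by apply: disrU; [exact: dO1|exact: disC].
    have ? : dis (Own b a) [set d] by exact: dO1.
    have [? ? ? ?] : [/\ dis (p |: Own a b) (cm z), dis (p |: Own a b) [set q], dis (p |: Own a b) [set c] & dis (p |: Own a b) [set d]].
      by split; [apply: disUl; [apply: disC; exact: dC|apply: disC; exact: dCO]|exact: dp..].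
    have [? ? ?] : [/\ dis (cm z) [set q], dis (cm z) [set c] & dis (cm z) [set d]] by split; exact: dC.
    have [? ? ?] : [/\ dis [set q] [set c], dis [set q] [set d] & dis [set c] [set d]] by split; exact: dis11.
    by rewrite /pdis /=; splitall.
  - exact: setU11.
  - by apply/setU1P; right; apply: setU11.
  - by apply: fsimpleC => //; apply: Own_fsimple.
  - split.
    + by rewrite (adjC symE); apply: adjS zb => //; rewrite sub1set setU11.
    + exact: Own_att.
    + apply/negP => /adjP [x [y [xC /set1P -> Exq]]]; case/negP: qa; apply/AttP; split=> //; right.
      have [xW xA] := subC xC; exists x; rewrite (cm_eq xC); split=> //; exact: pr_of.
  - split; [|exact: nb_cm|exact: nb_cm].
    apply: adjrUr; apply: adjS za => //; by rewrite sub1set setU11.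
  - by split; [apply: adjrUl; apply: a1; rewrite // eq_sym|exact: a1|exact: a1].
  - by split; [exact: a1|apply: adjUl; exact: a1|apply: adjUl; exact: a1].
exact: (not_sing aW pA s2).
Qed.

(** Three attachments of [b], with the components they need in order to reach [b], complete the
    classes of the two ends to a K_5. These components are distinct because a component touching
    both ends has a single attachment. *)
Lemma both_five a b p : sides a b -> p \in Att a -> p \notin Att b -> 3 <= #|Att b| ->
  (forall z c d, z \in W -> z \notin A -> adj E (cm z) [set a] -> adj E (cm z) [set b] -> c \in pr E W A z -> d \in pr E W A z -> c = d) ->
  False.
Proof.
move=> sd pa pb c3 one; have [aV' bV aW bW [Eab rig cla clb]] := sd.
have pA := Att_A pa.
have dOb := Own_out (b := a) bW; have dOa := Own_out (b := b) aW.
have dOO := Own_dis (neq_ab Eab) aW bW.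
have cp := Own_conn_p pa pb.
have dO1 a' b' x : a' \notin W -> x \in A -> dis (Own a' b') [set x].
  by move=> aW' xA y yO /set1P e; apply: (Own_out aW' yO); rewrite e.
have piece y : y \in Att b -> exists X, [/\ conn E (y |: X), X \subset V, dis X A, adj E (Own b a) (y |: X) & dis (p |: Own a b) X /\ dis (Own b a) X] /\
    forall z, z \in X -> [/\ z \in W, z \notin A, y \in pr E W A z & forall c, c \in pr E W A z -> c = y].
  move=> yb; have yA := Att_A yb; case: (boolP (adj E (Own b a) [set y])) => aX.
    exists set0; split; last by move=> z; rewrite inE.
    split; rewrite ?setU0 ?sub0set //; [exact: conn1|by move=> x; rewrite inE|by split=> x _; rewrite inE].
  case/AttP: (yb) => _ [Eby|[z [zW zA h yz]]].
    by case/negP: aX; apply/adjP; exists b, y; rewrite setU11 set11.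
  have ha : adj E (cm z) [set a].
    apply: contraT => ha; case/negP: aX; apply: (adjS (A := cm z) (B := [set y])) => //; [exact: Own_sub|exact: nb_cm].
  exists (cm z); split; last first.
    move=> w wC; have [wW wA] := subC wC; rewrite (pr_cm wC); split=> // c cz; exact: (one z c y).
  have dCO a' b' : a' \notin W -> adj E (cm z) [set b'] -> dis (Own a' b') (cm z).
    move=> aW' hh x /OwnP [e|[_ _ _ h']] xC.
      by have [xW _] := subC xC; move: aW'; rewrite -e xW.
    by move: h'; rewrite (cm_eq xC) hh.
  split.
  - by apply: (connUadj symE (conn1 E y) (cm_conn zW zA)); rewrite (adjC symE); apply: nb_cm.
  - by apply/subsetP => x /subC [xW _]; apply: (subsetP WV).
  - by move=> x /subC [_ /negP].
  - by apply: adjrUr; rewrite (adjC symE); apply: adjS h => //; rewrite sub1set setU11.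
  - split; last exact: dCO.
    by apply: disUl; [move=> x /set1P -> /subC [_]; rewrite pA|exact: dCO].
have [y1 [y2 [y3 [y1b y2b y3b [n12 n13 n23]]]]] := pick3 c3.
have [y1A y2A y3A] : [/\ y1 \in A, y2 \in A & y3 \in A] by split; [exact: Att_A y1b|exact: Att_A y2b|exact: Att_A y3b].
have np y : y \in Att b -> p != y by move=> yb; apply: contraNneq pb => ->.
have [X1 [[cX1 sX1 dX1 aX1 [dp1 dQ1]] pX1]] := piece y1 y1b.
have [X2 [[cX2 sX2 dX2 aX2 [dp2 dQ2]] pX2]] := piece y2 y2b.
have [X3 [[cX3 sX3 dX3 aX3 [dp3 dQ3]] pX3]] := piece y3 y3b.
have dXX x y X Y : x != y -> 
   (forall z, z \in X -> [/\ z \in W, z \notin A, x \in pr E W A z & forall c, c \in pr E W A z -> c = x]) ->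
   (forall z, z \in Y -> [/\ z \in W, z \notin A, y \in pr E W A z & forall c, c \in pr E W A z -> c = y]) -> dis X Y.
  by move=> xy hX hY z /hX [_ _ h1 _] /hY [_ _ _ h2]; move: xy; rewrite (h2 x h1) eqxx.
have d12 : dis X1 X2 by apply: (dXX y1 y2).
have d13 : dis X1 X3 by apply: (dXX y1 y3).
have d23 : dis X2 X3 by apply: (dXX y2 y3).
have inV x : x \in A -> [set x] \subset V by move=> xA; rewrite sub1set (subsetP AV).
have a1 x y : x \in A -> y \in A -> x != y -> adj E [set x] [set y] by move=> xA yA xy; rewrite adj1P cA.
have dX x X : dis X A -> x \in A -> dis X [set x] by move=> dXA xA y yX /set1P e; apply: (dXA y yX); rewrite e.
have dU x y X Y : x \in A -> y \in A -> x != y -> dis X A -> dis Y A -> dis X Y -> dis (x |: X) (y |: Y).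
  move=> xA yA xy dXA dYA dXY; apply: disUl; apply: disrU => //; [exact: dis11| |exact: dX].
  by apply: disC; apply: dX.
have dP x X : x \in A -> p != x -> dis (p |: Own a b) X -> dis (p |: Own a b) (x |: X).
  by move=> xA px h; apply: disrU => //; apply: disUl; [exact: dis11|exact: dO1].
have dQ x X : x \in A -> dis (Own b a) X -> dis (Own b a) (x |: X).
  by move=> xA h; apply: disrU => //; exact: dO1.
have f5 : five E V (p |: Own a b) (Own b a) (y1 |: X1) (y2 |: X2) (y3 |: X3).
  split.
  - by split=> //; apply: Own_conn.
  - by split; [apply: subU; [exact: inV|exact: Own_V]|exact: Own_V|apply: subU => //; exact: inV..].
  - split; first split.
    + by apply: disUl => //; apply: disC; exact: dO1.
    + by apply: dP; rewrite ?np.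
    + by apply: dP; rewrite ?np.
    + by apply: dP; rewrite ?np.
    by split; [split; exact: dQ|split; exact: dU].
  - split; first split.
    + by apply: adjUr; apply/adjP; exists a, b; rewrite !setU11.
    + by apply: adjUl; apply: adjrUl; apply: a1; rewrite ?np.
    + by apply: adjUl; apply: adjrUl; apply: a1; rewrite ?np.
    + by apply: adjUl; apply: adjrUl; apply: a1; rewrite ?np.
    by split; [split|split; apply: adjUl; apply: adjrUl; exact: a1].
have ap : a \in p |: Own a b by apply/setU1P; right; apply: setU11.
have [s1 _] := simple5 symE rig f5 ap (setU11 b _) (Own_fsimple pA pb).
exact: (not_sing aW pA s1).
Qed.

End Closed.

(** If an attachment of [a] and one of [b] are nonadjacent, a separated pair for [both_open] is
    found. Otherwise all attachments form a clique, which cannot separate [V]; so [A] is a clique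
    covered by [Att a] and [Att b], and having five points it leaves at least three in one of
    them. *)
Lemma both_out a b x y : sides a b -> (forall z, z \in V -> z \in W \/ z = a \/ z = b) ->
  (exists2 c, c \in A & c \notin Att a) -> (exists2 c, c \in A & c \notin Att b) ->
  x \in Att a -> y \in Att b -> sepm E A x y -> False.
Proof.
move=> sd covV [ca caA cna] [cb cbA cnb] xa yb sxy; have sd' := sides_sym sd.
have [aV' bV aW bW [Eab rig cla clb]] := sd.
case: (classic (exists p q, [/\ p \in Att a, q \in Att b, p != q & ~~ E p q])) => [[p [q [pa qb pq npq]]]|ncl].
  have pb : p \notin Att b by apply: contra npq => pb; apply: clb.
  have qa : q \notin Att a by apply: contra npq => qa; apply: cla.
  have [pA qA] : p \in A /\ q \in A by split; [exact: Att_A pa|exact: Att_A qb].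
  have fin : sepm E A p q -> False by move=> s; apply: (both_open sd pa pb qb qa npq qb qa s).
  case: sxy => I [F [f [B0 [i [j [m0 [iF jF ij xB yB]]]]]]].
  have [B [m sub cov]] := cover_model symE (atom_conn symE aA) m0.
  have {xB} xB := subsetP (sub i iF) _ xB; have {yB} yB := subsetP (sub j jF) _ yB.
  have [kp kpF pBk] := cov p pA; have [kq kqF qBk] := cov q qA.
  case: (eqVneq kp kq) => [e|kpq]; last by apply: fin; exists I, F, f, B, kp, kq.
  (* [p] and [q] share a class but [x] and [y] do not, so one of the latter is separated from both
     [p] and [q]. *)
  have [k [l [kB lF lkp kab]]] : exists k l, [/\ k \in B l, l \in F, l != kp & (k \in Att a) || (k \in Att b)].
    case: (eqVneq i kp) => [ei|ikp]; last by exists x, i; rewrite xa.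
    by exists y, j; rewrite yb orbT -ei eq_sym.
  have skp : sepm E A k p by exists I, F, f, B, l, kp.
  have skq : sepm E A k q by move: lkp; rewrite e => lkp; exists I, F, f, B, l, kq.
  have [kA _ kp'] := sepm_mem skp; have [_ _ kq'] := sepm_mem skq.
  case: (boolP (k \in Att a)) kab => ka /=; case: (boolP (k \in Att b)) => kb //= _.
  - apply: fin; apply: (sepm_split symE skp) => //; [exact: cla|exact: clb].
  - apply: (both_open sd' qb qa pa pb _ ka kb); first by rewrite symE.
    exact: sepm_sym.
  - by apply: (both_open sd pa pb qb qa npq kb ka); apply: sepm_sym.
pose K := Att a :|: Att b.
have cK : is_clique K E.
  move=> p q /setUP [] hp /setUP [] hq pq; [exact: cla| | |exact: clb].
  - by apply: contraT => n; case: ncl; exists p, q.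
  - by apply: contraT => n; case: ncl; exists q, p; rewrite eq_sym symE.
have AK : A \subset K.
  apply/subsetP => c cA'; apply: contraT => cK'.
  pose D := [set z in W | (z \notin K) && ((z \in A) || (~~ adj E (cm z) [set a] && ~~ adj E (cm z) [set b]))].
  have [|||||] := atomE (D := D) (K := K) (x := c) aV _ _ _ _ aV' => //.
  - by apply/subsetP => z; rewrite inE => /andP [zW _]; apply: (subsetP WV).
  - by rewrite inE cK' cA' (subsetP AW).
  - move=> z w; rewrite inE => /and3P [zW zK zD] wV Ezw.
    have no d : d = a \/ d = b -> E z d -> False.
      move=> hd Ezd; case zA : (z \in A).
        case/negP: zK; case: hd => hd; apply/setUP; [left|right]; apply/AttP; split=> //; left; by rewrite symE -hd.
      rewrite zA /= in zD; have := @adj_at z d zW (negbT zA) Ezd.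
      by case/andP: zD => za zb h; case: hd => hd; move: h; rewrite hd ?(negbTE za) ?(negbTE zb).
    have wW : w \in W by case: (covV w wV) => // hw; case: (no w).
    case wK : (w \in K); [by right|left]; rewrite inE wW wK /=.
    case wA : (w \in A) => //=.
    case zA : (z \in A).
      have wz : z \in pr E W A w by apply: pr_of; rewrite ?wA // symE.
      apply/andP; split; apply/negP => h; case/negP: zK; apply/setUP; [left|right]; apply/AttP; split=> //; right; exists w; by rewrite wA.
    rewrite zA /= in zD; rewrite -(@cm_eq z w) //.
    by apply: cmp_closed (cm_refl wW (negbT wA)) _ _; rewrite ?inE ?zA // symE.
  - by rewrite inE (negbTE aW).
  - by move/setUP => [] /Att_A /(subsetP AW); rewrite (negbTE aW).
have cA : is_clique A E by apply: clique_sub cK.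
have memK c : c \in A -> c \notin Att a -> c \in Att b by move=> /(subsetP AK) /setUP [-> //|].
have memK' c : c \in A -> c \notin Att b -> c \in Att a by move=> /(subsetP AK) /setUP [//|->].
have pa := memK' cb cbA cnb; have qb := memK ca caA cna.
case: (classic (exists z c d, [/\ z \in W, z \notin A, adj E (cm z) [set a] & adj E (cm z) [set b]] /\
  [/\ c \in pr E W A z, d \in pr E W A z & c != d])) => [[z [c [d [[h1 h2 h3 h4] [h5 h6 h7]]]]]|none].
  exact: (both_wing cA sd pa cnb qb cna h1 h2 h3 h4 h5 h6 h7).
have one z c d : z \in W -> z \notin A -> adj E (cm z) [set a] -> adj E (cm z) [set b] -> c \in pr E W A z -> d \in pr E W A z -> c = d.
  by move=> *; apply/eqP; apply: contraT => cd; case: none; exists z, c, d.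
have c5 := sepm_card sxy.
have : 5 <= #|Att a| + #|Att b|.
  apply: leq_trans c5 _; apply: leq_trans (subset_leq_card AK) _; rewrite cardsU; exact: leq_subr.
case: (leqP 3 #|Att b|) => hb; first by move=> _; apply: (both_five cA sd pa cnb hb one).
case: (leqP 3 #|Att a|) => ha h.
  by apply: (both_five cA sd' qb cna ha) => z c d *; apply: (one z).
by have := leq_trans h (leq_add (ha : #|Att a| <= 2) (hb : #|Att b| <= 2)).
Qed.

End BothOut.

Section AtomImage.
Variables (T J : finType) (E1 : rel T) (E2 : rel J).

Lemma atom_image (A : {set T}) (f : T -> J) : {in A &, injective f} -> {in A &, forall a b, E1 a b = E2 (f a) (f b)} ->
  atom E1 A -> atom E2 (f @: A).
Proof.
move=> inj e [[x xA] H]; split; first by exists (f x); apply: imset_f.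
move=> D DS [d dD] cD _ /imsetP [z zA ->].
have /imsetP [d' d'A ed] := subsetP DS _ dD.
pose D1 := [set a in A | f a \in D].
have nbf a : a \in nb E1 A D1 -> f a \in nb E2 (f @: A) D.
  move=> /nbP [b [/setIdP [bA fb] aA aD Eba]]; have fa : f a \notin D by apply: contra aD => fa; rewrite inE aA.
  by apply/nbP; exists (f b); split=> //; [apply: imset_f|rewrite -e].
case: (H D1 _ _ _ z zA).
- by apply/subsetP => a; rewrite inE => /andP [].
- by exists d'; rewrite inE d'A -ed.
- move=> a b an bn ab; have [/nbP [_ [_ aA _ _]] /nbP [_ [_ bA _ _]]] := (an, bn).
  rewrite e //; apply: cD; rewrite ?nbf //; apply: contraNneq ab => h; apply/eqP; exact: inj.
- by rewrite inE => /andP [_]; left.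
- by move/nbf; right.
Qed.

End AtomImage.

Lemma model_mono (T : finType) (E1 E2 : rel T) (V : {set T}) (I : finType) (F : {set I}) a B :
  {in V &, forall x y, E1 x y -> E2 x y} -> model E1 V F a B -> model E2 V F a B.
Proof.
move=> sub [[cB sB dB] aF cF adjF]; split=> //.
  split=> // k kF; apply: conn_mono (cB k kF) => x y xB yB.
  by apply: sub; apply: (subsetP (sB k kF)).
move=> k l kF lF n1 n2; have /adjP [x [y [xB yB Exy]]] := adjF k l kF lF n1 n2.
apply/adjP; exists x, y; split=> //; apply: sub Exy; [exact: (subsetP (sB k kF))|exact: (subsetP (sB l lF))].
Qed.

(** * When the minor survives the deletion of an end *)

Section Star.
Variables (T : finType) (E : rel T).
Hypotheses (symE : symmetric E) (irrE : forall x, ~~ E x x).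
Variables (V : {set T}).
Hypothesis aV : atom E V.
Implicit Types (A C D K L P Q R S U W X Y : {set T}).

Let neqE a b : E a b -> a != b. Proof. by move=> Eab; apply: contraNneq (irrE a) => {2}->. Qed.

(** The surviving minor lives in a maximal atom [A] of [V :\ u]. If [v] is in [A], then [proj] with
    the class {u} gives [V = u |: A]. If not, the model is transferred to [V :\ v], with [u] added:
    then [proj] applies to the other end, or both ends are outside [A], which [both_out]
    excludes. *)
Lemma star_atom u v : u \in V -> v \in V -> E u v -> rigid E V u v -> star E V u v ->
  atom E (V :\ u) \/ (atom E (V :\ v) /\ star E V v u).
Proof.
move=> uV vV Euv rig [x [xV xv Eux s]].
have uv := neqE Euv; have xu : x != u by rewrite eq_sym; apply: neqE.
have Evu : E v u by rewrite symE.
have [I [F [a [B [i [j [A [m mA mt [iF jF ij vB xB]]]]]]]]] := sepm_restrict symE s.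
have hA := maxatom_hull symE mA; have [AVu aA maxA] := mA.
have [[cB sB dB] aF cF adjF] := m.
have mh := model_hull symE hA m mt.
case: (boolP (v \in A)) => vA.
  have [y0 y0B y0r] := met_pr m mt jF xB.
  have y0A := subsetP (pr_sub _ _ _ _) _ y0r.
  have s0 : sepm E A v y0 by exists I, F, a, (fun k => B k :&: A), i, j; split=> //; split; rewrite // inE ?vB ?y0B.
  have uP y : y \in [set u] -> E v y -> y = u by move=> /set1P.
  have sub1u : [set u] \subset V by rewrite sub1set.
  have xH : x \in V :\: [set u] by rewrite !inE xu.
  have xP : adj E [set x] [set u] by rewrite adj1P symE.
  have [_ eV] := proj symE irrE aV Evu (rigid_sym symE rig) (conn1 E u) sub1u (set11 u) uP mA vA xH xP y0r s0.
  left; have -> : V :\ u = A by rewrite eV setU1K //; apply/negP => /(subsetP AVu); rewrite !inE eqxx.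
  by [].
have [s0 s0B s0A] := mt i iF.
have s0v : s0 != v by apply: contraNneq vA => <-.
(* The class of [v] loses [v] and keeps the part that meets the atom. *)
set S' := cmp E (B i :\ v) s0.
have s0D : s0 \in B i :\ v by rewrite !inE s0v.
have subS y : y \in S' -> y != v /\ y \in B i by move/(subsetP (cmp_sub _ _ _)); rewrite !inE => /andP [].
pose B' k := if k == i then S' else if k == j then B j :|: [set u] else B k.
have AW : A \subset V :\ v.
  by apply/subsetP => y yA; rewrite !inE (contraNneq _ vA) => [|<- //]; have := subsetP AVu _ yA; rewrite inE => /andP [].
have inV k y : k \in F -> y \in B k -> y \in V /\ y != u.
  by move=> kF yB; have := subsetP (sB k kF) _ yB; rewrite !inE => /andP [].
have vk k y : k \in F -> k != i -> y \in B k -> y != v.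
  by move=> kF ki yB; apply: contraNneq ki => e; apply/eqP; apply: (dB k i v) => //; rewrite -e.
have ji : j != i by rewrite eq_sym.
have m' : model E (V :\ v) F a B'.
  apply: (model_grow (B := fun k => B k :&: A)); first exact: model_sub mh.
    split=> [k kF|k kF|k l y kF lF]; rewrite /B'.
    - case: eqP => [_|_]; first exact: conn_cmp.
      case: eqP => [_|_]; last exact: cB.
      by apply: (connU symE (cB j jF) (conn1 E u) xB (set11 u)); right; rewrite symE.
    - apply/subsetP => y; case: (eqVneq k i) => [e|ki].
        by move/subS => [yv yB]; have [yV _] := inV i y iF yB; rewrite !inE yv.
      have base : y \in B k -> y \in V :\ v.
        by move=> yB; have [yV _] := inV k y kF yB; rewrite !inE yV (vk k).
      case: (eqVneq k j) => [e|kj //]; case/setUP => [yB|/set1P ->]; last by rewrite !inE uv.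
      by apply: base; rewrite e.
    - have out k' : k' \in F -> u \in B k' -> False by move=> k'F /(inV k' u k'F) []; rewrite eqxx.
      case: (eqVneq k i) => [ek|ki]; case: (eqVneq l i) => [el|li].
      + by rewrite ek el.
      + move=> /subS [_ yi]; rewrite ek; case: (eqVneq l j) => [el|lj]; last exact: dB.
        by case/setUP => [yj|/set1P ey]; [rewrite el; exact: (dB i j y)|case: (out i iF); rewrite -ey].
      + rewrite el; case: (eqVneq k j) => [ek|kj] yk /subS [_ yi]; last exact: (dB k i y).
        by case/setUP: yk => [yj|/set1P ey]; [rewrite ek; exact: (dB j i y)|case: (out i iF); rewrite -ey].
      + case: (eqVneq k j) => [ek|kj]; case: (eqVneq l j) => [el|lj].
        * by rewrite ek el.
        * by case/setUP => [yj|/set1P ->] yl; [rewrite ek; exact: (dB j l y)|case: (out l lF)].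
        * by move=> yk /setUP [yj|/set1P ey]; [rewrite el; exact: (dB k j y)|case: (out k kF); rewrite -ey].
        * exact: dB.
  move=> k kF; rewrite /B'; case: eqP => [->|_].
    apply: (conn_cmp_sub (y := s0)).
    - exact: (hull_conn symE hA (cB i iF) (sB i iF) s0B s0A).
    - apply/subsetP => y /setIP [yB yA]; rewrite !inE yB andbT; by apply: contraNneq vA => <-.
    - by rewrite inE s0B.
    - exact: cmp_refl.
  case: eqP => [->|_]; last exact: subsetIl.
  by apply: subset_trans (subsetIl _ _) (subsetUl _ _).
have [A' mA' AA'] := maxatom_ex AW aA; have [A'V aA' maxA'] := mA'.
have hA' := maxatom_hull symE mA'.
have B'i : B' i = S' by rewrite /B' eqxx.
have B'j : B' j = B j :|: [set u] by rewrite /B' (negbTE ji) eqxx.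
case: (boolP (u \in A')) => uA'.
  have mt' : met F B' A'.
    move=> k kF; have [y yB yA] := mt k kF; case: (eqVneq k i) => [->|ki].
      by exists s0; [rewrite B'i; apply: cmp_refl|apply: (subsetP AA')].
    exists y; last exact: (subsetP AA').
    by rewrite /B' (negbTE ki); case: eqP => [<-|//]; rewrite inE yB.
  (* The edge leaving [S'] within its old class can only end in [v], so [p] is a neighbour of
     [v]. *)
  have [||p [q [pB pS qB qS Epq]]] := conn_cut (L := S') (cB i iF).
  - by exists s0 => //; apply: cmp_refl.
  - by exists v => //; apply/negP => /subS []; rewrite eqxx.
  have eq : q = v.
    by apply/eqP; apply: contraT => qv; case/negP: qS; apply: cmp_closed pS _ Epq; rewrite !inE qv.
  have [pv _] := subS p pS; have [pV pu] := inV i p iF pB.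
  have pH : p \in V :\: [set v] by rewrite !inE pv.
  have pP : adj E [set p] [set v] by rewrite adj1P -eq.
  have pB' : p \in B' i by rewrite B'i.
  have [y0 y0B y0r] := met_pr m' mt' iF pB'.
  have y0A := subsetP (pr_sub _ _ _ _) _ y0r.
  have uB' : u \in B' j by rewrite B'j !inE eqxx orbT.
  have s1 : sepm E A' u y0.
    exists I, F, a, (fun k => B' k :&: A'), j, i; split; first exact: (model_hull symE hA' m' mt').
    by split; rewrite // inE ?uB' ?y0B.
  have sub1v : [set v] \subset V by rewrite sub1set.
  have uP y : y \in [set v] -> E u y -> y = v by move=> /set1P.
  have [_ eV] := proj symE irrE aV Euv rig (conn1 E v) sub1v (set11 v) uP mA' uA' pH pP y0r s1.
  right; split.
    have -> : V :\ v = A' by rewrite eV setU1K //; apply/negP => /(subsetP A'V); rewrite !inE eqxx.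
    by [].
  exists p; split=> //; first by rewrite symE -eq.
  by exists I, F, a, B', j, i.
exfalso.
have eA : A' = A.
  apply: maxA => //; apply/subsetP => y yA'; have := subsetP A'V _ yA'; rewrite !inE => /andP [_ ->].
  by rewrite andbT; apply: contraNneq uA' => <-.
rewrite eA in mA' uA' hA'.
pose W := V :\ u :\ v.
have AW' : A \subset W.
  by apply/subsetP => y yA; have := subsetP AW _ yA; have := subsetP AVu _ yA; rewrite !inE => /andP [-> ->] /andP [-> _].
have mW : maxatom E W A by apply: maxatomS mA AW' _; apply: subsetDl.
have hW := maxatom_hull symE mW.
have WV : W \subset V by apply/subsetP => y; rewrite !inE => /and3P [].
have covW z : z \in V -> z \in W \/ z = u \/ z = v.
  by move=> zV; rewrite !inE zV; case: (eqVneq z u) => [->|_]; [right; left|case: (eqVneq z v) => [->|_]; [right; right|left]].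
have [uW vW] : u \notin W /\ v \notin W by rewrite !inE !eqxx andbF.
(* The attachments of [a] through [W] are those seen from the complement of the other end. *)
have att_pr c d y : c \in V -> c \notin A -> c != d -> W = V :\ c :\ d \/ W = V :\ d :\ c -> y \in Att E W A c -> y \in pr E (V :\ d) A c.
  move=> cV cA cd eW /AttP [yA [Ecy|[z [zW zA /adjP [w [c' [wC /set1P -> Ewc]]] yz]]]].
    by apply: pr_adj => //; rewrite !inE cd.
  have cD : c \in (V :\ d) :\: A by rewrite !inE cA cd.
  have Wd : W \subset V :\ d by case: eW => ->; apply/subsetP => t; rewrite !inE => /and3P [h1 h2 h3]; rewrite ?h1 ?h2 h3.
  have sub : cmp E (W :\: A) z \subset cmp E ((V :\ d) :\: A) c.
    have wD : w \in (V :\ d) :\: A.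
      by have /setDP [wW wA] := subsetP (cmp_sub _ _ _) _ wC; rewrite inE wA (subsetP Wd).
    apply: (conn_cmp_sub (y := w)) => //.
    - by apply: conn_cmp; rewrite // inE zA.
    - by apply: subset_trans (cmp_sub _ _ _) _; apply: setSD.
    - by apply: (cmp_closed (cmp_refl E cD) wD); rewrite symE.
  move: yz; rewrite !prE // => /nbP [t [tC _ _ Ety]]; apply/nbP; exists t; split=> //; first exact: (subsetP sub).
  by apply/negP => /(subsetP (cmp_sub _ _ _)); rewrite inE yA.
have uA : u \notin A by [].
have Xu y : y \in Att E W A u -> y \in pr E (V :\ v) A u by apply: att_pr => //; left.
have Xv y : y \in Att E W A v -> y \in pr E (V :\ u) A v by apply: att_pr => //; [rewrite eq_sym|right].
have uVv : u \in V :\ v by rewrite !inE uv.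
have vVu : v \in V :\ u by rewrite !inE eq_sym uv.
have sd : sides E V W A u v.
  split=> //; split=> //.
  - by move=> y z /Xu yr /Xu zr; apply: (pr_clique hA' uVv).
  - by move=> y z /Xv yr /Xv zr; apply: (pr_clique hA vVu).
have [y' y'B y'r] := met_pr m mt iF vB.
have y'A := subsetP (pr_sub _ _ _ _) _ y'r.
have y'v : y' \in Att E W A v.
  apply/AttP; split=> //; move: y'r; rewrite prE // => /nbP [z [zC _ _ Ezy]].
  case: (eqVneq z v) => [<-|zv]; [by left|right].
  have /setDP [zVu zA] := subsetP (cmp_sub _ _ _) _ zC.
  have zW : z \in W by rewrite in_setD1 zv.
  exists z; split=> //; last exact: pr_adj.
  have zD : z \in W :\: A by rewrite inE zA.
  have [|||p [q [pB pS qB qS Epq]]] := conn_cut (P := cmp E ((V :\ u) :\: A) v) (L := cmp E (W :\: A) z) (conn_cmp symE _).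
  - by rewrite inE vA vVu.
  - by exists z => //; apply: cmp_refl.
  - exists v; first by apply: cmp_refl; rewrite inE vA.
    by apply/negP => /(subsetP (cmp_sub _ _ _)); rewrite !inE eqxx andbF.
  have eq : q = v.
    apply/eqP; apply: contraT => qv; case/negP: qS; apply: cmp_closed pS _ Epq.
    by have /setDP [qVu qA] := subsetP (cmp_sub _ _ _) _ qB; rewrite inE qA in_setD1 qv.
  by apply/adjP; exists p, v; rewrite inE -eq.
have BjW : B j \subset W.
  by apply/subsetP => y yB; have [yV yu] := inV j y jF yB; rewrite !inE yu yV (vk j).
have [t tB tA] := mt j jF.
have [x' x'B x'r] := hull_exit (cB j jF) BjW xB tB tA.
have x'A := subsetP (pr_sub _ _ _ _) _ x'r.
have x'u : x' \in Att E W A u.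
  apply/AttP; split=> //; case: (boolP (x \in A)) => xA; first by left; move: x'r; rewrite /pr xA => /set1P ->.
  have xW := subsetP BjW _ xB.
  by right; exists x; split=> //; apply/adjP; exists x, u; rewrite inE symE cmp_refl // inE xA.
apply: (both_out symE irrE aV WV hW aA sd covW _ _ x'u y'v).
- have [c cA cn] := maxatom_pr symE mA' uVv uA; exists c => //; apply: contra cn; exact: Xu.
- have [c cA cn] := maxatom_pr symE mA vVu vA; exists c => //; apply: contra cn; exact: Xv.
- exists I, F, a, (fun k => B k :&: A), j, i; split=> //; by split; rewrite // inE ?x'B ?y'B.
Qed.

(** If the neighbours of [u] formed a clique, [V] would be complete with at least six vertices, and
    two of them could be merged against rigidity. So there is a nonadjacent pair; separation reaches
    one by [sepm_split], as all neighbours of [u] are adjacent to [v]. *)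
Lemma star_step u v : u \in V -> v \in V -> E u v -> rigid E V u v -> atom E (V :\ u) -> star E V u v ->
  clean E V u v -> step E V u v.
Proof.
move=> uV vV Euv rig aVu [x0 [x0V x0v Eux0 s0]] cl; split=> //.
have uv := neqE Euv.
have Xu x : E u x -> x != u by move=> h; rewrite eq_sym; apply: neqE.
have inVu x : x \in V -> E u x -> x \in V :\ u by move=> xV h; rewrite !inE Xu.
have vVu : v \in V :\ u by apply: inVu.
have Evx0 : E v x0 by apply: cl.
have [w1 [w2 [[w1V w2V w12 nw] [Euw1 Euw2 w1v w2v]]]] : exists w1 w2, [/\ w1 \in V, w2 \in V, w1 != w2 & ~~ E w1 w2] /\
    [/\ E u w1, E u w2, w1 != v & w2 != v].
  apply: NNPP => nex.
  have cl2 : is_clique [set x in V | E u x] E.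
    move=> x y; rewrite !inE => /andP [xV Eux] /andP [yV Euy] xy.
    case: (eqVneq x v) => [e|xv]; first by rewrite e; apply: cl => //; rewrite -e eq_sym.
    case: (eqVneq y v) => [->|yv]; first by rewrite symE; apply: cl.
    by apply: contraT => nE; case: nex; exists x, y.
  have allV z : z \in V -> z != u -> E u z.
    move=> zV zu; have [|||||] := atomE (D := [set u]) (K := [set x in V | E u x]) (x := u) aV _ _ _ _ zV.
    - by rewrite sub1set.
    - exact: set11.
    - exact: cl2.
    - by move=> a b /set1P -> bV Eub; right; rewrite inE bV.
    - by move/set1P => e; rewrite e eqxx in zu.
    - by rewrite inE => /andP [].
  have cV x y : x \in V -> y \in V -> x != u -> y != u -> x != y -> E x y.
    by move=> xV yV xu yu xy; apply: cl2 => //; rewrite inE ?xV ?yV allV.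
  have c5 := sepm_card s0.
  have c4 : 4 <= #|V :\ u :\ v| by move: c5; rewrite (cardsD1 v) vVu.
  have [d dS] : exists d, d \in V :\ u :\ v by apply: pick_in; apply: leq_trans c4.
  have [a [b [c [aS bS cS [ab ac bc]]]]] : exists a b c, [/\ a \in V :\ u :\ v :\ d, b \in V :\ u :\ v :\ d, c \in V :\ u :\ v :\ d & [/\ a != b, a != c & b != c]].
    by apply: pick3; move: c4; rewrite (cardsD1 d) dS.
  move: dS aS bS cS; rewrite !inE => /and3P [dv du dV] /and4P [ad av au aV'] /and4P [bd bv bu bV] /and4P [cd cv cu cV'].
  have [? ? ? ?] : [/\ E u a, E u b, E u c & E u d] by split; apply: allV.
  have [? ? ? ?] : [/\ E v a, E v b, E v c & E v d] by split; apply: cV; rewrite // eq_sym.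
  have [? ? ? ?] : [/\ E a b, E a c, E b c & E a d] by split; apply: cV.
  have [? ?] : E b d /\ E c d by split; apply: cV.
  have f5 : five E V [set u] [set v] ([set a] :|: [set b]) [set c] [set d] by split; mk symE.
  have [_ [_ [sg _]]] := simple5 symE rig f5 (set11 u) (set11 v) (@fsimple11 _ E u v).
  by apply: (two_sing (conn1 E a) (conn1 E b) (dis11 ab) sg).
have [Evw1 Evw2] : E v w1 /\ E v w2 by split; apply: cl.
have fin a b : a \in V -> b \in V -> a != b -> ~~ E a b -> E u a -> E u b -> E v a -> E v b -> sepm E (V :\ u) a b ->
    exists w1 w2, [/\ w1 \in V, w2 \in V, w1 != w2 & ~~ E w1 w2] /\
    [/\ E u w1, E u w2, E v w1, E v w2 & good E (V :\ u) w1 w2].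
  by move=> *; exists a, b; split=> //; split=> //; apply: atom_good.
have spl a b : E v a -> E v b -> E u b -> b \in V -> a != b -> sepm E (V :\ u) v a -> sepm E (V :\ u) a b.
  by move=> Eva Evb Eub bV ab s; apply: (sepm_split symE s); rewrite ?inVu // neqE.
case: (eqVneq x0 w1) => [e|n1]; first by rewrite e in s0; apply: (fin w1 w2) => //; apply: spl.
case: (boolP (E x0 w1)) => h; last by apply: (fin x0 w1) => //; apply: spl.
have s1 : sepm E (V :\ u) v w1.
  apply: (sepm_split symE (k := x0)) => //; [exact: sepm_sym|by rewrite symE|exact: inVu|by rewrite eq_sym].
by apply: (fin w1 w2) => //; apply: spl.
Qed.

End Star.

(** * Contracting an end into a neighbour missed by the other end *)

Section Absorb.
Variables (T : finType) (E : rel T).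
Hypotheses (symE : symmetric E) (irrE : forall x, ~~ E x x).
Implicit Types (A D K L P Q R S U W X Y : {set T}).

Let neqE a b : E a b -> a != b. Proof. by move=> Eab; apply: contraNneq (irrE a) => {2}->. Qed.

(* The graph obtained by contracting [u] into its neighbour [x], read on vertex sets avoiding [u]. *)
Definition absorbed u x : rel T :=
  [rel a b | [|| E a b, [&& a == x, E u b & b != x] | [&& b == x, E u a & a != x]]].

Lemma absorbed_sym u x : symmetric (absorbed u x).
Proof. by move=> a b; rewrite /absorbed /= symE orbCA !orbA (orbC (_ || _)) -!orbA [in RHS]orbC -orbA; congr (_ || _); rewrite orbC. Qed.

Lemma absorbed_old u x a b : E a b -> absorbed u x a b.
Proof. by rewrite /absorbed /= => ->. Qed.

Lemma absorbed_new u x b : E u b -> b != x -> absorbed u x x b.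
Proof. by rewrite /absorbed /= eqxx => -> ->; rewrite orbT. Qed.

Lemma absorbed_out u x a b : a != x -> b != x -> absorbed u x a b = E a b.
Proof. by rewrite /absorbed /= => /negbTE -> /negbTE ->; rewrite !orbF. Qed.

Lemma absorbed_x u x b : b != x -> absorbed u x x b = E x b || E u b.
Proof. by rewrite /absorbed /= eqxx => h; rewrite h (negbTE h) andbT orbF. Qed.

(** A clique separation of [u |: A] has a side avoiding both [u] and [x], and its separator stays a
    clique after the contraction. Since [A] is then an atom, the opposite side is {x} alone; the
    neighbourhood of [x] is a clique, and [u] takes the place of [x]. *)
Lemma absorbed_atom u x z A : u \notin A -> x \in A -> E u x -> z \in A -> E u z -> z != x -> ~~ E x z ->
  atom (absorbed u x) A ->
  atom E (u |: A) \/ (is_clique (nb E (u |: A) [set x]) E /\ atom E (u |: (A :\ x))).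
Proof.
move=> uA xA Eux zA Euz zx nxz aA; set Ex := absorbed u x in aA *.
set S := u |: A.
case: (classic (atom E S)) => [|na]; [by left|right].
have ux : u != x by apply: neqE.
have uS : u \in S by apply: setU11.
have AS t : t \in A -> t \in S by move=> h; apply/setU1P; right.
have [D [DS [d dD] cD [uD xD [r [rS rD rn]]]]] : exists D, [/\ D \subset S, exists d, d \in D, is_clique (nb E S D) E &
    [/\ u \notin D, x \notin D & exists r, [/\ r \in S, r \notin D & r \notin nb E S D]]].
  have [D [DS [d dD] cD [r [rS rD rn]]]] : exists D, [/\ D \subset S, (exists x, x \in D), is_clique (nb E S D) E &
    exists z, [/\ z \in S, z \notin D & z \notin nb E S D]].
    apply: NNPP => nex; apply: na; split; first by exists u.
    move=> D DS Dne cD z' zS; case zD : (z' \in D); first by left.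
    case zn : (z' \in nb E S D); first by right.
    by case: nex; exists D; split => //; exists z'; rewrite zD zn.
  case: (boolP ((u \in D) || (x \in D))) => [hux|]; last first.
    by rewrite negb_or => /andP [uD xD]; exists D; split=> //; [exists d|split=> //; exists r].
  (* The opposite side of the same separation; being adjacent, [u] and [x] cannot occur on both
     sides. *)
  pose D' := S :\: (D :|: nb E S D).
  have inD' t : t \in D' -> [/\ t \in S, t \notin D & t \notin nb E S D].
    by case/setDP => h1; rewrite inE negb_or => /andP [].
  have sub : nb E S D' \subset nb E S D.
    apply/subsetP => t /nbP [w [wD' tS tD' Ewt]]; have [wS wD wn] := inD' w wD'.
    case tD : (t \in D).
      case/negP: wn; apply/nbP; exists t; by rewrite symE.
    apply: contraT => tn; case/negP: tD'; by rewrite inE tS inE tD (negbTE tn).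
  have out t : (t = u) \/ (t = x) -> t \notin D'.
    move=> tux; apply/negP => /inD' [tS tD tn]; case/negP: tn; apply/nbP.
    case: tux tD => -> tD.
      by exists x; rewrite symE; move: hux; rewrite (negbTE tD).
    by exists u; move: hux; rewrite (negbTE tD) orbF; split=> //; apply: AS.
  exists D'; split.
  - exact: subsetDl.
  - by exists r; rewrite in_setD rS in_setU negb_or rD rn.
  - exact: clique_sub cD.
  - split; [by apply: out; left|by apply: out; right|].
    exists d; split; [exact: (subsetP DS)| |].
      by apply/negP => /inD' []; rewrite dD.
    by apply/negP => /(subsetP sub) /nbP [w [_ _ h _]]; rewrite dD in h.
have DA : D \subset A.
  apply/subsetP => t tD; have := subsetP DS _ tD => /setU1P [e|//]; by rewrite -e tD in uD.
have nbx t : t \in nb Ex A D -> t != x -> t \in nb E S D.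
  move=> /nbP [w [wD tA tD Ewt]] tx; apply/nbP; exists w; split=> //; first exact: AS.
  by move: Ewt; rewrite /Ex absorbed_out //; apply: contraNneq xD => <-.
have nbx' : x \in nb Ex A D -> x \in nb E S D \/ u \in nb E S D.
  move=> /nbP [w [wD _ _ Ewx]]; have wx : w != x by apply: contraNneq xD => <-.
  move: Ewx; rewrite /Ex absorbed_sym absorbed_x // => /orP [h|h]; [left|right]; apply/nbP; exists w; rewrite symE; split=> //.
  exact: AS.
have cN : is_clique (nb Ex A D) Ex.
  have half t : t \in nb Ex A D -> t != x -> x \in nb Ex A D -> Ex x t.
    move=> tn tx /nbx' [xn|un].
      by apply: absorbed_old; apply: cD => //; [exact: nbx|rewrite eq_sym].
    apply: absorbed_new => //; apply: cD => //; first exact: nbx.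
    by have /nbP [_ [_ tA _ _]] := tn; apply: contraNneq uA => ->.
  move=> s t sn tn st; case: (eqVneq s x) => [e|sx]; first by rewrite e in st *; apply: half; rewrite -?e // e eq_sym.
  case: (eqVneq t x) => [e|tx]; first by rewrite e /Ex absorbed_sym; apply: half; rewrite -?e // e.
  by apply: absorbed_old; apply: cD => //; apply: nbx.
have [_ HA] := aA.
have cov := HA D DA (ex_intro _ d dD) cN.
have R2 t : t \in S -> t \notin D -> t \notin nb E S D -> t = u \/ t = x.
  move=> /setU1P [->|tA] tD tn; [by left|right]; apply/eqP; apply: contraT => tx.
  by case: (cov t tA) => h; [rewrite h in tD|rewrite (nbx t h tx) in tn].
have zu : z != u by rewrite eq_sym; apply: neqE.
have zS := AS z zA; have xS := AS x xA.
(* The neighbour [z] of [u] that [x] misses prevents [u] from being cut off. *)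
have un : u \in nb E S D.
  apply: contraT => un.
  have noadj t : t \in S -> E u t -> t \notin D by move=> tS Eut; apply: contra un => tD; apply/nbP; exists t; rewrite symE.
  have zn : z \in nb E S D.
    apply: contraT => zn; case: (R2 z zS (noadj z zS Euz) zn) => e; [by rewrite e eqxx in zu|by rewrite e eqxx in zx].
  have xn : x \notin nb E S D by apply: contra nxz => xn; apply: cD; rewrite // eq_sym.
  have cx : is_clique (nb Ex A [set x]) Ex.
    have sub t : t \in nb Ex A [set x] -> t \in nb E S D.
      move=> /nbP [w [/set1P -> tA tx Ext]]; rewrite inE in tx; rewrite ?/Ex absorbed_x // in Ext.
      apply: contraT => tn; have tD : t \notin D.
        case/orP: Ext => h; last exact: noadj (AS t tA) h.
        apply: contra xn => tD; apply/nbP; exists t; by rewrite symE.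
      by case: (R2 t (AS t tA) tD tn) => e; [rewrite -e tA in uA|rewrite e eqxx in tx].
    by move=> s t sn tn st; apply: absorbed_old; apply: cD; rewrite ?sub.
  have dA := subsetP DA _ dD.
  have [|||/set1P e|dn] := HA [set x] _ _ _ d dA.
  - by rewrite sub1set.
  - by exists x; rewrite inE.
  - exact: cx.
  - by rewrite -e dD in xD.
  - move: dn => /nbP [w [/set1P -> _ dx Exd]]; rewrite inE in dx; rewrite ?/Ex absorbed_x // in Exd.
    case/orP: Exd => h; last by move: (noadj d (AS d dA) h); rewrite dD.
    by case/negP: xn; apply/nbP; exists d; rewrite symE.
have rx : r = x by case: (R2 r rS rD rn) => // e; rewrite e un in rn.
rewrite rx in rn => {rD rS}.
have subx : nb E S [set x] \subset nb E S D.
  apply/subsetP => t /nbP [w [/set1P -> tS tx Ext]]; rewrite inE in tx; apply: contraT => tn.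
  have tD : t \notin D by apply: contra rn => tD; apply/nbP; exists t; rewrite symE.
  by case: (R2 t tS tD tn) => e; [rewrite e un in tn|rewrite e eqxx in tx].
have cx := clique_sub subx cD.
split=> //.
have unx : u \in nb E S [set x] by apply/nbP; exists x; rewrite set11 inE symE.
pose f s := if s == x then u else s.
have -> : u |: (A :\ x) = f @: A.
  apply/setP => t; apply/idP/imsetP => [/setU1P [->|]|[s sA ->]].
  - by exists x; rewrite // /f eqxx.
  - by rewrite !inE => /andP [tx tA]; exists t; rewrite // /f (negbTE tx).
  - by rewrite /f; case: eqP => [_|/eqP sx]; [apply: setU11|apply/setU1P; right; rewrite !inE sx].
have Exu t : t \in A -> t != x -> Ex x t = E u t.
  move=> tA tx; rewrite /Ex absorbed_x //; apply/orP/idP => [[h|//]|]; last by right.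
  apply: cx => //; last by apply: contraNneq uA => ->.
  by apply/nbP; exists x; rewrite set11 inE; split=> //; apply: AS.
apply: atom_image aA => s t sA tA; rewrite /f.
  case: (eqVneq s x) => [->|sx]; case: (eqVneq t x) => [->|tx] // e; first by rewrite e tA in uA.
  by rewrite -e sA in uA.
case: (eqVneq s x) => [->|sx]; case: (eqVneq t x) => [->|tx].
- by rewrite /Ex /absorbed /= eqxx !andbF !orbF (negbTE (irrE x)) (negbTE (irrE u)).
- exact: Exu.
- by rewrite /Ex absorbed_sym -/(Ex x s) Exu // symE.
- by rewrite /Ex absorbed_out.
Qed.

(** Contract [u] into a neighbour [x] that [v] misses. The contracted edge [vx] comes from [uv]
    alone, so by rigidity the maximal atom [A] carrying the minor misses [v]. Then [proj] applies to
    a part [P] of the component of [v], with an atom of [V :\: P] around [u] provided by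
    [absorbed_atom]. *)
Lemma star_unclean V u v : atom E V -> u \in V -> v \in V -> E u v -> rigid E V u v -> atom E (V :\ u) ->
  star E V u v -> ~ clean E V u v -> [/\ clean E V v u, atom E (V :\ v) & star E V v u].
Proof.
move=> aV uV vV Euv rig aVu [x0 [x0V x0v Eux0 s0]] ncl.
have uv := neqE Euv; have Evu : E v u by rewrite symE.
pose A0 := V :\ u.
have inA0 y : y \in V -> y != u -> y \in A0 by move=> yV yu; rewrite !inE yu.
have A0V y : y \in A0 -> y \in V /\ y != u by rewrite !inE => /andP [].
have vA0 : v \in A0 by apply: inA0; rewrite // eq_sym.
(* If [v] sees [x0], any neighbour of [u] that [v] misses can be [x]: contraction makes it adjacent
   to [x0], and [sepm_split] transfers the separation. *)
have [x [xV Eux xv nvx s1]] : exists x, [/\ x \in V, E u x, x != v, ~~ E v x & sepm (absorbed u x) A0 v x].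
  case: (boolP (E v x0)) => Evx0; last first.
    exists x0; split=> //; apply: sepm_mono s0 => a b _ _; exact: absorbed_old.
  have [x [xV Eux xv nvx]] : exists x, [/\ x \in V, E u x, x != v & ~~ E v x].
    apply: NNPP => nex; apply: ncl => x xV Eux xv; apply: contraT => nvx; case: nex; by exists x.
  have x0x : x0 != x by apply: contraNneq nvx => <-.
  exists x; split=> //; apply: (sepm_split (absorbed_sym u x) (k := x0)).
  - apply: sepm_sym; apply: sepm_mono s0 => a b _ _; exact: absorbed_old.
  - by apply: absorbed_old; rewrite symE.
  - by rewrite absorbed_sym; apply: absorbed_new.
  - by apply: inA0; rewrite // eq_sym; apply: neqE.
  - by rewrite eq_sym.
  - by [].
set Ex := absorbed u x in s1; have symEx : symmetric Ex := absorbed_sym u x.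
have old a b : E a b -> Ex a b by apply: absorbed_old.
have outE a b : a != x -> b != x -> Ex a b -> E a b by move=> ax bx; rewrite /Ex absorbed_out.
have xu : x != u by rewrite eq_sym; apply: neqE.
have xA0 : x \in A0 by apply: inA0.
have [I [F [a [B [i [j [A [m mA mt [iF jF ij vB xB]]]]]]]]] := sepm_restrict symEx s1.
have hA := maxatom_hull symEx mA; have [AA0 aA _] := mA.
have [[cB sB dB] aF cF adjF] := m.
have mh := model_hull symEx hA m mt.
have uA : u \notin A by apply/negP => /(subsetP AA0) /A0V []; rewrite eqxx.
pose R0 := A0 :\: A.
have inR0 y : y \in A0 -> y \notin A -> y \in R0 by move=> h1 h2; rewrite inE h1 h2.
have subR0 t y : y \in cmp Ex R0 t -> y \in A0 /\ y \notin A by move/(subsetP (cmp_sub _ _ _)) => /setDP.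
have prE1 t y w : t \in A0 -> t \notin A -> w \in cmp Ex R0 t -> y \in A -> Ex w y -> y \in pr Ex A0 A t.
  move=> tA0 tA wC yA Ewy; rewrite prE //; apply/nbP; exists w; split=> //.
  by apply/negP => /subR0 []; rewrite yA.
(* Otherwise the component of [x] attaches to [A] along a set avoiding [x], hence along a clique of
   [E], which would separate the atom [V :\ u]. *)
have xA : x \in A.
  apply: contraT => xA; have [b bA bn] := maxatom_pr symEx mA xA0 xA.
  have cl := pr_clique hA xA0; have prA y : y \in pr Ex A0 A x -> y \in A by apply: (subsetP (pr_sub _ _ _ _)).
  have [|||||] := atomE (D := cmp Ex R0 x) (K := pr Ex A0 A x) (x := x) aVu _ _ _ _ (subsetP AA0 _ bA).
  - by apply: subset_trans (cmp_sub _ _ _) (subsetDl _ _).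
  - by apply: cmp_refl; apply: inR0.
  - move=> y z yr zr yz; apply: outE; last exact: cl.
      by apply: contraNneq xA => <-; apply: prA.
    by apply: contraNneq xA => <-; apply: prA.
  - move=> y z yC zA0 Eyz; case zA : (z \in A); last by left; apply: cmp_closed yC _ (old _ _ Eyz); rewrite inR0 ?zA.
    by right; apply: (prE1 x z y) => //; exact: old.
  - by move/subR0 => []; rewrite bA.
  - by rewrite (negbTE bn).
pose C s := if s == x then x |: [set u] else [set s].
have Cx : C x = x |: [set u] by rewrite /C eqxx.
have Co s : s != x -> C s = [set s] by rewrite /C => /negbTE ->.
have Cself s : s \in C s by case: (eqVneq s x) => [->|sx]; [rewrite Cx setU11|rewrite Co // set11].
have fC S : S \subset A0 -> fam E (u |: S) S C.
  move=> /subsetP SA; split=> [s sS|s sS|s t y sS tS].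
  - case: (eqVneq s x) => [->|sx]; last by rewrite Co //; apply: conn1.
    by rewrite Cx; apply: (connU symE (conn1 E x) (conn1 E u) (set11 x) (set11 u)); right; rewrite symE.
  - apply/subsetP => y; case: (eqVneq s x) => [e|sx]; last by rewrite Co // => /set1P ->; apply/setU1P; right.
    by rewrite e Cx => /setU1P [->|/set1P ->]; [apply/setU1P; right; rewrite -e|apply: setU11].
  - have h s' : s' \in S -> y \in C s' -> y = s' \/ y = u /\ s' = x.
      by move=> sS'; case: (eqVneq s' x) => [->|sx]; [rewrite Cx => /setU1P [|/set1P]; [left|right]|rewrite Co // => /set1P; left].
    have nu s' : s' \in S -> s' != u by move/SA/A0V => [].
    move=> /(h _ sS) [e|[e1 e2]] /(h _ tS) [e'|[e1' e2']].
    + by rewrite -e -e'.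
    + by move: (nu s sS); rewrite -e e1' eqxx.
    + by move: (nu t tS); rewrite -e' e1 eqxx.
    + by rewrite e2 e2'.
have eC : {in A0 &, forall s t, Ex s t = QE E C s t}.
  have one t : t != x -> Ex x t = QE E C x t.
    move=> tx; rewrite /Ex absorbed_x // /QE /= Cx Co // eq_sym tx /=.
    apply/orP/adjP => [[h|h]|[p [q [/setU1P [->|/set1P ->] /set1P ->]]]]; [| |by left|by right].
      by exists x, t; rewrite setU11 set11.
    by exists u, t; rewrite set11; split=> //; apply/setU1P; right; rewrite inE.
  move=> s t _ _; case: (eqVneq s x) => [->|sx].
    case: (eqVneq t x) => [->|tx]; last exact: one.
    by rewrite /Ex /absorbed /QE /= eqxx !andbF !orbF (negbTE (irrE x)).
  case: (eqVneq t x) => [->|tx]; first by rewrite symEx (QE_sym symE) one.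
  rewrite /Ex absorbed_out // /QE /= !Co // adj1P; case: (eqVneq s t) => [->|//].
  exact: negbTE.
have vx : v != x by rewrite eq_sym.
have uCx : u \in C x by rewrite Cx; apply/setU1P; right; rewrite inE.
have fsx : fsimple E u v (C x) (C v).
  by rewrite Cx Co // => p q /setU1P [->|/set1P ->] /set1P -> // Exv; rewrite symE Exv in nvx.
have vA : v \notin A.
  apply/negP => vA; have fCV : fam E V A C.
    have [c1 c2 c3] := fC A AA0; split=> // s sA; apply: subset_trans (c2 s sA) _.
    by rewrite subUset sub1set uV; apply: subset_trans AA0 (subsetDl _ _).
  have aQ : atom (QE E C) A by apply: atom_ext aA => s t sA tA; apply: eC; apply: (subsetP AA0).
  have sQ : sepm (QE E C) A x v.
    have : sepm Ex A x v.
      by exists I, F, a, (fun k => B k :&: A), j, i; split=> //; split; rewrite // 1?eq_sym // inE ?xB ?vB.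
    by apply: sepm_mono => s t sA tA; rewrite eC //; apply: (subsetP AA0).
  have sg := rig _ _ _ _ _ fCV xA vA _ uCx (Cself v) fsx aQ sQ x xA.
  by move: xu; rewrite (sg _ x u) ?eqxx // eq_sym.
pose L := cmp Ex R0 v; pose kap := pr Ex A0 A v.
have kapA y : y \in kap -> y \in A by apply: (subsetP (pr_sub _ _ _ _)).
have ckap : is_clique kap Ex := pr_clique hA vA0.
have vL : v \in L by apply: cmp_refl; apply: inR0.
have xL y : y \in L -> y != x by move/subR0 => [_]; apply: contraNneq => ->.
have Exvx : Ex v x by rewrite symEx; apply: absorbed_new.
have xk : x \in kap by apply: (prE1 v x v).
(* As [V :\ u] is an atom, the attachments of [L] cannot form a clique of [E], although they do for
   [Ex]; a nonadjacent pair must therefore involve [x]. *)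
have [z [zk Euz zx nxz]] : exists z, [/\ z \in kap, E u z, z != x & ~~ E x z].
  have [b bA bn] := maxatom_pr symEx mA vA0 vA.
  have sub y : y \in nb E A0 L -> y \in kap.
    move=> /nbP [w [wL yA0 yL Ewy]]; apply: (prE1 v y w) => //; last exact: old.
    by apply: contraT => yA; case/negP: yL; apply: cmp_closed wL _ (old _ _ Ewy); apply: inR0.
  have [|||||p [q [pn qn pq npq]]] := atomN (D := L) (x := v) (z := b) aVu.
  - by apply: subset_trans (cmp_sub _ _ _) (subsetDl _ _).
  - exact: vL.
  - exact: (subsetP AA0).
  - by apply/negP => /subR0 []; rewrite bA.
  - by apply: contra bn => /sub.
  - have Epq := ckap p q (sub p pn) (sub q qn) pq.
    case: (eqVneq p x) => [e|px].
      have qx : q != x by rewrite -e eq_sym.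
      move: Epq; rewrite e ?/Ex absorbed_x // -e (negbTE npq) /= => h.
      by exists q; split=> //; [exact: sub|rewrite eq_sym].
    case: (eqVneq q x) => [e|qx]; last by move: npq; rewrite outE.
    move: Epq; rewrite e symEx /Ex absorbed_x // symE -e (negbTE npq) /= => h.
    by exists p; split=> //; [exact: sub|rewrite symE].
(* [proj] allows [u] no neighbour in [P] other than [v], so the other neighbours of [u] are removed
   from the component. *)
pose LX := [set y in L | ~~ E u y || (y == v)].
have LXP y : y \in LX -> y \in L /\ (E u y -> y = v).
  by rewrite inE => /andP [yL h]; split=> // Euy; move: h; rewrite Euy /= => /eqP.
have vLX : v \in LX by rewrite inE vL eqxx orbT.
pose P := cmp E LX v.
have cP : conn E P by apply: conn_cmp.
have vP : v \in P by apply: cmp_refl.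
have PL y : y \in P -> y \in L /\ (E u y -> y = v) by move/(subsetP (cmp_sub _ _ _)) => /LXP.
have PA0 y : y \in P -> y \in A0 /\ y \notin A by move/PL => [/subR0].
have PV : P \subset V by apply/subsetP => y /PA0 [/A0V []].
have uP y : y \in P -> E u y -> y = v by move/PL => [].
have uPn : u \notin P by apply/negP => /PA0 [/A0V []]; rewrite eqxx.
have ab := absorbed_atom uA xA Eux (kapA z zk) Euz zx nxz aA.
have [S0 [aS0 uS0 S0V S0A]] : exists S0, [/\ atom E S0, u \in S0, S0 \subset V :\: P & forall y, y \in A -> y != x -> y \in S0].
  have AVP y : y \in A -> y \in V :\: P.
    move=> yA; have [yV _] := A0V y (subsetP AA0 _ yA); rewrite inE yV andbT.
    by apply/negP => /PA0 []; rewrite yA.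
  have uVP : u \in V :\: P by rewrite inE uPn.
  case: ab => [h|[_ h]].
    exists (u |: A); split=> //; [exact: setU11| |by move=> y yA _; apply/setU1P; right].
    by apply/subsetP => y /setU1P [->|/AVP].
  exists (u |: (A :\ x)); split=> //; [exact: setU11| |by move=> y yA yx; apply/setU1P; right; rewrite !inE yx].
  by apply/subsetP => y /setU1P [->|]; rewrite // in_setD1 => /andP [_ /AVP].
have [A' mA' SA'] := maxatom_ex S0V aS0; have hA' := maxatom_hull symE mA'.
have uA' := subsetP SA' _ uS0.
have [s0' s0B s0A] := mt i iF.
have xBi y : y \in B i -> y != x.
  by move=> yB; apply: contraNneq ij => e; apply/eqP; apply: (dB i j y) => //; rewrite e.
have BA0 k y : k \in F -> y \in B k -> y \in A0 by move=> kF; apply: (subsetP (sB k kF)).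
have cBi : conn E (B i) by apply: conn_mono (cB i iF) => p q /xBi px /xBi qx; apply: outE.
set S' := cmp E (B i :\: P) s0'.
have s0D : s0' \in B i :\: P by rewrite inE s0B andbT; apply/negP => /PA0 []; rewrite s0A.
have subS y : y \in S' -> y \notin P /\ y \in B i by move/(subsetP (cmp_sub _ _ _)); rewrite inE => /andP [].
have mQ : model (QE E C) A F a (fun k => B k :&: A).
  by apply: model_mono mh => s t sA tA; rewrite eC //; apply: (subsetP AA0).
have mL := model_lift symE (fC A AA0) mQ.
set M := (fun k => \bigcup_(s in B k :&: A) C s) in mL.
have MP k y : k \in F -> y \in M k -> (y \in B k /\ y \in A) \/ (y = u /\ k = j).
  move=> kF /bigcupP [s /setIP [sB' sA]]; case: (eqVneq s x) => [e|sx]; last by rewrite Co // => /set1P ->; left.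
  rewrite e Cx => /setU1P [->|/set1P ->]; first by left; rewrite -e.
  by right; split=> //; apply: (dB k j x) => //; rewrite -e.
have MI k y : y \in B k -> y \in A -> y \in M k by move=> yB yA; apply/bigcupP; exists y; rewrite ?inE ?yB.
have uM : u \in M j by apply/bigcupP; exists x; rewrite ?inE ?xB.
have ji : j != i by rewrite eq_sym.
pose B' k := if k == i then S' else M k.
have B'i : B' i = S' by rewrite /B' eqxx.
have B'o k : k != i -> B' k = M k by rewrite /B' => /negbTE ->.
have [[cM sM dM] _ _ _] := mL.
have m' : model E (V :\: P) F a B'.
  apply: (model_grow (B := M)).
  - apply: model_sub mL; apply/subsetP => y /setU1P [->|yA]; first by rewrite inE uPn.
    have [yV _] := A0V y (subsetP AA0 _ yA); rewrite inE yV andbT.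
    by apply/negP => /PA0 []; rewrite yA.
  - split=> [k kF|k kF|k l y kF lF].
    + by case: (eqVneq k i) => [->|ki]; [rewrite B'i; apply: conn_cmp|rewrite B'o //; apply: cM].
    + apply/subsetP => y; case: (eqVneq k i) => [->|ki].
        by rewrite B'i => /subS [yP yB]; rewrite inE yP; case: (A0V y (BA0 i y iF yB)).
      rewrite B'o // => /(MP k y kF) [[yB yA]|[-> _]]; last by rewrite inE uPn.
      rewrite inE; have [-> _] := A0V y (BA0 k y kF yB); rewrite andbT.
      by apply/negP => /PA0 []; rewrite yA.
    + have ui : u \notin B i by apply/negP => /(BA0 i u iF) /A0V []; rewrite eqxx.
      case: (eqVneq k i) => [ek|ki]; case: (eqVneq l i) => [el|li].
      * by rewrite ek el.
      * rewrite ek B'i B'o // => /subS [_ yi] /(MP l y lF) [[yl _]|[e _]]; first exact: (dB i l y).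
        by rewrite -e yi in ui.
      * rewrite el B'i B'o // => /(MP k y kF) [[yk _]|[e _]] /subS [_ yi]; first exact: (dB k i y).
        by rewrite -e yi in ui.
      * by rewrite !B'o //; apply: dM.
  - move=> k kF; case: (eqVneq k i) => [->|ki]; last by rewrite B'o.
    rewrite B'i; apply/subsetP => y /(MP i y iF) [[yB yA]|[_ e]]; last by rewrite e eqxx in ij.
    have sub : B i :&: A \subset S'.
      apply: (conn_cmp_sub (y := s0')).
      * apply: conn_mono (hull_conn symEx hA (cB i iF) (sB i iF) s0B s0A) => p q /setIP [/xBi px _] /setIP [/xBi qx _].
        exact: outE.
      * apply/subsetP => t /setIP [tB tA]; rewrite inE tB andbT; by apply/negP => /PA0 []; rewrite tA.
      * by rewrite inE s0B.
      * exact: cmp_refl.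
    by apply: (subsetP sub); rewrite inE yB.
have mt' : met F B' A'.
  move=> k kF; case: (eqVneq k j) => [->|kj]; first by exists u; rewrite ?B'o.
  have [t tB tA] := mt k kF.
  have tx : t != x by apply: contraNneq kj => e; apply/eqP; apply: (dB k j t) => //; rewrite e.
  case: (eqVneq k i) => [->|ki].
    exists s0'; first by rewrite B'i; apply: cmp_refl.
    by apply: (subsetP SA'); apply: S0A; rewrite // xBi.
  by exists t; [rewrite B'o // MI|apply: (subsetP SA'); apply: S0A].
have [||p [q [pB pS qB qS Epq]]] := conn_cut (L := S') cBi.
- by exists s0' => //; apply: cmp_refl.
- by exists v => //; apply/negP => /subS []; rewrite vP.
have qP : q \in P by apply: contraT => qP; case/negP: qS; apply: cmp_closed pS _ Epq; rewrite inE qP.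
have [pP _] := subS p pS; have [pV pu] := A0V p (BA0 i p iF pB).
have pH : p \in V :\: P by rewrite inE pP.
have apP : adj E [set p] P by apply/adjP; exists p, q; rewrite inE.
have pB' : p \in B' i by rewrite B'i.
have uB' : u \in B' j by rewrite B'o.
have [y0 y0B y0r] := met_pr m' mt' iF pB'.
have y0A := subsetP (pr_sub _ _ _ _) _ y0r.
have s2 : sepm E A' u y0.
  exists I, F, a, (fun k => B' k :&: A'), j, i; split; first exact: (model_hull symE hA' m' mt').
  by split; rewrite // inE ?uB' ?y0B.
have [eP eV] := proj symE irrE aV Euv rig cP PV vP uP mA' uA' pH apP y0r s2.
have Epv : E p v by move: apP; rewrite eP adj1P.
have [A'V aA' _] := mA'.
split; last first.
- exists p; split=> //; first by rewrite symE.
  by exists I, F, a, B', j, i; rewrite eP in m'.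
- have -> : V :\ v = A' by rewrite eV setU1K //; apply/negP => /(subsetP A'V); rewrite inE vP.
  by [].
(* A neighbour [y] of [v] missed by [u] would lie in [A], and [v] could join its class. On an atom
   given by [atom_good] the quotient is the graph with [uy] added, with [uv] the only edge between
   the two classes, against rigidity. *)
move=> y yV Evy yu; apply: contraT => nuy; exfalso.
have yA0 : y \in A0 by apply: inA0.
have yv : y != v by rewrite eq_sym; apply: neqE.
have yx : y != x by apply: contraNneq nvx => <-.
case yA : (y \in A); last first.
  have yL : y \in L by apply: cmp_closed vL _ (old _ _ Evy); apply: inR0; rewrite ?yA.
  have : y \in P by apply: cmp_closed vP _ Evy; rewrite inE yL nuy.
  by rewrite eP inE (negbTE yv).
have yk : y \in kap by apply: (prE1 v y v) => //; apply: old.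
have Exy : E x y.
  have := ckap x y xk yk; rewrite eq_sym ?/Ex absorbed_x // => /(_ yx) /orP [//|h]; by rewrite h in nuy.
have uy : u != y by rewrite eq_sym.
case: ab => [aS|[cx _]]; last first.
  case/negP: nuy; apply: cx => //; apply/nbP; exists x; rewrite set11 inE; split=> //.
  - exact: setU11.
  - by rewrite eq_sym.
  - by rewrite symE.
  - by apply/setU1P; right.
have sxy : sepm Ex A x y.
  have [k kB kr] := met_pr m mt iF vB.
  have kA := kapA k kr.
  have skx : sepm Ex A k x.
    by exists I, F, a, (fun k => B k :&: A), i, j; split=> //; split; rewrite // inE ?kB ?xB.
  have kx := xBi k kB.
  case: (eqVneq k y) => [<-|ky]; first exact: sepm_sym.
  apply: (sepm_split symEx skx) => //; first exact: ckap; first exact: ckap.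
  by rewrite eq_sym.
have suy : sepm E (u |: A) u y.
  apply: (sepm_lift symE (fC A AA0) (i := x) (j := y)) => //.
  by apply: sepm_mono sxy => s t sA tA; rewrite eC //; apply: (subsetP AA0).
have [S [SuA uS yS aS' sS]] := atom_good symE aS nuy suy.
pose G s := if s == y then y |: [set v] else [set s].
have Gy : G y = y |: [set v] by rewrite /G eqxx.
have Go s : s != y -> G s = [set s] by rewrite /G => /negbTE ->.
have vS : v \notin S by apply/negP => /(subsetP SuA) /setU1P [e|]; [rewrite e eqxx in uv|apply/negP].
have SV t : t \in S -> t \in V.
  by move=> /(subsetP SuA) /setU1P [-> //|tA]; case: (A0V t (subsetP AA0 _ tA)).
have GP s t : s \in S -> t \in G s -> t = s \/ t = v /\ s = y.
  by move=> sS'; case: (eqVneq s y) => [->|sy]; [rewrite Gy => /setU1P [|/set1P]; [left|right]|rewrite Go // => /set1P; left].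
have fG : fam E V S G.
  split=> [s sS'|s sS'|s t w sS' tS].
  - case: (eqVneq s y) => [->|sy]; last by rewrite Go //; apply: conn1.
    by rewrite Gy; apply: (connU symE (conn1 E y) (conn1 E v) (set11 y) (set11 v)); right; rewrite symE.
  - by apply/subsetP => t /(GP s t sS') [->|[-> _]] //; apply: SV.
  - move=> /(GP _ _ sS') [e|[e1 e2]] /(GP _ _ tS) [e'|[e1' e2']].
    + by rewrite -e -e'.
    + by rewrite -e1' e sS' in vS.
    + by rewrite -e1 e' tS in vS.
    + by rewrite e2 e2'.
set N := add_edge E u y.
have eG : {in S &, forall s t, N s t = QE E G s t}.
  have symN : symmetric N := add_edge_sym symE u y.
  have Ny t : t \in S -> t != y -> N y t = QE E G y t.
    move=> tS ty; rewrite /N /add_edge /QE /= Gy Go // (eq_sym y t) ty eqxx (eq_sym y u) (negbTE uy) /=.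
    case: (eqVneq t u) => [->|tu].
      by rewrite orbT; apply/esym/adjP; exists v, u; rewrite set11; split=> //; apply/setU1P; right; rewrite inE.
    rewrite orbF; have tA : t \in A by have /setU1P [e|//] := subsetP SuA _ tS; rewrite e eqxx in tu.
    apply/idP/adjP => [Eyt|[p' [q' [/setU1P [->|/set1P ->] /set1P -> h]]]] //.
      by exists y, t; rewrite setU11 set11.
    have tk : t \in kap by apply: (prE1 v t v) => //; apply: old.
    have tx : t != x by apply: contraNneq nvx => <-.
    by apply: outE => //; apply: ckap; rewrite // eq_sym.
  move=> s t sS' tS; case: (eqVneq s y) => [->|sy].
    case: (eqVneq t y) => [->|ty]; last exact: Ny.
    by rewrite /N /add_edge /QE /= (negbTE (irrE y)) (eq_sym y u) (negbTE uy) andbF eqxx.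
  case: (eqVneq t y) => [->|ty]; first by rewrite symN (QE_sym symE) Ny.
  rewrite /N /add_edge /QE /= (negbTE sy) (negbTE ty) andbF orbF /= !Go // adj1P.
  by case: (eqVneq s t) => [->|//]; rewrite (negbTE (irrE t)).
have aG : atom (QE E G) S by apply: atom_ext aS' => s t sS' tS; apply: eG.
have sG : sepm (QE E G) S u y by apply: sepm_mono sS => s t sS' tS; rewrite -eG.
have fs : fsimple E u v (G u) (G y).
  by rewrite Go // Gy => p' q' /set1P -> /setU1P [->|/set1P ->] // h; rewrite h in nuy.
have uGu : u \in G u by rewrite Go // inE.
have vGy : v \in G y by rewrite Gy; apply/setU1P; right; rewrite inE.
have sg := rig _ _ _ _ _ fG uS yS uy uGu vGy fs aG sG y yS.
by move: yv; rewrite (sg y v) ?eqxx // Gy setU11.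
Qed.

Lemma base_or_step V u v : atom E V -> u \in V -> v \in V -> E u v -> rigid E V u v -> sepm E V u v ->
  (baseK5 E V u v \/ baseK222 E V u v) \/ (step E V u v \/ step E V v u).
Proof.
move=> aV uV vV Euv rig sV.
have Evu : E v u by rewrite symE.
have rig' := rigid_sym symE rig.
have fin p q : p \in V -> q \in V -> E p q -> rigid E V p q -> rigid E V q p -> atom E (V :\ p) -> star E V p q -> step E V p q \/ step E V q p.
  move=> pV qV Epq r1 r2 aVp st; case: (classic (clean E V p q)) => cl.
    by left; apply: star_step.
  have [cl' aVq st'] := star_unclean aV pV qV Epq r1 aVp st cl.
  by right; apply: star_step; rewrite // symE.
have fin2 p q : p \in V -> q \in V -> E p q -> rigid E V p q -> rigid E V q p -> star E V p q -> step E V p q \/ step E V q p.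
  move=> pV qV Epq r1 r2 st; case: (star_atom symE irrE aV pV qV Epq r1 st) => [a1|[a2 st2]].
    exact: fin.
  have Eqp : E q p by rewrite symE.
  by case: (fin q p qV pV Eqp r2 r1 a2 st2); [right|left].
case: (base_or_star symE irrE aV Euv rig sV) => [h|[h|[st|st]]]; [by left|by right| |]; right.
- exact: fin2.
- by case: (fin2 v u vV uV Evu rig' rig st); [right|left].
Qed.

End Absorb.

(** * Smaller rigid pairs *)

Section Roots.
Variables (T : finType) (E : rel T).
Hypotheses (symE : symmetric E).
Implicit Types (A D K L P Q R S U W X Y Z : {set T}).

(** A triangle minor rooted at three vertices; if these are common neighbours of [u] and [v], it
    completes {u}, {v} to a K_5. *)
Definition rooted3 Z w1 w2 w3 : Prop := exists S1 S2 S3,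
  [/\ w1 \in S1, w2 \in S2 & w3 \in S3] /\ [/\ conn E S1, conn E S2 & conn E S3] /\
  [/\ S1 \subset Z, S2 \subset Z & S3 \subset Z] /\ [/\ dis S1 S2, dis S1 S3 & dis S2 S3] /\
  [/\ adj E S1 S2, adj E S1 S3 & adj E S2 S3].

Lemma rooted3_12 Z w1 w2 w3 : rooted3 Z w1 w2 w3 -> rooted3 Z w2 w1 w3.
Proof.
move=> [S1 [S2 [S3 h]]]; destr; exists S2, S1, S3.
have ? : dis S2 S1 by apply: disC.
by splitall => //; rewrite (adjC symE).
Qed.

Lemma rooted3_23 Z w1 w2 w3 : rooted3 Z w1 w2 w3 -> rooted3 Z w1 w3 w2.
Proof.
move=> [S1 [S2 [S3 h]]]; destr; exists S1, S3, S2.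
have ? : dis S3 S2 by apply: disC.
by splitall => //; rewrite (adjC symE).
Qed.

(** An arm leading from [z] to [w], without [z] itself, so that arms to different roots can be
    disjoint. *)
Definition leg Z z w Q : Prop := [/\ Q \subset Z :\ z & (Q = set0 /\ w = z) \/ [/\ conn E Q, w \in Q & adj E [set z] Q]].

Lemma leg_conn Z z w Q : leg Z z w Q -> conn E (z |: Q) /\ w \in z |: Q.
Proof.
case=> _ [[-> ->]|[cQ wQ a]]; first by rewrite setU0; split; [apply: conn1|rewrite inE].
by split; [apply: (connUadj symE (conn1 E z) cQ)|apply/setU1P; right].
Qed.

(** Grow the first arm as far as the two others permit. It touches one of them outside [z], and [z]
    with the remaining arm is the third vertex of the triangle. *)
Lemma leg_pair Z z w1 w2 w3 Q1 Q2 Q3 : z \in Z -> leg Z z w1 Q1 -> leg Z z w2 Q2 -> leg Z z w3 Q3 ->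
  dis Q1 Q2 -> dis Q1 Q3 -> dis Q2 Q3 -> w2 \in cmp E (Z :\ z) w1 -> rooted3 Z w1 w2 w3.
Proof.
move=> zZ l1 l2 l3 d12 d13 d23 w2C; have w1Z := cmp_in w2C; have w2Z := subsetP (cmp_sub _ _ _) _ w2C.
set C := cmp E (Z :\ z) w1 in w2C.
have cC : conn E C by apply: conn_cmp.
have sC y : y \in C -> y != z /\ y \in Z by move/(subsetP (cmp_sub _ _ _)); rewrite !inE => /andP [].
have real w Q : leg Z z w Q -> w \in Z :\ z -> [/\ conn E Q, w \in Q & adj E [set z] Q].
  by case=> _ [[_ ->]|//]; rewrite !inE eqxx.
have [cQ1 w1Q a1] := real _ _ l1 w1Z; have [cQ2 w2Q a2] := real _ _ l2 w2Z.
have [s1 s2 s3] : [/\ Q1 \subset Z :\ z, Q2 \subset Z :\ z & Q3 \subset Z :\ z] by case: l1; case: l2; case: l3.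
have w1C : w1 \in C by apply: cmp_refl.
have Q1C : Q1 \subset C by apply: (conn_cmp_sub cQ1 s1 w1Q).
pose D := C :\: (Q2 :|: Q3); pose P := cmp E D w1.
have Q1D : Q1 \subset D.
  apply/subsetP => y yQ; rewrite inE (subsetP Q1C) // andbT inE negb_or.
  by apply/andP; split; apply/negP => h; [apply: (d12 y)|apply: (d13 y)].
have w1D := subsetP Q1D _ w1Q.
have cP : conn E P by apply: conn_cmp.
have w1P : w1 \in P by apply: cmp_refl.
have Q1P : Q1 \subset P by apply: (conn_cmp_sub cQ1 Q1D w1Q).
have sP y : y \in P -> [/\ y \in C, y \notin Q2 & y \notin Q3].
  by move/(subsetP (cmp_sub _ _ _)) => /setDP [yC]; rewrite inE negb_or => /andP [].
have zP : adj E [set z] P by apply: adjS a1.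
have PZ : P \subset Z by apply/subsetP => y /sP [/sC []].
have QZ Q : Q \subset Z :\ z -> Q \subset Z by move=> h; apply: subset_trans h (subsetDl _ _).
have dz Q : Q \subset Z :\ z -> dis Q [set z] by move=> h x /(subsetP h); rewrite !inE => /andP [/negbTE ->].
have dPz : dis P [set z] by move=> y /sP [/sC [yz _] _ _] /set1P e; rewrite e eqxx in yz.
have dP2 : dis P Q2 by move=> y /sP [_ /negP].
have dP3 : dis P Q3 by move=> y /sP [_ _ /negP].
have [||p [q [pC pP qC qP Epq]]] := conn_cut (L := P) cC; [by exists w1|by exists w2 => //; apply/negP => /sP [_]; rewrite w2Q|].
have : q \in Q2 :|: Q3.
  by apply: contraT => h; case/negP: qP; apply: cmp_closed pP _ Epq; rewrite inE h.
case/setUP => qQ.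
  have [c3 w3m] := leg_conn l3.
  exists P, Q2, (z |: Q3); split=> //; split=> //; split.
    by split; [|exact: QZ|apply: subU; [rewrite sub1set|exact: QZ]].
  split; first by split=> //; apply: disrU => //; apply: dz.
  split; first by apply/adjP; exists p, q.
    by apply: adjrUl; rewrite (adjC symE).
  by apply: adjrUl; rewrite (adjC symE).
case: l3 => _ [[e _]|[c3 w3Q a3]]; first by rewrite e inE in qQ.
have [c2 w2m] := leg_conn l2.
apply: rooted3_23; exists P, Q3, (z |: Q2); split=> //; split=> //; split.
  by split; [|exact: QZ|apply: subU; [rewrite sub1set|exact: QZ]].
split; first by split=> //; apply: disrU => //; [apply: dz|apply: disC].
split; first by apply/adjP; exists p, q.
  by apply: adjrUl; rewrite (adjC symE).
by apply: adjrUl; rewrite (adjC symE).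
Qed.

(** A minimal connected set through [w1] and [w2] acts as a path; the point where [w3] reaches it is
    a centre [z] of three disjoint arms. Either two arms are also connected outside [z], or [z]
    separates all three roots. *)
Lemma root3 Z w1 w2 w3 : conn E Z -> w1 \in Z -> w2 \in Z -> w3 \in Z -> w1 != w2 -> w1 != w3 -> w2 != w3 ->
  rooted3 Z w1 w2 w3 \/ exists z, [/\ z \in Z, w2 \notin cmp E (Z :\ z) w1, w3 \notin cmp E (Z :\ z) w1 & w3 \notin cmp E (Z :\ z) w2].
Proof.
move=> cZ w1Z w2Z w3Z n12 n13 n23.
suff [z [Q1 [Q2 [Q3 [zZ [l1 l2 l3] [d12 d13 d23]]]]]] : exists z Q1 Q2 Q3, [/\ z \in Z, [/\ leg Z z w1 Q1, leg Z z w2 Q2 & leg Z z w3 Q3] &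
    [/\ dis Q1 Q2, dis Q1 Q3 & dis Q2 Q3]].
  case h1 : (w2 \in cmp E (Z :\ z) w1); first by left; apply: (leg_pair zZ l1 l2 l3).
  case h2 : (w3 \in cmp E (Z :\ z) w1).
    by left; apply: rooted3_23; apply: (leg_pair zZ l1 l3 l2) => //; apply: disC.
  case h3 : (w3 \in cmp E (Z :\ z) w2); last by right; exists z; rewrite h1 h2 h3.
  left; apply: rooted3_12; apply: rooted3_23; apply: (leg_pair zZ l2 l3 l1) => //; exact: disC.
have [G [[cG GZ w1G w2G] minG]] : exists G, [/\ conn E G, G \subset Z, w1 \in G & w2 \in G] /\
    forall G', conn E G' -> G' \subset G -> w1 \in G' -> w2 \in G' -> G' = G.
  suff aux n : forall G : {set T}, #|G| <= n -> [/\ conn E G, G \subset Z, w1 \in G & w2 \in G] ->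
     exists G, [/\ conn E G, G \subset Z, w1 \in G & w2 \in G] /\
      forall G', conn E G' -> G' \subset G -> w1 \in G' -> w2 \in G' -> G' = G by apply: (aux #|Z| Z).
  elim: n => [|n IH] G h [h1 h2 h3 h4].
    by move: h; rewrite leqn0 cards_eq0 => /eqP e; rewrite e inE in h3.
  case: (classic (exists G', [/\ conn E G', G' \subset G, w1 \in G', w2 \in G' & G' <> G])) => [[G' [k1 k2 k3 k4 k5]]|nex].
    apply: (IH G'); last by split=> //; apply: subset_trans h2.
    rewrite -ltnS; apply: leq_trans h; apply: proper_card; rewrite properEneq k2 andbT; exact/eqP.
  exists G; split=> // G' k1 k2 k3 k4; apply: NNPP => k5; apply: nex; by exists G'.
have legG z w : z \in G -> w \in G -> w != z -> leg Z z w (cmp E (G :\ z) w).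
  move=> zG wG wz; have wD : w \in G :\ z by rewrite !inE wz.
  have sub y : y \in cmp E (G :\ z) w -> y != z /\ y \in G by move/(subsetP (cmp_sub _ _ _)); rewrite !inE => /andP [].
  split; first by apply/subsetP => y /sub [yz yG]; rewrite !inE yz (subsetP GZ).
  right; split; [exact: conn_cmp|exact: cmp_refl|].
  have [||p [q [pG pC qG qC Epq]]] := conn_cut (L := cmp E (G :\ z) w) cG.
  - by exists w => //; apply: cmp_refl.
  - by exists z => //; apply/negP => /sub []; rewrite eqxx.
  have eq : q = z by apply/eqP; apply: contraT => qz; case/negP: qC; apply: cmp_closed pC _ Epq; rewrite !inE qz.
  by apply/adjP; exists z, p; split; [exact: set11|exact: pC|rewrite symE -eq].
have dG z : z \in G -> w1 != z -> dis (cmp E (G :\ z) w1) (cmp E (G :\ z) w2).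
  move=> zG w1z x x1 x2; have w2z : w2 != z by have := cmp_in x2; rewrite !inE => /andP [].
  have w2C : w2 \in cmp E (G :\ z) w1.
    by rewrite -(cmp_eq symE x1) (cmp_eq symE x2); apply: cmp_refl; rewrite !inE w2z.
  have w1D : w1 \in G :\ z by rewrite !inE w1z.
  have e : cmp E (G :\ z) w1 = G.
    apply: minG => //; [exact: conn_cmp|by apply: subset_trans (cmp_sub _ _ _) (subsetDl _ _)|exact: cmp_refl].
  by have := subsetP (cmp_sub E (G :\ z) w1) z; rewrite e zG !inE eqxx => /(_ isT).
case: (boolP (w3 \in G)) => w3G.
  exists w3, (cmp E (G :\ w3) w1), (cmp E (G :\ w3) w2), set0; split=> //.
    split; [exact: legG|exact: legG|]; split; [exact: sub0set|by left].
  by split; [exact: dG|by move=> x _; rewrite inE|by move=> x _; rewrite inE].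
pose D3 := cmp E (Z :\: G) w3.
have w3D : w3 \in Z :\: G by rewrite inE w3G.
have sub3 y : y \in D3 -> y \notin G /\ y \in Z by move/(subsetP (cmp_sub _ _ _)); rewrite !inE => /andP [].
have w3C : w3 \in D3 by apply: cmp_refl.
have [||p [z [pZ pD zZ zD Epz]]] := conn_cut (L := D3) cZ.
- by exists w3.
- by exists w1 => //; apply/negP => /sub3 []; rewrite w1G.
have zG : z \in G by apply: contraT => zG; case/negP: zD; apply: cmp_closed pD _ Epz; rewrite inE zG.
have l3 : leg Z z w3 D3.
  split; first by apply/subsetP => y /sub3 [yG yZ]; rewrite !inE yZ andbT; apply: contraNneq yG => ->.
  by right; split=> //; [apply: conn_cmp|apply/adjP; exists z, p; rewrite inE eqxx symE].
have leg0 w : w = z -> leg Z z w set0 by move=> ->; split; [exact: sub0set|left].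
have d3 w : dis (cmp E (G :\ z) w) D3.
  by move=> y h /sub3 [yG _]; case/negP: yG; move/(subsetP (cmp_sub _ _ _)): h => /setD1P [].
have de A : dis set0 A by move=> y; rewrite inE.
have de' A : dis A set0 by move=> y _; rewrite inE.
case: (eqVneq w1 z) => [e1|z1].
  exists z, set0, (cmp E (G :\ z) w2), D3; split=> //; split=> //; first exact: leg0.
  by apply: legG; rewrite // -e1 eq_sym.
case: (eqVneq w2 z) => [e2|z2].
  exists z, (cmp E (G :\ z) w1), set0, D3; split=> //; split=> //; [exact: legG|exact: leg0].
by exists z, (cmp E (G :\ z) w1), (cmp E (G :\ z) w2), D3; split=> //; split=> //; [exact: legG|exact: legG|exact: dG].
Qed.

End Roots.

(** * Replacing an edge by a path through a new vertex *)

Section Subdivide.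
Variables (J : finType) (N : rel J).
Hypotheses (symN : symmetric N).
Variables (S : {set J}) (u w1 w2 c : J).
Hypotheses (uS : u \notin S) (w1S : w1 \in S) (w2S : w2 \in S) (w12 : w1 != w2) (nw : ~~ N w1 w2).
Hypotheses (uw1 : N u w1) (uw2 : N u w2) (nbu : forall s, s \in S -> N u s -> [\/ s = w1, s = w2 | s = c]).
Hypotheses (cw : c \in S -> N c w1 /\ N c w2) (card_S : 4 <= #|S|).
Let N' := add_edge N w1 w2.

Let oldN a b : N a b -> N' a b. Proof. exact: add_edge_old. Qed.
Let newN a b : N' a b -> ~~ N a b -> (a = w1 /\ b = w2) \/ (a = w2 /\ b = w1).
Proof. by rewrite /N' /add_edge /= => /or3P [->|/andP [/eqP -> /eqP ->]|/andP [/eqP -> /eqP ->]] //; [left|right]. Qed.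

(** A clique separation with a side avoiding [w1] and [w2] would survive the addition of their edge.
    If these are on opposite sides, [u] is in the separator, whose only other possible vertex is
    [c]; then each side is a single vertex, and [S] has at most three elements. *)
Lemma subdivide_atom : atom N' S -> atom N (u |: S).
Proof.
move=> [_ HS]; split; first by exists u; apply: setU11.
move=> D DS [d dD] cK t tU.
case tD : (t \in D); [by left|right]; apply: contraT => tK; exfalso.
pose K := nb N (u |: S) D; pose D' := (u |: S) :\: (D :|: K).
have KP y : y \in u |: S -> y \notin D -> (exists2 x, x \in D & N x y) -> y \in K.
  by move=> yU yD [x xD Nxy]; apply/nbP; exists x.
have inD' y : y \in D' -> [/\ y \in u |: S, y \notin D & y \notin K].
  by case/setDP => h; rewrite inE negb_or => /andP [].
have D'I y : y \in u |: S -> y \notin D -> y \notin K -> y \in D' by move=> h1 h2 h3; rewrite in_setD in_setU negb_or h1 h2 h3.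
have tD' : t \in D' by apply: D'I; rewrite ?tD.
have nDD' x y : x \in D -> y \in D' -> ~~ N x y.
  by move=> xD /inD' [yU yD yK]; apply: contra yK => Nxy; apply: KP => //; exists x.
have uU : u \in u |: S by apply: setU11.
have SU s : s \in S -> s \in u |: S by move=> h; apply/setU1P; right.
have US s : s \in u |: S -> s != u -> s \in S by move=> /setU1P [->|//]; rewrite eqxx.
have parts s : s \in u |: S -> [\/ s \in D, s \in D' | s \in K].
  move=> sU; case sD : (s \in D); first by apply: Or31.
  by case sK : (s \in K); [apply: Or33|apply: Or32; apply: D'I; rewrite ?sD ?sK].
have KU s : s \in K -> s \in u |: S /\ s \notin D by move/nbP => [x [_ h1 h2 _]].
have KD' s : s \in K -> s \notin D' by move=> sK; apply/negP => /inD' [_ _]; rewrite sK.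
(* A side of the separation avoiding both ends of the new edge stays separated in [N']. *)
have side X Y : (X = D /\ Y = D') \/ (X = D' /\ Y = D) -> w1 \notin X -> w2 \notin X -> False.
  move=> hXY w1X w2X.
  have XY x y : x \in X -> y \in Y -> ~~ N x y.
    by case: hXY => -[-> ->] xX yY; [apply: nDD'|rewrite symN; apply: nDD'].
  have XU x : x \in X -> x \in u |: S by case: hXY => -[-> _]; [apply: (subsetP DS)|case/inD'].
  have part s : s \in u |: S -> [\/ s \in X, s \in Y | s \in K].
    by move=> sU; case: hXY => -[-> ->]; case: (parts s sU) => h; [apply: Or31|apply: Or32|apply: Or33|apply: Or32|apply: Or31|apply: Or33].
  have XK s : s \in X -> s \notin K by case: hXY => -[-> _]; [move=> sD; apply/negP => /KU []; rewrite sD|case/inD'].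
  have XnY s : s \in X -> s \notin Y.
    case: hXY => -[-> ->]; first by move=> sD; apply/negP => /inD' [_]; rewrite sD.
    by case/inD'.
  have [x0 x0X] : exists x, x \in X by case: hXY => -[-> _]; [exists d|exists t].
  have [y0 y0Y] : exists x, x \in Y by case: hXY => -[_ ->]; [exists t|exists d].
  have YU y : y \in Y -> y \in u |: S by case: hXY => -[_ ->]; [case/inD'|apply: (subsetP DS)].
  have YX y : y \in Y -> y \notin X by move=> yY; apply/negP => /XnY; rewrite yY.
  have YK y : y \in Y -> y \notin K by case: hXY => -[_ ->]; [case/inD'|move=> sD; apply/negP => /KU []; rewrite sD].
  have uX : u \notin X.
    apply/negP => uX; case/negP: nw; apply: cK => //.
      by case: (part w1 (SU _ w1S)) => // h; [rewrite h in w1X|have := XY u w1 uX h; rewrite uw1].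
    by case: (part w2 (SU _ w2S)) => // h; [rewrite h in w2X|have := XY u w2 uX h; rewrite uw2].
  have XS : X \subset S by apply/subsetP => x xX; apply: US; [exact: XU|apply: contraNneq uX => <-].
  have sub : nb N' S X \subset K.
    apply/subsetP => y /nbP [x [xX yS yX N'xy]]; case: (part y (SU _ yS)) => // h; first by rewrite h in yX.
    have := XY x y xX h => nxy; case: (newN N'xy nxy) => -[e1 e2].
      by rewrite e1 in xX; rewrite xX in w1X.
    by rewrite e1 in xX; rewrite xX in w2X.
  have cN : is_clique (nb N' S X) N'.
    by move=> x y /(subsetP sub) xK /(subsetP sub) yK xy; apply: oldN; apply: cK.
  have all y : y \in Y -> y = u.
    move=> yY; apply/eqP; apply: contraT => yu; have yS := US y (YU y yY) yu.
    case: (HS X XS (ex_intro _ x0 x0X) cN y yS) => h; first by have := YX y yY; rewrite h.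
    by have := YK y yY; rewrite (subsetP sub _ h).
  have uY : u \in Y by rewrite -(all y0 y0Y).
  case/negP: nw; apply: cK => //.
    case: (part w1 (SU _ w1S)) => // h; first by rewrite h in w1X.
    by move: w1S; rewrite (all _ h) (negbTE uS).
  case: (part w2 (SU _ w2S)) => // h; first by rewrite h in w2X.
  by move: w2S; rewrite (all _ h) (negbTE uS).
have uD : u \in D -> w1 \in D' \/ w2 \in D' -> False.
  by move=> h [] h'; have := nDD' _ _ h h'; rewrite ?uw1 ?uw2.
have uD' : u \in D' -> w1 \in D \/ w2 \in D -> False.
  by move=> h [] h'; have := nDD' _ _ h' h; rewrite symN ?uw1 ?uw2.
have KE s : s \in K -> s \in S -> u \in K -> w1 \notin K -> w2 \notin K -> s = c.
  move=> sK sS uK w1K w2K; have us : u != s by apply: contraNneq uS => ->.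
  by case: (nbu sS (cK u s uK sK us)) => // e; rewrite -e sK in w1K w2K.
(* Without [a], the rest of its side has in [N'] only [a] and [c] as possible neighbours, a clique
   that would cut it off from [b]. *)
have one X Y a b : (X = D /\ Y = D') \/ (X = D' /\ Y = D) -> (a = w1 /\ b = w2) \/ (a = w2 /\ b = w1) -> u \in K -> a \in X -> b \in Y ->
   w1 \notin K -> w2 \notin K -> forall x, x \in X -> x = a.
  move=> hXY hab uK aX bY w1K w2K x1 x1X; apply/eqP; apply: contraT => x1a; exfalso.
  have XY x y : x \in X -> y \in Y -> ~~ N x y.
    by case: hXY => -[-> ->] xX yY; [apply: nDD'|rewrite symN; apply: nDD'].
  have XU x : x \in X -> x \in u |: S by case: hXY => -[-> _]; [apply: (subsetP DS)|case/inD'].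
  have part s : s \in u |: S -> [\/ s \in X, s \in Y | s \in K].
    by move=> sU; case: hXY => -[-> ->]; case: (parts s sU) => h; [apply: Or31|apply: Or32|apply: Or33|apply: Or32|apply: Or31|apply: Or33].
  have uX : u \notin X by case: hXY => -[-> _]; [exact: (KU u uK).2|exact: KD'].
  have XnY s : s \in X -> s \notin Y.
    case: hXY => -[-> ->]; first by move=> sD; apply/negP => /inD' [_]; rewrite sD.
    by case/inD'.
  have XS x : x \in X -> x \in S by move=> xX; apply: US; [exact: XU|apply: contraNneq uX => <-].
  have [aS bS] : a \in S /\ b \in S by case: hab => -[-> ->].
  have bK : b \notin K by case: hab => -[_ ->].
  have ca : c \in S -> N c a by case/cw => h1 h2; case: hab => -[-> _].
  have nbE y : y \in nb N' S (X :\ a) -> y = a \/ (y = c /\ y \in K).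
    move=> /nbP [x [/setD1P [xa xX] yS yX N'xy]].
    have xb : x != b by apply: contraTneq bY => <-; apply: XnY.
    have Nxy : N x y.
      apply: contraT => nxy; case: (newN N'xy nxy) => -[e1 _]; case: hab => -[ea eb]; by rewrite ?ea ?eb e1 eqxx in xa xb.
    case: (part y (SU y yS)) => h.
    - by left; apply/eqP; apply: contraT => ya; rewrite !inE ya h in yX.
    - by have := XY x y xX h; rewrite Nxy.
    - by right; split=> //; apply: KE.
  have [|||/setD1P [_ bX]|bn] := HS (X :\ a) _ _ _ b bS.
  - by apply/subsetP => y /setD1P [_ /XS].
  - by exists x1; rewrite !inE x1a.
  - move=> y z yn zn yz; have yS : y \in S by case/nbP: yn => ? [].
    have zS : z \in S by case/nbP: zn => ? [].
    apply: oldN; case: (nbE y yn) (nbE z zn) => [ey|[ey _]] [ez|[ez _]]; subst; rewrite ?eqxx // in yz *.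
      by rewrite symN; apply: ca.
    exact: ca.
  - by have := XnY b bX; rewrite bY.
  - case: (nbE b bn) => [e|[_ h]]; last by rewrite h in bK.
    by have := XnY a aX; rewrite -e bY.
have fin a b : (a = w1 /\ b = w2) \/ (a = w2 /\ b = w1) -> a \in D -> b \in D' -> False.
  move=> hab aD bD'.
  have uK : u \in K.
    case: (parts u uU) => // h; exfalso; [apply: uD|apply: uD'] => //; case: hab => -[e1 e2]; subst; auto.
  have [w1K w2K] : w1 \notin K /\ w2 \notin K.
    have aK : a \notin K by apply/negP => /KU []; rewrite aD.
    have bK : b \notin K by case/inD': bD'.
    by case: hab => -[e1 e2]; subst.
  have h1 := one D D' a b (or_introl (conj erefl erefl)) hab uK aD bD' w1K w2K.
  have hba : (b = w1 /\ a = w2) \/ (b = w2 /\ a = w1) by case: hab => -[-> ->]; auto.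
  have h2 := one D' D b a (or_intror (conj erefl erefl)) hba uK bD' aD w1K w2K.
  have : S \subset [set a; b; c].
    apply/subsetP => s sS; rewrite !inE; case: (parts s (SU s sS)) => h.
    - by rewrite (h1 s h) eqxx.
    - by rewrite (h2 s h) eqxx orbT.
    - by rewrite (KE s) ?eqxx ?orbT.
  move/subset_leq_card => h; have := leq_trans card_S h.
  by rewrite setUC cardsU1 cards2; case: (c \in _); case: (a != b).
case w1D : (w1 \in D); case w2D : (w2 \in D).
- by apply: (side D' D); [right|apply/negP => /inD' [_]; rewrite w1D|apply/negP => /inD' [_]; rewrite w2D].
- case w2D' : (w2 \in D'); first by apply: (fin w1 w2); auto.
  by apply: (side D' D); [right|apply/negP => /inD' [_]; rewrite w1D|rewrite w2D'].
- case w1D' : (w1 \in D'); first by apply: (fin w2 w1); auto.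
  by apply: (side D' D); [right|rewrite w1D'|apply/negP => /inD' [_]; rewrite w2D].
- by apply: (side D D'); rewrite ?w1D ?w2D //; left.
Qed.

End Subdivide.

Section Point.
Variables (T : finType) (E : rel T).
Hypotheses (symE : symmetric E).
Implicit Types (A D K L P Q R S U W X Y Z : {set T}).

Definition absorb_point (x y s : T) : {set T} := if s == x then [set x; y] else [set s].

Lemma absorb_pointP x y s t : reflect (t = s \/ s = x /\ t = y) (t \in absorb_point x y s).
Proof.
rewrite /absorb_point; case: (eqVneq s x) => [->|sx]; rewrite !inE.
  by apply: (iffP orP) => [[/eqP|/eqP]|[->|[_ ->]]]; [left|right|left|right].
apply: (iffP eqP); first by left.
by case=> // -[e]; rewrite e eqxx in sx.
Qed.

Lemma absorb_point_self x y s : s \in absorb_point x y s.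
Proof. by apply/absorb_pointP; left. Qed.

Lemma absorb_point_new x y : y \in absorb_point x y x.
Proof. by apply/absorb_pointP; right. Qed.

Lemma fam_point S x y : x \in S -> y \notin S -> E x y -> fam E (y |: S) S (absorb_point x y).
Proof.
move=> xS yS Exy; split=> [s sS|s sS|s t z sS tS].
- rewrite /absorb_point; case: (s == x); last exact: conn1.
  by apply: (connU symE (conn1 E x) (conn1 E y) (set11 x) (set11 y)); right.
- by apply/subsetP => t /absorb_pointP [->|[_ ->]]; apply/setU1P; [right|left].
- move=> /absorb_pointP [e1|[e1 e2]] /absorb_pointP [e3|[e3 e4]].
  + by rewrite -e1 -e3.
  + by rewrite -e1 e4 (negbTE yS) in sS.
  + by rewrite -e3 e2 (negbTE yS) in tS.
  + by rewrite e1 e3.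
Qed.

(** Trades edges that [E'] adds at [x] for an extra vertex [y], adjacent to [x], that sees their
    other ends. *)
Lemma sepm_point (E' : rel T) S x y p q p' q' : x \in S -> y \notin S -> E x y ->
  (forall s t, s \in S -> t \in S -> E' s t -> s != t /\ [\/ E s t, s = x /\ E y t | t = x /\ E s y]) ->
  sepm E' S p q -> p' \in absorb_point x y p -> q' \in absorb_point x y q -> sepm E (y |: S) p' q'.
Proof.
move=> xS yS Exy sub s p'p q'q; apply: (sepm_lift symE (fam_point xS yS Exy) _ p'p q'q).
apply: sepm_mono s => a b aS bS /(sub a b aS bS) [ab h]; rewrite /QE /= ab /=.
case: h => [Eab|[-> Eyb]|[-> Eay]]; apply/adjP.
- by exists a, b; rewrite !absorb_point_self.
- by exists y, b; rewrite absorb_point_self absorb_point_new.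
- by exists a, y; rewrite absorb_point_self absorb_point_new.
Qed.

End Point.

(** * An end with only two neighbours besides the other end *)

Section Two.
Variables (T : finType) (E : rel T).
Hypotheses (symE : symmetric E) (irrE : forall x, ~~ E x x).
Variables (V : {set T}) (u v w1 w2 : T).
Hypotheses (aV : atom E V) (uV : u \in V) (vV : v \in V) (Euv : E u v) (rig : rigid E V u v).
Hypotheses (w12 : w1 != w2) (nw : ~~ E w1 w2).
Hypotheses (uw1 : E u w1) (uw2 : E u w2) (vw1 : E v w1) (vw2 : E v w2).
Hypothesis (nbu : forall y, y \in V -> E u y -> [\/ y = v, y = w1 | y = w2]).
Implicit Types (A D K L P Q R S U W X Y Z : {set T}) (F H : {set {set T}}).

Let N : rel {set T} := QE E (@id {set T}).
Let symN : symmetric N. Proof. exact: (QE_sym symE). Qed.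
Let NI A B : A != B -> adj E A B -> N A B. Proof. by rewrite /N /QE /= => ->. Qed.
Let neqE a b : E a b -> a != b. Proof. by move=> Eab; apply: contraNneq (irrE a) => {2}->. Qed.
Let vu : v != u. Proof. by rewrite eq_sym; apply: neqE. Qed.

Lemma fam_attach H X : fam E V H id -> conn E X -> X \subset V -> (forall Y, Y \in H -> dis X Y) -> fam E V (X |: H) id.
Proof.
move=> [c s d] cX sX dX; split=> [Y|Y|Y Z x].
- by case/setU1P => [->|/c].
- by case/setU1P => [->|/s].
- case/setU1P => [->|YH]; case/setU1P => [->|ZH] // h1 h2; [by case: (dX Z ZH x)|by case: (dX Y YH x)|exact: (d Y Z x)].
Qed.

Lemma atom_attach_class H X A1 A2 : conn E X -> (forall Y, Y \in H -> dis X Y) -> A1 \in H -> A2 \in H -> A1 != A2 -> ~~ adj E A1 A2 ->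
  adj E X A1 -> adj E X A2 -> atom N H -> atom N (X |: H).
Proof.
move=> cX dX h1 h2 n12 na a1 a2 aH.
have XH : X \notin H by apply/negP => /dX d; case: cX => -[x xX] _; apply: (d x).
apply: (atom_attach symN (p := A1) (q := A2)) => //.
- by rewrite /N /QE /= negb_and na orbT.
- by apply: NI => //; apply: (conn_neq cX); apply: dX.
- by apply: NI => //; apply: (conn_neq cX); apply: dX.
Qed.

Section Classes.
Variables (A1 A2 : {set T}).
Hypotheses (n12 : A1 != A2) (w1A : w1 \in A1) (w2A : w2 \in A2) (na : ~~ adj E A1 A2).

Let vA1 : v \notin A1.
Proof. by apply: contra na => h; apply/adjP; exists v, w2. Qed.
Let vA2 : v \notin A2.
Proof. by apply: contra na => h; apply/adjP; exists w1, v; rewrite symE. Qed.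

(** Separation of {u} from [A2] passes to the class of [v], a common neighbour; if no class contains
    [v], the class {v} is first attached to the nonadjacent pair [A1], [A2]. The edge [uv] is simple
    because all other neighbours of [u] are in [A1] and [A2]. *)
Lemma rigid_classes H : fam E V H id -> [set u] \in H -> A1 \in H -> A2 \in H -> atom N H -> sepm N H [set u] A2 ->
  forall X, X \in H -> sing X.
Proof.
have main H' Xv : fam E V H' id -> [set u] \in H' -> A1 \in H' -> A2 \in H' -> Xv \in H' -> v \in Xv -> atom N H' -> sepm N H' [set u] A2 ->
   forall X, X \in H' -> sing X.
  move=> fH uH a1 a2 XvH vX aH sH X XH; have [c s d] := fH.
  have nX1 : Xv != A1 by apply: contraNneq vA1 => <-.
  have nX2 : Xv != A2 by apply: contraNneq vA2 => <-.
  have nuX : [set u] != Xv by apply: contraTneq vX => <-; rewrite inE.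
  have [_ _ nu2] := sepm_mem sH.
  have sXv : sepm N H' [set u] Xv.
    apply: (sepm_split symN (k := A2)) => //; first exact: sepm_sym.
    - by apply: NI; rewrite 1?eq_sym //; apply/adjP; exists w2, u; rewrite symE set11.
    - by apply: NI; rewrite 1?eq_sym //; apply/adjP; exists w2, v; rewrite symE.
    - by rewrite eq_sym.
  have fs : fsimple E u v [set u] Xv.
    move=> x y /set1P -> yX Euy; split=> //; case: (nbu (subsetP (s Xv XvH) _ yX) Euy) => // e.
      by case/eqP: nX1; apply: (d _ _ w1) => //; rewrite -e.
    by case/eqP: nX2; apply: (d _ _ w2) => //; rewrite -e.
  exact: (rig fH uH XvH nuX (set11 u) vX fs aH sXv).
move=> fH uH a1 a2 aH sH X XH; have [c s d] := fH.
case: (classic (exists2 Xv, Xv \in H & v \in Xv)) => [[Xv XvH vX]|nv]; first exact: (main H Xv).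
have dv Y : Y \in H -> dis [set v] Y by move=> YH x /set1P -> vY; apply: nv; exists Y.
have vsub : [set v] \subset V by rewrite sub1set.
have aw1 : adj E [set v] A1 by apply/adjP; exists v, w1; rewrite set11.
have aw2 : adj E [set v] A2 by apply/adjP; exists v, w2; rewrite set11.
have inU Y : Y \in H -> Y \in [set v] |: H by move=> h; apply/setU1P; right.
apply: (main ([set v] |: H) [set v]); rewrite ?setU11 ?set11 ?inU //.
- by apply: fam_attach => //; apply: conn1.
- by apply: (atom_attach_class (A1 := A1) (A2 := A2)) => //; apply: conn1.
- by apply: sepm_sub sH; apply: subsetUr.
Qed.

Lemma subdivide_classes F : fam E V F id -> (forall X, X \in F -> u \notin X) -> A1 \in F -> A2 \in F ->
  atom (add_edge N A1 A2) F -> sepm (add_edge N A1 A2) F A1 A2 ->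
  [/\ fam E V ([set u] |: F) id, atom N ([set u] |: F) & sepm N ([set u] |: F) [set u] A2].
Proof.
move=> fF uF a1 a2 aF sF; have [c s d] := fF.
have uF' : [set u] \notin F by apply/negP => /uF; rewrite set11.
have du Y : Y \in F -> dis [set u] Y by move=> YF x /set1P -> uY; move: (uF Y YF); rewrite uY.
have nu Y : Y \in F -> [set u] != Y by move=> YF; apply: (conn_neq (conn1 E u)); apply: du.
have Nu1 : N [set u] A1 by apply: NI; rewrite ?nu //; apply/adjP; exists u, w1; rewrite set11.
have Nu2 : N [set u] A2 by apply: NI; rewrite ?nu //; apply/adjP; exists u, w2; rewrite set11.
have nN : ~~ N A1 A2 by rewrite /N /QE /= negb_and na orbT.
split.
- by apply: fam_attach => //; [apply: conn1|rewrite sub1set].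
- have [C [Cv CF]] : exists C, (forall X, X \in F -> v \in X -> X = C) /\ (C \in F -> N C A1 /\ N C A2).
    case: (classic (exists2 Xv, Xv \in F & v \in Xv)) => [[Xv XvF vX]|nv].
      exists Xv; split; first by move=> X XF vX'; apply: (d _ _ v).
      move=> _; split; apply: NI.
      + by apply: contraNneq vA1 => <-.
      + by apply/adjP; exists v, w1.
      + by apply: contraNneq vA2 => <-.
      + by apply/adjP; exists v, w2.
    exists set0; split; first by move=> X XF vX; case: nv; exists X.
    by move=> /c [[x]]; rewrite inE.
  apply: (@subdivide_atom _ N symN F [set u] A1 A2 C) => //.
  + move=> X XF /andP [_ /adjP [x [y [/set1P -> yX Euy]]]].
    case: (nbu (subsetP (s X XF) _ yX) Euy) => e; subst y.
    * by apply: Or33; apply: Cv.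
    * by apply: Or31; apply: (d _ _ w1).
    * by apply: Or32; apply: (d _ _ w2).
  + exact: leq_trans (sepm_card sF).
- apply: (sepm_point symN (E' := add_edge N A1 A2) (x := A1) (y := [set u]) a1 uF' _ _ sF).
  + by rewrite symN.
  + move=> X Y XF YF /or3P [h|/andP [/eqP -> /eqP ->]|/andP [/eqP -> /eqP ->]].
    * by split; [case/andP: h|apply: Or31].
    * by split=> //; apply: Or32.
    * by rewrite eq_sym; split=> //; apply: Or33; rewrite symN.
  + exact: absorb_point_new.
  + exact: absorb_point_self.
Qed.

End Classes.

Let E' := add_edge E w1 w2.
Let symE' : symmetric E'. Proof. exact: add_edge_sym. Qed.
Let oldE a b : E a b -> E' a b. Proof. exact: add_edge_old. Qed.
Let newE a b : E' a b -> [\/ E a b, a = w1 /\ b = w2 | a = w2 /\ b = w1].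
Proof.
by rewrite /E' /add_edge /= => /or3P [h|/andP [/eqP -> /eqP ->]|/andP [/eqP -> /eqP ->]]; [apply: Or31|apply: Or32|apply: Or33].
Qed.
Let irrE' a : ~~ E' a a.
Proof. by apply/negP => /newE [h|[e1 e2]|[e1 e2]]; [case/negP: (irrE a)|move: w12; rewrite -e1 -e2 eqxx|move: w12; rewrite -e1 -e2 eqxx]. Qed.

Section Family.
Variables (I : finType) (SI : {set I}) (B : I -> {set T}) (i j : I).
Hypotheses (fB : fam E' (V :\ u) SI B) (iS : i \in SI) (jS : j \in SI) (ij : i != j) (w1B : w1 \in B i) (w2B : w2 \in B j).
Hypotheses (fs : fsimple E' w1 w2 (B i) (B j)) (aS : atom (QE E' B) SI) (sS : sepm (QE E' B) SI i j).

(** Passes from indices to the classes themselves. As [w1 w2] is simple for the family, the added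
    edge affects the quotient only between [B i] and [B j]. *)
Lemma family_classes : [/\ fam E V (B @: SI) id, forall X, X \in B @: SI -> u \notin X, ~~ adj E (B i) (B j) & B i != B j] /\
  [/\ atom (add_edge N (B i) (B j)) (B @: SI) & sepm (add_edge N (B i) (B j)) (B @: SI) (B i) (B j)].
Proof.
have [c s d] := fB.
have w1E k : k \in SI -> w1 \in B k -> k = i by move=> kS h; apply: (d _ _ w1).
have w2E k : k \in SI -> w2 \in B k -> k = j by move=> kS h; apply: (d _ _ w2).
have inj : {in SI &, injective B}.
  by move=> k l kS lS e; have [[x xB] _] := c k kS; apply: (d _ _ x); rewrite -?e.
have nij : ~~ adj E (B i) (B j).
  by apply/negP => /adjP [x [y [xB yB Exy]]]; have [e1 e2] := fs xB yB (oldE Exy); case/negP: nw; rewrite -e1 -e2.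
have Bij : B i != B j by apply: contraNneq ij => /inj -> //.
have eB : {in SI &, forall k l, QE E' B k l = add_edge N (B k) (B l) (B i) (B j) || N (B k) (B l)}.
  move=> k l kS lS; rewrite /QE /add_edge /= /N /QE /=.
  have -> : (B k == B l) = (k == l) by apply/eqP/eqP => [/inj ->|->].
  have e k' l' : k' \in SI -> l' \in SI -> (B k' == B l') = (k' == l') by move=> kS' lS'; apply/eqP/eqP => [/inj ->|->].
  rewrite !e // (negbTE nij) andbF /=.
  case: (eqVneq k l) => [->|kl] /=.
    rewrite orbF; apply/esym/negbTE/negP => /orP [] /andP [/eqP e1 /eqP e2]; by move: ij; rewrite e1 e2 eqxx.
  apply/adjP/idP => [[x [y [xB yB /newE [Exy|[e1 e2]|[e1 e2]]]]]|].
  - by apply/orP; right; apply/adjP; exists x, y.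
  - by subst; rewrite (w1E k) // (w2E l) // !eqxx.
  - by subst; rewrite (w2E k) // (w1E l) // !eqxx orbT.
  - case/orP => [/orP [] /andP [/eqP e1 /eqP e2]|/adjP [x [y [xB yB Exy]]]].
    + by exists w1, w2; rewrite -e1 -e2; split=> //; rewrite /E' /add_edge /= !eqxx orbT.
    + by exists w2, w1; rewrite -e1 -e2; split=> //; rewrite /E' /add_edge /= !eqxx !orbT.
    + by exists x, y; split=> //; apply: oldE.
have eB2 : {in SI &, forall k l, QE E' B k l = add_edge N (B i) (B j) (B k) (B l)}.
  move=> k l kS lS; rewrite eB // /add_edge /= orbC.
  have -> : N (B i) (B j) = false by rewrite /N /QE /= (negbTE nij) andbF.
  by rewrite !(eq_sym (B k)) !(eq_sym (B l)) /= (andbC (B i == B l)).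
split; first split=> //.
- split=> [X /imsetP [k kS ->]|X /imsetP [k kS ->]|X Y x /imsetP [k kS ->] /imsetP [l lS ->] h1 h2].
  + apply: conn_mono (c k kS) => x y xB yB /newE [//|[e1 e2]|[e1 e2]]; subst;
      by move: ij; rewrite -(w1E k) // -(w2E k) // eqxx.
  + by apply: subset_trans (s k kS) (subsetDl _ _).
  + by rewrite (d k l x).
- by move=> X /imsetP [k kS ->]; apply/negP => /(subsetP (s k kS)); rewrite !inE eqxx.
split; first exact: atom_image aS.
set N2 := add_edge N (B i) (B j).
have symN2 : symmetric N2 by apply: add_edge_sym.
apply: (sepm_lift symN2 (I := I) (B := fun k => [set B k]) (S := SI) (i := i) (j := j)); rewrite ?set11 //.
  split=> [k kS|k kS|k l X kS lS /set1P -> /set1P]; [exact: conn1|by rewrite sub1set; apply: imset_f|exact: inj].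
apply: sepm_mono sS => k l kS lS h; rewrite /QE /= adj1P /N2 -eB2 // h andbT.
by case/andP: h.
Qed.

Let subdiv : [/\ fam E V ([set u] |: B @: SI) id, atom N ([set u] |: B @: SI) & sepm N ([set u] |: B @: SI) [set u] (B j)].
Proof. by have [[f1 f2 f3 f4] [f5 f6]] := family_classes; apply: (@subdivide_classes (B i)) => //; apply: imset_f. Qed.

Lemma family_sing k : k \in SI -> sing (B k).
Proof.
have [[f1 f2 f3 f4] _] := family_classes; have [g1 g2 g3] := subdiv.
have inB l : l \in SI -> B l \in [set u] |: B @: SI by move=> lS; apply/setU1P; right; apply: imset_f.
move=> kS; apply: (rigid_classes f4 w1B w2B f3 g1) => //; rewrite ?setU11 ?inB //.
Qed.

(** The classes of [w1] and [w2] are nonadjacent in [E], so [X] can be attached to them as one more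
    class of an atom. *)
Lemma attached_sing X : conn E X -> X \subset V :\ u -> (forall k, k \in SI -> dis X (B k)) -> adj E X (B i) -> adj E X (B j) -> sing X.
Proof.
move=> cX sX dX a1 a2; have [[f1 f2 f3 f4] _] := family_classes; have [g1 g2 g3] := subdiv.
have inB l : l \in SI -> B l \in [set u] |: B @: SI by move=> lS; apply/setU1P; right; apply: imset_f.
have XV : X \subset V by apply: subset_trans sX (subsetDl _ _).
have dX' Y : Y \in [set u] |: B @: SI -> dis X Y.
  case/setU1P => [->|/imsetP [k kS ->]]; last exact: dX.
  by move=> x /(subsetP sX) /setD1P [xu _] /set1P e; rewrite e eqxx in xu.
have inU Y : Y \in [set u] |: B @: SI -> Y \in X |: ([set u] |: B @: SI) by move=> h; apply/setU1P; right.
apply: (rigid_classes f4 w1B w2B f3 (H := X |: ([set u] |: B @: SI))); rewrite ?setU11 ?inU ?inB ?setU11 //.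
- exact: fam_attach.
- by apply: (atom_attach_class (A1 := B i) (A2 := B j)); rewrite ?inB.
- by apply: sepm_sub g3; apply: subsetUr.
Qed.

End Family.

Section Component.
Variable S : {set T}.
Hypotheses (mS : maxatom E' (V :\ u) S) (w1S : w1 \in S) (w2S : w2 \in S) (sS : sepm E' S w1 w2).

Let SV : S \subset V :\ u. Proof. by case: mS. Qed.

Let QE1 (B : T -> {set T}) : (forall s, s \in S -> s \in B s) -> (forall s t, s \in S -> t \in S -> adj E' (B s) (B t) -> s != t -> E' s t) ->
  {in S &, forall s t, E' s t = QE E' B s t}.
Proof.
move=> h1 h2 s t sS' tS; rewrite /QE /=; case: (eqVneq s t) => [->|st] /=; first exact/negbTE.
by apply/idP/idP => h; [apply/adjP; exists s, t; rewrite !h1|apply: h2].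
Qed.

Let simple1 : fsimple E' w1 w2 [set w1] [set w2].
Proof. by move=> x y /set1P -> /set1P ->. Qed.

Lemma rigid_side : rigid E' S w1 w2.
Proof.
move=> I SI B i j [c s d] iS jS ij w1B w2B fs aS' sS' k kS.
apply: (family_sing (SI := SI) (B := B) (i := i) (j := j)) => //; split=> // l lS.
exact: subset_trans (s l lS) SV.
Qed.

(** The component [L] of [e] attaches along a clique [kap] containing [w1] and [w2]: directly if [v]
    is in [L], and otherwise because [V] is an atom, so that [kap] must use the new edge. Hence [L]
    is a single vertex; a further attachment could take [e] into its class without changing the
    quotient, against rigidity. *)
Lemma outside_side e y : e \in V -> e \notin S -> e != u -> y \in V -> E e y -> [\/ y = w1, y = w2 | e = v /\ y = u].
Proof.
move=> eV eS eu yV Eey.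
pose R := (V :\ u) :\: S; pose L := cmp E' R e; pose kap := pr E' (V :\ u) S e.
have eVu : e \in V :\ u by rewrite !inE eu.
have eR : e \in R by rewrite inE eS.
have hS := maxatom_hull symE' mS.
have kapE : kap = nb E' S L by rewrite /kap prE.
have ck : is_clique kap E' := pr_clique hS eVu.
have subL x : x \in L -> [/\ x \in V, x != u & x \notin S].
  by move/(subsetP (cmp_sub _ _ _)) => /setDP [/setD1P [? ?] ?].
have LE a b : a \in L -> E' a b -> E a b.
  move=> /subL [_ _ aS'] /newE [//|[e1 _]|[e1 _]]; subst; by rewrite ?w1S ?w2S in aS'.
have eL : e \in L by apply: cmp_refl.
have cL : conn E L.
  apply: conn_mono (conn_cmp symE' eR) => a b aL _; exact: LE.
have kS x : x \in kap -> x \in S by apply: (subsetP (pr_sub _ _ _ _)).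
have kI a b : a \in L -> b \in S -> E a b -> b \in kap.
  move=> aL bS Eab; rewrite kapE; apply/nbP; exists a; split=> //; [|exact: oldE].
  by apply/negP => /subL []; rewrite bS.
have clL a b : a \in L -> b \in V -> E a b -> [\/ b \in L, b \in kap | a = v /\ b = u].
  move=> aL bV Eab; have [aV' au aS'] := subL a aL; case: (eqVneq b u) => [eb|bu].
    apply: Or33; split=> //; subst b; rewrite symE in Eab.
    by case: (nbu aV' Eab) => // h; subst; rewrite ?w1S ?w2S in aS'.
  case bS : (b \in S); first by apply: Or32; apply: kI bS Eab.
  by apply: Or31; apply: cmp_closed aL _ (oldE Eab); rewrite !inE bu bS.
have [k1 k2] : w1 \in kap /\ w2 \in kap.
  case vL : (v \in L); first by split; apply: kI vL _ _.
  apply: NNPP => nk.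
  have ckE : is_clique kap E.
    move=> a b ak bk ab; case: (newE (ck a b ak bk ab)) => // -[e1 e2]; subst; by case: nk.
  have [t tS tk] := maxatom_pr symE' mS eVu eS.
  have tV : t \in V by have := subsetP SV _ tS; rewrite inE => /andP [].
  have [||||] := atomE (D := L) (K := kap) (x := e) aV _ _ ckE _ tV => //.
  - by apply/subsetP => x /subL [].
  - by move=> a b aL bV /(clL a b aL bV) [h|h|[e1 _]]; [left|right|subst; rewrite aL in vL].
  - by move/subL => []; rewrite tS.
  - by rewrite (negbTE tk).
have adjL w : w \in kap -> adj E L [set w].
  by rewrite kapE => /nbP [x [xL _ _ Exw]]; apply/adjP; exists x, w; rewrite set11; split=> //; apply: LE.
have f1 : fam E' (V :\ u) S (fun s => [set s]).
  split=> [s _|s sS'|s t x _ _ /set1P -> /set1P //]; [exact: conn1|by rewrite sub1set (subsetP SV)].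
have q1 : {in S &, forall s t, E' s t = QE E' (fun s => [set s]) s t}.
  by apply: QE1 => [s _|s t _ _]; [exact: set11|rewrite adj1P].
have aE : atom E' S by case: mS.
have LVu : L \subset V :\ u by apply/subsetP => x /subL [h1 h2 _]; rewrite !inE h2.
have sL : sing L.
  apply: (attached_sing f1 w1S w2S w12 (set11 w1) (set11 w2) simple1) => //.
  - exact: atom_ext aE.
  - by apply: sepm_mono sS => s t sS' tS; rewrite q1.
  - by move=> k kS' x /subL [_ _ xS] /set1P ek; rewrite ek kS' in xS.
  - exact: adjL.
  - exact: adjL.
have k12 x : x \in kap -> x = w1 \/ x = w2.
  move=> xk; apply: NNPP => nx; have xS := kS x xk.
  have [x1 x2] : w1 != x /\ w2 != x by split; apply/eqP => h; apply: nx; auto.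
  have /adjP [e' [_ [e'L /set1P -> Eex]]] := adjL x xk.
  rewrite (sL e' e) // in Eex.
  pose B := absorb_point x e.
  have [B1 B2] : B w1 = [set w1] /\ B w2 = [set w2] by rewrite /B /absorb_point (negbTE x1) (negbTE x2).
  have f2 : fam E' (V :\ u) S B.
    have [c s d] : fam E' (e |: S) S B by apply: (fam_point symE') => //; apply: oldE; rewrite symE.
    split=> // k kS'; apply: subset_trans (s k kS') _; by rewrite subUset sub1set eVu SV.
  have ke t : t \in S -> E' e t -> x != t -> E' x t.
    by move=> tS Eet; apply: ck => //; apply: kI eL tS (LE _ _ eL Eet).
  have q2 : {in S &, forall s t, E' s t = QE E' B s t}.
    apply: QE1 => [s _|s t sS' tS]; first exact: absorb_point_self.
    move=> /adjP [a [b [/absorb_pointP ha /absorb_pointP hb Eab]]] st.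
    case: ha hb Eab st sS' tS => [->|[-> ->]] [->|[-> ->]] Eab st sS' tS //.
    - by rewrite symE'; apply: ke; rewrite // 1?symE' // eq_sym.
    - exact: ke.
    - by rewrite (negbTE (irrE' e)) in Eab.
  have := @family_sing _ S B w1 w2 f2 w1S w2S w12; rewrite B1 B2 => /(_ (set11 _) (set11 _) simple1 _ _ x xS) sg.
  have : e = x.
    apply: sg; [exact: atom_ext aE|by apply: sepm_mono sS => s t sS' tS; rewrite q2|exact: absorb_point_new|exact: absorb_point_self].
  by move=> ex; rewrite ex xS in eS.
case: (clL e y eL yV Eey) => [yL|yk|h]; [|by case: (k12 y yk); [apply: Or31|apply: Or32]|exact: Or33].
by case/negP: (irrE e); rewrite {2}(sL e y).
Qed.

End Component.

End Two.

(** * Three common neighbours separated by one vertex *)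

Section Many.
Variables (T : finType) (E : rel T).
Hypotheses (symE : symmetric E) (irrE : forall x, ~~ E x x).
Variables (V : {set T}) (u v z : T) (w : 'I_3 -> T).
Hypotheses (aV : atom E V) (uV : u \in V) (vV : v \in V) (zV : z \in V) (Euv : E u v) (rig : rigid E V u v) (sV : sepm E V u v).
Hypotheses (zu : z != u) (zv : z != v) (nuz : ~~ E u z).
Hypotheses (wV : forall i, w i \in V) (wv : forall i, w i != v) (uw : forall i, E u (w i)) (vw : forall i, E v (w i)).
Let R := V :\ u :\ v :\ z.
Let C i := cmp E R (w i).
Hypothesis sepw : forall i j, i != j -> w j \notin C i.
Implicit Types (A D K L P Q S U W X Y Z : {set T}).

Let neqE a b : E a b -> a != b. Proof. by move=> Eab; apply: contraNneq (irrE a) => {2}->. Qed.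
Let K := [set u; v; z].

Let wz i : w i != z. Proof. by apply: contraNneq nuz => <-. Qed.
Let wu i : w i != u. Proof. by rewrite eq_sym; apply: neqE. Qed.
Let wR i : w i \in R. Proof. by rewrite !inE wz wv wu wV. Qed.
Let wC i : w i \in C i. Proof. exact: cmp_refl. Qed.
Let cC i : conn E (C i). Proof. exact: conn_cmp. Qed.
Let KV : K \subset V. Proof. by apply/subsetP => x; rewrite !inE -orbA => /or3P [] /eqP ->. Qed.
Let RP x : x \in V -> x \in R \/ x \in K.
Proof. by move=> xV; rewrite !inE xV; case: (x == u); case: (x == v); case: (x == z); auto. Qed.
Let RK x : x \in R -> x \notin K.
Proof. by rewrite !inE !negb_or => /and4P [-> -> ->]. Qed.
Let CP i x : x \in C i -> [/\ x \in V, x \notin K & x \in R].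
Proof. by move=> h; have xR := subsetP (cmp_sub _ _ _) _ h; split=> //; [move: xR; rewrite !inE => /and4P []|exact: RK]. Qed.
Let uK : u \in K. Proof. by rewrite !inE eqxx. Qed.
Let vK : v \in K. Proof. by rewrite !inE eqxx orbT. Qed.
Let zK : z \in K. Proof. by rewrite !inE eqxx orbT. Qed.
Let closedC i a b : a \in C i -> b \in V -> E a b -> b \in C i \/ b \in K.
Proof. by move=> aC bV Eab; case: (RP bV) => h; [left; apply: cmp_closed aC h Eab|right]. Qed.
Let disC' i j x : i != j -> x \in C i -> x \in C j -> False.
Proof.
move=> ij xi xj; have := sepw ij; rewrite -[C i](cmp_eq symE xi) (cmp_eq symE xj) cmp_refl //.
Qed.
Let nadjC i j a b : i != j -> a \in C i -> b \in C j -> ~~ E a b.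
Proof.
move=> ij ai bj; apply/negP => Eab; have [bV bK _] := CP bj.
by case: (closedC ai bV Eab) => h; [apply: (disC' ij h bj)|rewrite h in bK].
Qed.
Let other (i : 'I_3) : exists j k : 'I_3, [/\ j != i, k != i & j != k].
Proof.
case: i => [[|[|[|//]]] h].
- by exists (Ordinal (isT : 1 < 3)), (Ordinal (isT : 2 < 3)).
- by exists (Ordinal (isT : 0 < 3)), (Ordinal (isT : 2 < 3)).
- by exists (Ordinal (isT : 0 < 3)), (Ordinal (isT : 1 < 3)).
Qed.

(** Otherwise the clique {u, v} would separate [C i] from the other components. *)
Let adjz i : exists2 p, p \in C i & E p z.
Proof.
apply: NNPP => nex; have [j [k [ji ki jk]]] := other i.
have [|||||] := atomE (D := C i) (K := [set u; v]) (x := w i) aV _ _ _ _ (wV j).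
- by apply/subsetP => x /CP [].
- exact: wC.
- by move=> a b /set2P [] -> /set2P [] -> //; rewrite ?eqxx // symE.
- move=> a b aC bV Eab; case: (closedC aC bV Eab) => [|bK]; [by left|right].
  move: bK; rewrite !inE => /orP [//|/eqP e]; case: nex; by exists a; rewrite -?e.
- by move=> h; have := sepw (i := i) (j := j); rewrite eq_sym ji h => /(_ isT).
- by rewrite !inE (negbTE (wu j)) (negbTE (wv j)).
Qed.

(** A clique separation of the rest extends to [V] unless it separates [z] from [u] or from [v]. In
    that case the separator has to cut both other components, in two vertices that are not
    adjacent. *)
Let atomC i : atom E (V :\: C i).
Proof.
have KC x : x \in K -> x \notin C i by move=> xK; apply/negP => /CP [_]; rewrite xK.
split; first by exists u; rewrite inE KC // uV.
move=> D DS [d dD] cN t tS; case tD : (t \in D); [by left|right]; apply: contraT => tN; exfalso.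
set M := nb E (V :\: C i) D in cN tN.
pose D' := (V :\: C i) :\: (D :|: M).
have inD' x : x \in D' -> [/\ x \in V, x \notin C i, x \notin D & x \notin M].
  by case/setDP => /setDP [h1 h2]; rewrite inE negb_or => /andP [].
have nDD' x y : x \in D -> y \in D' -> ~~ E x y.
  move=> xD /inD' [yV yC yD yM]; apply: contra yM => Exy; apply/nbP; exists x; split=> //; by rewrite inE yC.
have tD' : t \in D' by rewrite in_setD tS in_setU negb_or tD tN.
have inDV x : x \in D -> x \in V /\ x \notin C i by move/(subsetP DS)/setDP.
have MD x : x \in M -> x \notin D by move/nbP => [? []].
have parts x : x \in V -> x \notin C i -> [\/ x \in D, x \in D' | x \in M].
  move=> xV xC; case xD : (x \in D); [exact: Or31|case xM : (x \in M); [exact: Or33|apply: Or32]].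
  by rewrite in_setD in_setU negb_or xD xM inE xC xV.
have [tV tC] : t \in V /\ t \notin C i by case/setDP: tS.
have noK X Y : (X = D /\ Y = D') \/ (X = D' /\ Y = D) -> exists2 x, x \in X & x \in K.
  move=> hXY; apply: NNPP => nex.
  have XV x : x \in X -> x \in V /\ x \notin C i by case: hXY => -[-> _]; [exact: inDV|case/inD'].
  have XY x y : x \in X -> y \in Y -> ~~ E x y.
    by case: hXY => -[-> ->] h1 h2; [apply: nDD'|rewrite symE; apply: nDD'].
  have [x0 x0X] : exists x, x \in X by case: hXY => -[-> _]; [exists d|exists t].
  have [y0 [y0Y y0V y0X y0M]] : exists y, [/\ y \in Y, y \in V, y \notin X & y \notin M].
    case: hXY => -[-> ->]; first by exists t; rewrite tD.
    exists d; have [h1 h2] := inDV d dD; split=> //; first by apply/negP => /inD' [_ _]; rewrite dD.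
    by apply/negP => /MD; rewrite dD.
  have part x : x \in V -> x \notin C i -> [\/ x \in X, x \in Y | x \in M].
    by move=> h1 h2; case: hXY => -[-> ->]; case: (parts x h1 h2) => h; [apply: Or31|apply: Or32|apply: Or33|apply: Or32|apply: Or31|apply: Or33].
  have [|||] := atomE (D := X) (K := M) (x := x0) aV _ x0X cN _ y0V.
  - by apply/subsetP => x /XV [].
  - move=> a b aX bV Eab; have [aV' aC] := XV a aX.
    have bC : b \notin C i.
      apply/negP => bC; rewrite symE in Eab; case: (closedC bC aV' Eab) => h; first by rewrite h in aC.
      by apply: nex; exists a.
    by case: (part b bV bC) => h; [left|have := XY a b aX h; rewrite Eab|right].
  - by move=> h; rewrite h in y0X.
  - by move=> h; rewrite h in y0M.
have [x xD xK] := noK D D' (or_introl (conj erefl erefl)).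
have [y yD' yK] := noK D' D (or_intror (conj erefl erefl)).
have [p [pK pz hp]] : exists p, [/\ p \in K, (p = u \/ p = v) & (p \in D /\ z \in D') \/ (p \in D' /\ z \in D)].
  have nxy := nDD' x y xD yD'.
  have xy : x != y by apply: contraTneq xD => ->; case/inD': yD'.
  have KE a : a \in K -> [\/ a = u, a = v | a = z].
    by rewrite !inE -orbA => /or3P [] /eqP ->; [apply: Or31|apply: Or32|apply: Or33].
  have Evu : E v u by rewrite symE.
  case: (KE x xK) => ex; case: (KE y yK) => ey; rewrite ?ex ?ey ?eqxx ?Euv ?Evu // in xy nxy xD yD'.
  - by exists u; split; auto.
  - by exists v; split; auto.
  - by exists u; split; auto.
  - by exists v; split; auto.
have cross j : j != i -> exists2 m, m \in C j & m \in M.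
  move=> ji; have [q qC Eqz] := adjz j.
  have Epw : E p (w j) by case: pz => ->.
  have cP : conn E ([set p] :|: (C j :|: [set z])).
    apply: (connU symE (conn1 E p) _ (set11 p) (y := w j)); [|by rewrite inE wC|by right].
    by apply: (connU symE (cC j) (conn1 E z) qC (set11 z)); right.
  have mem a : a \in [set p] :|: (C j :|: [set z]) -> [\/ a = p, a \in C j | a = z].
    by move=> /setUP [/set1P|/setUP [|/set1P]]; [apply: Or31|apply: Or32|apply: Or33].
  have pP : p \in [set p] :|: (C j :|: [set z]) by rewrite !inE eqxx.
  have zP : z \in [set p] :|: (C j :|: [set z]) by rewrite !inE eqxx !orbT.
  have outD a : a \in D' -> a \notin D by case/inD'.
  have [||a [b [aP aD bP bD Eab]]] := conn_cut (L := D) cP.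
  - by case: hp => -[h1 h2]; [exists p|exists z].
  - by case: hp => -[h1 h2]; [exists z|exists p] => //; apply: outD.
  have bC' c : c \in C j -> c \notin C i by move=> h1; apply/negP => h2; apply: (disC' ji h1 h2).
  have bM : b \notin D' by apply/negP => /(nDD' a b aD); rewrite Eab.
  case: (mem b bP) => [e|bC|e].
  - by subst b; case: hp => -[h1 _]; [rewrite h1 in bD|rewrite h1 in bM].
  - exists b => //; have [bV _ _] := CP bC; case: (parts b bV (bC' b bC)) => // h; [by rewrite h in bD|by rewrite h in bM].
  - by subst b; case: hp => -[_ h1]; [rewrite h1 in bM|rewrite h1 in bD].
have [j [k [ji ki jk]]] := other i.
have [a aC aM] := cross j ji; have [b bC bM] := cross k ki.
have ab : a != b by apply/eqP => e; apply: (disC' jk aC); rewrite e.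
by have := nadjC jk aC bC; rewrite (cN a b aM bM ab).
Qed.

(** Makes {u, v, z} a clique, so that removing components [C i] gives sides of clique
    separations. *)
Let E2 := add_edge (add_edge E u z) v z.
Let symE2 : symmetric E2. Proof. by apply: add_edge_sym; apply: add_edge_sym. Qed.
Let oldE2 a b : E a b -> E2 a b. Proof. by move=> h; do 2!apply: add_edge_old. Qed.
Let newE2 a b : E2 a b -> [\/ E a b, (a = u \/ a = v) /\ b = z | a = z /\ (b = u \/ b = v)].
Proof.
by rewrite /E2 /add_edge /= => /or3P [/or3P [h|/andP [/eqP -> /eqP ->]|/andP [/eqP -> /eqP ->]]|/andP [/eqP -> /eqP ->]|/andP [/eqP -> /eqP ->]]; constructor; auto.
Qed.
Let newK a b : E2 a b -> a \notin K -> E a b.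
Proof. by case/newE2 => // [[[->|->] _]|[-> _]]; rewrite !inE eqxx ?orbT. Qed.
Let cK : is_clique K E2.
Proof.
have h1 : E2 u z by rewrite /E2 /add_edge /= !eqxx !orbT.
have h2 : E2 v z by rewrite /E2 /add_edge /= !eqxx !orbT.
have h3 : E2 u v by apply: oldE2.
by move=> a b; rewrite !inE -!orbA => /or3P [] /eqP -> /or3P [] /eqP ->; rewrite ?eqxx // symE2.
Qed.
Let nKC x i : x \in K -> x \notin C i. Proof. by move=> xK; apply/negP => /CP [_]; rewrite xK. Qed.

Let csepC X : (forall x, x \in X -> exists i, x \in C i /\ C i \subset X) -> csep E2 V (V :\: X) K.
Proof.
move=> hX; split=> //.
- exact: subsetDl.
- apply/subsetP => x xK; rewrite inE (subsetP KV) // andbT; apply/negP => /hX [i [xi _]].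
  by have := nKC i xK; rewrite xi.
- move=> x y xV xS /setDP [yV yX] Exy.
  have /hX [i [xC CX]] : x \in X by move: xS; rewrite !inE xV andbT negbK.
  have [_ xK _] := CP xC; case: (closedC xC yV (newK Exy xK)) => [yC|//].
  by rewrite (subsetP CX _ yC) in yX.
Qed.

Let csep1 i : csep E2 V (V :\: C i) K.
Proof. by apply: csepC => x xC; exists i. Qed.

Let csep2 i j : csep E2 V (V :\: (C i :|: C j)) K.
Proof. by apply: csepC => x /setUP [] xC; [exists i; rewrite subsetUl|exists j; rewrite subsetUr]. Qed.

(** If two different components each contained a class, at least four other classes would each need
    a vertex of the three-element set [K]. So some two components contain no class, and the model
    restricts to their complement. *)
Lemma two_pendant : exists i j, i != j /\ sepm E2 (V :\: (C i :|: C j)) u v.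
Proof.
have [I [F [a [B [p [q [m0 [pF qF pq uB vB]]]]]]]] := sV.
have m : model E2 V F a B by apply: model_mono m0 => x y _ _; apply: oldE2.
have [[cB sB dB] aF cF adjF] := m.
have block i j k l : i != j -> k \in F -> l \in F -> (forall x, x \in B k -> x \notin V :\: C i) -> (forall x, x \in B l -> x \notin V :\: C j) -> False.
  move=> ij kF lF mi mj.
  have cov x : x \in V -> x \in V :\: C i \/ x \in V :\: C j.
    move=> xV; rewrite !in_setD xV !andbT; case xi : (x \in C i); [right|by left].
    by apply/negP => /(disC' ij xi).
  have [e ne] := two_sides_antipodal (csep1 i) (csep1 j) cov m kF lF mi mj.
  have hK := two_sides_K symE2 (csep1 i) (csep1 j) cov m kF lF mi mj.
  have c4 : 4 <= #|F :\ k :\ l|.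
    case: cF => [[_ /(_ k kF)]|[c6 _]]; first by move=> h; move: ne; rewrite e h eqxx.
    by move: c6; rewrite (cardsD1 k) kF (cardsD1 l) !inE eq_sym ne lF !add1n => -[->].
  have c3 : #|K| <= 3 by rewrite /K setUC cardsU1 cards2; case: (_ \in _); case: (u != v).
  pose f t := odflt u [pick x in B t | x \in K].
  have fP t : t \in F :\ k :\ l -> f t \in B t /\ f t \in K.
    move=> /setD1P [tl /setD1P [tk tF]]; have [x xB xK] := hK t tF tk tl; rewrite /f.
    by case: pickP => [y /andP [? ?] //|/(_ x)] /=; rewrite xB xK.
  have inj : {in F :\ k :\ l &, injective f}.
    move=> s t sF tF est; have [h1 _] := fP s sF; have [h2 _] := fP t tF.
    have sF' : s \in F by case/setD1P: sF => _ /setD1P [].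
    have tF' : t \in F by case/setD1P: tF => _ /setD1P [].
    by apply: (dB s t (f s)) => //; rewrite est.
  have : #|f @: (F :\ k :\ l)| <= #|K|.
    by apply: subset_leq_card; apply/subsetP => x /imsetP [t tF ->]; case: (fP t tF).
  rewrite card_in_imset // => h; have := leq_trans c4 (leq_trans h c3); by [].
have nmet i : ~ met F B (V :\: C i) -> exists2 t, t \in F & forall x, x \in B t -> x \notin V :\: C i.
  move=> nm; apply: NNPP => nex; apply: nm => k kF; apply: NNPP => n1; apply: nex; exists k => // x xB.
  by apply/negP => xS; apply: n1; exists x.
have [i [j [ij mi mj]]] : exists i j, [/\ i != j, met F B (V :\: C i) & met F B (V :\: C j)].
  pose i0 := Ordinal (isT : 0 < 3); pose i1 := Ordinal (isT : 1 < 3); pose i2 := Ordinal (isT : 2 < 3).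
  case: (classic (met F B (V :\: C i0))) => [m0'|/nmet [t0 t0F h0]].
    case: (classic (met F B (V :\: C i1))) => [m1'|/nmet [t1 t1F h1]]; first by exists i0, i1.
    case: (classic (met F B (V :\: C i2))) => [m2'|/nmet [t2 t2F h2]]; first by exists i0, i2.
    by case: (@block i1 i2 t1 t2).
  exists i1, i2; split=> //.
    by apply: NNPP => /nmet [t tF h]; case: (@block i0 i1 t0 t).
  by apply: NNPP => /nmet [t tF h]; case: (@block i0 i2 t0 t).
exists i, j; split=> //; set S0 := V :\: (C i :|: C j).
have mt : met F B S0.
  move=> k kF; have [x xB xS] := mi k kF; have [y yB yS] := mj k kF.
  have /setDP [xV xi] := xS; have /setDP [yV yj] := yS.
  case yi : (y \in C i); last by exists y; rewrite // in_setD in_setU yi (negbTE yj).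
  have [||s [t [sB' sC tB tC Est]]] := conn_cut (L := C i) (cB k kF); [by exists y|by exists x|].
  have [sV' sK _] := CP sC.
  have tV := subsetP (sB k kF) _ tB.
  have tK : t \in K by case: (closedC sC tV (newK Est sK)) => // h; rewrite h in tC.
  by exists t; rewrite // in_setD in_setU (negbTE (nKC i tK)) (negbTE (nKC j tK)).
have hS := csep_hull (csep2 i j).
have KS x : x \in K -> x \in S0 by move=> xK; rewrite /S0 in_setD in_setU (negbTE (nKC i xK)) (negbTE (nKC j xK)) (subsetP KV).
exists I, F, a, (fun k => B k :&: S0), p, q; split; first exact: (model_hull symE2 hS m mt).
by split; rewrite // inE ?uB ?vB KS.
Qed.

(* [z] regains its two lost edges by absorbing a vertex seeing [u], [v] and [z]. *)
Let lift_z (E' : rel T) S q : symmetric E' -> u \in S -> v \in S -> z \in S -> q \notin S -> E' q u -> E' q v -> E' q z ->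
  {in S &, forall x y, E x y -> E' x y} -> sepm E2 S u v -> sepm E' (q |: S) u v.
Proof.
move=> symE' uS vS zS qS Equ Eqv Eqz sub s.
apply: (sepm_point symE' (x := z) (y := q) zS qS _ _ s); rewrite ?absorb_point_self //; first by rewrite symE'.
move=> a b aS bS /newE2 [h|[[->|->] ->]|[-> [->|->]]].
- by split; [exact: neqE|apply: Or31; apply: sub].
- by split; [rewrite eq_sym|apply: Or33; rewrite symE'].
- by split; [rewrite eq_sym|apply: Or33; rewrite symE'].
- by split=> //; apply: Or32.
- by split=> //; apply: Or32.
Qed.

(** Contracted to one vertex, [C i] sees [u], [v] and [z]; merging it with [z] restores the edges
    added in [E2], so rigidity applies. *)
Let pendant_sing i j : i != j -> sepm E2 (V :\: (C i :|: C j)) u v -> C i = [set w i].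
Proof.
move=> ij s; set S0 := V :\: (C i :|: C j) in s.
pose B x := if x == w i then C i else [set x].
have Bw : B (w i) = C i by rewrite /B eqxx.
have Bo x : x != w i -> B x = [set x] by rewrite /B => /negbTE ->.
pose S := w i |: (V :\: C i).
have wiD : w i \notin V :\: C i by rewrite inE wC.
have oth x : x \in V :\: C i -> x != w i by apply: contraTneq => ->.
have BP x y : x \in S -> y \in B x -> (x = w i /\ y \in C i) \/ (y = x /\ x \notin C i).
  case/setU1P => [->|xS]; first by rewrite Bw; left.
  by rewrite (Bo x (oth x xS)) => /set1P; right; case/setDP: xS.
have fB : fam E V S B.
  split=> [x xS|x xS|x y t xS yS].
  - by rewrite /B; case: eqP => _; [exact: cC|exact: conn1].
  - apply/subsetP => y /(BP x y xS) [[_ /CP []] //|[-> xC]].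
    by case/setU1P: xS => [->|/setDP []].
  - move=> /(BP x t xS) [[-> h1]|[e1 h1]] /(BP y t yS) [[-> h2]|[e2 h2]] //.
    + by rewrite -e2 h1 in h2.
    + by rewrite -e1 h2 in h1.
    + by rewrite -e1 -e2.
have symQ : symmetric (QE E B) := QE_sym symE B.
have eQ : {in V :\: C i &, forall x y, E x y = QE E B x y}.
  move=> x y xS yS; rewrite /QE /= !Bo ?oth // adj1P; case: (eqVneq x y) => [->|//]; exact: negbTE.
have KS x : x \in K -> x \in V :\: C i by move=> xK; rewrite inE (nKC i xK) (subsetP KV).
have Qw x : x \in K -> (exists2 a, a \in C i & E a x) -> QE E B (w i) x.
  move=> xK [a aC Eax]; have xw := oth x (KS x xK); rewrite /QE /= eq_sym xw Bw Bo //=.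
  by apply/adjP; exists a, x; rewrite set11.
have Qu : QE E B (w i) u by apply: Qw => //; exists (w i); rewrite // symE.
have Qv : QE E B (w i) v by apply: Qw => //; exists (w i); rewrite // symE.
have Qz : QE E B (w i) z by apply: Qw => //; apply: adjz.
have aQ : atom (QE E B) S.
  apply: (atom_attach symQ (p := u) (q := z)) => //; rewrite ?KS //.
  - exact: atom_ext (atomC i).
  - by rewrite eq_sym.
  - by rewrite -eQ ?KS.
have uw' : u != w i by rewrite eq_sym.
have vw' : v != w i by rewrite eq_sym.
have S0K x : x \in K -> x \in S0 by move=> xK; rewrite /S0 in_setD in_setU (negbTE (nKC i xK)) (negbTE (nKC j xK)) (subsetP KV).
have S0S : S0 \subset V :\: C i by apply: setDS; apply: subsetUl.
have sQ : sepm (QE E B) S u v.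
  apply: (sepm_sub (V := w i |: S0)); first by apply: setUS.
  apply: lift_z => //; try exact: S0K; first by rewrite /S0 in_setD in_setU wC.
  by move=> x y /(subsetP S0S) xS /(subsetP S0S) yS; rewrite eQ.
have fs : fsimple E u v (B u) (B v) by rewrite !Bo // => x y /set1P -> /set1P ->.
have inS x : x \in K -> x \in S by move=> xK; apply/setU1P; right; apply: KS.
have sg := rig fB (inS u uK) (inS v vK) (neqE Euv) _ _ fs aQ sQ (setU11 _ _).
rewrite (Bo u uw') (Bo v vw') Bw in sg; have {}sg := sg (set11 u) (set11 v).
by apply/setP => x; rewrite inE; apply/idP/eqP => [xC|-> //]; apply: sg.
Qed.

(** The two removed components are single vertices, both with neighbours [u], [v], [z]. One can be
    deleted because the other still restores the edges to [z]. *)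
Lemma pendant_pair : exists a b, [/\ a \in V, b \in V & a != b] /\ [/\ a != u, a != v, b != u & b != v] /\
  [/\ forall y, y \in V -> E a y -> E b y, atom E (V :\ a), rigid E (V :\ a) u v & sepm E (V :\ a) u v].
Proof.
have [i [j [ij s]]] := two_pendant.
have Ci := pendant_sing ij s.
have Cj : C j = [set w j] by apply: (pendant_sing (j := i)); rewrite 1?eq_sym // setUC.
have wij : w i != w j by apply/eqP => e; apply: (disC' ij (wC i)); rewrite e.
have Ez t : C t = [set w t] -> E (w t) z by move=> e; have [p] := adjz t; rewrite e => /set1P ->.
exists (w i), (w j); split=> //; split=> //.
have eV : V :\ w i = V :\: C i by rewrite Ci.
split.
- move=> y yV Ey; case: (closedC (wC i) yV Ey).
    by rewrite Ci => /set1P e; rewrite e (negbTE (irrE _)) in Ey.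
  by rewrite !inE -orbA => /or3P [] /eqP ->; rewrite ?Ez // symE.
- by rewrite eV; apply: atomC.
- move=> I S B k l [c sb d] kS lS kl uB vB fs aS sS.
  apply: (rig (i := k) (j := l)) => //; split=> // t tS; apply: subset_trans (sb t tS) (subsetDl _ _).
- set S0 := V :\: (C i :|: C j) in s.
  have S0K x : x \in K -> x \in S0 by move=> xK; rewrite /S0 in_setD in_setU (negbTE (nKC i xK)) (negbTE (nKC j xK)) (subsetP KV).
  apply: (sepm_sub (V := w j |: S0)).
    rewrite subUset sub1set !inE eq_sym wij wV; apply/subsetP => x /setDP [xV].
    by rewrite in_setU negb_or Ci in_set1 in_setD1 xV andbT => /andP [].
  apply: lift_z => //; try exact: S0K; [by rewrite /S0 in_setD in_setU wC orbT|by rewrite symE|by rewrite symE|exact: Ez].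
Qed.

End Many.

(** * A third common neighbour *)

Section Third.
Variables (T : finType) (E : rel T).
Hypotheses (symE : symmetric E) (irrE : forall x, ~~ E x x).
Variables (V : {set T}) (u v w1 w2 w3 : T).
Hypotheses (aV : atom E V) (uV : u \in V) (vV : v \in V) (Euv : E u v) (rig : rigid E V u v) (sV : sepm E V u v).
Hypotheses (cl : clean E V u v) (w1V : w1 \in V) (w2V : w2 \in V) (w3V : w3 \in V) (nw : ~~ E w1 w2).
Hypotheses (w12 : w1 != w2) (w13 : w1 != w3) (w23 : w2 != w3) (w3v : w3 != v).
Hypotheses (uw1 : E u w1) (uw2 : E u w2) (uw3 : E u w3) (vw1 : E v w1) (vw2 : E v w2).

(** If the three neighbours root a triangle outside [u], [v], then [V] is a K_5, although [w1] and
    [w2] are nonadjacent. Otherwise a vertex [z] separates them; it is not adjacent to [u], since by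
    cleanness {u, v, z} would be a clique separator. *)
Lemma third_neighbour : exists a b, [/\ a \in V, b \in V & a != b] /\ [/\ a != u, a != v, b != u & b != v] /\
  [/\ forall y, y \in V -> E a y -> E b y, atom E (V :\ a), rigid E (V :\ a) u v & sepm E (V :\ a) u v].
Proof.
have neqE a b : E a b -> a != b by move=> Eab; apply: contraNneq (irrE a) => {2}->.
have vw3 : E v w3 by apply: cl.
have neqE' a b : E a b -> b != a by move=> h; rewrite eq_sym; apply: neqE.
pose Z := V :\ u :\ v.
have inZ x : x \in V -> E u x -> E v x -> x \in Z by move=> xV h1 h2; rewrite !inE !neqE'.
have [z1 z2 z3] : [/\ w1 \in Z, w2 \in Z & w3 \in Z] by split; apply: inZ.
have cuv : is_clique [set u; v] E.
  by move=> a b /set2P [] -> /set2P [] -> //; rewrite ?eqxx // symE.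
have ZV x : x \in Z -> [/\ x \in V, x != u & x != v] by rewrite !inE => /and3P [].
have cZ : conn E Z.
  suff -> : Z = cmp E Z w1 by apply: conn_cmp.
  apply/eqP; rewrite eqEsubset cmp_sub andbT; apply/subsetP => x /[dup] xZ /ZV [xV xu xv].
  have [||||] := atomE (D := cmp E Z w1) (x := w1) aV _ _ cuv _ xV.
  - by apply/subsetP => t /(subsetP (cmp_sub _ _ _)) /ZV [].
  - exact: cmp_refl.
  - move=> a b aC bV Eab; case: (boolP (b \in Z)) => bZ; first by left; apply: cmp_closed aC bZ Eab.
    by right; move: bZ; rewrite !inE bV andbT negb_and !negbK orbC.
  - by [].
  - by rewrite !inE (negbTE xu) (negbTE xv).
case: (root3 symE cZ z1 z2 z3 w12 w13 w23) => [[S1 [S2 [S3 h]]]|[z [zZ n12 n13 n23]]].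
  have {h} [[m1 m2 m3] [[c1 c2 c3] [[s1 s2 s3] [[d12 d13 d23] [a12 a13 a23]]]]] := h.
  have sZV (S : {set T}) : S \subset Z -> S \subset V by move=> hS; apply/subsetP => x /(subsetP hS) /ZV [].
  have dZ (S : {set T}) x : S \subset Z -> x = u \/ x = v -> dis [set x] S.
    by move=> h hx y /set1P -> /(subsetP h) /ZV [_]; case: hx => ->; rewrite eqxx.
  have f5 : five E V [set u] [set v] S1 S2 S3.
    split; splitall; rewrite ?sub1set ?sZV //; try exact: conn1; try (by apply: dZ => //; auto).
    - by apply: dis11; apply: neqE.
    - exact: adj11.
    - by apply/adjP; exists u, w1; rewrite set11.
    - by apply/adjP; exists u, w2; rewrite set11.
    - by apply/adjP; exists u, w3; rewrite set11.
    - by apply/adjP; exists v, w1; rewrite set11.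
    - by apply/adjP; exists v, w2; rewrite set11.
    - by apply/adjP; exists v, w3; rewrite set11.
  have [a [b [c [eV [_ _ _ aa]]]]] := five_base symE Euv rig aV f5.
  move: aa; rewrite !adj1P => -[_ [_ [Eab Eac Ebc]]]; exfalso; case/negP: nw.
  have in3 x : x \in Z -> [\/ x = a, x = b | x = c].
    move=> /ZV [xV xu xv]; move: xV; rewrite eV !inE (negbTE xu) (negbTE xv) /= -orbA.
    by case/or3P => /eqP ->; [apply: Or31|apply: Or32|apply: Or33].
  by case: (in3 w1 z1) (in3 w2 z2) => e1 [] e2; move: w12; rewrite e1 e2 ?eqxx // symE.
have [zV zu zv] := ZV z zZ.
have nuz : ~~ E u z.
  apply/negP => Euz; have Evz := cl zV Euz zv.
  have cK : is_clique [set u; v; z] E.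
    by move=> a b; rewrite !inE -!orbA => /or3P [] /eqP -> /or3P [] /eqP ->; rewrite ?eqxx // symE.
  have sep a b : a \in Z -> b \in Z -> a != z -> b != z -> b \notin cmp E (Z :\ z) a -> False.
    move=> aZ bZ az bz nb; have [bV bu bv] := ZV b bZ.
    have [||||] := atomE (D := cmp E (Z :\ z) a) (x := a) aV _ _ cK _ bV.
    - by apply/subsetP => t /(subsetP (cmp_sub _ _ _)) /setD1P [_] /ZV [].
    - by apply: cmp_refl; rewrite in_setD1 az.
    - move=> c d cC dV Ecd; case: (boolP (d \in Z :\ z)) => dZ; first by left; apply: cmp_closed cC dZ Ecd.
      right; move: dZ; rewrite !inE dV andbT !negb_and !negbK; case: (d == z); case: (d == u); by case: (d == v).
    - by move=> h; rewrite h in nb.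
    - by rewrite !inE (negbTE bu) (negbTE bv) (negbTE bz).
  case: (eqVneq w1 z) => [e|n1]; first by apply: (sep w2 w3) => //; rewrite -e eq_sym.
  case: (eqVneq w2 z) => [e|n2]; first by apply: (sep w1 w3) => //; rewrite -e eq_sym.
  exact: (sep w1 w2).
pose w (i : 'I_3) := nth w1 [:: w1; w2; w3] i.
have all3 (P : T -> Prop) : P w1 -> P w2 -> P w3 -> forall i, P (w i) by move=> h1 h2 h3 [[|[|[|//]]] h].
have rev a b : b \notin cmp E (Z :\ z) a -> a \notin cmp E (Z :\ z) b.
  move=> h; apply: contra h => h; rewrite (cmp_eq symE h); apply: cmp_refl; exact: cmp_in h.
apply: (@pendant_pair _ E symE irrE V u v z w) => //.
- exact: (all3 (fun x => x \in V)).
- by apply: (all3 (fun x => x != v)) => //; apply: neqE'.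
- exact: (all3 (E u)).
- exact: (all3 (E v)).
have [n21 n31 n32] : [/\ w1 \notin cmp E (Z :\ z) w2, w1 \notin cmp E (Z :\ z) w3 & w2 \notin cmp E (Z :\ z) w3] by split; apply: rev.
by move=> [[|[|[|//]]] h] [[|[|[|//]]] k].
Qed.

End Third.

(** * Induction over rigid pairs *)

Section Induction.
Variables (T : finType) (Q : rel T -> {set T} -> T -> T -> Prop).
Hypothesis Q_base : forall (E : rel T) (V : {set T}) u v, symmetric E -> (forall x, ~~ E x x) -> baseK5 E V u v \/ baseK222 E V u v -> Q E V u v.
Hypothesis Q_sym : forall (E : rel T) (V : {set T}) u v, Q E V v u -> Q E V u v.
Hypothesis Q_fold : forall (E : rel T) (V : {set T}) u v a b, symmetric E -> (forall x, ~~ E x x) -> [/\ a \in V, b \in V & a != b] ->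
  [/\ a != u, a != v, b != u & b != v] -> (forall y, y \in V -> E a y -> E b y) -> Q E (V :\ a) u v -> Q E V u v.
Hypothesis Q_join : forall (E : rel T) (V : {set T}) u v w1 w2 (S : {set T}), symmetric E -> (forall x, ~~ E x x) -> u \in V -> v \in V -> E u v ->
  S \subset V :\ u -> [/\ w1 \in S, w2 \in S, w1 != w2 & ~~ E w1 w2] -> [/\ E u w1, E u w2, E v w1 & E v w2] ->
  (forall y, y \in V -> E u y -> [\/ y = v, y = w1 | y = w2]) ->
  (forall e y, e \in V -> e \notin S -> e != u -> y \in V -> E e y -> [\/ y = w1, y = w2 | e = v /\ y = u]) ->
  Q (add_edge E w1 w2) S w1 w2 -> Q E V u v.

(** Induction on the number of vertices, with [E] varying because a join adds an edge. Geometry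
    enters only through the closure properties assumed of [Q]. *)
Theorem rigid_induction (E : rel T) (V : {set T}) u v : symmetric E -> (forall x, ~~ E x x) -> u \in V -> v \in V -> E u v ->
  atom E V -> rigid E V u v -> sepm E V u v -> Q E V u v.
Proof.
move: {2}#|V| (leqnn #|V|) => n; elim: n E V u v => [|n IH] E V u v h symE irrE uV vV Euv aV rig sV.
  by move: h; rewrite leqn0 cards_eq0 => /eqP e; rewrite e inE in uV.
have lt (S : {set T}) x : x \in V -> S \subset V :\ x -> #|S| <= n.
  move=> xV /subset_leq_card h'; rewrite -ltnS; apply: leq_trans h; by rewrite (cardsD1 x V) xV add1n ltnS.
have one a b : a \in V -> b \in V -> E a b -> rigid E V a b -> sepm E V a b -> step E V a b -> Q E V a b.
  move=> aV' bV Eab rg sb [cl [w1 [w2 [[w1V w2V w12 nw] [aw1 aw2 bw1 bw2 gd]]]]].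
  case: (classic (exists w3, [/\ w3 \in V, E a w3, w3 != b, w1 != w3 & w2 != w3])) => [[w3 [w3V aw3 w3b w13 w23]]|nex].
    have [c [d [h1 [h2 [h3 h4 h5 h6]]]]] := third_neighbour symE irrE aV aV' bV Eab rg sb cl w1V w2V w3V nw w12 w13 w23 w3b aw1 aw2 aw3 bw1 bw2.
    apply: (Q_fold symE irrE h1 h2 h3); have [cV dV cd] := h1; have [ca cb da db] := h2.
    by apply: IH => //; rewrite ?inE ?(eq_sym a) ?(eq_sym b) ?ca ?cb //; apply: (lt _ c).
  have nba y : y \in V -> E a y -> [\/ y = b, y = w1 | y = w2].
    move=> yV Eay; case: (eqVneq y b) => [->|yb]; first exact: Or31.
    case: (eqVneq w1 y) => [->|y1]; first exact: Or32.
    case: (eqVneq w2 y) => [->|y2]; first exact: Or33.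
    by case: nex; exists y.
  have [S0 [S0V w1S w2S aS sS]] := gd.
  have [S mS sub] := maxatom_ex S0V aS.
  have [SV aS' _] := mS.
  have [w1S' w2S'] : w1 \in S /\ w2 \in S by split; apply: (subsetP sub).
  have sS' := sepm_sub sub sS.
  have rg' := rigid_side symE irrE aV' bV Eab rg nw aw1 aw2 bw1 bw2 nba mS.
  apply: (Q_join (w1 := w1) (w2 := w2) (S := S)) => //.
    exact: (outside_side symE irrE aV aV' bV Eab rg w12 nw aw1 aw2 bw1 bw2 nba mS).
  have irrE' x : ~~ add_edge E w1 w2 x x.
    rewrite /add_edge /= (negbTE (irrE x)) /=; apply/norP.
    by split; apply/negP => /andP [/eqP e1 /eqP e2]; move: w12; rewrite -e1 -e2 eqxx.
  apply: IH => //; [exact: (lt _ a)|exact: add_edge_sym|by rewrite /add_edge /= !eqxx orbT].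
case: (base_or_step symE irrE aV uV vV Euv rig sV) => [hb|[st|st]]; first exact: Q_base.
- exact: one.
- apply: Q_sym; apply: one => //; [by rewrite symE|exact: rigid_sym|exact: sepm_sym].
Qed.

End Induction.

Local Open Scope ring_scope.

(** * Realizations in space *)

Section Points.
Variable R : realType.
Implicit Types (x y z m : 'rV[R]_3) (t : R).

Definition vec (a b c : R) : 'rV[R]_3 := \row_i nth 0 [:: a; b; c] i.
(** [k1] and [k2] are the second and third index in the form produced by [big_ord_recl]. *)
Definition k1 : 'I_3 := lift ord0 ord0.
Definition k2 : 'I_3 := lift ord0 (lift ord0 ord0).

Lemma sqdist3 x y : sqdist x y = (x 0 0 - y 0 0) ^+ 2 + ((x 0 k1 - y 0 k1) ^+ 2 + (x 0 k2 - y 0 k2) ^+ 2).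
Proof. by rewrite /sqdist !big_ord_recl big_ord0 addr0. Qed.

Lemma sqdist_vec (a b c a' b' c' : R) : sqdist (vec a b c) (vec a' b' c') = (a - a') ^+ 2 + ((b - b') ^+ 2 + (c - c') ^+ 2).
Proof. by rewrite sqdist3 !mxE. Qed.

Lemma sqdistC x y : sqdist x y = sqdist y x.
Proof. by rewrite !sqdist3; ring. Qed.

Lemma sqdist_ge0 x y : 0 <= sqdist x y.
Proof. by apply: sumr_ge0 => i _; apply: sqr_ge0. Qed.

Lemma sqdist_eq0 x y : sqdist x y = 0 -> x = y.
Proof.
move=> h; apply/rowP => i; apply/eqP; rewrite -subr_eq0 -sqrf_eq0; apply/eqP.
by apply: (psumr_eq0P (P := xpredT) _ h) => // j _; apply: sqr_ge0.
Qed.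

(** Stewart's theorem. *)
Lemma stewart x1 x2 y t :
  sqdist (x1 + t *: (x2 - x1)) y = (1 - t) * sqdist x1 y + t * sqdist x2 y - t * (1 - t) * sqdist x1 x2.
Proof. by rewrite !sqdist3 !mxE; ring. Qed.

(* The two prescribed distances force [x] onto the line through [x1] and [x2]. *)
Lemma stewart_collinear x1 x2 x y t : sqdist x x1 = t ^+ 2 * sqdist x1 x2 -> sqdist x x2 = (1 - t) ^+ 2 * sqdist x1 x2 ->
  sqdist x y = (1 - t) * sqdist x1 y + t * sqdist x2 y - t * (1 - t) * sqdist x1 x2.
Proof.
move=> h1 h2; have /sqdist_eq0 <- : sqdist (x1 + t *: (x2 - x1)) x = 0.
  by rewrite stewart !(sqdistC _ x) h1 h2; ring.
exact: stewart.
Qed.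

Lemma line_sqdist x1 x2 t : sqdist (x1 + t *: (x2 - x1)) x1 = t ^+ 2 * sqdist x1 x2 /\
  sqdist (x1 + t *: (x2 - x1)) x2 = (1 - t) ^+ 2 * sqdist x1 x2.
Proof. by split; rewrite !sqdist3 !mxE; ring. Qed.

(** The midpoint is shifted along a unit vector orthogonal to [x2 - x1], by the length that
    Pythagoras prescribes. *)
Lemma bisector x1 x2 (r : R) : sqdist x1 x2 <= 4 * r -> exists m, sqdist m x1 = r /\ sqdist m x2 = r.
Proof.
move=> h.
have [n1 [n2 [n3 [nn np]]]] : exists n1 n2 n3, n1 ^+ 2 + n2 ^+ 2 + n3 ^+ 2 = 1 /\
    n1 * (x2 0 0 - x1 0 0) + n2 * (x2 0 k1 - x1 0 k1) + n3 * (x2 0 k2 - x1 0 k2) = 0.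
  set a := x2 0 0 - _; set b := x2 0 k1 - _; set c := x2 0 k2 - _.
  (* The unit normal is the first basis vector if the first two coordinates of the difference
     vanish, and otherwise these coordinates turned by a right angle and normalized. *)
  case: (eqVneq (a ^+ 2 + b ^+ 2) 0) => [e|ne].
    have : a ^+ 2 = 0 by have := sqr_ge0 a; have := sqr_ge0 b; lra.
    by move/eqP; rewrite sqrf_eq0 => /eqP ->; exists 1, 0, 0; split; ring.
  have p : 0 <= a ^+ 2 + b ^+ 2 by rewrite addr_ge0 // sqr_ge0.
  have s2 := sqr_sqrtr p; set s := Num.sqrt _ in s2.
  have s0 : s != 0 by apply: contraNneq ne => e; rewrite -s2 e expr0n.
  exists (- b / s), (a / s), 0; split; last by field.
  rewrite expr0n addr0 !expr_div_n s2 sqrrN; field; by [].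
pose s := Num.sqrt (r - sqdist x1 x2 / 4).
have s2 : s ^+ 2 = r - sqdist x1 x2 / 4 by apply: sqr_sqrtr; lra.
exists (vec ((x1 0 0 + x2 0 0) / 2 + s * n1) ((x1 0 k1 + x2 0 k1) / 2 + s * n2) ((x1 0 k2 + x2 0 k2) / 2 + s * n3)).
rewrite !sqdist3 !mxE /= in s2 *; move: nn np s2; move: (x1 0 0) (x1 0 k1) (x1 0 k2) (x2 0 0) (x2 0 k1) (x2 0 k2).
move=> a b c a' b' c' nn np s2; split; apply/eqP; rewrite -subr_eq0; apply/eqP.
  transitivity (s ^+ 2 * (n1 ^+ 2 + n2 ^+ 2 + n3 ^+ 2) + s * (n1 * (a' - a) + n2 * (b' - b) + n3 * (c' - c))
     + ((a - a') ^+ 2 + ((b - b') ^+ 2 + (c - c') ^+ 2)) / 4 - r); first by field.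
  by rewrite nn np s2; field.
transitivity (s ^+ 2 * (n1 ^+ 2 + n2 ^+ 2 + n3 ^+ 2) - s * (n1 * (a' - a) + n2 * (b' - b) + n3 * (c' - c))
   + ((a - a') ^+ 2 + ((b - b') ^+ 2 + (c - c') ^+ 2)) / 4 - r); first by field.
by rewrite nn np s2; field.
Qed.

Definition dot3 (a b : R * R * R) := a.1.1 * b.1.1 + a.1.2 * b.1.2 + a.2 * b.2.
Definition det3 (a b c : R * R * R) := a.1.1 * (b.1.2 * c.2 - b.2 * c.1.2) - a.1.2 * (b.1.1 * c.2 - b.2 * c.1.1)
  + a.2 * (b.1.1 * c.1.2 - b.1.2 * c.1.1).

(** In space, [x] is parallel to the component of [y] orthogonal to [a] and [b]. The identity
    follows from writing products of two determinants as Gram determinants. *)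
Lemma gram (a b x y : R * R * R) : dot3 a a = 1 -> dot3 b b = 1 -> dot3 a b = 0 -> dot3 a x = 0 -> dot3 b x = 0 ->
  (dot3 x y) ^+ 2 = dot3 x x * (dot3 y y - dot3 a y ^+ 2 - dot3 b y ^+ 2).
Proof.
have g (p q : R * R * R) : det3 a b p * det3 a b q = dot3 a a * (dot3 b b * dot3 p q - dot3 b q * dot3 b p)
    - dot3 a b * (dot3 a b * dot3 p q - dot3 b q * dot3 a p) + dot3 a q * (dot3 a b * dot3 b p - dot3 b b * dot3 a p).
  by rewrite /det3 /dot3; ring.
move=> aa bb ab ax bx.
have h1 := g x y; have h2 := g x x; have h3 := g y y.
rewrite aa bb ab ax bx in h1 h2 h3.
have -> : dot3 x y = det3 a b x * det3 a b y by rewrite h1; ring.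
rewrite exprMn !expr2 h2 h3; ring.
Qed.

Definition rel_to (o x : 'rV[R]_3) : R * R * R := (x 0 0 - o 0 0, x 0 k1 - o 0 k1, x 0 k2 - o 0 k2).

Lemma dot_sqdist (o x y : 'rV[R]_3) : dot3 (rel_to o x) (rel_to o y) = (sqdist x o + sqdist y o - sqdist x y) / 2.
Proof. by rewrite !sqdist3 /dot3 /=; field. Qed.

Lemma sqr_eq4 (a : R) : a ^+ 2 = 4 -> a = 2 \/ a = -2.
Proof.
have -> : 4 = 2 ^+ 2 :> R by ring.
by move/eqP; rewrite eqf_sqr => /orP [] /eqP; auto.
Qed.

(** Seen from [c], the points [a], [b], [u] are orthonormal; the lengths at [v] fix its first two
    coordinates and its norm, hence the third coordinate up to sign. *)
Lemma K5_values (a b c u v : 'rV[R]_3) : sqdist a c = 1 -> sqdist b c = 1 -> sqdist a b = 2 -> sqdist u c = 1 -> sqdist u a = 2 -> sqdist u b = 2 ->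
  sqdist v c = 4 -> sqdist v a = 5 -> sqdist v b = 5 -> sqdist u v = 1 \/ sqdist u v = 9.
Proof.
move=> ac bc ab uc ua ub vc va vb.
have := gram (a := rel_to c a) (b := rel_to c b) (x := rel_to c u) (rel_to c v).
have xx (x : 'rV[R]_3) : sqdist x x = 0 by rewrite sqdist3; ring.
rewrite !dot_sqdist !xx (sqdistC a u) (sqdistC b u) (sqdistC a v) (sqdistC b v) ac bc ab uc ua ub vc va vb => h.
have /sqr_eq4 [e|e] : ((1 + 4 - sqdist u v) / 2) ^+ 2 = 4 by rewrite h; field.
  by left; lra.
by right; lra.
Qed.

(** The lengths force [c] to be the midpoint of [o] and [u'], which determines the distances of the
    nonadjacent pairs [c], [d] and [v], [o]. Then [c], [d], [u] are orthonormal seen from [o], and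
    only the sign of one coordinate of [v] remains free. *)
Lemma K222_values (o u' c d u v : 'rV[R]_3) : sqdist u' o = 4 -> sqdist c o = 1 -> sqdist u' c = 1 -> sqdist d o = 1 -> sqdist u' d = 5 ->
  sqdist u o = 1 -> sqdist u c = 2 -> sqdist u d = 2 -> sqdist v c = 4 -> sqdist v u' = 5 -> sqdist v d = 6 ->
  sqdist u v = 2 \/ sqdist u v = 10.
Proof.
move=> u'o co u'c dO u'd uo uc ud vc vu' vd.
have mid (y : 'rV[R]_3) : sqdist c y = (1 - 2^-1) * sqdist o y + 2^-1 * sqdist u' y - 2^-1 * (1 - 2^-1) * sqdist o u'.
  by apply: stewart_collinear; rewrite (sqdistC o) u'o ?(sqdistC c u') ?co ?u'c; field.
have m1 := mid d; have m2 := mid v; rewrite !(sqdistC o) (sqdistC c v) (sqdistC u' v) in m1 m2.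
have cd : sqdist c d = 2 by rewrite m1 dO u'd u'o; field.
have vo : sqdist v o = 5 by move: m2; rewrite vc vu' u'o; lra.
have := gram (a := rel_to o c) (b := rel_to o d) (x := rel_to o u) (rel_to o v).
have xx (x : 'rV[R]_3) : sqdist x x = 0 by rewrite sqdist3; ring.
rewrite !dot_sqdist !xx (sqdistC c u) (sqdistC d u) (sqdistC c v) (sqdistC d v) co dO cd uo uc ud vo vc vd => h.
have /sqr_eq4 [e|e] : ((1 + 5 - sqdist u v) / 2) ^+ 2 = 4 by rewrite h; field.
  by left; lra.
by right; lra.
Qed.

(* The ends of the new edge are at distance [D1] or [D2], and [u] is put on their line at distances
   [(D1 + D2) / 2] and [|D1 - D2| / 2], in the order that separates the two values. *)
Lemma join_params (d1 d2 a b : R) : 0 < d1 -> 0 < d2 -> d1 != d2 -> exists t1 t2 : R,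
  [/\ t1 ^+ 2 * d1 = t2 ^+ 2 * d2, (1 - t1) ^+ 2 * d1 = (1 - t2) ^+ 2 * d2, 0 < t1 ^+ 2 * d1 & 0 < (1 - t1) ^+ 2 * d1] /\
  (1 - t1) * a + t1 * b - t1 * (1 - t1) * d1 != (1 - t2) * a + t2 * b - t2 * (1 - t2) * d2 /\
  ~ (a = t1 ^+ 2 * d1 /\ b = (1 - t1) ^+ 2 * d1).
Proof.
move=> p1 p2 ne.
have s1 := sqr_sqrtr (ltW p1); have s2 := sqr_sqrtr (ltW p2).
have q1 : 0 < Num.sqrt d1 by rewrite sqrtr_gt0.
have q2 : 0 < Num.sqrt d2 by rewrite sqrtr_gt0.
move: s1 s2 q1 q2; move: (Num.sqrt d1) (Num.sqrt d2) => D1 D2 e1 e2 q1 q2.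
have D12 : D1 != D2 by apply: contraNneq ne => e; rewrite -e1 -e2 e.
have n1 : D1 != 0 by rewrite gt_eqF.
have n2 : D2 != 0 by rewrite gt_eqF.
have pa : 0 < (D1 + D2) / 2 by lra.
have pb : 0 < ((D1 - D2) / 2) ^+ 2.
  by rewrite exprn_even_gt0 //= mulf_neq0 ?subr_eq0 // invr_neq0 // pnatr_eq0.
have pa2 : 0 < ((D1 + D2) / 2) ^+ 2 by apply: exprn_gt0.
set al := (D1 + D2) / 2 in pa pa2.
(* The two values differ by a nonzero multiple of [A - B - D1 * D2], so they coincide only if
   [A - B] is [D1 * D2]. *)
have main (A B : R) : A - B != D1 * D2 -> (1 - al / D1) * A + al / D1 * B - al / D1 * (1 - al / D1) * D1 ^+ 2 !=
   (1 - al / D2) * A + al / D2 * B - al / D2 * (1 - al / D2) * D2 ^+ 2.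
  move=> h; rewrite -subr_eq0.
  have -> : (1 - al / D1) * A + al / D1 * B - al / D1 * (1 - al / D1) * D1 ^+ 2 -
   ((1 - al / D2) * A + al / D2 * B - al / D2 * (1 - al / D2) * D2 ^+ 2) = al * (D1 - D2) * (A - B - D1 * D2) / (D1 * D2).
    by field; rewrite n1 n2.
  apply: mulf_neq0; last by rewrite invr_eq0 mulf_neq0.
  by apply: mulf_neq0; [apply: mulf_neq0; [rewrite gt_eqF|]|]; rewrite ?subr_eq0.
have f1 : (al / D1) ^+ 2 * D1 ^+ 2 = al ^+ 2 by field.
have f2 : (al / D2) ^+ 2 * D2 ^+ 2 = al ^+ 2 by field.
have f3 : (1 - al / D1) ^+ 2 * D1 ^+ 2 = ((D1 - D2) / 2) ^+ 2 by rewrite /al; field.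
have f4 : (1 - al / D2) ^+ 2 * D2 ^+ 2 = ((D1 - D2) / 2) ^+ 2 by rewrite /al; field.
(* Consequently [u] and [v] could coincide only in the case that the choice of order excludes. *)
have f5 : al ^+ 2 - ((D1 - D2) / 2) ^+ 2 = D1 * D2 by rewrite /al; field.
have p12 : 0 < D1 * D2 by apply: mulr_gt0.
(* If the first order fails, [b - a] is negative and the exchanged order succeeds. *)
rewrite -e1 -e2; case: (eqVneq (a - b) (D1 * D2)) => [e|h].
  have swap (t : R) : 1 - (1 - t) = t by ring.
  exists (1 - al / D1), (1 - al / D2); rewrite !swap f1 f2 f3 f4; split=> //; split.
    have /main : b - a != D1 * D2 by apply/eqP; lra.
    by rewrite ![(1 - al / _) * b + _]addrC ![al / _ * (1 - _)]mulrC.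
  by case=> ea eb; move: e; rewrite ea eb; lra.
exists (al / D1), (al / D2); rewrite f1 f2 f3 f4; split=> //; split; first exact: main.
by case=> ea eb; case/eqP: h; rewrite ea eb.
Qed.

End Points.

(** * Edges with exactly two values of their length *)

Section TwoValued.
Variables (R : realType) (T : finType).
Implicit Types (E : rel T) (V S : {set T}).

Definition edge E V u v x y : Prop := [/\ x \in V, y \in V, E x y & ~ ((x = u /\ y = v) \/ (x = v /\ y = u))].

(** The lengths are those of [p1], and [p2] is a second realization of them. Carrying both
    realizations lets the induction place new points in each. *)
Definition two_valued E V u v : Prop := exists p1 p2 : T -> 'rV[R]_3,
  (forall x y, edge E V u v x y -> 0 < sqdist (p1 x) (p1 y) /\ sqdist (p2 x) (p2 y) = sqdist (p1 x) (p1 y)) /\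
  [/\ 0 < sqdist (p1 u) (p1 v), 0 < sqdist (p2 u) (p2 v), sqdist (p1 u) (p1 v) != sqdist (p2 u) (p2 v) &
    forall q : T -> 'rV[R]_3, (forall x y, edge E V u v x y -> sqdist (q x) (q y) = sqdist (p1 x) (p1 y)) ->
      sqdist (q u) (q v) = sqdist (p1 u) (p1 v) \/ sqdist (q u) (q v) = sqdist (p2 u) (p2 v)].

Lemma two_valued_sym E V u v : two_valued E V v u -> two_valued E V u v.
Proof.
have flip x y : edge E V u v x y -> edge E V v u x y by case=> h1 h2 h3 h4; split=> // h; apply: h4; case: h; auto.
have flip' x y : edge E V v u x y -> edge E V u v x y by case=> h1 h2 h3 h4; split=> // h; apply: h4; case: h; auto.
move=> [p1 [p2 [h1 [h2 h3 h4 h5]]]]; exists p1, p2; rewrite (sqdistC (p1 u)) (sqdistC (p2 u)).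
split; first by move=> x y /flip; apply: h1.
split=> // q hq; rewrite (sqdistC (q u)); apply: h5 => x y /flip'; apply: hq.
Qed.

Lemma two_valued_fold E V u v a b : symmetric E -> (forall x, ~~ E x x) -> [/\ a \in V, b \in V & a != b] ->
  [/\ a != u, a != v, b != u & b != v] -> (forall y, y \in V -> E a y -> E b y) -> two_valued E (V :\ a) u v -> two_valued E V u v.
Proof.
move=> symE irrE [aV bV ab] [au av bu bv] sub [p1 [p2 [h1 [h2 h3 h4 h5]]]].
pose f x := if x == a then b else x.
have fE x y : edge E V u v x y -> edge E (V :\ a) u v (f x) (f y).
  have out x' : x' \in V -> x' != a -> x' \in V :\ a by move=> h h'; rewrite !inE h'.
  have bVa : b \in V :\ a by rewrite !inE eq_sym ab.
  case=> xV yV Exy nuv; rewrite /f.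
  case: (eqVneq x a) => [e|xa]; case: (eqVneq y a) => [e'|ya].
  - by rewrite e e' (negbTE (irrE a)) in Exy.
  - rewrite e in Exy; split=> //; [exact: out|exact: sub|].
    by case=> -[eb _]; [rewrite eb eqxx in bu|rewrite eb eqxx in bv].
  - rewrite e' symE in Exy; split=> //; [exact: out|by rewrite symE; apply: sub|].
    by case=> -[_ eb]; [rewrite eb eqxx in bv|rewrite eb eqxx in bu].
  - by split=> //; apply: out.
have fu : f u = u by rewrite /f eq_sym (negbTE au).
have fv : f v = v by rewrite /f eq_sym (negbTE av).
exists (p1 \o f), (p2 \o f) => /=; rewrite fu fv; split; first by move=> x y /fE; apply: h1.
split=> // q hq; apply: h5 => x y [/setD1P [xa xV] /setD1P [ya yV] Exy nuv].
by rewrite hq //= /f (negbTE xa) (negbTE ya).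
Qed.

Lemma sqdist_ivec (a b c a' b' c' : int) : sqdist (vec (a%:~R : R) b%:~R c%:~R) (vec a'%:~R b'%:~R c'%:~R) =
  ((a - a') ^+ 2 + ((b - b') ^+ 2 + (c - c') ^+ 2))%:~R.
Proof. by rewrite sqdist_vec !rmorphD /= !rmorphXn /= !rmorphB. Qed.

Lemma two_valued_K5 E V u v : symmetric E -> (forall x, ~~ E x x) -> baseK5 E V u v -> two_valued E V u v.
Proof.
move=> symE irrE [a [b [c [eV [_ _ d aa]]]]].
move: aa; rewrite !adj1P => -[[Euv Eua Eub Euc] [[Eva Evb Evc] [Eab Eac Ebc]]].
have ne x y : E x y -> ((x == y) = false) * ((y == x) = false).
  by move=> Exy; rewrite (eq_sym y); split; apply/negbTE; apply: contraTneq Exy => ->.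
have eqs := (ne _ _ Euv, ne _ _ Eua, ne _ _ Eub, ne _ _ Euc, ne _ _ Eva, ne _ _ Evb, ne _ _ Evc, ne _ _ Eab, ne _ _ Eac, ne _ _ Ebc).
(* [c] is the origin, [a], [b], [u] are the unit vectors and [v] is at height [s] on the axis of
   [u]. For [s] equal to 2 and -2 the point [v] is reflected in the plane of [a], [b], [c]. Integer
   coordinates reduce the checks to computation. *)
pose p (s : int) x : 'rV[R]_3 := vec (if x == a then 1 else 0 : int)%:~R (if x == b then 1 else 0 : int)%:~R (if x == u then 1 else if x == v then s else 0)%:~R.
have pE x : x \in V -> [\/ x = u, x = v | [\/ x = a, x = b | x = c]].
  by rewrite eV !inE -!orbA => /or4P [/eqP ->|/eqP ->|/eqP ->|/orP [] /eqP ->];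
    [apply: Or31|apply: Or32|apply: Or33; apply: Or31|apply: Or33; apply: Or32|apply: Or33; apply: Or33].
exists (p 2), (p (- 2)); split.
  move=> x y [xV yV Exy nuv].
  case: (pE x xV) Exy nuv => [->|->|[->|->|->]]; case: (pE y yV) => [->|->|[->|->|->]] Exy nuv;
  rewrite ?(negbTE (irrE _)) // in Exy; try (by case: nuv; auto);
  by rewrite /p !sqdist_ivec !eqxx !eqs ltr0z; split.
have d1 : sqdist (p 2 u) (p 2 v) = 1 by rewrite /p !sqdist_ivec !eqxx !eqs.
have d2 : sqdist (p (-2) u) (p (-2) v) = 9 by rewrite /p !sqdist_ivec !eqxx !eqs.
rewrite d1 d2; split=> //; first by apply/eqP; lra.
move=> q hq.
have hV x : x \in [:: u; v; a; b; c] -> x \in V by rewrite eV !inE -!orbA.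
have [uV vV aV bV cV] : [/\ u \in V, v \in V, a \in V, b \in V & c \in V] by split; apply: hV; rewrite !inE eqxx ?orbT.
have val x y : x \in V -> y \in V -> E x y -> y \in [:: a; b; c] -> sqdist (q x) (q y) = sqdist (p 2 x) (p 2 y).
  move=> xV yV Exy yin; apply: hq; split=> // h.
  have : (y == v) || (y == u) by case: h => -[_ ->]; rewrite eqxx ?orbT.
  by move: yin; rewrite !inE => /or3P [] /eqP ->; rewrite !eqs.
apply: (@K5_values _ (q a) (q b) (q c)); rewrite val ?inE ?eqxx ?orbT // /p !sqdist_ivec !eqxx !eqs //.
Qed.
End TwoValued.

Section Octahedron.
Variables (R : realType) (T : finType).
Implicit Types (E : rel T) (V S : {set T}).

Lemma two_valued_K222 E V u v : symmetric E -> (forall x, ~~ E x x) -> baseK222 E V u v -> two_valued R E V u v.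
Proof.
move=> symE irrE [u' [v' [c [c' [eV [[_ _ d aa] [nuu nvv ncc]]]]]]].
move: aa; rewrite !adj1P => -[[Euv Euv' Eu'v Eu'v'] [[Euc Euc' Eu'c Eu'c'] [Evc Evc' Ev'c Ev'c']]].
have ne x y : E x y -> ((x == y) = false) * ((y == x) = false).
  by move=> Exy; rewrite (eq_sym y); split; apply/negbTE; apply: contraTneq Exy => ->.
have ne' (x y : T) : dis [set x] [set y] -> ((x == y) = false) * ((y == x) = false).
  by move=> dd; rewrite (eq_sym y); split; apply/negbTE; apply/eqP => e; apply: (dd x); rewrite ?inE ?e eqxx.
have [[d1 d2 d3] _] := d.
have eqs := (ne _ _ Euv, ne _ _ Euv', ne _ _ Eu'v, ne _ _ Eu'v', ne _ _ Euc, ne _ _ Euc', ne _ _ Eu'c, ne _ _ Eu'c',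
  ne _ _ Evc, ne _ _ Evc', ne _ _ Ev'c, ne _ _ Ev'c', ne' _ _ d1, ne' _ _ d2, ne' _ _ d3).
(* [v'] is the origin, [c] the midpoint of [v'] and [u'], [c'] and [u] are the other unit vectors,
   and [v] is at height [s] above [c]. The sign of [s] reflects [v] in the plane of the remaining
   points other than [u]. *)
pose p (s : int) x : 'rV[R]_3 := vec (if x == u' then 2 else if x == c then 1 else if x == v then 1 else 0 : int)%:~R
  (if x == c' then 1 else 0 : int)%:~R (if x == u then 1 else if x == v then s else 0)%:~R.
have pE x : x \in V -> [\/ x = u, x = v | [\/ x = u', x = v' | x = c \/ x = c']].
  rewrite eV !inE -!orbA => /or4P [/eqP ->|/eqP ->|/eqP ->|/or3P [] /eqP ->]; auto.
  - by apply: Or31.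
  - by apply: Or33; apply: Or31.
  - by apply: Or32.
  - by apply: Or33; apply: Or32.
  - by apply: Or33; apply: Or33; left.
  - by apply: Or33; apply: Or33; right.
exists (p 2), (p (- 2)); split.
  move=> x y [xV yV Exy nuv].
  case: (pE x xV) Exy nuv => [->|->|[->|->|[->|->]]]; case: (pE y yV) => [->|->|[->|->|[->|->]]] Exy nuv;
  rewrite ?(negbTE (irrE _)) ?(negbTE nuu) ?(negbTE nvv) ?(negbTE ncc) // in Exy; try (by case: nuv; auto);
  try (by rewrite symE ?(negbTE nuu) ?(negbTE nvv) ?(negbTE ncc) in Exy);
  by rewrite /p !sqdist_ivec !eqxx !eqs ltr0z; split.
have e1 : sqdist (p 2 u) (p 2 v) = 2 by rewrite /p !sqdist_ivec !eqxx !eqs.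
have e2 : sqdist (p (-2) u) (p (-2) v) = 10 by rewrite /p !sqdist_ivec !eqxx !eqs.
rewrite e1 e2; split=> //; first by apply/eqP; lra.
move=> q hq.
have hV x : x \in [:: u; u'; v; v'; c; c'] -> x \in V by rewrite eV !inE -!orbA.
have [uV vV u'V v'V] : [/\ u \in V, v \in V, u' \in V & v' \in V] by split; apply: hV; rewrite !inE eqxx ?orbT.
have [cV c'V] : c \in V /\ c' \in V by split; apply: hV; rewrite !inE eqxx ?orbT.
have val x y : x \in V -> y \in V -> E x y -> (x \in [:: u'; v'; c; c']) || (y \in [:: u'; v'; c; c']) -> sqdist (q x) (q y) = sqdist (p 2 x) (p 2 y).
  move=> xV yV Exy yin; apply: hq; split=> // h.
  have : ((x == v) || (x == u)) && ((y == v) || (y == u)) by case: h => -[-> ->]; rewrite !eqxx ?orbT.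
  by move: yin; rewrite !inE => /orP [] /or4P [] /eqP ->; rewrite !eqs ?andbF.
apply: (@K222_values _ (q v') (q u') (q c) (q c')); rewrite val ?inE ?eqxx ?orbT // 1?symE // /p !sqdist_ivec !eqxx !eqs //.
Qed.

End Octahedron.

(** * Extending a two-valued pair by a collinear point *)

Section Join.
Variables (R : realType) (T : finType).
Implicit Types (E : rel T) (V S : {set T}).

Lemma two_valued_join E V u v w1 w2 S : symmetric E -> (forall x, ~~ E x x) -> u \in V -> v \in V -> E u v ->
  S \subset V :\ u -> [/\ w1 \in S, w2 \in S, w1 != w2 & ~~ E w1 w2] -> [/\ E u w1, E u w2, E v w1 & E v w2] ->
  (forall y, y \in V -> E u y -> [\/ y = v, y = w1 | y = w2]) ->
  (forall e y, e \in V -> e \notin S -> e != u -> y \in V -> E e y -> [\/ y = w1, y = w2 | e = v /\ y = u]) ->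
  two_valued R (add_edge E w1 w2) S w1 w2 -> two_valued R E V u v.
Proof.
move=> symE irrE uV vV Euv SV [w1S w2S w12 nw] [uw1 uw2 vw1 vw2] nbu nbo [r1 [r2 [h1 [h2 h3 h4 h5]]]].
have neqE a b : E a b -> a != b by move=> Eab; apply: contraNneq (irrE a) => {2}->.
have uS : u \notin S by apply/negP => /(subsetP SV); rewrite !inE eqxx.
have SVV x : x \in S -> x \in V by move/(subsetP SV)/setD1P => [].
have nvu : v != u by rewrite eq_sym; apply: neqE.
have [n1 n2] : v != w1 /\ v != w2 by split; apply: neqE.
have inner x y : x \in S -> y \in S -> E x y -> edge (add_edge E w1 w2) S w1 w2 x y.
  move=> xS yS Exy; split=> //; first exact: add_edge_old.
  by case=> -[e1 e2]; move: Exy; rewrite e1 e2 ?(symE w2 w1) (negbTE nw).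
have outer x y : edge E V u v x y -> x \notin S -> y = w1 \/ y = w2.
  move=> [xV yV Exy nuv] xS; case: (eqVneq x u) => [e|xu].
    rewrite e in Exy nuv; case: (nbu y yV Exy) => h; [by case: nuv; left|by left|by right].
  case: (nbo x y xV xS xu yV Exy) => [h|h|h]; [by left|by right|by case: nuv; right].
set d1 := sqdist (r1 w1) (r1 w2) in h2 h4 h5; set d2 := sqdist (r2 w1) (r2 w2) in h3 h4 h5.
(* Large enough for [bisector] in both realizations: the vertices outside [S] other than [u] are
   placed at squared distance [rho] from both [w1] and [w2]. *)
pose rho := d1 + d2.
have rho0 : 0 < rho by apply: addr_gt0.
have [m1 [m11 m12]] : exists m, sqdist m (r1 w1) = rho /\ sqdist m (r1 w2) = rho.
  by apply: bisector; rewrite -/d1 /rho; lra.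
have [m2 [m21 m22]] : exists m, sqdist m (r2 w1) = rho /\ sqdist m (r2 w2) = rho.
  by apply: bisector; rewrite -/d2 /rho; lra.
(* Whether [v] lies in [S] or is one of the newly placed vertices, [a] and [b] are its prescribed
   squared distances to [w1] and [w2], the same in both realizations. *)
pose a := if v \in S then sqdist (r1 v) (r1 w1) else rho.
pose b := if v \in S then sqdist (r1 v) (r1 w2) else rho.
have [t1 [t2 [[e1 e2 l1 l2] [dv nab]]]] := join_params a b h2 h3 h4.
pose p (r : T -> 'rV[R]_3) m t x := if x \in S then r x else if x == u then r w1 + t *: (r w2 - r w1) else m.
have pS r m t x : x \in S -> p r m t x = r x by rewrite /p => ->.
have pu r m t : p r m t u = r w1 + t *: (r w2 - r w1) by rewrite /p (negbTE uS) eqxx.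
have po r m t x : x \notin S -> x != u -> p r m t x = m by rewrite /p => /negbTE -> /negbTE ->.
pose p1 := p r1 m1 t1; pose p2 := p r2 m2 t2.
have out x y : x \notin S -> y = w1 \/ y = w2 -> 0 < sqdist (p1 x) (p1 y) /\ sqdist (p2 x) (p2 y) = sqdist (p1 x) (p1 y).
  move=> xS hy; have [g1 g2] := line_sqdist (r1 w1) (r1 w2) t1; have [g3 g4] := line_sqdist (r2 w1) (r2 w2) t2.
  rewrite -/d1 in g1 g2; rewrite -/d2 in g3 g4.
  rewrite /p1 /p2; case: (eqVneq x u) => [->|xu].
    by rewrite !pu; case: hy => ->; rewrite !pS // ?g1 ?g2 ?g3 ?g4.
  by rewrite !(po _ _ _ x) //; case: hy => ->; rewrite !pS // ?m11 ?m12 ?m21 ?m22.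
have all x y : edge E V u v x y -> 0 < sqdist (p1 x) (p1 y) /\ sqdist (p2 x) (p2 y) = sqdist (p1 x) (p1 y).
  move=> h; case: (boolP (x \in S)) => xS; last by apply: out => //; apply: outer h xS.
  case: (boolP (y \in S)) => yS.
    by case: h => _ _ Exy _; rewrite /p1 /p2 !pS //; apply: h1; apply: inner.
  have h' : edge E V u v y x.
    by case: h => xV yV Exy nuv; split=> //; [rewrite symE|move=> h; apply: nuv; case: h => -[? ?]; auto].
  by rewrite (sqdistC (p1 x)) (sqdistC (p2 x)); apply: out => //; apply: outer h' yS.
have [w1V w2V] : w1 \in V /\ w2 \in V by split; apply: SVV.
have ev w : w \in S -> E v w -> edge E V u v v w.
  move=> wS Evw; split=> //; first exact: SVV.
  by case=> -[e e']; [rewrite e eqxx in nvu|rewrite e' (negbTE uS) in wS].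
have eu w : w \in S -> E u w -> w != v -> edge E V u v u w.
  move=> wS Euw wv; split=> //; first exact: SVV.
  by case=> -[e e']; [rewrite e' eqxx in wv|rewrite e eqxx in nvu].
have pa : sqdist (p1 v) (p1 w1) = a /\ sqdist (p1 v) (p1 w2) = b.
  rewrite /a /b /p1 (pS _ _ _ w1) // (pS _ _ _ w2) //; case: ifP => vS; first by rewrite pS.
  by rewrite po ?vS // m11 m12.
have [pa1 pb1] := pa.
have value q t : sqdist (q u) (q w1) = t ^+ 2 * sqdist (q w1) (q w2) -> sqdist (q u) (q w2) = (1 - t) ^+ 2 * sqdist (q w1) (q w2) ->
    sqdist (q v) (q w1) = a -> sqdist (q v) (q w2) = b ->
    sqdist (q u) (q v) = (1 - t) * a + t * b - t * (1 - t) * sqdist (q w1) (q w2).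
  by move=> g1 g2 <- <-; rewrite (stewart_collinear _ g1 g2) !(sqdistC (q v)).
have [eu1 eu2] : edge E V u v u w1 /\ edge E V u v u w2 by split; apply: eu; rewrite // eq_sym.
have [ev1 ev2] : edge E V u v v w1 /\ edge E V u v v w2 by split; apply: ev.
have len1 : sqdist (p1 u) (p1 w1) = t1 ^+ 2 * d1 /\ sqdist (p1 u) (p1 w2) = (1 - t1) ^+ 2 * d1.
  by rewrite /p1 pu !pS //; apply: line_sqdist.
have [len11 len12] := len1.
have len21 : sqdist (p2 u) (p2 w1) = t2 ^+ 2 * d2 by rewrite (all _ _ eu1).2 len11.
have len22 : sqdist (p2 u) (p2 w2) = (1 - t2) ^+ 2 * d2 by rewrite (all _ _ eu2).2 len12.
have D1 : sqdist (p1 w1) (p1 w2) = d1 by rewrite /p1 !pS.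
have D2 : sqdist (p2 w1) (p2 w2) = d2 by rewrite /p2 !pS.
have V1 : sqdist (p1 u) (p1 v) = (1 - t1) * a + t1 * b - t1 * (1 - t1) * d1.
  by rewrite -D1; apply: value; rewrite ?D1.
have V2 : sqdist (p2 u) (p2 v) = (1 - t2) * a + t2 * b - t2 * (1 - t2) * d2.
  by rewrite -D2; apply: value; rewrite ?D2 // ?(all _ _ ev1).2 ?(all _ _ ev2).2.
have pos (q : T -> 'rV[R]_3) : sqdist (q u) (q w1) = t1 ^+ 2 * d1 -> sqdist (q u) (q w2) = (1 - t1) ^+ 2 * d1 ->
   sqdist (q v) (q w1) = a -> sqdist (q v) (q w2) = b -> 0 < sqdist (q u) (q v).
  move=> g1 g2 g3 g4; rewrite lt_def sqdist_ge0 andbT; apply/eqP => /sqdist_eq0 e.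
  by apply: nab; rewrite -g3 -g4 -g1 -g2 e.
exists p1, p2; split=> //; split.
- exact: pos.
- by apply: pos; rewrite ?(all _ _ eu1).2 ?(all _ _ eu2).2 ?(all _ _ ev1).2 ?(all _ _ ev2).2.
- by rewrite V1 V2.
move=> q hq; rewrite V1 V2.
have hS : forall x y, edge (add_edge E w1 w2) S w1 w2 x y -> sqdist (q x) (q y) = sqdist (r1 x) (r1 y).
  move=> x y [xS yS Exy nww]; have E0 : E x y.
    by move: Exy => /or3P [//|/andP [/eqP e /eqP e']|/andP [/eqP e /eqP e']]; case: nww; [left|right].
  rewrite hq; first by rewrite /p1 !pS.
  split=> //; [exact: SVV|exact: SVV|].
  by case=> -[e e']; [rewrite e (negbTE uS) in xS|rewrite e' (negbTE uS) in yS].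
have [q1 q2 q3 q4] : [/\ sqdist (q u) (q w1) = t1 ^+ 2 * d1, sqdist (q u) (q w2) = (1 - t1) ^+ 2 * d1,
    sqdist (q v) (q w1) = a & sqdist (q v) (q w2) = b] by rewrite !hq.
by case: (h5 q hS) => e; [left|right]; rewrite -e; apply: value => //; rewrite e ?q1 ?q2 ?e1 ?e2.
Qed.

End Join.

Theorem mainTheorem11 (R : realType) (T : finType) (G : rel T) (u v : T) :
  minimal_pair G u v ->
  (exists l : T -> T -> R,
     (forall x y, G x y -> 0 < l x y) /\
     exists a b : R, [/\ 0 < a, 0 < b, a != b &
       forall d, Omega3 G l u v d <-> (d = a \/ d = b)]) /\
  ~ SIP3 R G u v.
Proof.
move=> mp; have [[[symG irrG] uv nG _ _] _] := mp.
have [p1 [p2 [h1 [h2 h3 h4 h5]]]] : two_valued R (add_edge G u v) [set: T] u v.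
  apply: (@rigid_induction T (@two_valued R T)); rewrite ?inE //.
  - move=> E V x y symE irrE [h|h]; [exact: two_valued_K5|exact: two_valued_K222].
  - exact: two_valued_sym.
  - exact: two_valued_fold.
  - exact: two_valued_join.
  - exact: minimal_sym mp.
  - exact: minimal_irr mp.
  - by rewrite /add_edge /= !eqxx orbT.
  - exact: minimal_atom mp.
  - exact: minimal_rigid mp.
  - exact: minimal_sepm mp.
have edgeG x y : G x y <-> edge (add_edge G u v) [set: T] u v x y.
  split=> [Gxy|[_ _ Exy nuv]].
    split; rewrite ?inE //; first exact: add_edge_old.
    by case=> -[e e']; move: Gxy; rewrite e e' ?(symG v u) (negbTE nG).
  by move: Exy => /or3P [//|/andP [/eqP e /eqP e']|/andP [/eqP e /eqP e']]; case: nuv; [left|right].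
pose l x y := sqdist (p1 x) (p1 y).
have l0 x y : G x y -> 0 < l x y by move/edgeG/h1 => [].
have om d : Omega3 G l u v d <-> (d = l u v \/ d = sqdist (p2 u) (p2 v)).
  split=> [[q [hq <-]]|[->|->]].
  - by apply: h5 => x y /edgeG; apply: hq.
  - by exists p1.
  - by exists p2; split=> // x y /edgeG/h1 [].
split; first by exists l; split=> //; exists (l u v), (sqdist (p2 u) (p2 v)).
move=> sip; have cv := sip l (fun x y h => ltW (l0 x y h)).
have o1 : Omega3 G l u v (l u v) by apply/om; left.
have o2 : Omega3 G l u v (sqdist (p2 u) (p2 v)) by apply/om; right.
(* Convexity would put the midpoint of the two values into [Omega3], giving a third value. *)
have mid (x y : R) : x != y -> Omega3 G l u v x -> Omega3 G l u v y -> x < y -> exists z, [/\ Omega3 G l u v z, z != x & z != y].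
  move=> _ ox oy xy; exists ((x + y) / 2); split; [apply: (cv x y) => //; apply/andP; split; lra|apply/eqP; lra|apply/eqP; lra].
have [z [oz z1 z2]] : exists z, [/\ Omega3 G l u v z, z != l u v & z != sqdist (p2 u) (p2 v)].
  case: (ltgtP (l u v) (sqdist (p2 u) (p2 v))) => [lt|lt|e]; last by rewrite -/(l u v) e eqxx in h4.
    exact: mid.
  by have [|z [? ? ?]] := mid _ _ _ o2 o1 lt; [rewrite lt_eqF|exists z].
by case/om: oz => e; [rewrite e eqxx in z1|rewrite e eqxx in z2].
Qed.
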